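(* Let $\mathsf{Top}_S$ and $\mathsf{Top}_Q$ denote the category of topological spaces equipped with the Strøm and with the Quillen model structure, respectively. Then the exact completion $(\mathrm{Ho}\,\mathsf{Top}_S)_{\mathrm{ex}}$ of the homotopy category of $\mathsf{Top}_S$ is locally cartesian closed, and the exact completion $(\mathrm{Ho}\,\mathsf{Top}_Q)_{\mathrm{ex}}$ of the homotopy category of $\mathsf{Top}_Q$ is locally cartesian closed.
   Context: In the Strøm model structure the weak equivalences are the homotopy equivalences and the fibrations are the Hurewicz fibrations, so $\mathrm{Ho}\,\mathsf{Top}_S$ is (equivalent to) the category of topological spaces and homotopy classes of continuous maps. In the Quillen model structure the weak equivalences are the weak homotopy equivalences and the fibrations are the Serre fibrations; $\mathrm{Ho}\,\mathsf{Top}_Q$ is equivalent to the category of CW-complexes and homotopy classes of continuous maps. Both homotopy categories have weak finite limits (limits without uniqueness of the universal arrow). Exact completion (ex/wlex completion) of a category $\mathbb{C}$ with weak finite limits. A pseudo equivalence relation in $\mathbb{C}$ is a parallel pair $r_1,r_2\colon R\rightrightarrows X$ (not necessarily jointly monic) that is reflexive (there is $\rho\colon X\to R$ with $r_1\rho=r_2\rho=\mathrm{id}_X$), symmetric (there is $\sigma\colon R\to R$ with $r_1\sigma=r_2$, $r_2\sigma=r_1$) and transitive (for a weak pullback $R\xleftarrow{a}T\xrightarrow{b}R$ of $r_2,r_1$ there is $\tau\colon T\to R$ with $r_1\tau=r_1a$, $r_2\tau=r_2b$). Objects of $\mathbb{C}_{\mathrm{ex}}$ are pseudo equivalence relations in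 $\mathbb{C}$; an arrow from $R\rightrightarrows X$ to $(s_1,s_2)\colon S\rightrightarrows Y$ is an equivalence class of arrows $f\colon X\to Y$ for which there is $\hat f\colon R\to S$ with $s_i\hat f=fr_i$, where $f\sim f'$ if there is $t\colon X\to S$ with $s_1t=f$, $s_2t=f'$. $\mathbb{C}_{\mathrm{ex}}$ is a (Barr-)exact category with finite limits. *)

(* Defs.v *)
From HB Require Import structures.
From mathcomp Require Import all_boot all_order all_algebra.
From mathcomp Require Import all_classical all_reals all_analysis.

Import Order.TTheory GRing.Theory Num.Theory numFieldNormedType.Exports.

Set Implicit Arguments.
Unset Strict Implicit.
Unset Printing Implicit Defensive.

Local Open Scope classical_set_scope.
Local Open Scope ring_scope.

(* Categories are E-categories: hom-types carry an equivalence relation [===]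
   which plays the role of equality of arrows.  An arrow of the category
   described in the usual set-based way is thus an [===]-class, and quotients
   of hom-sets are formed by coarsening [===]. *)

Record ecat := ECat {
  ob :> Type;
  hom : ob -> ob -> Type;
  heq : forall X Y, hom X Y -> hom X Y -> Prop;
  idm : forall X, hom X X;
  comp : forall X Y Z, hom Y Z -> hom X Y -> hom X Z;
  heq_refl : forall X Y (f : hom X Y), heq f f;
  heq_sym : forall X Y (f g : hom X Y), heq f g -> heq g f;
  heq_trans : forall X Y (f g h : hom X Y), heq f g -> heq g h -> heq f h;
  comp_heq : forall X Y Z (g g' : hom Y Z) (f f' : hom X Y),
    heq g g' -> heq f f' -> heq (comp g f) (comp g' f');
  comp_assoc : forall X Y Z W (h : hom Z W) (g : hom Y Z) (f : hom X Y),
    heq (comp h (comp g f)) (comp (comp h g) f);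
  comp_idl : forall X Y (f : hom X Y), heq (comp (idm Y) f) f;
  comp_idr : forall X Y (f : hom X Y), heq (comp f (idm X)) f }.

Arguments hom {e} X Y.
Arguments heq {e X Y} f g.
Arguments idm {e} X.
Arguments comp {e X Y Z} g f.

Declare Scope ecat_scope.
Delimit Scope ecat_scope with ecat.
Local Open Scope ecat_scope.

Notation "f === g" := (heq f g) (at level 70, no associativity) : ecat_scope.
Notation "g \c f" := (comp g f) (at level 40, left associativity) : ecat_scope.

#[global] Hint Resolve heq_refl : core.

Definition arrow_class (C : ecat) := forall X Y : C, hom X Y -> Prop.

Section Limits.
Variable C : ecat.

Definition is_terminal (T : C) :=
  forall X : C, exists h : hom X T, forall k : hom X T, k === h.

Definition is_product (A B P : C) (p1 : hom P A) (p2 : hom P B) :=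
  forall (X : C) (f : hom X A) (g : hom X B),
    exists h : hom X P, [/\ p1 \c h === f, p2 \c h === g &
      forall k : hom X P, p1 \c k === f -> p2 \c k === g -> k === h].

Definition is_weak_pullback (X Y Z T : C) (f : hom X Z) (g : hom Y Z)
    (a : hom T X) (b : hom T Y) :=
  f \c a === g \c b /\
  forall (W : C) (h : hom W X) (k : hom W Y), f \c h === g \c k ->
    exists u : hom W T, a \c u === h /\ b \c u === k.

(* [h] is an exponential transpose of [f : W x A -> B]: the arrow [m] below is
   [h x A : W x A -> E x A]. *)
Definition is_transpose (A B E P : C) (p1 : hom P E) (p2 : hom P A)
    (ev : hom P B) (W Q : C) (q1 : hom Q W) (q2 : hom Q A)
    (f : hom Q B) (h : hom W E) :=
  exists m : hom Q P, [/\ p1 \c m === h \c q1, p2 \c m === q2 & ev \c m === f].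

Definition is_exponential (A B E P : C) (p1 : hom P E) (p2 : hom P A)
    (ev : hom P B) :=
  is_product p1 p2 /\
  forall (W Q : C) (q1 : hom Q W) (q2 : hom Q A), is_product q1 q2 ->
  forall f : hom Q B,
    exists h : hom W E, is_transpose p1 p2 ev q1 q2 f h /\
      forall k : hom W E, is_transpose p1 p2 ev q1 q2 f k -> k === h.

Definition has_terminal := exists T : C, is_terminal T.

Definition has_binary_products := forall A B : C,
  exists (P : C) (p1 : hom P A) (p2 : hom P B), is_product p1 p2.

Definition has_exponentials := forall A B : C,
  exists (E P : C) (p1 : hom P E) (p2 : hom P A) (ev : hom P B),
    is_exponential p1 p2 ev.

Definition cartesian_closed :=
  [/\ has_terminal, has_binary_products & has_exponentials].

End Limits.

Section Slice.
Variables (C : ecat) (X : C).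

Definition slice_ob := {Y : C & hom Y X}.

Definition slice_hom (A B : slice_ob) :=
  {f : hom (projT1 A) (projT1 B) | projT2 B \c f === projT2 A}.

Definition slice_heq A B (f g : slice_hom A B) := proj1_sig f === proj1_sig g.

Program Definition slice_idm A : slice_hom A A :=
  exist _ (idm (projT1 A)) _.
Next Obligation. by move=> [Y p]; exact: comp_idr. Qed.

Program Definition slice_comp A B D (g : slice_hom B D) (f : slice_hom A B) :
  slice_hom A D := exist _ (proj1_sig g \c proj1_sig f) _.
Next Obligation.
move=> A B D [g gP] [f fP] /=.
exact: heq_trans (comp_assoc _ _ _)
  (heq_trans (comp_heq gP (heq_refl _)) fP).
Qed.

Program Definition slice : ecat :=
  @ECat slice_ob slice_hom slice_heq slice_idm slice_comp _ _ _ _ _ _ _.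
Next Obligation. by move=> *; exact: heq_refl. Qed.
Next Obligation. by move=> A B f g; exact: heq_sym. Qed.
Next Obligation. by move=> A B f g h; exact: heq_trans. Qed.
Next Obligation. by move=> A B D g g' f f'; exact: comp_heq. Qed.
Next Obligation. by move=> *; exact: comp_assoc. Qed.
Next Obligation. by move=> *; exact: comp_idl. Qed.
Next Obligation. by move=> *; exact: comp_idr. Qed.

End Slice.

(* Binary products in the slices are the pullbacks of [C], so that together
   with the terminal object they provide all finite limits. *)
Definition locally_cartesian_closed (C : ecat) :=
  has_terminal C /\ forall X : C, cartesian_closed (slice X).

(* Localization of [C] at a class of arrows [W]: the category generated by the
   arrows of [C] and formal inverses of the arrows in [W], modulo the least
   congruence which makes [loc_in] a functor and inverts [W]. *)
Section Localization.
Variables (C : ecat) (W : arrow_class C).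

Inductive loc_hom : C -> C -> Type :=
| loc_in X Y (f : hom X Y) : loc_hom X Y
| loc_inv X Y (w : hom X Y) (Ww : W w) : loc_hom Y X
| loc_comp X Y Z (g : loc_hom Y Z) (f : loc_hom X Y) : loc_hom X Z.

Inductive loc_heq :
  forall X Y : C, loc_hom X Y -> loc_hom X Y -> Prop :=
| loc_refl X Y (f : loc_hom X Y) : loc_heq f f
| loc_sym X Y (f g : loc_hom X Y) : loc_heq f g -> loc_heq g f
| loc_trans X Y (f g h : loc_hom X Y) :
    loc_heq f g -> loc_heq g h -> loc_heq f h
| loc_congr X Y Z (g g' : loc_hom Y Z) (f f' : loc_hom X Y) :
    loc_heq g g' -> loc_heq f f' -> loc_heq (loc_comp g f) (loc_comp g' f')
| loc_assoc X Y Z T (h : loc_hom Z T) (g : loc_hom Y Z) (f : loc_hom X Y) :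
    loc_heq (loc_comp h (loc_comp g f)) (loc_comp (loc_comp h g) f)
| loc_idl X Y (f : loc_hom X Y) : loc_heq (loc_comp (loc_in (idm Y)) f) f
| loc_idr X Y (f : loc_hom X Y) : loc_heq (loc_comp f (loc_in (idm X))) f
| loc_in_heq X Y (f g : hom X Y) : f === g -> loc_heq (loc_in f) (loc_in g)
| loc_in_comp X Y Z (g : hom Y Z) (f : hom X Y) :
    loc_heq (loc_in (g \c f)) (loc_comp (loc_in g) (loc_in f))
| loc_invl X Y (w : hom X Y) (Ww : W w) :
    loc_heq (loc_comp (loc_inv Ww) (loc_in w)) (loc_in (idm X))
| loc_invr X Y (w : hom X Y) (Ww : W w) :
    loc_heq (loc_comp (loc_in w) (loc_inv Ww)) (loc_in (idm Y)).

Definition localization : ecat :=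
  @ECat C loc_hom loc_heq (fun X => loc_in (idm X)) loc_comp
    loc_refl loc_sym loc_trans loc_congr loc_assoc loc_idl loc_idr.

End Localization.

(* A category with the two classes of arrows that determine a model structure
   on it (the cofibrations are the arrows with the left lifting property
   against the trivial fibrations).  The homotopy category is the localization
   at the weak equivalences. *)
Record model_data := ModelData {
  mcat :> ecat;
  weq : arrow_class mcat;
  fib : arrow_class mcat }.

Definition Ho (M : model_data) : ecat := localization (@weq M).

Section ExactCompletion.
Variable C : ecat.

(* Which weak pullback of [pr2] and [pr1] is used in [pseudo_trans] is
   irrelevant, since any two of them map to each other over [prel]. *)
Record pseudo_eqrel := PseudoEqrel {
  pcar : C;
  prel : C;
  pr1 : hom prel pcar;
  pr2 : hom prel pcar;
  pseudo_refl : exists rho : hom pcar prel,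
    pr1 \c rho === idm pcar /\ pr2 \c rho === idm pcar;
  pseudo_sym : exists sigma : hom prel prel,
    pr1 \c sigma === pr2 /\ pr2 \c sigma === pr1;
  pseudo_trans : exists (T : C) (a b : hom T prel),
    is_weak_pullback pr2 pr1 a b /\
    exists tau : hom T prel, pr1 \c tau === pr1 \c a /\ pr2 \c tau === pr2 \c b
}.

Definition ex_hom (R S : pseudo_eqrel) :=
  {f : hom (pcar R) (pcar S) | exists fhat : hom (prel R) (prel S),
     pr1 S \c fhat === f \c pr1 R /\ pr2 S \c fhat === f \c pr2 R}.

Definition ex_heq R S (f f' : ex_hom R S) :=
  exists t : hom (pcar R) (prel S),
    pr1 S \c t === proj1_sig f /\ pr2 S \c t === proj1_sig f'.

Program Definition ex_idm R : ex_hom R R := exist _ (idm (pcar R)) _.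
Next Obligation.
move=> R; exists (idm (prel R)).
by split; exact: heq_trans (comp_idr _) (heq_sym (comp_idl _)).
Qed.

Program Definition ex_comp R S T (g : ex_hom S T) (f : ex_hom R S) :
  ex_hom R T := exist _ (proj1_sig g \c proj1_sig f) _.
Next Obligation.
move=> R S T [g [gh [g1 g2]]] [f [fh [f1 f2]]] /=.
have sq (p : hom (prel T) (pcar T)) q r :
    p \c gh === g \c q -> q \c fh === f \c r -> p \c (gh \c fh) === g \c f \c r.
  move=> pE qE; apply: heq_trans (comp_assoc _ _ _) _.
  apply: heq_trans (comp_heq pE (heq_refl _)) _.
  apply: heq_trans (heq_sym (comp_assoc _ _ _)) _.
  exact: heq_trans (comp_heq (heq_refl _) qE) (comp_assoc _ _ _).
by exists (gh \c fh); split; [exact: sq g1 f1|exact: sq g2 f2].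
Qed.

Lemma ex_heq_of_heq R S (f f' : ex_hom R S) :
  proj1_sig f === proj1_sig f' -> ex_heq f f'.
Proof.
move=> ff'; have [rho [r1 r2]] := pseudo_refl S.
exists (rho \c proj1_sig f); split; apply: heq_trans (comp_assoc _ _ _) _.
  exact: heq_trans (comp_heq r1 (heq_refl _)) (comp_idl _).
exact: heq_trans (comp_heq r2 (heq_refl _)) (heq_trans (comp_idl _) ff').
Qed.

Lemma ex_heq_sym R S (f g : ex_hom R S) : ex_heq f g -> ex_heq g f.
Proof.
move=> [t [t1 t2]]; have [s [s1 s2]] := pseudo_sym S.
exists (s \c t); split; apply: heq_trans (comp_assoc _ _ _) _.
  exact: heq_trans (comp_heq s1 (heq_refl _)) t2.
exact: heq_trans (comp_heq s2 (heq_refl _)) t1.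
Qed.

Lemma ex_heq_trans R S (f g h : ex_hom R S) :
  ex_heq f g -> ex_heq g h -> ex_heq f h.
Proof.
move=> [t [t1 t2]] [u [u1 u2]].
have [T [a [b [[_ wpb] [tau [tau1 tau2]]]]]] := pseudo_trans S.
have [v [va vb]] := wpb _ t u (heq_trans t2 (heq_sym u1)).
exists (tau \c v); split; apply: heq_trans (comp_assoc _ _ _) _.
  apply: heq_trans (comp_heq tau1 (heq_refl _)) _.
  apply: heq_trans (heq_sym (comp_assoc _ _ _)) _.
  exact: heq_trans (comp_heq (heq_refl _) va) t1.
apply: heq_trans (comp_heq tau2 (heq_refl _)) _.
apply: heq_trans (heq_sym (comp_assoc _ _ _)) _.
exact: heq_trans (comp_heq (heq_refl _) vb) u2.
Qed.

Lemma ex_comp_heq R S T (g g' : ex_hom S T) (f f' : ex_hom R S) :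
  ex_heq g g' -> ex_heq f f' -> ex_heq (ex_comp g f) (ex_comp g' f').
Proof.
move=> [t [t1 t2]] [u [u1 u2]]; apply: (@ex_heq_trans _ _ _ (ex_comp g f')).
  case: g {t1} => g [gh [g1 g2]]; exists (gh \c u).
  split; apply: heq_trans (comp_assoc _ _ _) _.
    apply: heq_trans (comp_heq g1 (heq_refl _)) _.
    apply: heq_trans (heq_sym (comp_assoc _ _ _)) _.
    exact: comp_heq (heq_refl _) u1.
  apply: heq_trans (comp_heq g2 (heq_refl _)) _.
  apply: heq_trans (heq_sym (comp_assoc _ _ _)) _.
  exact: comp_heq (heq_refl _) u2.
exists (t \c proj1_sig f'); split; apply: heq_trans (comp_assoc _ _ _) _.
  exact: comp_heq t1 (heq_refl _).
exact: comp_heq t2 (heq_refl _).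
Qed.

Program Definition exact_completion : ecat :=
  @ECat pseudo_eqrel ex_hom ex_heq ex_idm ex_comp _
    ex_heq_sym ex_heq_trans ex_comp_heq _ _ _.
Next Obligation. by move=> *; apply: ex_heq_of_heq. Qed.
Next Obligation. by move=> *; apply: ex_heq_of_heq; exact: comp_assoc. Qed.
Next Obligation. by move=> *; apply: ex_heq_of_heq; exact: comp_idl. Qed.
Next Obligation. by move=> *; apply: ex_heq_of_heq; exact: comp_idr. Qed.

End ExactCompletion.

Definition top_comp (X Y Z : topologicalType) (g : continuousType Y Z)
  (f : continuousType X Y) : continuousType X Z := g \o f.

Program Definition Top : ecat :=
  @ECat topologicalType continuousType (fun X Y f g => f =1 g)
    (fun X => idfun) top_comp _ _ _ _ _ _ _.
Next Obligation. by []. Qed.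
Next Obligation. by move=> X Y f g fg x; rewrite fg. Qed.
Next Obligation. by move=> X Y f g h fg gh x; rewrite fg gh. Qed.
Next Obligation.
by move=> X Y Z g g' f f' gg' ff' x; rewrite /top_comp /= ff' gg'.
Qed.
Next Obligation. by []. Qed.
Next Obligation. by []. Qed.
Next Obligation. by []. Qed.

Section Homotopy.
Variable R : realType.

Definition unit_itv : set R := `[0, 1]%classic.
Definition itv : topologicalType := set_type unit_itv.

Lemma itv0_subproof : (0 : R) \in unit_itv.
Proof. by rewrite inE /unit_itv /= in_itv /= lexx ler01. Qed.

Lemma itv1_subproof : (1 : R) \in unit_itv.
Proof. by rewrite inE /unit_itv /= in_itv /= lexx ler01. Qed.

Definition itv0 : itv := exist _ 0 itv0_subproof.
Definition itv1 : itv := exist _ 1 itv1_subproof.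

(* The [n]-cube with the product topology, and its boundary. *)
Definition cube (n : nat) : topologicalType := prod_topology (fun _ : 'I_n => itv).

Definition cube_boundary (n : nat) (t : cube n) :=
  exists i : 'I_n, t i = itv0 \/ t i = itv1.

Definition homotopic (X Y : topologicalType) (f g : continuousType X Y) :=
  exists H : continuousType (X * itv)%type Y,
    forall x, H (x, itv0) = f x /\ H (x, itv1) = g x.

Definition homotopy_equivalence : arrow_class Top :=
  fun X Y (f : continuousType X Y) =>
    exists g : continuousType Y X,
      homotopic (top_comp g f) (idm (X : Top)) /\
      homotopic (top_comp f g) (idm (Y : Top)).

Definition joined (X : topologicalType) (x y : X) :=
  exists c : continuousType itv X, c itv0 = x /\ c itv1 = y.

Definition pi0_bijective (X Y : topologicalType) (f : continuousType X Y) :=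
  (forall x x' : X, joined (f x) (f x') -> joined x x') /\
  (forall y : Y, exists x : X, joined (f x) y).

Definition based_cube (n : nat) (X : topologicalType) (x : X) :=
  {a : continuousType (cube n) X | forall t, cube_boundary t -> a t = x}.

(* Homotopy relative to the boundary; pi_n(X, x) is the quotient of
   [based_cube n x] by this relation. *)
Definition homotopic_rel (n : nat) (X : topologicalType) (x : X)
    (a b : based_cube n x) :=
  exists H : continuousType (cube n * itv)%type X,
    (forall t, H (t, itv0) = proj1_sig a t /\ H (t, itv1) = proj1_sig b t) /\
    (forall t s, cube_boundary t -> H (t, s) = x).

Program Definition based_cube_map (n : nat) (X Y : topologicalType)
    (f : continuousType X Y) (x : X) (a : based_cube n x) :
  based_cube n (f x) := exist _ (top_comp f (proj1_sig a)) _.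
Next Obligation. by move=> n X Y f x [a aP] t tb /=; rewrite /top_comp /= aP. Qed.

Definition pi_bijective (n : nat) (X Y : topologicalType)
    (f : continuousType X Y) (x : X) :=
  (forall a b : based_cube n x,
     homotopic_rel (based_cube_map f a) (based_cube_map f b) ->
     homotopic_rel a b) /\
  (forall c : based_cube n (f x), exists a : based_cube n x,
     homotopic_rel (based_cube_map f a) c).

(* For n >= 1 the map induced by [f] on pi_n is a group homomorphism, hence an
   isomorphism as soon as it is bijective. *)
Definition weak_homotopy_equivalence : arrow_class Top :=
  fun X Y (f : continuousType X Y) =>
    pi0_bijective f /\ forall n (x : X), (0 < n)%N -> pi_bijective n f x.

Definition has_hlp (A E B : topologicalType) (p : continuousType E B) :=
  forall (f : continuousType A E) (H : continuousType (A * itv)%type B),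
    (forall a, H (a, itv0) = p (f a)) ->
    exists K : continuousType (A * itv)%type E,
      (forall a, K (a, itv0) = f a) /\ (forall z, p (K z) = H z).

Definition hurewicz_fibration : arrow_class Top :=
  fun E B (p : continuousType E B) => forall A : topologicalType, has_hlp A p.

Definition serre_fibration : arrow_class Top :=
  fun E B (p : continuousType E B) => forall n : nat, has_hlp (cube n) p.

Definition Top_S : model_data :=
  @ModelData Top homotopy_equivalence hurewicz_fibration.

Definition Top_Q : model_data :=
  @ModelData Top weak_homotopy_equivalence serre_fibration.

End Homotopy.

(* Main.v *)
Require Import Defs.
From HB Require Import structures.
From mathcomp Require Import all_boot all_order all_algebra.
From mathcomp Require Import all_classical all_reals all_analysis.
From mathcomp Require Import ring lra zify.
From Stdlib Require Import -(notations) Setoid Morphisms.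
From Stdlib Require List Eqdep_dec PeanoNat.
Require Import Defs.
Import Order.TTheory GRing.Theory Num.Theory numFieldNormedType.Exports.

Set Implicit Arguments.
Unset Strict Implicit.
Unset Printing Implicit Defensive.

Local Open Scope classical_set_scope.
Local Open Scope ring_scope.
Local Open Scope ecat_scope.

(* Objects of C_ex are handled through the setoid presheaves they represent, so
   that C_ex is locally cartesian closed as soon as C has finite products, weak
   pullbacks and weak dependent products: for B -> A -> X with X in C there is a
   weakly universal E -> X carrying a section of B over the pullback of A.  In a
   homotopy category A -> X and B -> A may be replaced by fibrations, and such
   sections then become strict data (s, t) over Q(Z x_X A) and Q(Z x_X A1),
   where A1 covers the equivalence relation of A and Q represents the maps of
   the homotopy category.

   For the Strøm structure Q is the identity, and E is the space of all strict
   data on fibres, each taken together with a filter along which evaluation is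
   continuous.

   For the Quillen structure QY is a cell complex whose cells are all maps from
   balls to Y, and E is a cell complex whose cells are all strict data over
   vector spaces, glued along open collars.  Every space receives a weak
   equivalence from the analogous complex of its singular cells, which maps to
   E.  The data of the cells of E are only compatible on small sets, so the
   generic section is defined on the complex of those cells of the pullback that
   lie over a common cell of E; this complex is weakly equivalent to the whole
   pullback by subdivision. *)

(** * Exact completions *)

(** Weak universality is what makes strict data suffice: a classifying map only has to exist, so [E]
    may simply collect all strict data, and uniqueness of transposes is restored in [C_ex] by
    identifying elements that name the same function. The obstacle in the Quillen case is that
    pulling back along an arbitrary [A -> X] does not commute with the colimits that define a cell
    complex: a function on [E x_X A] that is continuous over each cell may fail to be continuous.
    Two kinds of trees answer opposite needs. The complexes [Q Y] carry the fine topology, so that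
    maps out of them are built cell by cell, by recursion on trees; as an inductive type closed
    under attaching cells they replace a transfinite construction, and they are strictly functorial,
    as the strict equations between faces demand. The complexes [E] carry a coarse topology in which
    every cell has an open neighbourhood retracting onto it; these neighbourhoods can be pulled back
    along [A -> X], and functions on them are glued over an open cover. *)

#[export] Instance heq_equivalence (C : ecat) (X Y : C) :
  Equivalence (@heq C X Y).
Proof. by split; [exact: heq_refl|exact: heq_sym|exact: heq_trans]. Qed.

#[export] Instance comp_proper (C : ecat) (X Y Z : C) :
  Proper (respectful (@heq C Y Z) (respectful (@heq C X Y) (@heq C X Z)))
    (@comp C X Y Z).
Proof. by move=> g g' gg f f' ff; exact: comp_heq. Qed.

Section Elements.
Variable C : ecat.
Implicit Types R S X : pseudo_eqrel C.

(** Arrows from the projective object on [T] to [R] in the exact completion are arrows [T -> pcar R]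
    modulo this relation, so these are the generalized elements of [R]. *)
Definition exr R (T : C) (a b : hom T (pcar R)) :=
  exists t : hom T (prel R), pr1 R \c t === a /\ pr2 R \c t === b.

#[export] Instance exr_equivalence R (T : C) : Equivalence (@exr R T).
Proof.
split=> [a|a b [t [ta tb]]|a b c [t [ta tb]] [u [ub uc]]].
- have [rho [r1 r2]] := pseudo_refl R.
  by exists (rho \c a); rewrite !comp_assoc r1 r2 comp_idl.
- have [s [s1 s2]] := pseudo_sym R.
  by exists (s \c t); rewrite !comp_assoc s1 s2.
- have [P [p [q [[_ wpb] [tau [t1 t2]]]]]] := pseudo_trans R.
  have [v [vp vq]] := wpb _ t u (heq_trans tb (heq_sym ub)).
  exists (tau \c v); rewrite !comp_assoc t1 t2 -!comp_assoc vp vq.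
  by split.
Qed.

#[export] Instance exr_proper R (T : C) :
  Proper (respectful (@heq C T _) (respectful (@heq C T _) iff)) (@exr R T).
Proof.
move=> a a' aa b b' bb; split=> -[t [ta tb]]; exists t.
  by rewrite ta tb.
by rewrite ta tb aa bb.
Qed.

Lemma heq_exr R (T : C) (a b : hom T (pcar R)) : a === b -> exr a b.
Proof. by move=> ->; reflexivity. Qed.

Lemma exr_comp R (T U : C) (a b : hom T (pcar R)) (w : hom U T) :
  exr a b -> exr (a \c w) (b \c w).
Proof.
by move=> [t [ta tb]]; exists (t \c w); rewrite !comp_assoc ta tb.
Qed.

Lemma exr_hom R S (f : ex_hom R S) (T : C) (a b : hom T (pcar R)) :
  exr a b -> exr (proj1_sig f \c a) (proj1_sig f \c b).
Proof.
case: f => f [fh [f1 f2]] [t [ta tb]] /=; exists (fh \c t).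
by rewrite !comp_assoc f1 f2 -!comp_assoc ta tb.
Qed.

Definition ex_hom_of R S (f : hom (pcar R) (pcar S))
  (fP : forall (T : C) (a b : hom T (pcar R)), exr a b -> exr (f \c a) (f \c b)) :
  ex_hom R S.
Proof.
(* The pair [pr1 R], [pr2 R] is the generic related pair; the witness for its image is the tracking
   arrow. *)
exists f; have [|t [t1 t2]] := fP _ (pr1 R) (pr2 R).
  by exists (idm _); rewrite !comp_idr.
by exists t.
Defined.

Variables (wpb : forall (X Y Z : C) (f : hom X Z) (g : hom Y Z),
    exists (T : C) (a : hom T X) (b : hom T Y), is_weak_pullback f g a b).

(* A pseudo equivalence relation on [E0] is a weakly representable equivalence
   relation on the sets of arrows into [E0]. *)
Lemma weak_pullback_mkpe (E0 E1 : C) (e1 e2 : hom E1 E0)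
    (rel : forall T : C, hom T E0 -> hom T E0 -> Prop)
    (relE : forall (T : C) (u v : hom T E0), rel T u v <->
      exists t : hom T E1, e1 \c t === u /\ e2 \c t === v)
    (relQ : forall T : C, Equivalence (rel T)) :
  exists (T : C) (a b : hom T E1),
    is_weak_pullback e2 e1 a b /\
    exists tau : hom T E1, e1 \c tau === e1 \c a /\ e2 \c tau === e2 \c b.
Proof.
have [T [a [b wp]]] := wpb e2 e1.
exists T, a, b; split=> //; have [ab _] := wp.
apply/relE; transitivity (e2 \c a); apply/relE; first by exists a.
by exists b; split=> //; symmetry.
Qed.

Definition mkpe (E0 E1 : C) (e1 e2 : hom E1 E0)
    (rel : forall T : C, hom T E0 -> hom T E0 -> Prop)
    (relE : forall (T : C) (u v : hom T E0), rel T u v <->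
      exists t : hom T E1, e1 \c t === u /\ e2 \c t === v)
    (relQ : forall T : C, Equivalence (rel T)) : pseudo_eqrel C.
Proof.
refine (@PseudoEqrel C E0 E1 e1 e2 _ _ (weak_pullback_mkpe relE relQ)).
- by apply/relE; reflexivity.
- by apply/relE; symmetry; apply/relE; exists (idm _); rewrite !comp_idr.
Defined.

Lemma exr_mkpe (E0 E1 : C) (e1 e2 : hom E1 E0) rel relE relQ (T : C)
    (u v : hom T E0) :
  @exr (@mkpe E0 E1 e1 e2 rel relE relQ) T u v <-> rel T u v.
Proof. exact: iff_sym (relE T u v). Qed.

Definition proj_obj (X : C) : pseudo_eqrel C.
Proof.
apply: (@mkpe X X (idm X) (idm X) (fun T u v => u === v)) => T u v.
split=> [uv|[t [<- <-]]]; last by reflexivity.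
by exists u; rewrite comp_idl.
Defined.

Lemma exr_proj (X T : C) (u v : hom T X) : @exr (proj_obj X) T u v <-> u === v.
Proof. exact: exr_mkpe. Qed.

Variable prodC : has_binary_products C.

(** This is the weak pullback of [(p, q)] and [(pr1 R, pr2 R)] over the product of two copies of
    [pcar R]: a point of [K] together with a witness that its two images are related. *)
Lemma weak_inserter R (K : C) (p q : hom K (pcar R)) :
  exists (L : C) (l : hom L K), exr (p \c l) (q \c l) /\
    forall (T : C) (k : hom T K), exr (p \c k) (q \c k) ->
      exists m : hom T L, l \c m === k.
Proof.
have [P [p1 [p2 PP]]] := prodC (pcar R) (pcar R).
have [pq [pq1 pq2 _]] := PP _ p q.
have [rr [rr1 rr2 _]] := PP _ (pr1 R) (pr2 R).
have [L [l [r [lr wpL]]]] := wpb pq rr.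
exists L, l; split.
  exists r; rewrite -rr1 -rr2 -!comp_assoc -lr !comp_assoc pq1 pq2.
  by split; reflexivity.
move=> T k [t [t1 t2]]; have [|m [m1 _]] := wpL _ k t; last by exists m.
have [h [_ _ hP]] := PP _ (p \c k) (q \c k).
rewrite (hP (pq \c k)) ?comp_assoc ?pq1 ?pq2 //; symmetry.
by apply: hP; rewrite comp_assoc ?rr1 ?rr2.
Qed.

Lemma weak_comma R (Y Z : C) (f : hom Y (pcar R)) (g : hom Z (pcar R)) :
  exists (V : C) (y : hom V Y) (z : hom V Z), exr (f \c y) (g \c z) /\
    forall (T : C) (h : hom T Y) (k : hom T Z), exr (f \c h) (g \c k) ->
      exists m : hom T V, y \c m === h /\ z \c m === k.
Proof.
have [P [p1 [p2 PP]]] := prodC Y Z.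
have [L [l [le lP]]] := weak_inserter (f \c p1) (g \c p2).
exists L, (p1 \c l), (p2 \c l); split; first by rewrite !comp_assoc.
move=> T h k hk; have [m [m1 m2 _]] := PP _ h k.
have [|n nP] := lP _ m; first by rewrite -!comp_assoc m1 m2.
by exists n; rewrite -!comp_assoc nP.
Qed.

Lemma weak_kernel2 R S (V : C) (a : hom V (pcar R)) (b : hom V (pcar S)) :
  exists (K : C) (k1 k2 : hom K V), forall (T : C) (u v : hom T V),
    (exr (a \c u) (a \c v) /\ exr (b \c u) (b \c v)) <->
    exists t : hom T K, k1 \c t === u /\ k2 \c t === v.
Proof.
have [K [k1 [k2 [ke kP]]]] := weak_comma a a.
have [L [l [le lP]]] := weak_inserter (b \c k1) (b \c k2).
exists L, (k1 \c l), (k2 \c l) => T u v; split=> [[au bu]|[t [<- <-]]].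
  have [m [m1 m2]] := kP _ u v au.
  have [|n nP] := lP _ m; first by rewrite -!comp_assoc m1 m2.
  by exists n; rewrite -!comp_assoc nP.
by rewrite !comp_assoc; split; apply: exr_comp => //; exact: exr_comp.
Qed.

Lemma ex_pullback (A B X : pseudo_eqrel C) (f : hom (pcar A) (pcar X))
    (g : hom (pcar B) (pcar X)) :
  exists (P : pseudo_eqrel C) (a : hom (pcar P) (pcar A))
    (b : hom (pcar P) (pcar B)),
  [/\ exr (f \c a) (g \c b),
    forall (T : C) (u v : hom T (pcar P)),
      exr u v <-> exr (a \c u) (a \c v) /\ exr (b \c u) (b \c v) &
    forall (T : C) (h : hom T (pcar A)) (k : hom T (pcar B)),
      exr (f \c h) (g \c k) ->
      exists m : hom T (pcar P), a \c m === h /\ b \c m === k].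
Proof.
have [V [a [b [ab Vw]]]] := weak_comma f g.
have [K [k1 [k2 kP]]] := weak_kernel2 a b.
have eqv T : Equivalence (fun u v : hom T V =>
    exr (a \c u) (a \c v) /\ exr (b \c u) (b \c v)).
  split=> [u|u v [H1 H2]|u v w [H1 H2] [H3 H4]].
  - by split; reflexivity.
  - by split; symmetry.
  - by split; [transitivity (a \c v)|transitivity (b \c v)].
by exists (mkpe kP eqv), a, b; split=> // T u v; exact: exr_mkpe.
Qed.

(** [D] is the locus of [V] where [p] and [q] are related in [S], with the relation induced by [R]
    along [a]. With [p] and [q] two evaluations, its sections express that two functions agree at
    every argument. *)
Lemma ex_subobject R S (V : C) (a : hom V (pcar R)) (p q : hom V (pcar S)) :
  exists (D : pseudo_eqrel C) (d : hom (pcar D) V),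
  [/\ exr (p \c d) (q \c d),
    forall (T : C) (u v : hom T (pcar D)),
      exr u v <-> exr (a \c d \c u) (a \c d \c v) &
    forall (T : C) (k : hom T V), exr (p \c k) (q \c k) ->
      exists m : hom T (pcar D), d \c m === k].
Proof.
have [L [l [le lP]]] := weak_inserter p q.
have [K [k1 [k2 [ke kP]]]] := weak_comma (a \c l) (a \c l).
have relE T (u v : hom T L) : exr (a \c l \c u) (a \c l \c v) <->
    exists t : hom T K, k1 \c t === u /\ k2 \c t === v.
  split=> [uv|[t [<- <-]]]; first exact: kP.
  by rewrite !(comp_assoc (a \c l)); exact: exr_comp.
have eqv T : Equivalence (fun u v : hom T L =>
    exr (a \c l \c u) (a \c l \c v)).
  split=> [u|u v H1|u v w H1 H2]; first by reflexivity.
    by symmetry.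
  by transitivity (a \c l \c v).
by exists (mkpe relE eqv), l; split=> // T u v; exact: exr_mkpe.
Qed.

End Elements.

(** * Weak dependent products and exponentials in the slices of the exact completion *)

Section DependentProducts.
Variable C : ecat.

Definition is_section (X : C) (A B : pseudo_eqrel C) (f : hom (pcar A) X)
    (be : hom (pcar B) (pcar A)) (W : C) (x : hom W X) (V : C) (u : hom V W)
    (a : hom V (pcar A)) (s : hom V (pcar B)) :=
  [/\ is_weak_pullback x f u a, be \c s === a &
    forall (T : C) (v v' : hom T V),
      u \c v === u \c v' -> exr (a \c v) (a \c v') -> exr (s \c v) (s \c v')].

(* A section over [x : W -> X] is an arrow over [A] from the pullback of [A]
   along [x] to [B] in the exact completion, where [X] and [W] are projective. *)
Definition weak_dependent_products :=
  forall (X : C) (A B : pseudo_eqrel C) (f : hom (pcar A) X)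
    (be : hom (pcar B) (pcar A)),
  exists (E : C) (x0 : hom E X) (V0 : C) (u0 : hom V0 E)
    (a0 : hom V0 (pcar A)) (s0 : hom V0 (pcar B)),
  is_section f be x0 u0 a0 s0 /\
  forall (W : C) (x : hom W X) (V : C) (u : hom V W) (a : hom V (pcar A))
    (s : hom V (pcar B)), is_section f be x u a s ->
  exists F : hom W E, x0 \c F === x /\
    forall (T : C) (v : hom T V) (v0 : hom T V0),
      F \c (u \c v) === u0 \c v0 -> a \c v === a0 \c v0 ->
      exr (s \c v) (s0 \c v0).

End DependentProducts.

Section ExactCompletionLCC.
Variable C : ecat.
Hypotheses (termC : has_terminal C) (prodC : has_binary_products C).
Hypothesis wpb : forall (X Y Z : C) (f : hom X Z) (g : hom Y Z),
  exists (T : C) (a : hom T X) (b : hom T Y), is_weak_pullback f g a b.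

Let Cex : ecat := exact_completion C.

Lemma ex_terminal : has_terminal Cex.
Proof.
have [T TP] := termC.
exists (proj_obj wpb T) => R; have [h hP] := TP (pcar R).
have hh (U : C) (a b : hom U (pcar R)) : exr a b ->
    @exr _ (proj_obj wpb T) _ (h \c a) (h \c b).
  move=> _; apply/exr_proj; have [k kP] := TP U.
  by rewrite (kP (h \c a)) (kP (h \c b)).
exists (ex_hom_of hh) => k; change (@exr _ (proj_obj wpb T) _ (proj1_sig k) h).
by apply/exr_proj; exact: hP.
Qed.

Lemma slice_terminal (D : ecat) (X : D) : has_terminal (slice X).
Proof.
exists (existT (fun Y => hom Y X) X (idm X)) => -[Y p].
have pP : idm X \c p === p by exact: comp_idl.
by exists (exist (fun g => idm X \c g === p) p pP) => -[k kP]; exact: heq_trans (heq_sym (comp_idl k)) kP.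
Qed.

Variable X : pseudo_eqrel C.
Local Notation SX := (@slice Cex X).
Local Notation car A := (pcar (projT1 A)).
Local Notation str A := (proj1_sig (projT2 A)).
Local Notation fn h := (proj1_sig (proj1_sig h)).

Definition slice_obj (A : pseudo_eqrel C) (f : ex_hom A X) : SX :=
  existT (fun Y : Cex => hom Y (X : Cex)) (A : Cex) f.

Definition slice_map (A B : SX) (f : ex_hom (projT1 A) (projT1 B))
  (fP : exr (str B \c proj1_sig f) (str A)) : hom A B := exist _ f fP.

Lemma slice_over (A B : SX) (f : hom A B) : exr (str B \c fn f) (str A).
Proof. exact: (proj2_sig f). Qed.

Lemma test_hom_subproof (T : C) (R : pseudo_eqrel C) (a : hom T (pcar R))
  (U : C) (c d : hom U (pcar (proj_obj wpb T))) :
  exr c d -> exr (a \c c) (a \c d).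
Proof. by move=> /exr_proj cd; rewrite cd; reflexivity. Qed.

Definition test_map (T : C) (x : hom T (pcar X)) : ex_hom (proj_obj wpb T) X :=
  ex_hom_of (test_hom_subproof x).

Definition test_obj (T : C) (x : hom T (pcar X)) : SX :=
  slice_obj (test_map x).

Definition test_hom (T : C) (x : hom T (pcar X)) (A : SX) (a : hom T (car A))
    (aP : exr (str A \c a) x) : hom (test_obj x) A :=
  @slice_map (test_obj x) A (ex_hom_of (test_hom_subproof a)) aP.

(** The universal property is tested on objects with projective domain: there an arrow is a single
    element, so pairings and their uniqueness become statements about elements of [P]. *)
Lemma product_elements (A B P : SX) (p1 : hom P A) (p2 : hom P B) :
  is_product p1 p2 ->
  (forall (T : C) (h : hom T (car A)) (k : hom T (car B)),
    exr (str A \c h) (str B \c k) -> exists q : hom T (car P),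
      exr (fn p1 \c q) h /\ exr (fn p2 \c q) k) /\
  (forall (T : C) (q q' : hom T (car P)), exr (fn p1 \c q) (fn p1 \c q') ->
    exr (fn p2 \c q) (fn p2 \c q') -> exr q q').
Proof.
move=> PP; split=> [T h k hk|T q q' e1 e2].
  have kh : exr (str B \c k) (str A \c h) by symmetry.
  have [m [m1 m2 _]] := PP _ (test_hom (reflexivity (str A \c h))) (test_hom kh).
  by exists (fn m); split; [exact: m1|exact: m2].
have o1 : exr (str A \c (fn p1 \c q)) (str P \c q).
  by rewrite comp_assoc; apply: exr_comp; exact: slice_over.
have o2 : exr (str B \c (fn p2 \c q)) (str P \c q).
  by rewrite comp_assoc; apply: exr_comp; exact: slice_over.
have o' : exr (str P \c q') (str P \c q).
  transitivity (str A \c (fn p1 \c q')).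
    by rewrite comp_assoc; apply: exr_comp; symmetry; exact: slice_over.
  by transitivity (str A \c (fn p1 \c q)) => //; apply: exr_hom; symmetry.
have [m [_ _ mP]] := PP _ (test_hom o1) (test_hom o2).
have H1 := mP (test_hom (reflexivity (str P \c q))).
have H2 := mP (test_hom o').
transitivity (fn m); first by apply: H1; apply/heq_exr.
by symmetry; apply: H2; [symmetry; exact: e1|symmetry; exact: e2].
Qed.

Lemma ex_pullback_product (A B : SX) (P : pseudo_eqrel C)
    (a : hom (pcar P) (car A)) (b : hom (pcar P) (car B)) :
  exr (str A \c a) (str B \c b) ->
  (forall (T : C) (u v : hom T (pcar P)),
      exr u v <-> exr (a \c u) (a \c v) /\ exr (b \c u) (b \c v)) ->
  (forall (T : C) (h : hom T (car A)) (k : hom T (car B)),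
      exr (str A \c h) (str B \c k) ->
      exists m : hom T (pcar P), a \c m === h /\ b \c m === k) ->
  exists (p : ex_hom P X) (p1 : hom (slice_obj p) A) (p2 : hom (slice_obj p) B),
    [/\ is_product p1 p2, fn p1 = a & fn p2 = b].
Proof.
move=> ab Pe Pu.
have ha (T : C) (c d : hom T (pcar P)) : exr c d -> exr (a \c c) (a \c d).
  by move=> /Pe[].
have hb (T : C) (c d : hom T (pcar P)) : exr c d -> exr (b \c c) (b \c d).
  by move=> /Pe[].
have hx (T : C) (c d : hom T (pcar P)) : exr c d ->
    exr (str A \c a \c c) (str A \c a \c d).
  by move=> /ha cd; rewrite -!comp_assoc; exact: exr_hom.
pose Q := slice_obj (ex_hom_of hx).
have o1 : exr (str A \c proj1_sig (ex_hom_of ha)) (str Q) by reflexivity.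
have o2 : exr (str B \c proj1_sig (ex_hom_of hb)) (str Q) by symmetry.
pose p1 : hom Q A := @slice_map Q A _ o1.
pose p2 : hom Q B := @slice_map Q B _ o2.
exists (ex_hom_of hx), p1, p2; split=> // W f g.
have fg : exr (str A \c fn f) (str B \c fn g).
  by transitivity (str W); [|symmetry]; exact: slice_over.
have [m [m1 m2]] := Pu _ _ _ fg.
have mh (T : C) (c d : hom T (car W)) : exr c d -> exr (m \c c) (m \c d).
  move=> cd; apply/Pe; rewrite !comp_assoc m1 m2.
  by split; [exact: (exr_hom (proj1_sig f))|exact: (exr_hom (proj1_sig g))].
have mo : exr (str Q \c proj1_sig (ex_hom_of mh)) (str W).
  by rewrite /= -comp_assoc m1; exact: slice_over.
exists (@slice_map W Q _ mo); split; [exact: heq_exr|exact: heq_exr|].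
move=> k k1 k2; apply/Pe; split; rewrite ?m1 ?m2; [exact: k1|exact: k2].
Qed.

Lemma slice_products : has_binary_products SX.
Proof.
move=> A B; have [P [a [b [ab Pe Pu]]]] := ex_pullback wpb prodC (str A) (str B).
have [p [p1 [p2 [PP _ _]]]] := ex_pullback_product ab Pe Pu.
by exists (slice_obj p), p1, p2.
Qed.

Hypothesis wdpC : weak_dependent_products C.

Section Exponential.
Variables A B : SX.
Let X0 : C := pcar X.
Let f : hom (car A) X0 := str A.
Let g : hom (car B) X0 := str B.

Let f_hom (T : C) (a b : hom T (car A)) : exr a b -> exr (f \c a) (f \c b).
Proof. exact: exr_hom. Qed.

Variables (A' : pseudo_eqrel C) (xA : hom (pcar A') X0)
  (aA : hom (pcar A') (car A)).
Hypotheses (A'c : exr xA (f \c aA))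
  (A'e : forall (T : C) (u v : hom T (pcar A')),
    exr u v <-> xA \c u === xA \c v /\ exr (aA \c u) (aA \c v))
  (A'u : forall (T : C) (h : hom T X0) (k : hom T (car A)),
    exr h (f \c k) ->
    exists m : hom T (pcar A'), xA \c m === h /\ aA \c m === k).

Variables (B' : pseudo_eqrel C) (be : hom (pcar B') (pcar A'))
  (bB : hom (pcar B') (car B)).
Hypotheses (B'c : exr (f \c aA \c be) (g \c bB))
  (B'e : forall (T : C) (u v : hom T (pcar B')),
    exr u v <-> exr (be \c u) (be \c v) /\ exr (bB \c u) (bB \c v))
  (B'u : forall (T : C) (h : hom T (pcar A')) (k : hom T (car B)),
    exr (f \c aA \c h) (g \c k) ->
    exists m : hom T (pcar B'), be \c m === h /\ bB \c m === k).

Variables (E0 : C) (x0 : hom E0 X0) (V0 : C) (u0 : hom V0 E0)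
  (a0 : hom V0 (pcar A')) (s0 : hom V0 (pcar B')).
Hypotheses (E0s : is_section xA be x0 u0 a0 s0)
  (E0u : forall (W : C) (x : hom W X0) (V : C) (u : hom V W)
    (a : hom V (pcar A')) (s : hom V (pcar B')), is_section xA be x u a s ->
  exists F : hom W E0, x0 \c F === x /\
    forall (T : C) (v : hom T V) (v0 : hom T V0),
      F \c (u \c v) === u0 \c v0 -> a \c v === a0 \c v0 ->
      exr (s \c v) (s0 \c v0)).

Let val0 : hom V0 (car B) := bB \c s0.
Let arg0 : hom V0 (car A) := aA \c a0.

Let sq0 : x0 \c u0 === xA \c a0. Proof. by case: E0s => [[]]. Qed.

Lemma val0_ext (T : C) (v v' : hom T V0) : u0 \c v === u0 \c v' ->
  exr (arg0 \c v) (arg0 \c v') -> exr (val0 \c v) (val0 \c v').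
Proof.
move=> uv; rewrite -!comp_assoc => av; have [_ _ H] := E0s.
have /B'e[] // : exr (s0 \c v) (s0 \c v').
apply: H => //; apply/A'e; split=> //.
by rewrite !comp_assoc -sq0 -!comp_assoc uv.
Qed.

Lemma V0_lift (T : C) (p : hom T E0) (a : hom T (car A)) :
  exr (x0 \c p) (f \c a) ->
  exists v : hom T V0, u0 \c v === p /\ arg0 \c v === a.
Proof.
move=> pa; have [m [m1 m2]] := A'u pa.
have [[_ H] _ _] := E0s; have [|v [v1 v2]] := H _ p m; first by rewrite m1.
by exists v; split=> //; rewrite -comp_assoc v2.
Qed.

Lemma x0_arg (T : C) (v : hom T V0) : exr (x0 \c (u0 \c v)) (f \c (arg0 \c v)).
Proof. by rewrite !comp_assoc sq0; do 2!apply: exr_comp. Qed.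

(** Extensional equality of names of functions: same point of [X], and related values at related
    arguments. Dividing [E0] by it is what makes transposes unique. *)
Definition exp_rel (T : C) (p q : hom T E0) :=
  exr (x0 \c p) (x0 \c q) /\
  forall (U : C) (w : hom U T) (v v' : hom U V0),
    u0 \c v === p \c w -> u0 \c v' === q \c w ->
    exr (arg0 \c v) (arg0 \c v') -> exr (val0 \c v) (val0 \c v').

#[local] Instance exp_rel_proper (T : C) :
  Proper (respectful heq (respectful heq iff)) (@exp_rel T).
Proof.
move=> p p' pp q q' qq; split=> -[pq H]; split.
- by rewrite -pp -qq.
- by move=> U w v v'; rewrite -pp -qq; exact: H.
- by rewrite pp qq.
- by move=> U w v v'; rewrite pp qq; exact: H.
Qed.

Lemma exp_rel_equivalence (T : C) : Equivalence (@exp_rel T).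
Proof.
split=> [p|p q [pq H]|p q r [pq H] [qr K]].
- split=> [|U w v v' vp vq]; first by reflexivity.
  by apply: val0_ext; rewrite vp vq.
- split=> [|U w v v' vp vq va]; first by symmetry.
  by symmetry; apply: (H _ w) => //; symmetry.
- split=> [|U w v v' vp vr va]; first by transitivity (x0 \c q).
  have [|v1 [v1q v1a]] := @V0_lift _ (q \c w) (arg0 \c v).
    transitivity (x0 \c (u0 \c v)); last exact: x0_arg.
    by rewrite vp !comp_assoc; symmetry; exact: exr_comp.
  transitivity (val0 \c v1).
    by apply: (H _ w) => //; rewrite v1a; reflexivity.
  by apply: (K _ w) => //; rewrite v1a.
Qed.

(** Agreement at all arguments is itself a dependent product. Over the object [P] of pairs of names
    in one fibre, [A2] is the pullback of [A] and [D] its part where the two values agree; a section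
    of [D] over a pair proves that the pair is related, and [weak_dependent_products] collects these
    sections in [F0]. *)
Lemma exp_rel_representable :
  exists (E1 : C) (e1 e2 : hom E1 E0), forall (T : C) (p q : hom T E0),
    exp_rel p q <-> exists t : hom T E1, e1 \c t === p /\ e2 \c t === q.
Proof.
have [P [p [q [pq Pu]]]] := weak_comma wpb prodC (R := X) x0 x0.
have [A2 [pA [aA2 [A2c A2u]]]] : exists (A2 : pseudo_eqrel C)
    (pA : hom (pcar A2) P) (aA2 : hom (pcar A2) (car A)),
    [/\ exr (x0 \c p \c pA) (f \c aA2) &
    forall (T : C) (h : hom T P) (k : hom T (car A)),
      exr (x0 \c p \c h) (f \c k) ->
      exists m : hom T (pcar A2), pA \c m === h /\ aA2 \c m === k].
  have [A2 [pA [aA2 [A2c _ A2u]]]] :=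
    @ex_pullback _ wpb prodC (proj_obj wpb P) (projT1 A) X (x0 \c p) f.
  by exists A2, pA, aA2.
have [v [v1 v2]] : exists v : hom (pcar A2) V0,
    u0 \c v === p \c pA /\ arg0 \c v === aA2.
  by apply: V0_lift; rewrite comp_assoc.
have [v' [v1' v2']] : exists v : hom (pcar A2) V0,
    u0 \c v === q \c pA /\ arg0 \c v === aA2.
  apply: V0_lift; rewrite comp_assoc; transitivity (x0 \c p \c pA) => //.
  by symmetry; apply: exr_comp.
have [D [d [Dc De Du]]] := ex_subobject wpb prodC (R := A2) (S := projT1 B)
  (idm _) (val0 \c v) (val0 \c v').
have [F0 [y0 [V1 [u1 [a1 [s1 [[[V1c V1u] s1a _] F0u]]]]]]] := wdpC (pA) d.
exists F0, (p \c y0), (q \c y0) => T p' q'; split=> [|[t [<- <-]]]; last first.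
  split; first by rewrite !comp_assoc; do 2!apply: exr_comp.
  move=> U w z z' z1 z1' za.
  have [|k [k1 k2]] := A2u _ (y0 \c (t \c w)) (arg0 \c z).
    transitivity (x0 \c (u0 \c z)); last exact: x0_arg.
    by rewrite z1 !comp_assoc; reflexivity.
  have [|l [l1 l2]] := V1u _ (t \c w) k; first by symmetry; exact: k1.
  have H : exr (val0 \c v \c k) (val0 \c v' \c k).
    have -> : k === d \c (s1 \c l) by rewrite comp_assoc s1a l2.
    by rewrite !(comp_assoc _ d); exact: exr_comp.
  transitivity (val0 \c v \c k).
    rewrite -comp_assoc; apply: val0_ext.
      by rewrite z1 comp_assoc v1 -(comp_assoc p pA) k1 !comp_assoc.
    by rewrite comp_assoc v2 k2; reflexivity.
  transitivity (val0 \c v' \c k) => //.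
  rewrite -comp_assoc; apply: val0_ext.
    by rewrite z1' comp_assoc v1' -(comp_assoc q pA) k1 !comp_assoc.
  by rewrite comp_assoc v2' k2.
move=> [xpq pqP].
have [m [m1 m2]] := Pu _ _ _ xpq.
have [V [u [a [Vc Vu]]]] := wpb m pA.
have [|s sP] := Du _ a.
  rewrite -!(comp_assoc val0); apply: (pqP _ u).
  - by rewrite comp_assoc v1 -comp_assoc -Vc comp_assoc m1.
  - by rewrite comp_assoc v1' -comp_assoc -Vc comp_assoc m2.
  - by rewrite !comp_assoc v2 v2'; reflexivity.
have [|F [F1 _]] := F0u _ m V u a s.
  split=> // U z z' _ az; apply/De; rewrite comp_idl !comp_assoc.
  by rewrite sP.
by exists F; rewrite -!comp_assoc F1.
Qed.

Lemma slice_exponential : exists (E P : SX) (p1 : hom P E) (p2 : hom P A)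
  (ev : hom P B), is_exponential p1 p2 ev.
Proof.
have [E1 [e1 [e2 EP]]] := exp_rel_representable.
pose E := mkpe wpb EP exp_rel_equivalence.
have Ee (T : C) (p q : hom T (pcar E)) : exr p q <-> exp_rel p q.
  exact: exr_mkpe.
have Eh (T : C) (p q : hom T (pcar E)) : exr p q -> exr (x0 \c p) (x0 \c q).
  by case/Ee.
pose ES : SX := slice_obj (@ex_hom_of _ E X x0 Eh).
have [P [eP [aP [Pc Pe Pu]]]] := ex_pullback wpb prodC (str ES) (str A).
have [p [p1 [p2 [PP p1E p2E]]]] := ex_pullback_product Pc Pe Pu.
have [vP [vP1 vP2]] := V0_lift Pc.
have evh (T : C) (z z' : hom T (pcar P)) : exr z z' ->
    exr (val0 \c vP \c z) (val0 \c vP \c z').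
  move=> /Pe[/Ee[_ H] za]; rewrite -!(comp_assoc val0); apply: (H _ (idm T)).
  - by rewrite comp_idr comp_assoc vP1.
  - by rewrite comp_idr comp_assoc vP1.
  - by rewrite !comp_assoc vP2.
have valf (T : C) (v : hom T V0) : exr (g \c (val0 \c v)) (f \c (arg0 \c v)).
  rewrite !comp_assoc; apply: exr_comp; have [_ e _] := E0s.
  transitivity (f \c aA \c be \c s0).
    by rewrite /val0; apply: exr_comp; symmetry; exact: B'c.
  by apply: heq_exr; rewrite /arg0 -e; rewrite !comp_assoc.
have evo : exr (str B \c (val0 \c vP)) (proj1_sig p).
  transitivity (f \c (arg0 \c vP)); first exact: valf.
  transitivity (f \c aP); first by apply/heq_exr; rewrite vP2.
  by have := slice_over p2; rewrite p2E.
pose ev : hom (slice_obj p) B := @slice_map (slice_obj p) B (ex_hom_of evh) evo.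
exists ES, (slice_obj p), p1, p2, ev; split=> // W Q q1 q2 QP phi.
have [Qu Qe] := product_elements QP.
pose xW : hom (car W) X0 := str W.
have xWh (T : C) (c d : hom T (car W)) : exr c d -> exr (xW \c c) (xW \c d).
  exact: exr_hom.
(* Over the pullback [V] of [A'] along [xW] the arrow [phi] becomes a section of [B']; the arrow [F]
   that classifies this section is the transpose of [phi]. *)
have [V [u [a [Vc Vu]]]] := wpb xW xA.
have [|r [r1 r2]] := Qu _ u (aA \c a).
  change (exr (xW \c u) (f \c (aA \c a))).
  by rewrite Vc comp_assoc; exact: exr_comp.
have phih (T : C) (c d : hom T (car Q)) : exr c d ->
    exr (fn phi \c c) (fn phi \c d) by exact: exr_hom.
have phio (T : C) (c : hom T (car Q)) (d : hom T (car A)) :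
    exr (fn q2 \c c) d -> exr (f \c d) (g \c (fn phi \c c)).
  move=> cd; transitivity (f \c (fn q2 \c c)).
    by symmetry; apply: f_hom.
  transitivity (str Q \c c).
    by rewrite comp_assoc; apply: exr_comp; exact: slice_over.
  by rewrite comp_assoc; apply: exr_comp; symmetry; exact: slice_over.
have [|s [s1 s2]] := B'u (h := a) (k := fn phi \c r).
  by rewrite -comp_assoc; exact: phio.
have Vs : is_section xA be xW u a s.
  split=> // T z z' uz az; apply/B'e; rewrite !comp_assoc s1 s2; split=> //.
  rewrite -!comp_assoc; apply: phih; apply: Qe; rewrite !comp_assoc.
    transitivity (u \c z); first exact: exr_comp.
    by rewrite uz; symmetry; exact: exr_comp.
  transitivity (aA \c a \c z); first exact: exr_comp.
  transitivity (aA \c a \c z'); last by symmetry; exact: exr_comp.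
  by rewrite -!comp_assoc; case/A'e: az.
have [F [F1 F2]] := E0u Vs.
have FP (T : C) (c : hom T (car Q)) (w : hom T (car W)) (v : hom T V0) :
    exr (fn q1 \c c) w -> exr (fn q2 \c c) (arg0 \c v) ->
    u0 \c v === F \c w -> exr (val0 \c v) (fn phi \c c).
  move=> cw cv vw.
  have [|z [z1 z2]] := Vu _ w (a0 \c v).
    by rewrite comp_assoc -sq0 -comp_assoc vw comp_assoc F1.
  have /B'e[_] : exr (s \c z) (s0 \c v) by apply: F2; rewrite ?z1 ?vw ?z2.
  rewrite !comp_assoc s2 => H; symmetry; transitivity (fn phi \c r \c z) => //.
  rewrite -comp_assoc; apply: phih; apply: Qe.
    transitivity w => //; rewrite comp_assoc -z1; symmetry.
    exact: exr_comp.
  transitivity (arg0 \c v) => //; symmetry; rewrite comp_assoc.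
  transitivity (aA \c a \c z); first exact: exr_comp.
  by rewrite -!comp_assoc z2; reflexivity.
have QV (T : C) (p' : hom T E0) (w : hom T (car W)) (v : hom T V0) :
    u0 \c v === p' -> exr (x0 \c p') (xW \c w) ->
    exists c : hom T (car Q), exr (fn q1 \c c) w /\ exr (fn q2 \c c) (arg0 \c v).
  move=> vp pw; apply: Qu; symmetry; transitivity (x0 \c p') => //.
  by rewrite -vp; symmetry; exact: x0_arg.
have Fh (T : C) (c d : hom T (car W)) : exr c d ->
    @exr _ E _ (F \c c) (F \c d).
  move=> cd; apply/Ee; split; first by rewrite !comp_assoc F1; exact: xWh.
  move=> U w v v' vc vd va.
  have [|e [ee1 ee2]] := QV _ _ (c \c w) v vc.
    by rewrite !comp_assoc F1; reflexivity.
  transitivity (fn phi \c e); first by apply: (FP _ _ _ _ ee1 ee2); rewrite vc comp_assoc.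
  symmetry; apply: (FP _ _ (d \c w)).
  - transitivity (c \c w) => //; exact: exr_comp.
  - by transitivity (arg0 \c v).
  - by rewrite vd comp_assoc.
have Fo : exr (str ES \c F) (str W) by exact: heq_exr.
pose hF : hom W ES := @slice_map W ES (@ex_hom_of _ _ E F Fh) Fo.
exists hF; split.
  have Fq : exr (str ES \c (F \c fn q1)) (str A \c fn q2).
    change (exr (x0 \c (F \c fn q1)) (f \c fn q2)).
    rewrite comp_assoc F1; transitivity (str Q); first exact: slice_over.
    by symmetry; exact: slice_over.
  have [m [m1 m2]] := Pu _ _ _ Fq.
  have mh (T : C) (c d : hom T (car Q)) : exr c d -> exr (m \c c) (m \c d).
    move=> cd; apply/Pe; rewrite !comp_assoc m1 m2; split.
      by rewrite -!comp_assoc; apply: (Fh); exact: exr_hom.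
    exact: exr_hom.
  have mo : exr (proj1_sig p \c m) (str Q).
    transitivity (f \c fn q2); last exact: slice_over.
    transitivity (f \c (fn p2 \c m)); last by rewrite p2E m2; reflexivity.
    rewrite comp_assoc; apply: exr_comp; symmetry.
    exact: (slice_over p2).
  exists (@slice_map Q (slice_obj p) (ex_hom_of mh) mo); split.
  - by change (@exr _ E _ (fn p1 \c m) (F \c fn q1)); rewrite p1E; exact: heq_exr.
  - by change (exr (fn p2 \c m) (fn q2)); rewrite p2E; exact: heq_exr.
  - change (exr (val0 \c vP \c m) (fn phi)).
    transitivity (fn phi \c idm _); last by rewrite comp_idr; reflexivity.
    rewrite -comp_assoc; apply: (FP _ _ (fn q1)); rewrite ?comp_idr //.
    + by reflexivity.
    + by rewrite comp_assoc vP2 m2; reflexivity.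
    + by rewrite comp_assoc vP1 m1.
move=> k [m [m1 m2 m3]].
have km1 : @exr _ E _ (eP \c fn m) (fn k \c fn q1) by rewrite -p1E; exact: m1.
have km2 : exr (aP \c fn m) (fn q2) by rewrite -p2E; exact: m2.
have km3 : exr (val0 \c vP \c fn m) (fn phi) by exact: m3.
have kx : exr (x0 \c fn k) xW by exact: (slice_over k).
(* Any other transpose [k] names a function with the same values as [phi], hence is related to [F]
   by [exp_rel]. *)
change (@exr _ E _ (fn k) F); apply/Ee; split; first by rewrite F1.
move=> U w v v' vk vF va.
have [|c [c1 c2]] := QV _ _ w v vk.
  by rewrite comp_assoc; exact: exr_comp.
transitivity (fn phi \c c); last first.
  by symmetry; apply: (FP _ _ w) => //; transitivity (arg0 \c v).
transitivity (val0 \c vP \c fn m \c c); last exact: exr_comp.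
have /Ee[_ H] : @exr _ E _ (fn k \c w) (eP \c (fn m \c c)).
  transitivity (fn k \c (fn q1 \c c)).
    by symmetry; apply: (exr_hom (proj1_sig k)).
  by rewrite !comp_assoc; symmetry; exact: exr_comp.
rewrite -!(comp_assoc val0); apply: (H _ (idm U)).
- by rewrite comp_idr.
- by rewrite comp_idr !(comp_assoc u0) vP1 -(comp_assoc eP).
- rewrite !(comp_assoc arg0) vP2; symmetry; transitivity (fn q2 \c c) => //.
  exact: exr_comp.
Qed.

End Exponential.

(** The weak dependent products are over a base in [C], so [A] and [B] are first pulled back along
    the projective cover [pcar X] of [X]; the relation of [X] comes back in [exp_rel]. *)
Lemma slice_exponentials : has_exponentials SX.
Proof.
move=> A B.
have [A' [xA [aA [A'c A'e A'u]]]] : exists (A' : pseudo_eqrel C)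
    (xA : hom (pcar A') (pcar X)) (aA : hom (pcar A') (car A)),
    [/\ exr xA (str A \c aA),
      forall (T : C) (u v : hom T (pcar A')),
        exr u v <-> xA \c u === xA \c v /\ exr (aA \c u) (aA \c v) &
      forall (T : C) (h : hom T (pcar X)) (k : hom T (car A)),
        exr h (str A \c k) ->
        exists m : hom T (pcar A'), xA \c m === h /\ aA \c m === k].
  have [A' [xA [aA [A'c A'e A'u]]]] :=
    @ex_pullback _ wpb prodC (proj_obj wpb (pcar X)) (projT1 A) X (idm _) (str A).
  exists A', xA, aA; split=> [|T u v|T h k hk].
  - transitivity (idm _ \c xA) => //.
    by apply: heq_exr; symmetry; exact: comp_idl.
  - split=> [/A'e[/exr_proj uv av]|[uv av]] //.
    by apply/A'e; split=> //; apply/exr_proj.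
  - apply: A'u; transitivity h => //.
    by apply: heq_exr; exact: comp_idl.
have [B' [be [bB [B'c B'e B'u]]]] :=
  ex_pullback wpb prodC (A := A') (str A \c aA) (str B).
have [E0 [x0 [V0 [u0 [a0 [s0 [E0s E0u]]]]]]] := wdpC xA be.
exact: (slice_exponential A'c A'e A'u B'c B'e B'u E0s E0u).
Qed.

End ExactCompletionLCC.

Theorem lcc_exact_completion (C : ecat) :
  has_terminal C -> has_binary_products C ->
  (forall (X Y Z : C) (f : hom X Z) (g : hom Y Z),
    exists (T : C) (a : hom T X) (b : hom T Y), is_weak_pullback f g a b) ->
  weak_dependent_products C ->
  locally_cartesian_closed (exact_completion C).
Proof.
move=> tC pC wC dC; split; first exact: ex_terminal.
move=> X; split.
- exact: slice_terminal.
- exact: slice_products.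
- exact: slice_exponentials.
Qed.

(** * Continuity and homotopies *)

Section ContinuousOn.
Implicit Types T S U : topologicalType.

(** Continuity of the restriction to [A], for total functions with arbitrary values outside [A];
    maps on spheres and balls are kept total in this way. *)
Definition cont_on T S (A : set T) (f : T -> S) :=
  forall x, A x -> forall W, open W -> W (f x) ->
  exists V, [/\ open V, V x & forall y, V y -> A y -> W (f y)].

Lemma continuous_openP T S (f : T -> S) :
  continuous f <-> cont_on setT f.
Proof.
split=> [cf x _ W oW Wfx|cf].
  exists (f @^-1` W); split=> //; apply: open_comp => // y _; exact: cf.
apply/continuousP => W oW; rewrite openE => x Wfx; rewrite /interior.
have [V [oV Vx VW]] := cf x I W oW Wfx; rewrite nbhsE.
by exists V => // y Vy; exact: VW.
Qed.

Lemma cont_onS T S (A B : set T) (f : T -> S) :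
  A `<=` B -> cont_on B f -> cont_on A f.
Proof.
move=> AB cf x /AB Bx W oW Wfx; have [V [oV Vx VW]] := cf x Bx W oW Wfx.
by exists V; split=> // y Vy /AB; exact: VW.
Qed.

Lemma continuous_cont_on T S (A : set T) (f : T -> S) :
  continuous f -> cont_on A f.
Proof. by move/continuous_openP; exact: cont_onS. Qed.

Lemma cont_on_eq T S (A : set T) (f g : T -> S) :
  (forall x, A x -> f x = g x) -> cont_on A f -> cont_on A g.
Proof.
move=> fg cf x Ax W oW; rewrite -fg // => Wfx.
have [V [oV Vx VW]] := cf x Ax W oW Wfx; exists V; split=> // y Vy Ay.
by rewrite -fg //; exact: VW.
Qed.

Lemma cont_on_comp T S U (A : set T) (B : set S) (f : T -> S) (g : S -> U) :
  cont_on A f -> cont_on B g -> (forall x, A x -> B (f x)) ->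
  cont_on A (fun x => g (f x)).
Proof.
move=> cf cg AB x Ax W oW Wx; have [V [oV Vx VW]] := cg _ (AB x Ax) W oW Wx.
have [V' [oV' V'x V'V]] := cf x Ax V oV Vx; exists V'; split=> // y V'y Ay.
by apply: VW; [exact: V'V|exact: AB].
Qed.

Lemma cont_on_pair T S U (A : set T) (f : T -> S) (g : T -> U) :
  cont_on A f -> cont_on A g -> cont_on A (fun x => (f x, g x)).
Proof.
move=> cf cg x Ax W oW Wx.
have := open_nbhs_nbhs (conj oW Wx) => -[[P Q] /= []].
rewrite !nbhsE => -[P' [oP P'x] P'P] [Q' [oQ Q'x] Q'Q] PQ.
have [V [oV Vx VP]] := cf x Ax P' oP P'x.
have [V' [oV' V'x V'Q]] := cg x Ax Q' oQ Q'x.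
exists (V `&` V'); split; [exact: openI|by []|move=> y [Vy V'y] Ay].
apply: PQ; split=> /=; [apply: P'P; exact: VP|apply: Q'Q; exact: V'Q].
Qed.

Lemma cont_on_closedU T S (A B : set T) (f : T -> S) : closed A -> closed B ->
  cont_on A f -> cont_on B f -> cont_on (A `|` B) f.
Proof.
move=> cA cB fA fB x ABx W oW Wx.
have aux (C : set T) : closed C -> cont_on C f ->
    exists V, [/\ open V, V x & forall y, V y -> C y -> W (f y)].
  move=> cC fC; have [Cx|nCx] := pselect (C x); first exact: fC.
  by exists (~` C); split=> //; exact: closed_openC.
have [V [oV Vx VW]] := aux A cA fA; have [V' [oV' Vx' VW']] := aux B cB fB.
exists (V `&` V'); split; [exact: openI|by []|move=> y [Vy V'y] [Ay|By]].
  exact: VW.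
exact: VW'.
Qed.

Lemma cont_on_local T S (A : set T) (f : T -> S) :
  (forall x, A x -> exists2 V, open V /\ V x & cont_on (V `&` A) f) ->
  cont_on A f.
Proof.
move=> H x Ax W oW Wx; have [V [oV Vx] cV] := H x Ax.
have [V' [oV' V'x V'W]] := cV x (conj Vx Ax) W oW Wx.
exists (V `&` V'); split; [exact: openI|by []|move=> y [Vy V'y] Ay].
by apply: V'W.
Qed.

Lemma set_val_continuous T (A : set T) : continuous (@set_val T A).
Proof. exact: initial_continuous. Qed.

Lemma continuous_set_type T S (A : set S) (f : T -> set_type A) :
  continuous (fun x => set_val (f x)) -> continuous f.
Proof.
move=> cf; apply/continuousP => W [V oV <-].
by rewrite -comp_preimage; move/continuousP: cf; exact.
Qed.

Lemma cont_on_set_type T S (A : set T) (f : T -> S) :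
  cont_on A f -> continuous (fun x : set_type A => f (set_val x)).
Proof.
move=> cf; apply/continuous_openP.
apply: (@cont_on_comp _ _ _ _ A) => //; last by move=> x _; exact: set_valP.
by apply: continuous_cont_on; exact: set_val_continuous.
Qed.

Definition to_set T (A : set T) (x : T) (Ax : A x) : set_type A :=
  exist _ x (mem_set Ax).

Lemma continuous_to_set T S (A : set S) (f : T -> S) (fA : forall x, A (f x)) :
  continuous f -> continuous (fun x => to_set (fA x)).
Proof. by move=> cf; exact: continuous_set_type. Qed.

Lemma set_type_cont_on T S (A : set T) (f : T -> S) :
  continuous (fun x : set_type A => f (set_val x)) -> cont_on A f.
Proof.
move=> /continuous_openP cf x Ax W oW Wx.
have [V [[V' oV' <-] Vx VW]] := cf (to_set Ax) I W oW Wx.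
exists V'; split=> // y V'y Ay; exact: (VW (to_set Ay)).
Qed.

End ContinuousOn.

Section ContinuousReal.
Variables (R : realType) (T : topologicalType).
Implicit Types f g : T -> R.

Lemma ctsD f g : continuous f -> continuous g -> continuous (fun x => f x + g x).
Proof. by move=> cf cg x; exact: (cvgD (cf x) (cg x)). Qed.

Lemma ctsB f g : continuous f -> continuous g -> continuous (fun x => f x - g x).
Proof. by move=> cf cg x; exact: (cvgB (cf x) (cg x)). Qed.

Lemma ctsM f g : continuous f -> continuous g -> continuous (fun x => f x * g x).
Proof. by move=> cf cg x; exact: (cvgM (cf x) (cg x)). Qed.

Lemma ctsmax f g : continuous f -> continuous g ->
  continuous (fun x => Num.max (f x) (g x)).
Proof. by move=> cf cg x; exact: (continuous_max (cf x) (cg x)). Qed.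

Lemma ctsmin f g : continuous f -> continuous g ->
  continuous (fun x => Num.min (f x) (g x)).
Proof. by move=> cf cg x; exact: (continuous_min (cf x) (cg x)). Qed.

Lemma ctscst (S : topologicalType) (a : S) : continuous (fun _ : T => a).
Proof. exact: cst_continuous. Qed.

Lemma closed_le_cts f g : continuous f -> continuous g ->
  closed [set x | f x <= g x].
Proof.
move=> cf cg.
have -> : [set x | f x <= g x] = (fun x => g x - f x) @^-1` [set y | 0 <= y].
  by apply/seteqP; split=> x /=; rewrite subr_ge0.
apply: preimage_closed; last exact: closed_ge.
by apply: in1W; apply: ctsB.
Qed.

Lemma open_lt_cts f g : continuous f -> continuous g ->
  open [set x | f x < g x].
Proof.
move=> cf cg.
have -> : [set x | f x < g x] = ~` [set x | g x <= f x].
  by apply/seteqP; split=> x /=; rewrite ltNge => /negP.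
by apply: closed_openC; exact: closed_le_cts.
Qed.

Lemma cts_if (S : topologicalType) f g (h k : T -> S) :
  continuous f -> continuous g ->
  cont_on [set x | f x <= g x] h -> cont_on [set x | g x <= f x] k ->
  (forall x, f x = g x -> h x = k x) ->
  continuous (fun x => if f x <= g x then h x else k x).
Proof.
move=> cf cg ch ck hk; apply/continuous_openP.
apply: (@cont_onS _ _ _ ([set x | f x <= g x] `|` [set x | g x <= f x])).
  by move=> x _ /=; case: (leP (f x) (g x)) => [|/ltW]; [left|right].
apply: cont_on_closedU; [exact: closed_le_cts|exact: closed_le_cts| |].
  by apply: cont_on_eq ch => x /= ->.
apply: cont_on_eq ck => x /= gf; case: ifP => // fg; apply/esym/hk.
by apply/eqP; rewrite eq_le fg gf.
Qed.

End ContinuousReal.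

Lemma cts_comp (T S U : topologicalType) (f : T -> S) (g : S -> U) :
  continuous g -> continuous f -> continuous (fun x => g (f x)).
Proof. by move=> cg cf x; exact: (continuous_comp (cf x) (cg (f x))). Qed.

Lemma cts_pair (T S U : topologicalType) (f : T -> S) (g : T -> U) :
  continuous f -> continuous g -> continuous (fun x => (f x, g x)).
Proof. by move=> cf cg x; exact: (cvg_pair (cf x) (cg x)). Qed.

Lemma cts_fst (T S U : topologicalType) (f : T -> S * U) :
  continuous f -> continuous (fun x => (f x).1).
Proof. by move=> cf; apply: (@cts_comp _ _ _ f fst) => //; move=> x; exact: cvg_fst. Qed.

Lemma cts_snd (T S U : topologicalType) (f : T -> S * U) :
  continuous f -> continuous (fun x => (f x).2).
Proof. by move=> cf; apply: (@cts_comp _ _ _ f snd) => //; move=> x; exact: cvg_snd. Qed.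

Lemma cts_id (T : topologicalType) : continuous (fun x : T => x).
Proof. by move=> x. Qed.

(** * Homotopies, homotopy pullbacks and Hurewicz fibrations *)

Section Homotopies.
Variable R : realType.
Local Notation I := (itv R).

Lemma clamp_subproof (x : R) : unit_itv (Num.max 0 (Num.min 1 x)).
Proof.
by rewrite /unit_itv /= in_itv /= le_max lexx /= ge_max ler01 ge_min lexx.
Qed.

Definition clamp (x : R) : I := to_set (@clamp_subproof x).

Lemma clamp_continuous : continuous clamp.
Proof.
apply: continuous_set_type => /=.
apply: ctsmax; first exact: ctscst.
apply: ctsmin; [exact: ctscst|exact: cts_id].
Qed.

Definition ival (t : I) : R := set_val t.

Lemma ival_clamp (x : R) : ival (clamp x) = Num.max 0 (Num.min 1 x).
Proof. by []. Qed.

Lemma itv_eq (s t : I) : ival s = ival t -> s = t.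
Proof. exact: val_inj. Qed.

Lemma ival_continuous : continuous ival.
Proof. exact: set_val_continuous. Qed.

Lemma ivalP (t : I) : 0 <= ival t <= 1.
Proof. by have := set_valP t; rewrite /unit_itv /= in_itv. Qed.

Lemma ivalK (t : I) : clamp (ival t) = t.
Proof.
apply: itv_eq; have /andP[t0 t1] := ivalP t.
by rewrite ival_clamp (min_r t1) (max_r t0).
Qed.

Lemma clampK (x : R) : 0 <= x <= 1 -> ival (clamp x) = x.
Proof. by case/andP=> x0 x1; rewrite ival_clamp min_r // max_r. Qed.

Lemma clamp0 : clamp 0 = itv0 R.
Proof. by apply: itv_eq; rewrite ival_clamp min_r ?ler01 // maxxx. Qed.

Lemma clamp1 : clamp 1 = itv1 R.
Proof. by apply: itv_eq; rewrite ival_clamp minxx max_r. Qed.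

Lemma clamp_le0 (x : R) : x <= 0 -> clamp x = itv0 R.
Proof.
by move=> x0; apply: itv_eq; rewrite ival_clamp max_l // ge_min x0 orbT.
Qed.

Lemma clamp_ge1 (x : R) : 1 <= x -> clamp x = itv1 R.
Proof. by move=> x0; apply: itv_eq; rewrite ival_clamp min_l // max_r. Qed.

(** The time parameter runs over the whole line, so that reparametrizations carry no bounds; [clamp]
    translates to and from the unit interval. *)
Definition hmt (X Y : topologicalType) (f g : X -> Y) :=
  exists H : X * R -> Y, [/\ continuous H, forall x, H (x, 0) = f x &
    forall x, H (x, 1) = g x].

Lemma homotopicP (X Y : topologicalType) (f g : continuousType X Y) :
  homotopic R f g <-> hmt f g.
Proof.
split=> [[H HP]|[H [cH H0 H1]]].
  exists (fun p => H (p.1, clamp p.2)); split.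
  - apply: cts_comp; first exact: cts_fun.
    apply: cts_pair; first by apply: cts_fst; exact: cts_id.
    apply: cts_comp; first exact: clamp_continuous.
    by apply: cts_snd; exact: cts_id.
  - by move=> x /=; rewrite clamp0; case: (HP x).
  - by move=> x /=; rewrite clamp1; case: (HP x).
have cK : continuous (fun p : X * I => H (p.1, ival p.2)).
  apply: cts_comp => //; apply: cts_pair; first by apply: cts_fst; exact: cts_id.
  apply: cts_comp; first exact: ival_continuous.
  by apply: cts_snd; exact: cts_id.
by exists (mkcts cK) => x; split; [exact: H0|exact: H1].
Qed.

Lemma hmt_cts (X Y : topologicalType) (f g : X -> Y) : hmt f g ->
  continuous f /\ continuous g.
Proof.
move=> [H [cH H0 H1]]; split.
  have -> : f = (fun x => H (x, 0)) by apply/funext => x; rewrite H0.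
  by apply: cts_comp => //; apply: cts_pair; [exact: cts_id|exact: ctscst].
have -> : g = (fun x => H (x, 1)) by apply/funext => x; rewrite H1.
by apply: cts_comp => //; apply: cts_pair; [exact: cts_id|exact: ctscst].
Qed.

Lemma hmt_refl (X Y : topologicalType) (f : X -> Y) : continuous f -> hmt f f.
Proof.
move=> cf; exists (fun p => f p.1); split=> //.
by apply: cts_comp => //; apply: cts_fst; exact: cts_id.
Qed.

Lemma hmt_sym (X Y : topologicalType) (f g : X -> Y) : hmt f g -> hmt g f.
Proof.
move=> [H [cH H0 H1]]; exists (fun p => H (p.1, 1 - p.2)); split.
- apply: cts_comp => //; apply: cts_pair; first by apply: cts_fst; exact: cts_id.
  by apply: ctsB; [exact: ctscst|apply: cts_snd; exact: cts_id].
- by move=> x /=; rewrite subr0.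
- by move=> x /=; rewrite subrr.
Qed.

Lemma hmt_trans (X Y : topologicalType) (f g h : X -> Y) :
  hmt f g -> hmt g h -> hmt f h.
Proof.
move=> [H [cH H0 H1]] [K [cK K0 K1]].
exists (fun p => if p.2 <= 2^-1 then H (p.1, 2 * p.2) else K (p.1, 2 * p.2 - 1)).
split.
- apply: cts_if.
  + by apply: cts_snd; exact: cts_id.
  + exact: ctscst.
  + apply: continuous_cont_on; apply: cts_comp => //.
    apply: cts_pair; first by apply: cts_fst; exact: cts_id.
    by apply: ctsM; [exact: ctscst|apply: cts_snd; exact: cts_id].
  + apply: continuous_cont_on; apply: cts_comp => //.
    apply: cts_pair; first by apply: cts_fst; exact: cts_id.
    apply: ctsB; last exact: ctscst.
    by apply: ctsM; [exact: ctscst|apply: cts_snd; exact: cts_id].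
  + by move=> x ->; rewrite mulfV ?pnatr_eq0 // subrr H1 K0.
- by move=> x /=; rewrite invr_ge0 ler0n mulr0 H0.
- move=> x /=; rewrite ifF ?mulr1; last first.
    by apply/negbTE; rewrite -ltNge invf_lt1 ?ltr0n // ltr1n.
  by rewrite -K1; congr (K (_, _)); ring.
Qed.

Lemma hmt_comp (X Y Z : topologicalType) (f f' : X -> Y) (g g' : Y -> Z) :
  hmt f f' -> hmt g g' -> hmt (g \o f) (g' \o f').
Proof.
move=> ff gg; have [cf cf'] := hmt_cts ff; have [cg cg'] := hmt_cts gg.
have [H [cH H0 H1]] := ff; have [K [cK K0 K1]] := gg.
apply: (@hmt_trans _ _ _ (g \o f')).
  exists (fun p => g (H p)); split; first exact: cts_comp.
    by move=> x; rewrite H0.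
  by move=> x; rewrite H1.
exists (fun p => K (f' p.1, p.2)); split.
- apply: cts_comp => //; apply: cts_pair.
    by apply: cts_comp => //; apply: cts_fst; exact: cts_id.
  by apply: cts_snd; exact: cts_id.
- by move=> x; rewrite K0.
- by move=> x; rewrite K1.
Qed.

Lemma hmt_compl (X Y Z : topologicalType) (f f' : X -> Y) (g : Y -> Z) :
  continuous g -> hmt f f' -> hmt (g \o f) (g \o f').
Proof. by move=> cg ff; apply: hmt_comp => //; exact: hmt_refl. Qed.

Lemma hmt_compr (X Y Z : topologicalType) (f : X -> Y) (g g' : Y -> Z) :
  continuous f -> hmt g g' -> hmt (g \o f) (g' \o f).
Proof. by move=> cf gg; apply: hmt_comp => //; exact: hmt_refl. Qed.

Lemma hmt_eq (X Y : topologicalType) (f g : X -> Y) : continuous f ->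
  f =1 g -> hmt f g.
Proof. by move=> cf /funext <-; exact: hmt_refl. Qed.

Section PathSpace.
Import ArrowAsCompactOpen.

Definition pth (Z : topologicalType) : topologicalType := continuousType R Z.

Definition pev (Z : topologicalType) (p : pth Z) (s : R) : Z :=
  (p : continuousType R Z) s.

(** The line is locally compact and regular, so evaluation on the compact-open path space is
    continuous whatever [Z] is. *)
Lemma pth_eval (Z : topologicalType) :
  continuous (fun q : pth Z * R => pev q.1 q.2).
Proof.
have -> : (fun q : pth Z * R => pev q.1 q.2) = @eval R Z by apply/funext => -[].
exact: (@eval_continuous R Z (@locally_compactR R) (@uniform_regular R)).
Qed.

Lemma pth_curry (T Z : topologicalType) (H : T * R -> Z) : continuous H ->
  exists P : T -> pth Z, continuous P /\ forall t s, pev (P t) s = H (t, s).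
Proof.
move=> cH; have [cu cur] := continuous_curry cH.
exists (fun t => (mkcts (cur t) : continuousType R Z)); split=> //.
exact: continuous_comp_initial.
Qed.

Lemma pth_eq (Z : topologicalType) (p q : pth Z) : pev p =1 pev q -> p = q.
Proof. by move/continuousEP. Qed.

End PathSpace.

Section HomotopyPullback.
Variables (X Y Z : topologicalType) (f : X -> Z) (g : Y -> Z).

(** Paths are parametrized by the line; the last clause makes them constant outside [[0, 1]], so
    that a point is determined by its path on the unit interval, as in [hpb_eq]. *)
Definition hpb_set : set (X * Y * pth Z) :=
  [set p | pev p.2 0 = f p.1.1 /\ pev p.2 1 = g p.1.2 /\
           forall s, pev p.2 s = pev p.2 (ival (clamp s))].

Definition hpb : topologicalType := set_type hpb_set.

Definition hpb1 (p : hpb) : X := (set_val p).1.1.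
Definition hpb2 (p : hpb) : Y := (set_val p).1.2.
Definition hpbp (p : hpb * R) : Z := pev (set_val p.1).2 p.2.

Lemma hpb1_continuous : continuous hpb1.
Proof. by do 2!apply: cts_fst; exact: set_val_continuous. Qed.

Lemma hpb2_continuous : continuous hpb2.
Proof. by apply: cts_snd; apply: cts_fst; exact: set_val_continuous. Qed.

Lemma hpbp_continuous : continuous hpbp.
Proof.
apply: (@cts_comp _ _ _ (fun p : hpb * R => ((set_val p.1).2, p.2))
   (fun p : pth Z * R => pev p.1 p.2)).
  exact: pth_eval.
apply: cts_pair; last by apply: cts_snd; exact: cts_id.
apply: cts_snd; apply: cts_comp; first exact: set_val_continuous.
by apply: cts_fst; exact: cts_id.
Qed.

Lemma hpb_start (p : hpb) : hpbp (p, 0) = f (hpb1 p).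
Proof. by have [] := set_valP p. Qed.

Lemma hpb_end (p : hpb) : hpbp (p, 1) = g (hpb2 p).
Proof. by have [_ []] := set_valP p. Qed.

Lemma hpb_eq (p q : hpb) : hpb1 p = hpb1 q -> hpb2 p = hpb2 q ->
  (forall s, 0 <= s <= 1 -> hpbp (p, s) = hpbp (q, s)) -> p = q.
Proof.
move=> e1 e2 e; apply: val_inj.
rewrite [LHS]surjective_pairing [RHS]surjective_pairing; congr (_, _).
  by rewrite [LHS]surjective_pairing [RHS]surjective_pairing; congr (_, _).
apply: pth_eq => s; have [_ [_ pP]] := set_valP p.
have [_ [_ qP]] := set_valP q; rewrite (pP s) (qP s).
by apply: (e (ival (clamp s))); exact: ivalP.
Qed.

Lemma hpb_map (T : topologicalType) (a : T -> X) (b : T -> Y) (H : T * R -> Z) :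
  continuous a -> continuous b -> continuous H ->
  (forall t, H (t, 0) = f (a t)) -> (forall t, H (t, 1) = g (b t)) ->
  exists m : T -> hpb, [/\ continuous m, forall t, hpb1 (m t) = a t,
    forall t, hpb2 (m t) = b t &
    forall t s, 0 <= s <= 1 -> hpbp (m t, s) = H (t, s)].
Proof.
move=> ca cb cH H0 H1.
have cH' : continuous (fun q : T * R => H (q.1, ival (clamp q.2))).
  apply: cts_comp => //; apply: cts_pair; first by apply: cts_fst; exact: cts_id.
  apply: cts_comp; first exact: ival_continuous.
  apply: cts_comp; first exact: clamp_continuous.
  by apply: cts_snd; exact: cts_id.
have [P [cP PH]] := pth_curry cH'.
have mP t : hpb_set (a t, b t, P t).
  split=> /=; rewrite ?PH /=; first by rewrite clampK ?lexx ?ler01.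
  by split=> [|s]; rewrite ?PH /= ?ivalK // clampK ?lexx ?ler01.
exists (fun t => to_set (mP t)); split=> // [|t s s01]; last first.
  by rewrite /hpbp /= PH /= clampK.
by apply: continuous_to_set; apply: cts_pair => //; exact: cts_pair.
Qed.

Lemma hpb_sq : hmt (f \o hpb1) (g \o hpb2).
Proof.
exists hpbp; split; [exact: hpbp_continuous|exact: hpb_start|exact: hpb_end].
Qed.

End HomotopyPullback.

(** Lifts are required on the half-line [0 <= s] only: the constructions clamp negative times to 0,
    and homotopies are read at times in [[0, 1]]. *)
Definition hlp (E B : topologicalType) (p : E -> B) :=
  forall (T : topologicalType) (f : T -> E) (H : T * R -> B),
    continuous f -> continuous H -> (forall t, H (t, 0) = p (f t)) ->
    exists K : T * R -> E, [/\ continuous K, forall t, K (t, 0) = f t &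
      forall t s, 0 <= s -> p (K (t, s)) = H (t, s)].

Lemma hpb2_hlp (X Z : topologicalType) (f : X -> Z) : continuous f ->
  hlp (@hpb2 _ _ _ f id).
Proof.
move=> cf T m H cm cH Hm.
(* The path of [m t], of length 1, followed by the track of [H] up to time [s], the whole of length
   [1 + s], rescaled to unit length. *)
pose G (q : T * R * R) : Z := if q.2 * (1 + Num.max 0 q.1.2) <= 1
  then hpbp (m q.1.1, q.2 * (1 + Num.max 0 q.1.2))
  else H (q.1.1, q.2 * (1 + Num.max 0 q.1.2) - 1).
have cl : continuous (fun q : T * R * R => q.2 * (1 + Num.max 0 q.1.2)).
  apply: ctsM; first by apply: cts_snd; exact: cts_id.
  apply: ctsD; first exact: ctscst.
  apply: ctsmax; first exact: ctscst.
  by apply: cts_snd; apply: cts_fst; exact: cts_id.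
have c11 : continuous (fun q : T * R * R => q.1.1).
  by do 2!apply: cts_fst; exact: cts_id.
have cG : continuous G.
  apply: cts_if => //; first exact: ctscst.
  - apply: continuous_cont_on; apply: cts_comp; first exact: hpbp_continuous.
    by apply: cts_pair => //; exact: cts_comp.
  - apply: continuous_cont_on; apply: cts_comp => //; apply: cts_pair => //.
    by apply: ctsB => //; exact: ctscst.
  - by move=> q ->; rewrite subrr Hm hpb_end.
have cH' : continuous (fun q : T * R => H (q.1, Num.max 0 q.2)).
  apply: cts_comp => //; apply: cts_pair; first by apply: cts_fst; exact: cts_id.
  by apply: ctsmax; [exact: ctscst|apply: cts_snd; exact: cts_id].
have ca : continuous (fun q : T * R => hpb1 (m q.1)).
  apply: cts_comp; first exact: hpb1_continuous.
  by apply: cts_comp => //; apply: cts_fst; exact: cts_id.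
have [|q|M [cM M1 M2 M3]] := hpb_map (f := f) (g := id) ca cH' cG.
- by move=> q; rewrite /G /= mul0r ler01 hpb_start.
- rewrite /G /= mul1r; case: ifP => [|_]; last by rewrite addrAC subrr add0r.
  rewrite -{2}[1]addr0 lerD2l => q0.
  have {q0}q0 : Num.max 0 q.2 = 0 by apply/eqP; rewrite eq_le q0 le_max lexx.
  by rewrite q0 addr0 Hm hpb_end.
exists M; split=> // [t|t s s0]; last by rewrite M2 /= max_r.
apply: hpb_eq => [||s s01]; rewrite ?M1 ?M2 ?M3 //= ?maxxx ?Hm //.
by rewrite /G /= maxxx addr0 mulr1; case/andP: s01 => _ ->.
Qed.

(** The end of the lifted homotopy lies strictly over [b]. By this step equations of the homotopy
    category become strict equations. *)
Lemma hlp_lift (T E B : topologicalType) (p : E -> B) (s : T -> E) (b : T -> B) :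
  hlp p -> continuous s -> hmt (p \o s) b ->
  exists s' : T -> E, [/\ continuous s', hmt s s' & forall t, p (s' t) = b t].
Proof.
move=> hp cs [H [cH H0 H1]]; have [K [cK K0 K1]] := hp _ s H cs cH H0.
exists (fun t => K (t, 1)); split; last by move=> t; rewrite K1 ?H1.
- by apply: cts_comp => //; apply: cts_pair; [exact: cts_id|exact: ctscst].
- by exists K.
Qed.

Section Pullback.
Variables (X Y Z : topologicalType) (f : X -> Z) (g : Y -> Z).

Definition pb_set : set (X * Y) := [set p | f p.1 = g p.2].
Definition pb : topologicalType := set_type pb_set.
Definition pb1 (p : pb) : X := (set_val p).1.
Definition pb2 (p : pb) : Y := (set_val p).2.

Lemma pb1_continuous : continuous pb1.
Proof. by apply: cts_fst; exact: set_val_continuous. Qed.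

Lemma pb2_continuous : continuous pb2.
Proof. by apply: cts_snd; exact: set_val_continuous. Qed.

Lemma pb_sq (p : pb) : f (pb1 p) = g (pb2 p).
Proof. by have := set_valP p. Qed.

Definition pb_mk (x : X) (y : Y) (e : f x = g y) : pb := @to_set _ pb_set (x, y) e.

Lemma pb_eq (p q : pb) : pb1 p = pb1 q -> pb2 p = pb2 q -> p = q.
Proof.
move=> e1 e2; apply: val_inj.
by rewrite [LHS]surjective_pairing [RHS]surjective_pairing; congr (_, _).
Qed.

Lemma pb_map (T : topologicalType) (a : T -> X) (b : T -> Y) :
  continuous a -> continuous b -> (forall t, f (a t) = g (b t)) ->
  exists m : T -> pb, [/\ continuous m, forall t, pb1 (m t) = a t &
    forall t, pb2 (m t) = b t].
Proof.
move=> ca cb e; exists (fun t => pb_mk (e t)); split=> //.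
by apply: continuous_to_set; exact: cts_pair.
Qed.

End Pullback.

Lemma hlp_pb1 (X Y Z : topologicalType) (f : X -> Z) (g : Y -> Z) :
  continuous f -> hlp g -> hlp (@pb1 _ _ _ f g).
Proof.
move=> cf hg T m H cm cH Hm.
have cH' : continuous (fun q : T * R => H (q.1, Num.max 0 q.2)).
  apply: cts_comp => //; apply: cts_pair; first by apply: cts_fst; exact: cts_id.
  by apply: ctsmax; [exact: ctscst|apply: cts_snd; exact: cts_id].
have [|||K [cK K0 K1]] := hg T (fun t => pb2 (m t)) (fun q => f (H (q.1, Num.max 0 q.2))).
- by apply: cts_comp => //; exact: pb2_continuous.
- exact: cts_comp.
- by move=> t /=; rewrite maxxx Hm pb_sq.
have [|||L [cL L1 L2]] := @pb_map _ _ _ f g _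
    (fun q : T * R => H (q.1, Num.max 0 q.2)) (fun q => K (q.1, Num.max 0 q.2)).
- exact: cH'.
- apply: cts_comp => //; apply: cts_pair; first by apply: cts_fst; exact: cts_id.
  by apply: ctsmax; [exact: ctscst|apply: cts_snd; exact: cts_id].
- move=> q; have q0 : 0 <= Num.max 0 q.2 by rewrite le_max lexx.
  by rewrite K1 //= (max_r q0).
exists L; split=> // [t|t s s0]; last by rewrite L1 /= max_r.
by apply: pb_eq; rewrite ?L1 ?L2 /= maxxx ?Hm ?K0.
Qed.

Lemma path_fibration_equiv (X Z : topologicalType) (f : X -> Z) :
  continuous f -> exists i : X -> hpb f id, [/\ continuous i,
    forall x, hpb1 (i x) = x, forall x, hpb2 (i x) = f x &
    hmt (i \o @hpb1 _ _ _ f id) id].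
Proof.
move=> cf.
have [|||i [ci i1 i2 i3]] := @hpb_map X Z Z f id X id f (fun q => f q.1) (@cts_id X) cf.
- by apply: cts_comp => //; apply: cts_fst; exact: cts_id.
- by [].
- by [].
exists i; split=> //.
have cp : continuous (fun q : hpb f id * R * R => hpbp (q.1.1, ival (clamp (q.1.2 * q.2)))).
  apply: cts_comp; first exact: hpbp_continuous.
  apply: cts_pair; first by do 2!apply: cts_fst; exact: cts_id.
  apply: cts_comp; first exact: ival_continuous.
  apply: cts_comp; first exact: clamp_continuous.
  apply: ctsM; last by apply: cts_snd; exact: cts_id.
  by apply: cts_snd; apply: cts_fst; exact: cts_id.
have c1 : continuous (fun q : hpb f id * R => hpb1 q.1).
  by apply: cts_comp; [exact: hpb1_continuous|apply: cts_fst; exact: cts_id].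
have c2 : continuous (fun q : hpb f id * R => hpbp (q.1, ival (clamp q.2))).
  apply: cts_comp; first exact: hpbp_continuous.
  apply: cts_pair; first by apply: cts_fst; exact: cts_id.
  apply: cts_comp; first exact: ival_continuous.
  apply: cts_comp; first exact: clamp_continuous.
  by apply: cts_snd; exact: cts_id.
have [q|q|H [cH H1 H2 H3]] := hpb_map (f := f) (g := id) c1 c2 cp.
- by rewrite /= mulr0 clampK ?lexx ?ler01 // hpb_start.
- by rewrite /= mulr1.
exists H; split=> // p.
- apply: hpb_eq => [||s s01]; rewrite ?H1 ?H2 ?H3 //= ?i1 ?i2 ?i3 //=.
    by rewrite clampK ?lexx ?ler01 // hpb_start.
  by rewrite mul0r clampK ?lexx ?ler01 // hpb_start.
- apply: hpb_eq => [||s s01]; rewrite ?H1 ?H2 ?H3 //=.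
    by rewrite clampK ?lexx ?ler01 // hpb_end.
  by rewrite mul1r clampK.
Qed.

End Homotopies.

(** * Localizations represented by homotopy classes *)

Section Colocal.
Variables (R : realType) (W : arrow_class Top).
Hypothesis W_cylinder : forall (X : topologicalType)
  (p : continuousType (X * itv R)%type X), p =1 fst -> W p.

Local Notation hmt := (hmt R).
Local Notation HoW := (localization W).

Definition lmap (X Y : topologicalType) (f : X -> Y) (cf : continuous f) :
  @hom HoW X Y := loc_in W (mkcts cf : @hom Top X Y).

Lemma lmap_comp (X Y Z : topologicalType) (f : X -> Y) (g : Y -> Z) (h : X -> Z)
    (cf : continuous f) (cg : continuous g) (ch : continuous h) :
  (forall x, h x = g (f x)) -> lmap ch === lmap cg \c lmap cf.
Proof.
move=> hE; apply: (@loc_trans _ W _ _ _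
  (loc_in W ((mkcts cg : @hom Top Y Z) \c (mkcts cf : @hom Top X Y)))).
  by apply: loc_in_heq => x; exact: hE.
exact: loc_in_comp.
Qed.

Lemma lmapE (X Y : topologicalType) (f : continuousType X Y) (cf : continuous f) :
  (loc_in W (f : @hom Top X Y) : @hom HoW X Y) === lmap cf.
Proof. exact: loc_in_heq. Qed.

Lemma lmap_id (X : topologicalType) (f : X -> X) (cf : continuous f) :
  (forall x, f x = x) -> lmap cf === idm (X : HoW).
Proof. by move=> fE; apply: loc_in_heq => x; exact: fE. Qed.

(** Both ends of the cylinder are sections of its projection to [X]. The projection is inverted, so
    they become equal in the localization, and so do their composites with a homotopy. *)
Lemma lmap_hmt (X Y : topologicalType) (f g : X -> Y) (cf : continuous f)
  (cg : continuous g) : hmt f g -> lmap cf === lmap cg.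
Proof.
move=> fg; have [H HP] := (homotopicP R (mkcts cf) (mkcts cg)).2 fg.
have cp : continuous (fun q : X * itv R => q.1) by apply: cts_fst; exact: cts_id.
have ci (s : itv R) : continuous (fun x : X => (x, s)).
  by apply: cts_pair; [exact: cts_id|exact: ctscst].
have Wp : W (mkcts cp : @hom Top _ _) by exact: W_cylinder.
pose P : @hom HoW (X * itv R)%type X := lmap cp.
pose V : @hom HoW X (X * itv R)%type := loc_inv Wp.
have VP : V \c P === idm _ by exact: loc_invl.
have iV s : lmap (ci s) === V.
  rewrite -(comp_idl (lmap (ci s))) -VP -comp_assoc.
  rewrite -(lmap_comp (h := idfun) (ci s) cp (@cts_id X)) //.
  by rewrite lmap_id // comp_idr.
have cH : continuous H by exact: cts_fun.
transitivity (lmap cH \c V).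
  by rewrite -(iV (itv0 R)); apply: lmap_comp => x; case: (HP x) => ->.
by rewrite -(iV (itv1 R)); symmetry; apply: lmap_comp => x; case: (HP x) => _ ->.
Qed.

Lemma lmap_iso (X Y : topologicalType) (f : X -> Y) (cf : continuous f) :
  W (mkcts cf : @hom Top X Y) -> exists v : @hom HoW Y X,
    v \c lmap cf === idm _ /\ lmap cf \c v === idm _.
Proof. by move=> Wf; exists (loc_inv Wf); split; [exact: loc_invl|exact: loc_invr]. Qed.

(** The property that Whitehead's theorem gives to CW complexes: composition with a [w] in [W] is
    bijective on homotopy classes of maps out of [K]. *)
Definition colocal (K : topologicalType) :=
  forall (Y Z : topologicalType) (w : continuousType Y Z), W w ->
    (forall f : K -> Z, continuous f ->
      exists2 l : K -> Y, continuous l & hmt (w \o l) f) /\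
    (forall f g : K -> Y, continuous f -> continuous g ->
      hmt (w \o f) (w \o g) -> hmt f g).

(* The action of a zigzag on homotopy classes of maps out of [K]; it is
   functional when [K] is colocal. *)
Fixpoint loc_act (K : topologicalType) (X Y : Top) (p : loc_hom W X Y) :
    (K -> X) -> (K -> Y) -> Prop :=
  match p with
  | loc_in _ _ f => fun a b => continuous a /\ hmt (f \o a) b
  | loc_inv _ _ w _ => fun a b => continuous b /\ hmt a (w \o b)
  | loc_comp _ _ _ g f => fun a c => exists b, loc_act f a b /\ loc_act g b c
  end.

Section Colocal1.
Variables (K : topologicalType) (cK : colocal K).

Lemma loc_act_cts (X Y : Top) (p : loc_hom W X Y) (a : K -> X) (b : K -> Y) :
  loc_act p a b -> continuous a /\ continuous b.
Proof.
elim: p a b => {X Y} [X Y f|X Y w Ww|X Y Z g ihg f ihf] a b /=.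
- by move=> [ca /hmt_cts[]].
- by move=> [ca /hmt_cts[]].
- by move=> [c [/ihf[ca _] /ihg[]]].
Qed.

Lemma loc_act_total (X Y : Top) (p : loc_hom W X Y) (a : K -> X) :
  continuous a -> exists b, loc_act p a b.
Proof.
elim: p a => {X Y} [X Y f|X Y w Ww|X Y Z g ihg f ihf] a ca /=.
- exists (f \o a); split=> //; apply: hmt_refl; apply: cts_comp => //.
  exact: cts_fun.
- have [H _] := cK Ww; have [l cl wl] := H a ca.
  by exists l; split=> //; exact: hmt_sym.
- have [b ab] := ihf a ca; have [_ cb] := loc_act_cts ab.
  by have [c bc] := ihg b cb; exists c, b.
Qed.

Lemma loc_act_hmt (X Y : Top) (p : loc_hom W X Y) (a a' : K -> X) (b b' : K -> Y) :
  hmt a a' -> hmt b b' -> loc_act p a b -> loc_act p a' b'.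
Proof.
elim: p a a' b b' => {X Y} [X Y f|X Y w Ww|X Y Z g ihg f ihf] a a' b b' aa bb /=.
- move=> [_ ab]; split; first by case: (hmt_cts aa).
  apply: hmt_trans bb; apply: hmt_trans ab; apply: hmt_compl; first exact: cts_fun.
  exact: hmt_sym.
- move=> [cb ab]; split; first by case: (hmt_cts bb).
  apply: hmt_trans (hmt_sym aa) _; apply: hmt_trans ab _.
  by apply: hmt_compl => //; exact: cts_fun.
- move=> [c [ac cb]]; exists c.
  have cc : hmt c c by apply: hmt_refl; case: (loc_act_cts ac).
  by split; [exact: ihf aa cc ac|exact: ihg cc bb cb].
Qed.

Lemma loc_act_heq (X Y : Top) (p q : loc_hom W X Y) : loc_heq p q ->
  forall (a : K -> X) (b : K -> Y), loc_act p a b <-> loc_act q a b.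
Proof.
have idP (X' : Top) (a b : K -> X') :
    loc_act (loc_in W (idm X')) a b <-> hmt a b.
  by split=> [[]//|ab]; split=> //; case: (hmt_cts ab).
elim=> {X Y p q} //.
- by move=> X Y f g _ ih a b; split=> /ih.
- by move=> X Y f g h _ ih1 _ ih2 a b; rewrite ih1 ih2.
- by move=> X Y Z g g' f f' _ ih1 _ ih2 a c /=; split=> -[b [/ih2 ab /ih1 bc]];
    exists b.
- move=> X Y Z T h g f a d /=; split.
    by move=> [c [[b [ab bc]] cd]]; exists b; split=> //; exists c.
  by move=> [b [ab [c [bc cd]]]]; exists c; split=> //; exists b.
- move=> X Y f a c /=; split=> [[b [ab /idP bc]]|ac].
    have [ca _] := loc_act_cts ab.
    by apply: loc_act_hmt ab => //; exact: hmt_refl.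
  exists c; split=> //; apply/idP/hmt_refl.
  by case: (loc_act_cts ac).
- move=> X Y f a c /=; split=> [[b [/idP ab bc]]|ac].
    have [_ cc] := loc_act_cts bc.
    by apply: loc_act_hmt bc; [exact: hmt_sym|exact: hmt_refl].
  exists a; split=> //; apply/idP/hmt_refl.
  by case: (loc_act_cts ac).
- move=> X Y f g fg a b /=; have -> : f \o a = g \o a by apply/funext => x; exact: fg.
  by [].
- move=> X Y Z g f a c /=; split=> [[ca ac]|[b [[ca ab] [cb bc]]]].
    have cfa : continuous (f \o a) by apply: cts_comp => //; exact: cts_fun.
    by exists (f \o a); do !split=> //; exact: hmt_refl.
  split=> //; apply: hmt_trans bc; apply: (hmt_compl (f := f \o a)) => //.
  exact: cts_fun.
- move=> X Y w Ww a c; rewrite idP /=; split=> [[b [[ca ab] [cc bc]]]|ac].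
    by have [_ H] := cK Ww; apply: H => //; exact: hmt_trans ab bc.
  have [ca cc] := hmt_cts ac.
  exists (w \o a); do !split=> //; last by apply: hmt_compl => //; exact: cts_fun.
  by apply: hmt_refl; apply: cts_comp => //; exact: cts_fun.
- move=> X Y w Ww a c; rewrite idP /=; split=> [[b [[cb ab] [_ bc]]]|ac].
    exact: hmt_trans ab bc.
  have [ca cc] := hmt_cts ac; have [H _] := cK Ww; have [l cl wl] := H a ca.
  exists l; do !split=> //; first exact: hmt_sym.
  exact: hmt_trans wl ac.
Qed.

Lemma loc_act_lmap (X Y : Top) (p : loc_hom W X Y) (a : K -> X) (b : K -> Y)
    (ca : continuous a) (cb : continuous b) :
  loc_act p a b -> (p : @hom HoW X Y) \c lmap ca === lmap cb.
Proof.
elim: p a b ca cb => {X Y} [X Y f|X Y w Ww|X Y Z g ihg f ihf] a b ca cb.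
- move=> [_ fab]; have cf : continuous f by exact: cts_fun.
  have cfa : continuous (f \o a) by exact: cts_comp.
  rewrite -(lmap_hmt cfa cb fab).
  rewrite (lmap_comp (g := f) ca cf cfa) //.
  by apply: comp_heq; [exact: lmapE|].
- move=> [_ awb]; have cw : continuous w by exact: cts_fun.
  have cwb : continuous (w \o b) by exact: cts_comp.
  rewrite (lmap_hmt ca cwb awb).
  have -> : lmap cwb === (loc_in W w : @hom HoW _ _) \c lmap cb.
    rewrite (lmap_comp (g := w) cb cw cwb) //.
    by apply: comp_heq => //; apply: heq_sym; exact: lmapE.
  rewrite comp_assoc; have -> : (loc_inv Ww : @hom HoW _ _) \c loc_in W w === idm _.
    exact: loc_invl.
  exact: comp_idl.
- move=> [c [ac cb']]; have [_ cc] := loc_act_cts ac.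
  have -> : (loc_comp g f : @hom HoW _ _) = (g : @hom HoW _ _) \c (f : @hom HoW _ _).
    by [].
  by rewrite -comp_assoc (ihf _ _ ca cc ac) (ihg _ _ cc cb cb').
Qed.

(** As in the Yoneda lemma, letting a zigzag act on the identity of [K] gives the map that
    represents it. *)
Lemma lmap_full (Y : topologicalType) (p : @hom HoW K Y) :
  exists (f : K -> Y) (cf : continuous f), p === lmap cf.
Proof.
have [b ab] := @loc_act_total K Y p _ (@cts_id K).
have [_ cb] := loc_act_cts ab; exists b, cb.
rewrite -(loc_act_lmap (@cts_id K) cb ab).
by rewrite lmap_id // comp_idr.
Qed.

Lemma lmap_faithful (Y : topologicalType) (f g : K -> Y) (cf : continuous f)
  (cg : continuous g) : lmap cf === lmap cg -> hmt f g.
Proof.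
move=> /(@loc_act_heq K Y) /(_ (@idfun K) g)[_ []] //.
by split; [exact: cts_id|exact: hmt_refl].
Qed.

End Colocal1.

End Colocal.

Lemma comp_pre (C : ecat) (X Y Z : C) (g : hom Y Z) (f : hom X Y) (h : hom X Z) :
  g \c f === h -> forall (T : C) (z : hom T X), g \c (f \c z) === h \c z.
Proof. by move=> e T z; rewrite comp_assoc e. Qed.

Lemma comp_pre2 (C : ecat) (X Y Y' Z : C) (g : hom Y Z) (f : hom X Y)
  (g' : hom Y' Z) (f' : hom X Y') :
  g \c f === g' \c f' ->
  forall (T : C) (z : hom T X), g \c (f \c z) === g' \c (f' \c z).
Proof. by move=> e T z; rewrite comp_assoc e -comp_assoc. Qed.

Lemma comp_preK (C : ecat) (X Y : C) (g : hom Y X) (f : hom X Y) :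
  g \c f === idm X -> forall (T : C) (z : hom T X), g \c (f \c z) === z.
Proof. by move=> e T z; rewrite comp_assoc e comp_idl. Qed.

Section PullbackMaps.
Variables (W W' X A A' : topologicalType).

Definition pbf (x' : W' -> X) (p' : A' -> X) (x : W -> X) (p : A -> X)
    (a : W' -> W) (b : A' -> A)
    (e : forall z : pb x' p', x (a (pb1 z)) = p (b (pb2 z))) (z : pb x' p') :
  pb x p := pb_mk (e z).

Lemma pbf_continuous x' p' x p a b e :
  continuous a -> continuous b -> continuous (@pbf x' p' x p a b e).
Proof.
move=> ca cb; apply: continuous_set_type; apply: cts_pair.
  by apply: cts_comp => //; exact: pb1_continuous.
by apply: cts_comp => //; exact: pb2_continuous.
Qed.
End PullbackMaps.

(* [rep_model] says that the zigzag arrows out of [X] are represented by the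
   maps out of [Q X]; it covers both model structures, with [Q X = X] for
   homotopy equivalences and a cellular approximation for weak homotopy
   equivalences. *)
Record rep_model (R : realType) (W : arrow_class Top) := RepModel {
  rQ : topologicalType -> topologicalType;
  reps : forall X, continuousType (rQ X) X;
  rmap : forall X Y : topologicalType, continuousType X Y ->
    continuousType (rQ X) (rQ Y);
  reps_nat : forall (X Y : topologicalType) (f : continuousType X Y) z,
    reps Y (rmap f z) = f (reps X z);
  rmap_comp : forall (X Y Z : topologicalType) (f : continuousType X Y)
    (g : continuousType Y Z) (h : continuousType X Z),
    h =1 g \o f -> forall z, rmap h z = rmap g (rmap f z);
  rcyl : forall (X : topologicalType)
    (p : continuousType (X * itv R)%type X), p =1 fst -> W _ _ p;
  reps_W : forall X, W _ _ (reps X);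
  rcolocal : forall X, colocal R W (rQ X) }.

Section Datum.
Variables (R : realType) (W : arrow_class Top) (M : rep_model R W).
Variables (X A A1 B S : topologicalType).
Variables (p : A -> X) (q : A1 -> X) (r1 r2 : A1 -> A) (be : B -> A)
  (s1 s2 : S -> B).
Hypotheses (cr1 : continuous r1) (cr2 : continuous r2).
Hypotheses (r1E : forall z, p (r1 z) = q z) (r2E : forall z, p (r2 z) = q z).

Lemma face_subproof (r : A1 -> A) (rE : forall z, p (r z) = q z)
  (Z : topologicalType) (x : Z -> X) (z : pb x q) : x (id (pb1 z)) = p (r (pb2 z)).
Proof. by rewrite rE pb_sq. Qed.

Definition face (r : A1 -> A) (rE : forall z, p (r z) = q z)
  (Z : topologicalType) (x : Z -> X) : pb x q -> pb x p := pbf (@face_subproof r rE Z x).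

Arguments face {r} rE {Z} x z.

Lemma face_continuous (r : A1 -> A) (rE : forall z, p (r z) = q z)
  (Z : topologicalType) (x : Z -> X) :
  continuous r -> continuous (face rE x : pb x q -> pb x p).
Proof. by move=> cr; apply: pbf_continuous => //; exact: cts_id. Qed.

Arguments face_continuous {r} rE {Z} x cr.

(** [A1] stands for the relation of [A] in the fibres and [S] for that of [B]: [t] witnesses that
    the section [s] preserves the relation. The domains carry [rQ M] because there the arrows of the
    localization are represented by maps. *)
Definition strict_datum (Z : topologicalType) (x : Z -> X)
    (s : rQ M (pb x p) -> B) (t : rQ M (pb x q) -> S) :=
  [/\ continuous s, continuous t,
    forall z, be (s z) = pb2 (reps M _ z),
    forall z, s1 (t z) = s (rmap M (mkcts (face_continuous r1E x cr1)) z) &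
    forall z, s2 (t z) = s (rmap M (mkcts (face_continuous r2E x cr2)) z)].

Lemma base_change_subproof (Z Z' : topologicalType) (x : Z -> X) (x' : Z' -> X)
  (F : Z' -> Z) (FE : forall z, x (F z) = x' z) (y : pb x' p) :
  x (F (pb1 y)) = p (id (pb2 y)).
Proof. by rewrite FE pb_sq. Qed.

Definition base_change (Z Z' : topologicalType) (x : Z -> X) (x' : Z' -> X)
  (F : Z' -> Z) (FE : forall z, x (F z) = x' z) : pb x' p -> pb x p :=
  pbf (base_change_subproof FE).

Lemma base_change_continuous (Z Z' : topologicalType) (x : Z -> X) (x' : Z' -> X)
  (F : Z' -> Z) (FE : forall z, x (F z) = x' z) :
  continuous F -> continuous (base_change FE).
Proof. by move=> cF; apply: pbf_continuous => //; exact: cts_id. Qed.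

Arguments base_change_continuous {Z Z' x x' F} FE cF.

Let HoW := localization W.

(** The datum on [E] lives only in the localization, since in the Quillen case it is obtained by
    inverting a weak equivalence. A strict datum over [Z] is classified after replacing [Z] by a
    weakly equivalent [Z']; [phi] is the arrow that its section [s'] represents. *)
Definition generic_datum (cbe : continuous be)
    (cs1 : continuous s1) (cs2 : continuous s2) :=
  exists (E : topologicalType) (x : E -> X) (cx : continuous x)
    (s : @hom HoW (pb x p) B) (t : @hom HoW (pb x q) S),
  [/\ lmap W cbe \c s === lmap W (@pb2_continuous _ _ _ x p),
    lmap W cs1 \c t === s \c lmap W (face_continuous r1E x cr1),
    lmap W cs2 \c t === s \c lmap W (face_continuous r2E x cr2) &
    forall (Z : topologicalType) (y : Z -> X)
      (s' : rQ M (pb y p) -> B) (t' : rQ M (pb y q) -> S)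
      (cs : continuous s'),
      continuous y -> strict_datum s' t' ->
      exists (Z' : topologicalType) (w : Z' -> Z) (F : Z' -> E)
        (cw : continuous w) (cF : continuous F)
        (FE : forall z, x (F z) = y (w z)),
      W (mkcts cw : @hom Top Z' Z) /\
      forall phi : @hom HoW (pb y p) B,
        phi \c lmap W (@cts_fun _ _ (reps M (pb y p))) === lmap W cs ->
        s \c lmap W (base_change_continuous FE cF) ===
        phi \c lmap W (base_change_continuous (fun z => erefl (y (w z))) cw)].

End Datum.

Arguments face {X A A1 p q r} rE {Z} x z.
Arguments face_continuous {X A A1 p q r} rE {Z} x cr.
Arguments base_change_continuous {X A p Z Z' x x' F} FE cF.

(** * Finite products and weak pullbacks in the homotopy category *)

Section HomotopyCategoryLimits.
Variables (R : realType) (W : arrow_class Top) (M : rep_model R W).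
Local Notation HoW := (localization W).
Local Notation L := (lmap W).
Local Notation hm := (hmt R).

Definition lreps (X : topologicalType) : @hom HoW (rQ M X) X :=
  L (@cts_fun _ _ (reps M X)).

Lemma lreps_iso (X : topologicalType) : exists v : @hom HoW X (rQ M X),
  v \c lreps X === idm _ /\ lreps X \c v === idm _.
Proof.
exists (loc_inv (@reps_W _ _ M X)).
have e : (loc_in W (reps M X : @hom Top _ _) : @hom HoW _ _) === lreps X.
  exact: lmapE.
by split; rewrite -e; [exact: loc_invl|exact: loc_invr].
Qed.

Lemma lreps_epi (X Y : topologicalType) (f g : @hom HoW X Y) :
  f \c lreps X === g \c lreps X -> f === g.
Proof.
move=> e; have [v [_ v2]] := lreps_iso X.
by rewrite -(comp_idr f) -(comp_idr g) -v2 !comp_assoc e.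
Qed.

Lemma rep_hmt (X Y : topologicalType) (f g : X -> Y) (cf : continuous f)
  (cg : continuous g) : hm f g -> L cf === L cg.
Proof. exact: (lmap_hmt (@rcyl _ _ M)). Qed.

Lemma rep_full (X Y : topologicalType) (f : @hom HoW (rQ M X) Y) :
  exists (g : rQ M X -> Y) (cg : continuous g), f === L cg.
Proof. exact: (lmap_full (@rcyl _ _ M) (@rcolocal _ _ M X)). Qed.

Lemma rep_faithful (X Y : topologicalType) (f g : rQ M X -> Y)
  (cf : continuous f) (cg : continuous g) : L cf === L cg -> hm f g.
Proof. exact: (lmap_faithful (@rcolocal _ _ M X)). Qed.

Lemma rep_terminal : has_terminal HoW.
Proof.
pose T : topologicalType := 'rV[R]_0.
have TE (t t' : T) : t = t' by rewrite !thinmx0.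
exists T => X; have ct : continuous (fun _ : X => (0 : 'rV[R]_0) : T) by exact: ctscst.
exists (L ct) => k; apply: lreps_epi.
have [f [cf ->]] := rep_full (k \c lreps X).
have [g [cg ->]] := rep_full (L ct \c lreps X).
by apply: rep_hmt; apply: hmt_eq => // x; exact: TE.
Qed.

Lemma hmt_pair (X Y Z : topologicalType) (f g : X -> Y * Z) :
  hm (fst \o f) (fst \o g) -> hm (snd \o f) (snd \o g) -> hm f g.
Proof.
move=> [H [cH H0 H1]] [K [cK K0 K1]]; exists (fun q => (H q, K q)); split.
- exact: cts_pair.
- by move=> x; rewrite H0 K0 /= -surjective_pairing.
- by move=> x; rewrite H1 K1 /= -surjective_pairing.
Qed.

Lemma fst_cts (X Y : topologicalType) : continuous (@fst X Y).
Proof. by apply: cts_fst; exact: cts_id. Qed.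

Lemma snd_cts (X Y : topologicalType) : continuous (@snd X Y).
Proof. by apply: cts_snd; exact: cts_id. Qed.

Lemma rep_products : has_binary_products HoW.
Proof.
move=> A B.
exists (((A : topologicalType) * (B : topologicalType))%type : topologicalType),
  (L (@fst_cts A B)), (L (@snd_cts A B)) => X f g.
have [v [v1 v2]] := lreps_iso X.
have [a [ca fa]] := rep_full (f \c lreps X).
have [b [cb gb]] := rep_full (g \c lreps X).
have cab : continuous (fun x => (a x, b x)) by exact: cts_pair.
exists (L cab \c v); split.
- apply: lreps_epi; rewrite -!comp_assoc v1 comp_idr fa.
  by symmetry; exact: lmap_comp.
- apply: lreps_epi; rewrite -!comp_assoc v1 comp_idr gb.
  by symmetry; exact: lmap_comp.
- move=> k k1 k2; apply: lreps_epi; rewrite -comp_assoc v1 comp_idr.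
  have [c [cc kc]] := rep_full (k \c lreps X).
  rewrite kc; apply: rep_hmt; apply: hmt_pair.
  + change (hm (fst \o c) a).
    apply: (@rep_faithful X A _ _ (cts_comp (@fst_cts A B) cc) ca).
    by rewrite (lmap_comp W cc (@fst_cts A B)) // -kc comp_assoc k1.
  + change (hm (snd \o c) b).
    apply: (@rep_faithful X B _ _ (cts_comp (@snd_cts A B) cc) cb).
    by rewrite (lmap_comp W cc (@snd_cts A B)) // -kc comp_assoc k2.
Qed.

(** The homotopy pullback of representing maps works: equality in the localization of two maps out
    of [rQ M V] is a homotopy, and the choice of the homotopy is why the universal arrow is not
    unique. *)
Lemma rep_weak_pullbacks (X Y Z : HoW) (f : hom X Z) (g : hom Y Z) :
  exists (T : HoW) (a : hom T X) (b : hom T Y), is_weak_pullback f g a b.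
Proof.
have [a [ca fa]] := rep_full (f \c lreps X).
have [b [cb gb]] := rep_full (g \c lreps Y).
have [vX [vX1 vX2]] := lreps_iso X.
have [vY [vY1 vY2]] := lreps_iso Y.
exists (hpb R a b), (lreps X \c L (@hpb1_continuous R _ _ _ a b)),
  (lreps Y \c L (@hpb2_continuous R _ _ _ a b)); split.
  rewrite !comp_assoc fa gb.
  have ch1 := cts_comp ca (@hpb1_continuous R _ _ _ a b).
  have ch2 := cts_comp cb (@hpb2_continuous R _ _ _ a b).
  rewrite -(lmap_comp W (@hpb1_continuous R _ _ _ a b) ca ch1) //.
  rewrite -(lmap_comp W (@hpb2_continuous R _ _ _ a b) cb ch2) //.
  by apply: rep_hmt; exact: hpb_sq.
move=> V h k hk.
have [h' [ch hh]] := rep_full (vX \c h \c lreps V).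
have [k' [ck kk]] := rep_full (vY \c k \c lreps V).
have [v [v1 v2]] := lreps_iso V.
have [|H [cH H0 H1]] :=
    @rep_faithful V Z (a \o h') (b \o k') (cts_comp ca ch) (cts_comp cb ck).
  rewrite (lmap_comp W ch ca) // (lmap_comp W ck cb) // -fa -gb -hh -kk.
  by rewrite -!comp_assoc (comp_preK vX2) (comp_preK vY2) !comp_assoc hk.
have [m [cm m1 m2 _]] := hpb_map ch ck cH H0 H1.
exists (L cm \c v); split; apply: lreps_epi; rewrite -!comp_assoc v1 comp_idr.
  rewrite -(lmap_comp W cm (@hpb1_continuous R _ _ _ a b) ch) // -hh.
  by rewrite -comp_assoc (comp_preK vX2).
rewrite -(lmap_comp W cm (@hpb2_continuous R _ _ _ a b) ck) // -kk.
by rewrite -comp_assoc (comp_preK vY2).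
Qed.

(** A homotopy out of [rQ M T] can be lifted along a Hurewicz fibration, so a square commuting in
    the localization is rectified to a strict one. Hurewicz fibrations serve for both model
    structures. *)
Lemma hlp_weak_pullback (Z A X : topologicalType) (x : Z -> X) (p : A -> X)
    (cx : continuous x) (cp : continuous p) : hlp R p ->
  is_weak_pullback (L cx) (L cp) (L (@pb1_continuous _ _ _ x p))
    (L (@pb2_continuous _ _ _ x p)).
Proof.
move=> hp; split.
  have ch1 := cts_comp cx (@pb1_continuous _ _ _ x p).
  have ch2 := cts_comp cp (@pb2_continuous _ _ _ x p).
  rewrite -(lmap_comp W (@pb1_continuous _ _ _ x p) cx ch1) //.
  rewrite -(lmap_comp W (@pb2_continuous _ _ _ x p) cp ch2) //.
  by apply: rep_hmt; apply: hmt_eq => // z; exact: pb_sq.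
move=> T h k hk.
have [v [v1 v2]] := lreps_iso T.
have [h' [ch hh]] := rep_full (h \c lreps T).
have [k' [ck kk]] := rep_full (k \c lreps T).
have [|l [cl kl pl]] := @hlp_lift R _ _ _ p k' (x \o h') hp ck.
  apply: (@rep_faithful T X (p \o k') (x \o h') (cts_comp cp ck)
    (cts_comp cx ch)).
  rewrite (lmap_comp W ck cp) // (lmap_comp W ch cx) // -hh -kk.
  by rewrite !comp_assoc hk.
have [m [cm m1 m2]] := pb_map ch cl (fun t => esym (pl t)).
exists (L cm \c v); split; apply: lreps_epi; rewrite -!comp_assoc v1 comp_idr.
  by rewrite -(lmap_comp W cm (@pb1_continuous _ _ _ x p) ch) // hh.
rewrite -(lmap_comp W cm (@pb2_continuous _ _ _ x p) cl) // kk.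
by symmetry; exact: rep_hmt.
Qed.

End HomotopyCategoryLimits.

(** * Weak dependent products in the homotopy category *)

Section HomotopyCategoryDependentProducts.
Variables (R : realType) (W : arrow_class Top) (M : rep_model R W).
Local Notation HoW := (localization W).
Local Notation L := (lmap W).
Local Notation hm := (hmt R).
Local Notation lr := (lreps M).

Hypothesis M_generic : forall (X A A1 B S : topologicalType)
  (p : A -> X) (q : A1 -> X) (r1 r2 : A1 -> A) (be : B -> A)
  (s1 s2 : S -> B) (cp : continuous p) (cr1 : continuous r1)
  (cr2 : continuous r2) (r1E : forall z, p (r1 z) = q z)
  (r2E : forall z, p (r2 z) = q z) (cbe : continuous be)
  (cs1 : continuous s1) (cs2 : continuous s2),
  generic_datum M cr1 cr2 r1E r2E cbe cs1 cs2.

Lemma rep_inv (X Y : topologicalType) (f : @hom HoW X Y) :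
  exists (g : rQ M X -> rQ M Y) (cg : continuous g), lr Y \c L cg === f \c lr X.
Proof.
have [v [v1 v2]] := lreps_iso M Y.
have [g [cg gE]] := rep_full (v \c f \c lr X).
by exists g, cg; rewrite -gE !comp_assoc v2 comp_idl.
Qed.

Lemma exr_epi (B : pseudo_eqrel HoW) (X : topologicalType)
  (a b : @hom HoW X (pcar B)) : exr (a \c lr X) (b \c lr X) -> exr a b.
Proof.
have [v [v1 v2]] := lreps_iso M X.
by move=> /(exr_comp v); rewrite -!comp_assoc v2 !comp_idr.
Qed.

Lemma rep_fibration (X Z : topologicalType) (f : @hom HoW X Z) :
  exists (Y : topologicalType) (p : Y -> Z) (cp : continuous p)
    (al : @hom HoW Y X) (al' : @hom HoW X Y),
  [/\ hlp R p, al \c al' === idm _, al' \c al === idm _ & f \c al === L cp].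
Proof.
have [g [cg fg]] := rep_full (f \c lr X).
have [v [v1 v2]] := lreps_iso M X.
have [i [ci i1 i2 i3]] := path_fibration_equiv R cg.
pose c1 := @hpb1_continuous R _ _ _ g id.
pose c2 := @hpb2_continuous R _ _ _ g id.
exists (hpb R g id), (@hpb2 R _ _ _ g id), c2, (lr X \c L c1), (L ci \c v).
split.
- exact: hpb2_hlp.
- rewrite -comp_assoc (comp_pre (h := idm _)) ?comp_idl //.
  rewrite -(lmap_comp W ci c1 (@cts_id _)) ?lmap_id //.
- rewrite -comp_assoc (comp_preK v1).
  rewrite -(lmap_comp W c1 ci (cts_comp ci c1)) //.
  transitivity (L (@cts_id (hpb R g id))); last by rewrite lmap_id.
  exact: (rep_hmt M).
- rewrite comp_assoc fg -(lmap_comp W c1 cg (cts_comp cg c1)) //.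
  by apply: (rep_hmt M); exact: hpb_sq.
Qed.

Section Section1.
Variables (X : topologicalType) (A B : pseudo_eqrel HoW)
  (f : @hom HoW (pcar A) X) (be : hom (pcar B) (pcar A)).

(* [A^] and [B^] are fibrant replacements of [pcar A] and [pcar B] over [X]
   and [A^]; [A1] and [S] cover the pairs of related points in the fibres of
   [A^] over [X], and the pairs of related points of [B^]. *)
Variables (Ah : topologicalType) (p : Ah -> X) (cp : continuous p)
  (al : @hom HoW Ah (pcar A)) (al' : @hom HoW (pcar A) Ah).
Hypotheses (hp : hlp R p) (al1 : al \c al' === idm _) (al2 : al' \c al === idm _)
  (fal : f \c al === L cp).
Variables (Bh : topologicalType) (bh : Bh -> Ah) (cbh : continuous bh)
  (ga : @hom HoW Bh (pcar B)) (ga' : @hom HoW (pcar B) Bh).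
Hypotheses (hbh : hlp R bh) (ga1 : ga \c ga' === idm _)
  (ga2 : ga' \c ga === idm _) (bga : al' \c be \c ga === L cbh).
Variables (rho1 rho2 : rQ M (prel A) -> Ah) (crho1 : continuous rho1)
  (crho2 : continuous rho2).
Hypotheses (rho1E : al \c L crho1 === pr1 A \c lr _)
  (rho2E : al \c L crho2 === pr2 A \c lr _).
Variables (tau1 tau2 : rQ M (prel B) -> Bh) (ctau1 : continuous tau1)
  (ctau2 : continuous tau2).
Hypotheses (tau1E : ga \c L ctau1 === pr1 B \c lr _)
  (tau2E : ga \c L ctau2 === pr2 B \c lr _).

Let rho (z : rQ M (prel A)) : Ah * Ah := (rho1 z, rho2 z).
Let crho : continuous rho. Proof. exact: cts_pair. Qed.
Let N := hpb R rho id.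
Let A1 : topologicalType := set_type [set n : N | p (hpb2 n).1 = p (hpb2 n).2].
Let r1 (n : A1) : Ah := (hpb2 (set_val n)).1.
Let r2 (n : A1) : Ah := (hpb2 (set_val n)).2.
Let q (n : A1) : X := p (r1 n).
Let r1E (n : A1) : p (r1 n) = q n. Proof. by []. Qed.
Let r2E (n : A1) : p (r2 n) = q n. Proof. by have := set_valP n. Qed.
Let cr1 : continuous r1.
Proof.
apply: cts_fst; apply: cts_comp; first exact: hpb2_continuous.
exact: set_val_continuous.
Qed.
Let cr2 : continuous r2.
Proof.
apply: cts_snd; apply: cts_comp; first exact: hpb2_continuous.
exact: set_val_continuous.
Qed.

Let tau (z : rQ M (prel B)) : Bh * Bh := (tau1 z, tau2 z).
Let ctau : continuous tau. Proof. exact: cts_pair. Qed.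
Let S : topologicalType := hpb R tau id.
Let s1 (n : S) : Bh := (hpb2 n).1.
Let s2 (n : S) : Bh := (hpb2 n).2.
Let cs1 : continuous s1. Proof. by apply: cts_fst; exact: hpb2_continuous. Qed.
Let cs2 : continuous s2. Proof. by apply: cts_snd; exact: hpb2_continuous. Qed.
Let cw : continuous (@hpb1 R _ _ _ tau id). Proof. exact: hpb1_continuous. Qed.

Lemma hmt_fst (T Y Z : topologicalType) (a b : T -> Y * Z) :
  hm a b -> hm (fst \o a) (fst \o b).
Proof. by apply: hmt_compl; exact: fst_cts. Qed.

Lemma hmt_snd (T Y Z : topologicalType) (a b : T -> Y * Z) :
  hm a b -> hm (snd \o a) (snd \o b).
Proof. by apply: hmt_compl; exact: snd_cts. Qed.

Let tau_s1 : L ctau1 \c L cw === L cs1.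
Proof.
rewrite -(lmap_comp W cw ctau1 (cts_comp ctau1 cw)) //.
by apply: (rep_hmt M); exact: hmt_fst (hpb_sq _ tau id).
Qed.

Let tau_s2 : L ctau2 \c L cw === L cs2.
Proof.
rewrite -(lmap_comp W cw ctau2 (cts_comp ctau2 cw)) //.
by apply: (rep_hmt M); exact: hmt_snd (hpb_sq _ tau id).
Qed.

Let exr_S (T : HoW) (t : hom T S) :
  exr (ga \c (L cs1 \c t)) (ga \c (L cs2 \c t)).
Proof.
exists (lr _ \c L cw \c t); rewrite -tau_s1 -tau_s2 !comp_assoc.
by rewrite tau1E tau2E; split.
Qed.

Let cn : continuous (fun n : A1 => hpb1 (set_val n)).
Proof. by apply: cts_comp; [exact: hpb1_continuous|exact: set_val_continuous]. Qed.

Let exr_A1 (T : HoW) (t : hom T A1) :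
  exr (al \c (L cr1 \c t)) (al \c (L cr2 \c t)).
Proof.
have e1 : L crho1 \c L cn === L cr1.
  rewrite -(lmap_comp W cn crho1 (cts_comp crho1 cn)) //.
  apply: (rep_hmt M).
  exact: hmt_compr (@set_val_continuous _ _) (hmt_fst (hpb_sq R rho id)).
have e2 : L crho2 \c L cn === L cr2.
  rewrite -(lmap_comp W cn crho2 (cts_comp crho2 cn)) //.
  apply: (rep_hmt M).
  exact: hmt_compr (@set_val_continuous _ _) (hmt_snd (hpb_sq R rho id)).
exists (lr _ \c L cn \c t); rewrite -e1 -e2 !comp_assoc.
by rewrite rho1E rho2E; split.
Qed.

Section Generic.
Variables (E : topologicalType) (x : E -> X) (cx : continuous x)
  (s : @hom HoW (pb x p) Bh) (t : @hom HoW (pb x q) S).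
Hypotheses (sE : L cbh \c s === L (@pb2_continuous _ _ _ x p))
  (t1E : L cs1 \c t === s \c L (face_continuous r1E x cr1))
  (t2E : L cs2 \c t === s \c L (face_continuous r2E x cr2)).

Let c1 := @pb1_continuous _ _ _ x p.
Let c2 := @pb2_continuous _ _ _ x p.

(** For the extensionality clause, represent [v] and [v'] by maps and move the first along the
    fibration [pb1] until both have the same component in [E]. A witness that their components in
    [A] are related then gives a map to [A1] over [X], hence a map to [pb x q] with the two maps as
    faces, and [t] on it relates the values. *)
Lemma generic_is_section :
  is_section f be (L cx) (L c1) (al \c L c2) (ga \c s).
Proof.
have [wp1 wp2] := hlp_weak_pullback M cx cp hp.
split.
- split; first by rewrite comp_assoc fal.
  move=> T h k hk; have [|m [m1 m2]] := wp2 T h (al' \c k).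
    by rewrite -fal -comp_assoc (comp_preK al1).
  by exists m; split=> //; rewrite -comp_assoc m2 comp_assoc al1 comp_idl.
- transitivity (al \c (al' \c be \c ga) \c s).
    by rewrite -!comp_assoc (comp_preK al1).
  by rewrite bga -comp_assoc sE.
move=> T v v' uv av; apply: exr_epi.
have [y [cy yE]] := rep_full (v \c lr T).
have [y' [cy' yE']] := rep_full (v' \c lr T).
have h1 : hlp R (@pb1 _ _ _ x p) by exact: hlp_pb1.
have [|y2 [cy2 yy2 y2E]] := @hlp_lift R _ _ _ _ y (@pb1 _ _ _ x p \o y') h1 cy.
  apply: (@rep_faithful _ _ M T E _ _ (cts_comp c1 cy) (cts_comp c1 cy')).
  by rewrite (lmap_comp W cy c1) // (lmap_comp W cy' c1) // -yE -yE' !comp_assoc uv.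
have {}y2E z : pb1 (y2 z) = pb1 (y' z) by exact: y2E.
have [w [w1 w2]] : exr (al \c L c2 \c v) (al \c L c2 \c v') by exact: av.
have [om [com omE]] := rep_inv (w : @hom HoW T (prel A)).
have cb2 : continuous (fun z => (pb2 (y2 z), pb2 (y' z))).
  by apply: cts_pair; apply: cts_comp => //; exact: pb2_continuous.
have [H [cH H0 H1]] : hm (rho \o om) (fun z => (pb2 (y2 z), pb2 (y' z))).
  apply: hmt_pair.
  - apply: (hmt_trans (g := fun z => pb2 (y z))).
      apply: (@rep_faithful _ _ M T Ah _ _ (cts_comp crho1 com) (cts_comp c2 cy)).
      rewrite (lmap_comp W com crho1) // (lmap_comp W cy c2) //.
      rewrite -[L crho1]comp_idl -al2 -(comp_assoc al') rho1E -!comp_assoc omE.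
      rewrite (comp_assoc _ w) w1 -yE -!comp_assoc (comp_preK al2).
      by [].
    by apply: hmt_compl yy2; exact: pb2_continuous.
  - apply: (@rep_faithful _ _ M T Ah _ _ (cts_comp crho2 com) (cts_comp c2 cy')).
    rewrite (lmap_comp W com crho2) // (lmap_comp W cy' c2) //.
    rewrite -[L crho2]comp_idl -al2 -(comp_assoc al') rho2E -!comp_assoc omE.
    rewrite (comp_assoc _ w) w2 -yE' -!comp_assoc (comp_preK al2).
    by [].
have [n [cn2 n1 n2 _]] := hpb_map (f := rho) (g := id) com cb2 cH H0 H1.
have nP z : p (hpb2 (n z)).1 = p (hpb2 (n z)).2.
  by rewrite n2 /= -!pb_sq y2E.
have cn1 : continuous (fun z => to_set (nP z) : A1) by exact: continuous_to_set.
have cpy : continuous (fun z => pb1 (y' z)) by exact: cts_comp.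
have [|m [cm m1 m2]] := @pb_map _ _ _ x q _ _ _ cpy cn1.
  by move=> z; rewrite /q /r1 /= n2 /= -y2E pb_sq.
have f1 : L (face_continuous r1E x cr1) \c L cm === v \c lr T.
  rewrite yE (rep_hmt M cy cy2 yy2).
  rewrite -(lmap_comp W cm (face_continuous r1E x cr1) cy2) // => z.
  apply: pb_eq; first by rewrite y2E -m1.
  by change (pb2 (y2 z) = r1 (pb2 (m z))); rewrite m2 /r1 /= n2.
have f2 : L (face_continuous r2E x cr2) \c L cm === v' \c lr T.
  rewrite yE'.
  rewrite -(lmap_comp W cm (face_continuous r2E x cr2) cy') // => z.
  apply: pb_eq; first by rewrite -m1.
  by change (pb2 (y' z) = r2 (pb2 (m z))); rewrite m2 /r2 /= n2.
rewrite -(comp_assoc (ga \c s)) -f1 -(comp_assoc (ga \c s)) -f2.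
have := exr_S (t \c L cm); rewrite !(comp_assoc (L _) t) t1E t2E.
by rewrite -!comp_assoc.
Qed.

End Generic.

Section Universal.
Variables (Z : topologicalType) (xz : @hom HoW Z X) (V : topologicalType)
  (u : @hom HoW V Z) (a : @hom HoW V (pcar A)) (sz : @hom HoW V (pcar B)).
Hypothesis secz : is_section f be xz u a sz.
Variables (y : rQ M Z -> X) (cy : continuous y).
Hypothesis yE : xz \c lr Z === L cy.

Let d1 := @pb1_continuous _ _ _ y p.
Let d2 := @pb2_continuous _ _ _ y p.

Lemma section_comparison : exists m : @hom HoW (pb y p) V,
  u \c m === lr Z \c L d1 /\ a \c m === al \c L d2.
Proof.
have [[_ wp] _ _] := secz; apply: wp.
rewrite !comp_assoc yE fal.
by have [] := hlp_weak_pullback M cy cp hp.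
Qed.

(** Lifting along the fibration [bh] makes the section strict. That it preserves the relation is a
    homotopy between a map into pairs of related points of [B] and the two faces of [s']; such a
    homotopy is exactly a map [t'] into the homotopy pullback [S], with strict faces. *)
Lemma section_strict (m : @hom HoW (pb y p) V) :
  u \c m === lr Z \c L d1 -> a \c m === al \c L d2 ->
  exists (s' : rQ M (pb y p) -> Bh) (cs' : continuous s')
    (t' : rQ M (pb y q) -> S),
  strict_datum bh s1 s2 cr1 cr2 r1E r2E s' t' /\
  ga' \c sz \c m \c lr (pb y p) === L cs'.
Proof.
move=> um am; have [_ bes ext] := secz.
have [s0 [cs0 s0E]] := rep_full (ga' \c sz \c m \c lr (pb y p)).
pose ce := @cts_fun _ _ (reps M (pb y p)).
have [|s' [cs' s0s' s'E]] := @hlp_lift R _ _ _ bh s0 (@pb2 _ _ _ y p \o reps M _) hbh cs0.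
  apply: (@rep_faithful _ _ M (pb y p) Ah _ _ (cts_comp cbh cs0)
    (cts_comp d2 ce)).
  rewrite (lmap_comp W cs0 cbh) // (lmap_comp W ce d2) // -s0E -bga.
  rewrite -!comp_assoc (comp_preK ga1) (comp_pre bes) (comp_pre2 am).
  by rewrite (comp_preK al2).
have {}s0E : ga' \c sz \c m \c lr (pb y p) === L cs'.
  by rewrite s0E; exact: (rep_hmt M).
pose rm (r : A1 -> Ah) (rE : forall n, p (r n) = q n) (cr : continuous r) :=
  rmap M (mkcts (face_continuous rE y cr)).
pose v r rE cr := m \c L (@face_continuous _ _ _ p q r rE _ y cr) \c lr (pb y q).
have vs r rE cr : ga' \c sz \c v r rE cr ===
    L (cts_comp cs' (@cts_fun _ _ (rm r rE cr))).
  rewrite (lmap_comp W (@cts_fun _ _ (rm r rE cr)) cs') // -s0E /v -!comp_assoc.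
  apply: comp_heq => //; apply: comp_heq => //; apply: comp_heq => //.
  have cfe := cts_comp (face_continuous rE y cr) (@cts_fun _ _ (reps M (pb y q))).
  rewrite -(lmap_comp W _ _ cfe) // -(lmap_comp W _ _ cfe) // => z.
  by rewrite /rm reps_nat.
pose d1' := @pb1_continuous _ _ _ y q.
pose d2' := @pb2_continuous _ _ _ y q.
have ar r rE cr : a \c v r rE cr === al \c (L cr \c (L d2' \c lr _)).
  rewrite /v !comp_assoc am -!comp_assoc; apply: comp_heq => //.
  rewrite !comp_assoc; apply: comp_heq => //.
  have c := cts_comp cr d2'.
  by rewrite -(lmap_comp W _ _ c) // -(lmap_comp W _ _ c).
have uv r rE cr : u \c v r rE cr === lr Z \c (L d1' \c lr _).
  rewrite /v !comp_assoc um -!comp_assoc; apply: comp_heq => //.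
  rewrite !comp_assoc; apply: comp_heq => //.
  by rewrite -(lmap_comp W _ _ d1').
have [|t0 [t1 t2]] := ext _ (v r1 r1E cr1) (v r2 r2E cr2) (heq_trans (uv _ _ _) (heq_sym (uv _ _ _))).
  by rewrite !ar; exact: exr_A1.
have [w [w1 w2]] := lreps_iso M (prel B).
have [te [cte teE]] := rep_full (w \c t0).
have tb (i : @hom HoW (prel B) (pcar B)) (ta : rQ M (prel B) -> Bh)
    (cta : continuous ta) (r : A1 -> Ah) rE cr : ga \c L cta === i \c lr _ ->
    i \c t0 === sz \c v r rE cr -> hm (ta \o te) (s' \o rm r rE cr).
  move=> iE it; apply: (@rep_faithful _ _ M (pb y q) Bh _ _ (cts_comp cta cte)
    (cts_comp cs' (@cts_fun _ _ (rm r rE cr)))).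
  rewrite -vs (lmap_comp W cte cta) // -teE -[L cta]comp_idl -ga2.
  by rewrite -!comp_assoc (comp_pre2 iE) (comp_preK w2) it.
have ts1 := tb _ _ _ _ _ _ tau1E t1.
have ts2 := tb _ _ _ _ _ _ tau2E t2.
have crm r rE cr : continuous (rm r rE cr) by exact: cts_fun.
have css : continuous (fun z => (s' (rm r1 r1E cr1 z), s' (rm r2 r2E cr2 z))).
  by apply: cts_pair; exact: cts_comp.
have [H [cH H0 H1]] : hm (tau \o te)
    (fun z => (s' (rm r1 r1E cr1 z), s' (rm r2 r2E cr2 z))).
  exact: hmt_pair.
have [t' [ct' _ t'E _]] := hpb_map (f := tau) (g := id) cte css cH H0 H1.
exists s', cs', t'; split=> //; split=> // z; first by rewrite /s1 t'E.
by rewrite /s2 t'E.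
Qed.

Variables (E : topologicalType) (x : E -> X) (cx : continuous x)
  (s : @hom HoW (pb x p) Bh) (t : @hom HoW (pb x q) S).
Hypotheses (sE : L cbh \c s === L (@pb2_continuous _ _ _ x p))
  (t1E : L cs1 \c t === s \c L (face_continuous r1E x cr1))
  (t2E : L cs2 \c t === s \c L (face_continuous r2E x cr2)).
Let c1 := @pb1_continuous _ _ _ x p.
Let c2 := @pb2_continuous _ _ _ x p.

(** The point [l] of the pullback over [Z'] lies below both sides: [ext] moves [sz] at [v] to its
    value at [l], [ext0] does the same for the generic section at [v0], and [sF] identifies the two
    values. *)
Lemma section_factor (m : @hom HoW (pb y p) V) (Z' : topologicalType)
    (w : Z' -> rQ M Z) (F : Z' -> E) (cw' : continuous w) (cF : continuous F)
    (FE : forall z, x (F z) = y (w z)) (w' : @hom HoW (rQ M Z) Z') :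
  u \c m === lr Z \c L d1 -> a \c m === al \c L d2 ->
  L cw' \c w' === idm _ -> w' \c L cw' === idm _ ->
  s \c L (base_change_continuous FE cF) ===
    ga' \c sz \c m \c L (base_change_continuous (fun z => erefl (y (w z))) cw') ->
  exists G : @hom HoW Z E, L cx \c G === xz /\
    forall (T : HoW) (v : hom T V) (v0 : hom T (pb x p)),
      G \c (u \c v) === L c1 \c v0 -> a \c v === al \c L c2 \c v0 ->
      exr (sz \c v) (ga \c s \c v0).
Proof.
move=> um am ww1 ww2 sF; have [e [e1 e2]] := lreps_iso M Z.
have xF : L cx \c L cF === L cy \c L cw'.
  have c := cts_comp cx cF.
  by rewrite -(lmap_comp W cF cx c) // -(lmap_comp W cw' cy c).
exists (L cF \c w' \c e); split.
  rewrite !comp_assoc xF -(comp_assoc (L cy)) ww1 comp_idr -yE.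
  by rewrite -comp_assoc e2 comp_idr.
move=> T v v0 Guv av; have [[sqz _] _ ext] := secz.
have [_ _ ext0] := generic_is_section cx sE t1E t2E.
pose k : @hom HoW (rQ M T) Z' := w' \c (e \c (u \c (v \c lr T))).
pose c : @hom HoW (rQ M T) Ah := al' \c (a \c (v \c lr T)).
pose yw := y \o w.
have cyw : continuous yw by exact: cts_comp.
have [|l [l1 l2]] := (hlp_weak_pullback M cyw cp hp).2 _ k c.
  rewrite (lmap_comp W cw' cy cyw) // -fal /c -!comp_assoc (comp_preK al1).
  rewrite /k (comp_preK ww1).
  by rewrite -yE -comp_assoc (comp_preK e2) (comp_pre2 sqz).
pose Fl := L (base_change_continuous FE cF) \c l.
pose wl := L (base_change_continuous (fun z => erefl (y (w z))) cw') \c l.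
pose b1 := @pb1_continuous _ _ _ yw p.
pose b2 := @pb2_continuous _ _ _ yw p.
have uwl : u \c (m \c wl) === u \c (v \c lr T).
  rewrite comp_assoc um /wl -comp_assoc.
  have -> : L d1 \c (L (base_change_continuous (fun z => erefl (y (w z))) cw') \c l)
      === L cw' \c k.
    rewrite comp_assoc -l1 comp_assoc; apply: comp_heq => //.
    have cc := cts_comp cw' b1.
    by rewrite -(lmap_comp W _ _ cc) // -(lmap_comp W _ _ cc).
  by rewrite /k (comp_preK ww1) (comp_preK e2).
have awl : a \c (m \c wl) === a \c (v \c lr T).
  rewrite comp_assoc am /wl -comp_assoc.
  have -> : L d2 \c (L (base_change_continuous (fun z => erefl (y (w z))) cw') \c l)
      === c.
    by rewrite comp_assoc -l2 -(lmap_comp W _ _ b2).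
  by rewrite /c (comp_preK al1).
have uFl : L c1 \c Fl === L c1 \c (v0 \c lr T).
  rewrite comp_assoc -Guv -comp_assoc.
  have -> : L c1 \c Fl === L cF \c k.
    rewrite comp_assoc -l1 comp_assoc; apply: comp_heq => //.
    have cc := cts_comp cF b1.
    by rewrite -(lmap_comp W _ _ cc) // -(lmap_comp W _ _ cc).
  by rewrite /k -!comp_assoc.
have aFl : al \c L c2 \c Fl === al \c L c2 \c (v0 \c lr T).
  rewrite (comp_assoc _ v0) -av -!comp_assoc.
  have -> : L c2 \c Fl === c.
    by rewrite comp_assoc -l2 -(lmap_comp W _ _ b2).
  by rewrite /c (comp_preK al1).
apply: exr_epi.
transitivity (ga \c s \c Fl).
  transitivity (sz \c (m \c wl)).
    rewrite -comp_assoc; apply: ext; first by rewrite uwl.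
    by rewrite awl; reflexivity.
  apply: heq_exr; rewrite -comp_assoc /Fl (comp_assoc s) sF -!comp_assoc.
  by rewrite (comp_preK ga1).
rewrite -(comp_assoc _ v0); apply: ext0; first exact: uFl.
by rewrite aFl; reflexivity.
Qed.

End Universal.

Lemma representable_section : exists (E : HoW) (x0 : hom E X) (V0 : HoW)
    (u0 : hom V0 E) (a0 : hom V0 (pcar A)) (s0 : hom V0 (pcar B)),
  is_section f be x0 u0 a0 s0 /\
  forall (Z : HoW) (x : hom Z X) (V : HoW) (u : hom V Z) (a : hom V (pcar A))
    (s : hom V (pcar B)), is_section f be x u a s ->
  exists F : hom Z E, x0 \c F === x /\
    forall (T : HoW) (v : hom T V) (v0 : hom T V0),
      F \c (u \c v) === u0 \c v0 -> a \c v === a0 \c v0 ->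
      exr (s \c v) (s0 \c v0).
Proof.
have [E [x [cx [s [t [sE t1E t2E univ]]]]]] :=
  M_generic cp cr1 cr2 r1E r2E cbh cs1 cs2.
exists E, (L cx), (pb x p), (L (@pb1_continuous _ _ _ x p)),
  (al \c L (@pb2_continuous _ _ _ x p)), (ga \c s).
split; first exact: (generic_is_section cx sE t1E t2E).
move=> Z xz V u a sz secz.
have [y [cy yE]] := rep_full (xz \c lr Z).
have [m [um am]] := section_comparison secz yE.
have [s' [cs' [t' [st sz']]]] := section_strict secz um am.
have [Z' [w [F [cw' [cF [FE [Ww sF]]]]]]] := univ _ _ _ _ cs' cy st.
have [w' [w1 w2]] := lmap_iso Ww.
have := section_factor secz yE cx sE t1E t2E (cF := cF) (FE := FE) um am w2 w1.
by apply; exact: (sF _ sz').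
Qed.

End Section1.

Lemma rep_weak_dependent_products : weak_dependent_products HoW.
Proof.
move=> X A B f be.
have [Ah [p [cp [al [al' [hp al1 al2 fal]]]]]] := rep_fibration f.
have [Bh [bh [cbh [ga [ga' [hbh ga1 ga2 bga]]]]]] := rep_fibration (al' \c be).
have lift (Y T' T : HoW) (g : @hom HoW T' T) (g' : hom T T') (h : hom Y T) :
    g \c g' === idm _ -> exists (k : rQ M Y -> T') (ck : continuous k),
      g \c L ck === h \c lr Y.
  move=> gg; have [k [ck kE]] := rep_full (g' \c h \c lr Y).
  by exists k, ck; rewrite -kE !comp_assoc gg comp_idl.
have [rho1 [crho1 rho1E]] := lift _ _ _ _ _ (pr1 A) al1.
have [rho2 [crho2 rho2E]] := lift _ _ _ _ _ (pr2 A) al1.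
have [tau1 [ctau1 tau1E]] := lift _ _ _ _ _ (pr1 B) ga1.
have [tau2 [ctau2 tau2E]] := lift _ _ _ _ _ (pr2 B) ga1.
exact: (representable_section hp al1 al2 fal hbh ga1 ga2 bga rho1E rho2E
  tau1E tau2E).
Qed.

End HomotopyCategoryDependentProducts.

(** * The Strøm model structure *)

Section StromModel.
Variable R : realType.
Local Notation he := (@homotopy_equivalence R).

Lemma homotopy_equivalence_hmt (X Y : topologicalType) (f : continuousType X Y) :
  he f <-> exists g : Y -> X,
    [/\ continuous g, hmt R (g \o f) id & hmt R (f \o g) id].
Proof.
split=> [[g [/homotopicP g1 /homotopicP g2]]|[g [cg g1 g2]]].
  by exists g; split=> //; exact: cts_fun.
by exists (mkcts cg); split; apply/homotopicP.
Qed.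

Lemma homotopy_equivalence_idfun (X : topologicalType) (f : continuousType X X) :
  f =1 id -> he f.
Proof.
move=> /funext fE; apply/homotopy_equivalence_hmt; exists id.
by split; rewrite ?fE; [exact: cts_id|apply: hmt_refl; exact: cts_id..].
Qed.

Lemma homotopy_equivalence_cylinder (X : topologicalType)
  (p : continuousType (X * itv R)%type X) : p =1 fst -> he p.
Proof.
move=> pE; apply/homotopy_equivalence_hmt; exists (fun x => (x, itv0 R)); split.
- by apply: cts_pair; [exact: cts_id|exact: ctscst].
- exists (fun q : X * itv R * R => (q.1.1, clamp (q.2 * ival q.1.2))); split.
  + apply: cts_pair; first by do 2!apply: cts_fst; exact: cts_id.
    apply: cts_comp; first exact: clamp_continuous.
    apply: ctsM; first by apply: cts_snd; exact: cts_id.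
    apply: cts_comp; first exact: ival_continuous.
    by apply: cts_snd; apply: cts_fst; exact: cts_id.
  + by move=> [x t] /=; rewrite mul0r clamp0 pE.
  + by move=> [x t] /=; rewrite mul1r ivalK.
- by apply: hmt_eq => [|x]; [apply: cts_comp; [exact: cts_fun|
    apply: cts_pair; [exact: cts_id|exact: ctscst]]|rewrite /= pE].
Qed.

Lemma homotopy_equivalence_colocal (K : topologicalType) : colocal R he K.
Proof.
move=> Y Z w /homotopy_equivalence_hmt[g [cg gw wg]]; split=> [f cf|a b ca cb ab].
  exists (g \o f); first exact: cts_comp.
  exact: hmt_compr cf wg.
apply: hmt_trans (hmt_sym (hmt_compr ca gw)) _.
apply: hmt_trans (hmt_compr cb gw).
exact: (hmt_compl cg ab).
Qed.

Definition strom_rep : rep_model R he :=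
  @RepModel R he id (fun X => idfun) (fun X Y f => f) (fun _ _ _ _ => erefl)
    (fun _ _ _ _ _ _ hE z => hE z) homotopy_equivalence_cylinder
    (fun X => @homotopy_equivalence_idfun X idfun (fun _ => erefl))
    homotopy_equivalence_colocal.

Section Generic.
Variables (X A A1 B S : topologicalType).
Variables (p : A -> X) (q : A1 -> X) (r1 r2 : A1 -> A) (be : B -> A)
  (s1 s2 : S -> B).
Hypotheses (cr1 : continuous r1) (cr2 : continuous r2).
Hypotheses (r1E : forall z, p (r1 z) = q z) (r2E : forall z, p (r2 z) = q z).

(** A strict datum on one fibre as bare functions on points; continuity enters only through the
    filters of [fibre_converges]. *)
Record fibre_datum := FibreDatum {
  fbase : X;
  fsec : forall a, p a = fbase -> B;
  fhom : forall n, q n = fbase -> S;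
  fsec_be : forall a (e : p a = fbase), be (fsec e) = a;
  fhom_s1 : forall n (e : q n = fbase) (e' : p (r1 n) = fbase),
    s1 (fhom e) = fsec e';
  fhom_s2 : forall n (e : q n = fbase) (e' : p (r2 n) = fbase),
    s2 (fhom e) = fsec e' }.

(** The first group says that [F] is a filter all of whose members contain [d]; the second says that
    base point and both evaluations are continuous along [F], jointly with the argument in the
    fibre. *)
Definition fibre_converges (d : fibre_datum) (F : set (set fibre_datum)) :=
  [/\ F setT, forall U V, F U -> F V -> F (U `&` V),
      forall U V, U `<=` V -> F U -> F V & forall U, F U -> U d] /\
  [/\ forall V, open V -> V (fbase d) ->
        exists2 G, F G & forall d', G d' -> V (fbase d'),
      forall a (e : p a = fbase d) V, open V -> V (fsec e) ->
        exists U G, [/\ open U, U a, F G & forall d' a' (e' : p a' = fbase d'),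
          G d' -> U a' -> V (fsec e')] &
      forall n (e : q n = fbase d) V, open V -> V (fhom e) ->
        exists U G, [/\ open U, U n, F G & forall d' n' (e' : q n' = fbase d'),
          G d' -> U n' -> V (fhom e')]].

(* The topology of a space of fibrewise maps is too coarse or too fine in
   general; a point of this space records in addition a filter along which
   the evaluations are continuous. *)
Definition fibre_space := {z : fibre_datum * set (set fibre_datum) |
  fibre_converges z.1 z.2}.

HB.instance Definition _ := gen_eqMixin fibre_space.
HB.instance Definition _ := gen_choiceMixin fibre_space.

Definition fs_datum (z : fibre_space) := (proj1_sig z).1.
Definition fs_filter (z : fibre_space) := (proj1_sig z).2.

Definition fs_open (U : set fibre_space) := forall z, U z ->
  exists2 G, fs_filter z G & forall z', fs_filter z' G -> U z'.

Lemma fs_openT : fs_open setT.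
Proof. by move=> z _; exists setT => //; case: (proj2_sig z) => -[]. Qed.

Lemma fs_openI : setI_closed fs_open.
Proof.
move=> U V oU oV z [/oU[G zG GU] /oV[H zH HV]]; exists (G `&` H).
  by case: (proj2_sig z) => -[_ h _ _] _; exact: h.
move=> z' z'GH.
have mono (K : set fibre_datum) : G `&` H `<=` K -> fs_filter z' K.
  by case: (proj2_sig z') => -[_ _ h _] _ GHK; exact: h GHK z'GH.
by split; [apply: GU|apply: HV]; apply: mono => ? [].
Qed.

Lemma fs_open_bigU (I : Type) (f : I -> set fibre_space) :
  (forall i, fs_open (f i)) -> fs_open (\bigcup_i f i).
Proof.
move=> of_ z [i _ fz]; have [G zG Gf] := of_ i z fz; exists G => // z' z'G.
by exists i => //; exact: Gf.
Qed.

HB.instance Definition _ := isOpenTopological.Build fibre_space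
  fs_openT fs_openI fs_open_bigU.

Lemma fs_open_basic (G : set fibre_datum) : open [set z | fs_filter z G].
Proof. by move=> z zG; exists G. Qed.

Lemma fs_filter_datum (z : fibre_space) (G : set fibre_datum) :
  fs_filter z G -> G (fs_datum z).
Proof. by case: (proj2_sig z) => -[_ _ _ h] _; exact: h. Qed.

Definition fs_base (z : fibre_space) : X := fbase (fs_datum z).

Lemma fs_base_continuous : continuous fs_base.
Proof.
apply/continuous_openP => z _ V oV Vz.
case: (proj2_sig z) => _ [/(_ V oV Vz)[G zG GV] _ _].
exists [set z | fs_filter z G]; split=> //; first exact: fs_open_basic.
by move=> z' z'G _; apply: GV; exact: fs_filter_datum.
Qed.

Definition fs_sec (z : pb fs_base p) : B := fsec (esym (pb_sq z)).
Definition fs_hom (z : pb fs_base q) : S := fhom (esym (pb_sq z)).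

Lemma fs_sec_continuous : continuous fs_sec.
Proof.
apply/continuous_openP => z _ V oV Vz.
case: (proj2_sig (pb1 z)) => _ [_ h _].
have [U [G [oU Uz zG UG]]] := h (pb2 z) (esym (pb_sq z)) V oV Vz.
exists ((@pb1 _ _ _ fs_base p) @^-1` [set y | fs_filter y G] `&` (@pb2 _ _ _ fs_base p) @^-1` U); split.
- apply: openI.
    by move/continuousP: (@pb1_continuous _ _ _ fs_base p); apply; exact: fs_open_basic.
  by move/continuousP: (@pb2_continuous _ _ _ fs_base p); apply.
- by [].
- by move=> y [yG Uy] _; apply: UG => //; exact: fs_filter_datum.
Qed.

Lemma fs_hom_continuous : continuous fs_hom.
Proof.
apply/continuous_openP => z _ V oV Vz.
case: (proj2_sig (pb1 z)) => _ [_ _ h].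
have [U [G [oU Uz zG UG]]] := h (pb2 z) (esym (pb_sq z)) V oV Vz.
exists ((@pb1 _ _ _ fs_base q) @^-1` [set y | fs_filter y G] `&` (@pb2 _ _ _ fs_base q) @^-1` U); split.
- apply: openI.
    by move/continuousP: (@pb1_continuous _ _ _ fs_base q); apply; exact: fs_open_basic.
  by move/continuousP: (@pb2_continuous _ _ _ fs_base q); apply.
- by [].
- by move=> y [yG Uy] _; apply: UG => //; exact: fs_filter_datum.
Qed.

(** A point [z] goes to the datum on its fibre together with the image of its neighbourhood filter.
    Continuity of [s] and [t] at the points over [z] is then exactly convergence of the evaluations
    along this filter. *)
Lemma fs_classify (Z : topologicalType) (y : Z -> X) (s : pb y p -> B)
    (t : pb y q -> S) : continuous y -> continuous s -> continuous t ->
  (forall z, be (s z) = pb2 z) ->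
  (forall z, s1 (t z) = s (face r1E y z)) ->
  (forall z, s2 (t z) = s (face r2E y z)) ->
  exists (F : Z -> fibre_space) (cF : continuous F)
    (FE : forall z, fs_base (F z) = y z),
  forall z, fs_sec (base_change FE z) = s z.
Proof.
move=> cy cs ct sE t1 t2.
have hb z a (e : p a = y z) : be (s (pb_mk (esym e))) = a by rewrite sE.
have h1 z n (e : q n = y z) (e' : p (r1 n) = y z) :
    s1 (t (pb_mk (esym e))) = s (pb_mk (esym e')).
  by rewrite t1; congr s; exact: pb_eq.
have h2 z n (e : q n = y z) (e' : p (r2 n) = y z) :
    s2 (t (pb_mk (esym e))) = s (pb_mk (esym e')).
  by rewrite t2; congr s; exact: pb_eq.
pose d z : fibre_datum := FibreDatum (@hb z) (@h1 z) (@h2 z).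
pose Phi (z : Z) : set (set fibre_datum) := [set V | nbhs z [set z' | V (d z')]].
have near_pb (C : topologicalType) (k : C -> X) (z : pb y k) (O : set (pb y k)) :
    open O -> O z -> exists (U : set C) (N : set Z), [/\ open U, U (pb2 z),
      nbhs (pb1 z) N & forall z' c (e : y z' = k c), N z' -> U c -> O (pb_mk e)].
  move=> [P oP <-] Oz.
  have := open_nbhs_nbhs (conj oP (Oz : P (set_val z))) => -[[N V] /= [hN]].
  rewrite nbhsE => -[V' [oV' V'z] V'V] NV; exists V', N; split=> // z' c e Nz Vc.
  by apply: NV; split => //=; exact: V'V.
have Pc z : fibre_converges (d z) (Phi z).
  split; split.
  - exact: filterT.
  - by move=> U V; exact: filterI.
  - by move=> U V UV; apply: filterS => z'; exact: UV.
  - by move=> U; exact: nbhs_singleton.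
  - move=> V oV Vy; exists [set d' | V (fbase d')] => //.
    by apply: cy; exact: open_nbhs_nbhs.
  - move=> a e V oV Va.
    have [||U [N [oU Ua hN UN]]] := near_pb A p (pb_mk (esym e)) (s @^-1` V).
    + by move/continuousP: cs; apply.
    + exact: Va.
    exists U, [set d' | exists2 z', N z' & d' = d z']; split=> //.
      by apply: filterS hN => z' Nz'; exists z'.
    by move=> d' a' e' [z' Nz' dE]; subst d' => Ua'; exact: UN.
  - move=> a e V oV Va.
    have [||U [N [oU Ua hN UN]]] := near_pb A1 q (pb_mk (esym e)) (t @^-1` V).
    + by move/continuousP: ct; apply.
    + exact: Va.
    exists U, [set d' | exists2 z', N z' & d' = d z']; split=> //.
      by apply: filterS hN => z' Nz'; exists z'.
    by move=> d' a' e' [z' Nz' dE]; subst d' => Ua'; exact: UN.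
pose F z : fibre_space := exist _ (d z, Phi z) (Pc z).
have cF : continuous F.
  apply/continuous_openP => z _ V oV Vz; have [G zG GV] := oV _ Vz.
  exists (interior [set z' | G (d z')]); split=> //; first exact: open_interior.
  by move=> z' z'G _; exact: GV.
exists F, cF, (fun z => erefl) => z.
by rewrite /fs_sec /=; congr s; apply: pb_eq.
Qed.

Lemma strom_generic (cbe : continuous be) (cs1 : continuous s1)
  (cs2 : continuous s2) : generic_datum strom_rep cr1 cr2 r1E r2E cbe cs1 cs2.
Proof.
exists fibre_space, fs_base, fs_base_continuous,
  (lmap he fs_sec_continuous), (lmap he fs_hom_continuous); split.
- by rewrite -(lmap_comp _ _ _ (@pb2_continuous _ _ _ fs_base p)) //;
    move=> z; rewrite /fs_sec fsec_be.
- have c := cts_comp cs1 fs_hom_continuous.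
  rewrite -(lmap_comp _ _ _ c) // -(lmap_comp _ _ _ c) //; move=> z.
  by rewrite /fs_hom /fs_sec /=; exact: fhom_s1.
- have c := cts_comp cs2 fs_hom_continuous.
  rewrite -(lmap_comp _ _ _ c) // -(lmap_comp _ _ _ c) //; move=> z.
  by rewrite /fs_hom /fs_sec /=; exact: fhom_s2.
move=> Z y s t cs cy [cs' ct sE t1 t2].
have [||F [cF [FE FsE]]] := fs_classify cy cs ct sE.
- by move=> z; rewrite t1.
- by move=> z; rewrite t2.
exists Z, id, F, (@cts_id Z), cF, FE; split.
  exact: homotopy_equivalence_idfun.
move=> phi phiE.
have e1 : lmap he (base_change_continuous (p := p)
    (fun z => erefl (y (id z))) (@cts_id Z)) === idm _.
  by apply: lmap_id => z; exact: pb_eq.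
rewrite e1 comp_idr -(lmap_comp he (base_change_continuous FE cF)
  fs_sec_continuous cs); last by move=> z; rewrite FsE.
by rewrite -phiE lmap_id // comp_idr.
Qed.

End Generic.

Theorem strom_locally_cartesian_closed :
  locally_cartesian_closed (exact_completion (Ho (Top_S R))).
Proof.
apply: lcc_exact_completion.
- exact: (rep_terminal strom_rep).
- exact: (rep_products strom_rep).
- exact: (rep_weak_pullbacks strom_rep).
- by apply: (@rep_weak_dependent_products _ _ strom_rep) => *; exact: strom_generic.
Qed.

End StromModel.

(** * Lifting against spheres and balls *)

Section Vectors.
Variable R : realType.
Implicit Types (T : topologicalType) (V : normedModType R).

Lemma ctsDv T (V : pseudoMetricNormedZmodType R) (f g : T -> V) :
  continuous f -> continuous g -> continuous (fun x => f x + g x).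
Proof. by move=> cf cg x; exact: (cvgD (cf x) (cg x)). Qed.

Lemma ctsNv T (V : pseudoMetricNormedZmodType R) (f : T -> V) :
  continuous f -> continuous (fun x => - f x).
Proof. by move=> cf x; exact: (cvgN (cf x)). Qed.

Lemma ctsZ T V (f : T -> R) (g : T -> V) : continuous f -> continuous g ->
  continuous (fun x => f x *: g x).
Proof. by move=> cf cg x; exact: (cvgZ (cf x) (cg x)). Qed.

Lemma cts_norm T V (f : T -> V) : continuous f -> continuous (fun x => `|f x|).
Proof. by move=> cf; apply: cts_comp => //; exact: norm_continuous. Qed.

Lemma ctsV T (f : T -> R) : continuous f -> (forall x, f x != 0) ->
  continuous (fun x => (f x)^-1).
Proof. by move=> cf f0 x; apply: cvgV => //; exact: cf. Qed.

(** The bound gives continuity at the zeros of [r]. Maps that divide by a norm, such as cones and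
    rescalings along rays, are continuous at the origin by this criterion. *)
Lemma cts_squeeze T V (f : T -> V) (r : T -> R) (C : R) : continuous r ->
  (forall x, `|f x| <= C * `|r x|) -> cont_on [set x | r x != 0] f ->
  continuous f.
Proof.
move=> cr fr cf; apply/continuous_openP => x _ W oW Wx.
have [rx|rx] := eqVneq (r x) 0; last first.
  have [U [oU Ux UW]] := cf x rx W oW Wx.
  exists (U `&` [set x | r x != 0]); split=> //; last by move=> y [Uy ry] _; exact: UW.
  apply: openI => //.
  have -> : [set x | r x != 0] = [set x | 0 < `|r x|].
    by apply/seteqP; split=> y /=; rewrite normr_gt0.
  by apply: open_lt_cts; [exact: ctscst|exact: cts_norm].
have fx : f x = 0.
  by apply/eqP; rewrite -normr_le0 (le_trans (fr x)) // rx normr0 mulr0.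
have : nbhs (0 : V) W by rewrite -fx; exact: open_nbhs_nbhs.
rewrite -nbhs_ballE => -[e /= e0 eW].
exists [set y | C * `|r y| < e]; split.
- apply: open_lt_cts; last exact: ctscst.
  by apply: ctsM; [exact: ctscst|exact: cts_norm].
- by rewrite /= rx normr0 mulr0.
- move=> y /= ye _; apply: eW; rewrite -ball_normE /= sub0r normrN.
  exact: le_lt_trans (fr y) ye.
Qed.

Section Rows.
Variable n : nat.
Local Notation E := 'rV[R]_n.
Implicit Types x y : E.

Lemma coord_le_norm x i : `|x ord0 i| <= `|x|.
Proof.
rewrite [leRHS](mx_normrE x).
exact: (le_bigmax _ (fun ij => `|x ij.1 ij.2|) (ord0, i)).
Qed.

Lemma norm_leP x (c : R) : 0 <= c -> reflect (forall i, `|x ord0 i| <= c) (`|x| <= c).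
Proof.
move=> c0; apply: (iffP idP) => [xc i|xc].
  exact: le_trans (coord_le_norm x i) xc.
rewrite [leLHS](mx_normrE x); apply: bigmax_le => // -[i j] _ /=.
by rewrite (ord1 i).
Qed.

Lemma norm_attained x : 0 < `|x| -> exists i, `|x| = `|x ord0 i|.
Proof.
move=> x0; have [|[i j] /= e] := @mx_norm_neq0 R 1 n x.
  by have := lt0r_neq0 x0.
by exists j; rewrite [LHS]e (ord1 i).
Qed.

Lemma cts_coord T (f : T -> E) i : continuous f -> continuous (fun t => f t ord0 i).
Proof.
move=> cf; apply: (@cts_comp _ _ _ f (fun M : E => M ord0 i)) => //.
exact: coord_continuous.
Qed.

Lemma cts_row T (f : T -> E) :
  (forall i, continuous (fun t => f t ord0 i)) -> continuous f.
Proof.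
move=> cf x W; rewrite -nbhs_ballE => -[e /= e0 eW].
have : nbhs x [set t | forall i, ball (f x ord0 i) e (f t ord0 i)].
  apply: filter_forall => i; apply: (cf i x).
  exact: nbhsx_ballx.
apply: filterS => t xt; apply: eW; split=> // i j; rewrite (ord1 i); exact: xt.
Qed.

(** The radial retraction of the whole space onto the unit ball; precomposing with it makes maps on
    the ball total. *)
Definition rc x : E := (Num.max 1 `|x|)^-1 *: x.

Lemma max1_gt0 (a : R) : 0 < Num.max 1 a.
Proof. by rewrite lt_max ltr01. Qed.

Lemma rc_continuous : continuous rc.
Proof.
apply: ctsZ; last exact: cts_id; apply: ctsV; last first.
  by move=> x; rewrite gt_eqF // max1_gt0.
by apply: ctsmax; [exact: ctscst|apply: cts_norm; exact: cts_id].
Qed.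

Lemma cts_rc T (f : T -> E) : continuous f -> continuous (fun t => rc (f t)).
Proof. by apply: cts_comp; exact: rc_continuous. Qed.

Lemma rc_id x : `|x| <= 1 -> rc x = x.
Proof. by move=> x1; rewrite /rc max_l // invr1 scale1r. Qed.

Lemma norm_rc x : `|rc x| = Num.min 1 `|x|.
Proof.
rewrite /rc normrZ ger0_norm ?invr_ge0 ?ltW ?max1_gt0 //.
have [x1|x1] := leP `|x| 1; first by rewrite invr1 mul1r.
by rewrite mulVf // gt_eqF // (lt_trans _ x1).
Qed.

Lemma norm_rc_le1 x : `|rc x| <= 1.
Proof. by rewrite norm_rc ge_min lexx. Qed.

Lemma rcZ x (a : R) : 0 < a -> 1 <= `|x| -> 1 <= a * `|x| -> rc (a *: x) = rc x.
Proof.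
move=> a0 x1 ax1; rewrite /rc normrZ (gtr0_norm a0) !max_r // scalerA.
by congr (_ *: _); rewrite invfM -mulrA mulrCA mulVf ?mulr1 // gt_eqF.
Qed.

Definition unit_ball : set E := [set x | `|x| <= 1].
Definition unit_sphere : set E := [set x | `|x| = 1].

Definition dir x : E := `|x|^-1 *: x.

Lemma norm_dir x : x != 0 -> `|dir x| = 1.
Proof. exact: normfZV. Qed.

Lemma dir_sphere x : `|x| = 1 -> dir x = x.
Proof. by move=> x1; rewrite /dir x1 invr1 scale1r. Qed.

Lemma dir_cont_on : cont_on [set x : E | x != 0] dir.
Proof.
apply: set_type_cont_on; apply: ctsZ; last exact: set_val_continuous.
apply: ctsV; first by apply: cts_norm; exact: set_val_continuous.
by move=> x; rewrite normr_eq0; exact: (set_valP x).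
Qed.

Lemma dirZ x (a : R) : 0 < a -> dir (a *: x) = dir x.
Proof.
move=> a0; rewrite /dir normrZ (gtr0_norm a0) scalerA.
by congr (_ *: _); rewrite invfM -mulrA mulrCA mulVf ?mulr1 // gt_eqF.
Qed.

Lemma rc_dir x : 1 <= `|x| -> rc x = dir x.
Proof. by move=> x1; rewrite /rc max_r. Qed.

Lemma dir_neq0 x : `|x| = 1 -> x != 0.
Proof. by move=> x1; rewrite -normr_eq0 x1 oner_eq0. Qed.

Lemma cone_continuous V (f : E -> V) (C : R) : cont_on unit_sphere f ->
  (forall u, `|u| = 1 -> `|f u| <= C) -> continuous (fun x => `|x| *: f (dir x)).
Proof.
move=> cf fC.
apply: (@cts_squeeze _ _ _ (fun x => `|x|) C).
- by apply: cts_norm; exact: cts_id.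
- move=> x; rewrite normrZ !normr_id mulrC.
  have [->|x0] := eqVneq x 0; first by rewrite normr0 !mulr0.
  by apply: ler_wpM2r => //; apply: fC; exact: norm_dir.
- apply: set_type_cont_on.
  have c : continuous (fun x : set_type [set x : E | `|x| != 0] => f (dir (set_val x))).
    apply: (@cont_on_set_type _ _ _ (fun x => f (dir x))).
    apply: (@cont_on_comp _ _ _ _ unit_sphere dir f) => //.
      by apply: cont_onS dir_cont_on => x /=; rewrite normr_eq0.
    by move=> x /=; rewrite normr_eq0; exact: norm_dir.
  by apply: ctsZ => //; apply: cts_norm; exact: set_val_continuous.
Qed.

Lemma unit_ball_closed : closed unit_ball.
Proof.
by apply: closed_le_cts; [apply: cts_norm; exact: cts_id|exact: ctscst].
Qed.

Lemma unit_ball_compact : compact unit_ball.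
Proof.
apply: bounded_closed_compact; last exact: unit_ball_closed.
exists 1; split=> // M M1 x /= x1; exact: le_trans (ltW M1).
Qed.

Lemma compact_lebesgue (K : set E) (N : E -> set E) : compact K ->
  (forall x, K x -> open (N x) /\ N x x) ->
  exists2 e : R, 0 < e & forall x, K x -> exists2 u, K u & ball x e `<=` N u.
Proof.
move=> /compact_near_coveringP cK NK.
pose P (e : R) x := exists2 u, K u & ball x e `<=` N u.
have : \forall e \near (0 : R)^'+, K `<=` P e.
  apply: cK => x Kx; have [oN Nx] := NK x Kx.
  have := open_nbhs_nbhs (conj oN Nx); rewrite -nbhs_ballE => -[r /= r0 rN].
  exists (ball x (r / 2), [set e | e < r / 2]) => /=; first split.
  - by apply: (nbhsx_ballx x (r / 2)); rewrite divr_gt0.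
  - by apply: nbhs_right_lt; rewrite divr_gt0.
  - move=> [y e] /= [xy er]; exists x => // z yz; apply: rN.
    rewrite (splitr r); apply: ball_triangle xy _.
    exact: le_ball (ltW er) _ yz.
move=> KP; have gt0 : \forall e \near (0 : R)^'+, 0 < e by exact: nbhs_right_gt.
by have [e [e0 eP]] := filter_ex (filterI gt0 KP); exists e.
Qed.

End Rows.
End Vectors.

(** * Relative lifting properties and weak homotopy equivalences *)

Section Lifting.
Variable R : realType.
Local Notation I := (itv R).
Local Notation sph n := (@unit_sphere R n).

(* A weak form of the right lifting property against the inclusion of a sphere
   into a ball: it holds up to a reparametrization [c] of the ball. *)
Definition wlp (E B : topologicalType) (q : E -> B) :=
  (forall b, exists e, q e = b) /\
  forall n (g : 'rV[R]_n -> E) (h : 'rV[R]_n -> B),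
    cont_on (sph n) g -> continuous h -> (forall u, `|u| = 1 -> q (g u) = h u) ->
    exists (k : 'rV[R]_n -> E) (c : 'rV[R]_n -> 'rV[R]_n),
      [/\ continuous k, continuous c, forall u, `|u| = 1 -> k u = g u /\ c u = u,
        forall x, `|x| <= 1 -> `|c x| <= 1 &
        forall x, `|x| <= 1 -> q (k x) = h (c x)].

(** These are the trivial Serre fibrations. Surjectivity is a separate clause because [g] is a total
    function: the lifting clause for [n = 0] says nothing when [E] is empty. *)
Definition rlp (E B : topologicalType) (q : E -> B) :=
  (forall b, exists e, q e = b) /\
  forall n (g : 'rV[R]_n -> E) (h : 'rV[R]_n -> B),
    cont_on (sph n) g -> continuous h -> (forall u, `|u| = 1 -> q (g u) = h u) ->
    exists k : 'rV[R]_n -> E,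
      [/\ continuous k, forall u, `|u| = 1 -> k u = g u &
        forall x, `|x| <= 1 -> q (k x) = h x].

Lemma rlp_wlp (E B : topologicalType) (q : E -> B) : rlp q -> wlp q.
Proof.
move=> [sq lq]; split=> // n g h cg ch gh; have [k [ck kg qk]] := lq n g h cg ch gh.
exists k, id; split=> //; first exact: cts_id.
by move=> u u1; rewrite kg.
Qed.

Section Cubes.
Variable n : nat.

(** Row vectors carry the maximum norm, so the unit ball is the cube [[-1, 1]^n] and an affine
    rescaling of coordinates identifies it with [cube R n], spheres corresponding to boundaries. *)
Definition to_cube (x : 'rV[R]_n) : cube R n :=
  fun i => clamp ((x ord0 i + 1) / 2).

Definition of_cube (t : cube R n) : 'rV[R]_n := \row_i (2 * ival (t i) - 1).

Lemma cts_cube (T : topologicalType) (f : T -> cube R n) :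
  (forall i, continuous (fun t => f t i)) -> continuous f.
Proof.
move=> cf x; apply/cvg_sup => i N [V [[U oU <-] Ufx VN]].
have : nbhs x ((fun t => f t i) @^-1` U).
  by apply: cf; apply: open_nbhs_nbhs.
by apply: filterS => t Ut; exact: VN.
Qed.

Lemma cube_proj_continuous (i : 'I_n) : continuous (fun t : cube R n => t i).
Proof. exact: (@proj_continuous _ (fun=> itv R) i). Qed.

Lemma to_cube_continuous : continuous to_cube.
Proof.
apply: cts_cube => i; apply: cts_comp; first exact: clamp_continuous.
apply: ctsM; last exact: ctscst.
by apply: ctsD; [apply: cts_coord; exact: cts_id|exact: ctscst].
Qed.

Lemma of_cube_continuous : continuous of_cube.
Proof.
apply: cts_row => i.
have -> : (fun t => of_cube t ord0 i) = (fun t => 2 * ival (t i) - 1).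
  by apply/funext => t; rewrite mxE.
apply: ctsB; last exact: ctscst; apply: ctsM; first exact: ctscst.
apply: cts_comp; first exact: ival_continuous.
exact: cube_proj_continuous.
Qed.

Lemma of_cubeK (t : cube R n) : to_cube (of_cube t) = t.
Proof.
apply/funext => i; rewrite /to_cube mxE -[RHS]ivalK; congr clamp.
by field.
Qed.

Lemma to_cubeK (x : 'rV[R]_n) : `|x| <= 1 -> of_cube (to_cube x) = x.
Proof.
move=> /(norm_leP _ ler01) x1; apply/rowP => i; rewrite mxE clampK; first by field.
by have := x1 i; rewrite ler_norml => /andP[]; lra.
Qed.

Lemma norm_of_cube (t : cube R n) : `|of_cube t| <= 1.
Proof.
apply/(norm_leP _ ler01) => i; rewrite mxE ler_norml.
by have /andP[] := ivalP (t i); lra.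
Qed.

Lemma boundary_of_cube (t : cube R n) : cube_boundary t -> `|of_cube t| = 1.
Proof.
move=> [i ti]; apply/eqP; rewrite eq_le norm_of_cube /=.
apply: le_trans (coord_le_norm _ i); rewrite mxE.
case: ti => ->; first by rewrite [ival _]/= mulr0 sub0r normrN normr1.
by rewrite [ival _]/= mulr1 ger0_norm; lra.
Qed.

Lemma boundary_to_cube (x : 'rV[R]_n) : 1 <= `|x| -> cube_boundary (to_cube x).
Proof.
move=> x1; have [|i xi] := @norm_attained R n x; first exact: lt_le_trans x1.
exists i; move: x1; rewrite xi ler_normr => /orP[x1|x1]; [right|left].
  by rewrite /to_cube clamp_ge1 //; lra.
by rewrite /to_cube clamp_le0 //; lra.
Qed.

End Cubes.

Section Cons.
Variable n : nat.
Implicit Types y : 'rV[R]_n.+1.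

Definition vhd y : R := y ord0 ord0.
Definition vtl y : 'rV[R]_n := \row_i y ord0 (lift ord0 i).
Definition vcons (s : R) (x : 'rV[R]_n) : 'rV[R]_n.+1 :=
  \row_i (if unlift ord0 i is Some j then x ord0 j else s).

Lemma vhd_cons s x : vhd (vcons s x) = s.
Proof. by rewrite /vhd mxE unlift_none. Qed.

Lemma vtl_cons s x : vtl (vcons s x) = x.
Proof. by apply/rowP => i; rewrite !mxE liftK. Qed.

Lemma vcons_eta y : vcons (vhd y) (vtl y) = y.
Proof. by apply/rowP => i; rewrite mxE; case: unliftP => [j ->|->]; rewrite ?mxE. Qed.

Lemma norm_vcons s x : `|vcons s x| = Num.max `|s| `|x|.
Proof.
apply/eqP; rewrite eq_le; apply/andP; split.
  apply/norm_leP; first by rewrite le_max normr_ge0.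
  move=> i; rewrite mxE; case: unliftP => [j _|_]; rewrite le_max ?lexx //.
  by rewrite coord_le_norm orbT.
rewrite ge_max; apply/andP; split.
  by have := coord_le_norm (vcons s x) ord0; rewrite -/(vhd _) vhd_cons.
apply/norm_leP => // i.
by have := coord_le_norm (vcons s x) (lift ord0 i); rewrite mxE liftK.
Qed.

Lemma norm_vconsE y : `|y| = Num.max `|vhd y| `|vtl y|.
Proof. by rewrite -{1}(vcons_eta y) norm_vcons. Qed.

Lemma cts_vhd (T : topologicalType) (f : T -> 'rV[R]_n.+1) : continuous f ->
  continuous (fun t => vhd (f t)).
Proof. exact: cts_coord. Qed.

Lemma cts_vtl (T : topologicalType) (f : T -> 'rV[R]_n.+1) : continuous f ->
  continuous (fun t => vtl (f t)).
Proof.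
move=> cf; apply: cts_row => i.
have -> : (fun t => vtl (f t) ord0 i) = (fun t => f t ord0 (lift ord0 i)).
  by apply/funext => t; rewrite mxE.
exact: cts_coord.
Qed.

Lemma cts_vcons (T : topologicalType) (f : T -> R) (g : T -> 'rV[R]_n) :
  continuous f -> continuous g -> continuous (fun t => vcons (f t) (g t)).
Proof.
move=> cf cg; apply: cts_row => i.
have -> : (fun t => vcons (f t) (g t) ord0 i) =
    (fun t => if unlift ord0 i is Some j then g t ord0 j else f t).
  by apply/funext => t; rewrite mxE.
by case: unliftP => [j _|_] //; exact: cts_coord.
Qed.

(** For the maximum norm the unit sphere in dimension [n + 1] is the boundary of the prism over the
    [n]-ball; [A1], [A2] and [A3] are its bottom, its top and its side. *)
Lemma vcons_boundary (E : topologicalType) (a b : 'rV[R]_n -> E)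
    (e : 'rV[R]_n * R -> E) : continuous a -> continuous b ->
  cont_on [set q : 'rV[R]_n * R | `|q.1| = 1 /\ `|q.2| <= 1] e ->
  (forall x, `|x| = 1 -> e (x, -1) = a x) ->
  (forall x, `|x| = 1 -> e (x, 1) = b x) ->
  exists g : 'rV[R]_n.+1 -> E, [/\ cont_on (sph n.+1) g,
    forall x, `|x| <= 1 -> g (vcons (-1) x) = a x,
    forall x, `|x| <= 1 -> g (vcons 1 x) = b x &
    forall x s, `|x| = 1 -> `|s| <= 1 -> g (vcons s x) = e (x, s)].
Proof.
move=> ca cb ce ea eb.
pose g y := if `|vtl y| == 1 then e (vtl y, vhd y) else
  if vhd y <= 0 then a (vtl y) else b (vtl y).
pose A1 : set 'rV[R]_n.+1 := [set y | `|y| = 1 /\ vhd y = -1].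
pose A2 : set 'rV[R]_n.+1 := [set y | `|y| = 1 /\ vhd y = 1].
pose A3 : set 'rV[R]_n.+1 := [set y | `|y| = 1 /\ `|vtl y| = 1].
have c1 : continuous (fun y => vtl y) by apply: cts_vtl; exact: cts_id.
have c2 : continuous (fun y => vhd y) by apply: cts_vhd; exact: cts_id.
have cn := cts_norm (@cts_id 'rV[R]_n.+1).
have closed_eq (f : 'rV[R]_n.+1 -> R) (r : R) : continuous f -> closed [set y | f y = r].
  move=> cf; have -> : [set y | f y = r] = [set y | f y <= r] `&` [set y | r <= f y].
    by apply/seteqP; split=> y /=; [move->|move=> [fr rf]; apply/eqP; rewrite eq_le fr].
  by apply: closedI; apply: closed_le_cts => //; exact: ctscst.
exists g; split.
- apply: (@cont_onS _ _ _ (A1 `|` (A2 `|` A3))).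
    move=> y /= y1; have := norm_vconsE y; rewrite y1 => /esym.
    have [h1 t1|h1 t1] := leP `|vhd y| `|vtl y|; first by right; right.
    move: t1 => /eqP; rewrite eqr_norml ler01 andbT => /orP[]/eqP h; [right; left|left] => //.
  have cl (f : 'rV[R]_n.+1 -> R) r : continuous f -> closed [set y : 'rV[R]_n.+1 | `|y| = 1 /\ f y = r].
    by move=> cf; exact: (closedI (closed_eq _ 1 cn) (closed_eq _ r cf)).
  apply: cont_on_closedU; [exact: cl|apply: closedU; apply: cl => //; exact: cts_norm| |].
  + apply: (@cont_on_eq _ _ _ (fun y => a (vtl y))) => [y [y1 y0]|].
      rewrite /g; case: ifP => [/eqP t1|_]; first by rewrite y0 ea.
      by rewrite y0 lerN10.
    by apply: continuous_cont_on; exact: cts_comp.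
  apply: cont_on_closedU; [exact: cl|apply: cl; exact: cts_norm| |].
  + apply: (@cont_on_eq _ _ _ (fun y => b (vtl y))) => [y [y1 y0]|].
      rewrite /g; case: ifP => [/eqP t1|_]; first by rewrite y0 eb.
      by rewrite y0 ler10.
    by apply: continuous_cont_on; exact: cts_comp.
  + apply: (@cont_on_eq _ _ _ (fun y => e (vtl y, vhd y))) => [y [y1 y0]|].
      by rewrite /g y0 eqxx.
    apply: (@cont_on_comp _ _ _ _ [set q : 'rV[R]_n * R | `|q.1| = 1 /\ `|q.2| <= 1]
      (fun y => (vtl y, vhd y))) => //.
      by apply: continuous_cont_on; exact: cts_pair.
    move=> y [y1 t1]; split=> //=; move: y1; rewrite norm_vconsE t1 => /esym y1.
    by rewrite y1 le_max lexx.
- move=> x x1; rewrite /g vtl_cons vhd_cons lerN10; case: eqP => // x1'.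
  exact: ea.
- move=> x x1; rewrite /g vtl_cons vhd_cons ler10; case: eqP => // x1'.
  exact: eb.
- by move=> x s x1 s1; rewrite /g vtl_cons vhd_cons x1 eqxx.
Qed.

End Cons.

Section WlpWeakEquivalence.
Variables (E B : topologicalType) (q : continuousType E B) (lq : wlp q).

(** The homotopy below is a map of the prism, with a given lift of its boundary. Any extension of
    that lift to the prism is the homotopy above, and only its boundary values enter. *)
Lemma wlp_pi_inj n (x : E) (a b : based_cube R n x) :
  homotopic_rel (based_cube_map q a) (based_cube_map q b) -> homotopic_rel a b.
Proof.
move=> [H [H01 Hb]].
pose a' (z : 'rV[R]_n) := proj1_sig a (to_cube z).
pose b' (z : 'rV[R]_n) := proj1_sig b (to_cube z).
have ca : continuous a' by apply: cts_comp; [exact: cts_fun|exact: to_cube_continuous].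
have cb : continuous b' by apply: cts_comp; [exact: cts_fun|exact: to_cube_continuous].
have bnd (z : 'rV[R]_n) : `|z| = 1 -> cube_boundary (to_cube z).
  by move=> z1; apply: boundary_to_cube; rewrite z1.
have [||g [cg ga gb ge]] := @vcons_boundary n E a' b' (fun=> x) ca cb
  (continuous_cont_on (@ctscst _ _ x)).
- by move=> z z1; rewrite /a' (proj2_sig a) //; exact: bnd.
- by move=> z z1; rewrite /b' (proj2_sig b) //; exact: bnd.
pose h (y : 'rV[R]_n.+1) := H (to_cube (vtl y), clamp ((vhd y + 1) / 2)).
have ch : continuous h.
  apply: cts_comp; first exact: cts_fun; apply: cts_pair.
    apply: cts_comp; first exact: to_cube_continuous.
    by apply: cts_vtl; exact: cts_id.
  apply: cts_comp; first exact: clamp_continuous.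
  apply: ctsM; last exact: ctscst.
  by apply: ctsD; [apply: cts_vhd; exact: cts_id|exact: ctscst].
have [|k [c [ck cc kg _ _]]] := lq.2 n.+1 g h cg ch.
  move=> y y1; have := norm_vconsE y; rewrite y1 -{3}(vcons_eta y) /h.
  have [h1 t1|h1 t1] := leP `|vhd y| `|vtl y|.
    rewrite ge; [|by rewrite t1|by rewrite (le_trans h1) // t1].
    by rewrite Hb //; apply: bnd; rewrite t1.
  have tl1 : `|vtl y| <= 1 by rewrite t1 ltW.
  move: t1 => /esym/eqP; rewrite eqr_norml ler01 andbT => /orP[]/eqP ->.
    by rewrite gb // clamp_ge1 ?(H01 _).2 //; lra.
  by rewrite ga // clamp_le0 ?(H01 _).1 //; lra.
have cK : continuous (fun z : cube R n * I => k (vcons (2 * ival z.2 - 1) (of_cube z.1))).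
  apply: cts_comp => //; apply: cts_vcons.
    apply: ctsB; last exact: ctscst; apply: ctsM; first exact: ctscst.
    apply: cts_comp; first exact: ival_continuous.
    by apply: cts_snd; exact: cts_id.
  apply: cts_comp; first exact: of_cube_continuous.
  by apply: cts_fst; exact: cts_id.
exists (mkcts cK); split=> [t|t s bt] /=.
  change (k (vcons (2 * 0 - 1) (of_cube t)) = sval a t /\
    k (vcons (2 * 1 - 1) (of_cube t)) = sval b t).
  rewrite mulr0 sub0r mulr1; have -> : (2 - 1 = 1 :> R) by lra.
  have n1 : `|of_cube t| <= 1 := norm_of_cube t.
  rewrite !(kg _ _).1 ?norm_vcons ?normrN ?normr1 ?max_l // ga // gb //.
  by rewrite /a' /b' of_cubeK.
have n1 := boundary_of_cube bt; have /andP[s0 s1] := ivalP s.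
have ns : `|2 * ival s - 1| <= 1 by rewrite ler_norml; lra.
change (k (vcons (2 * ival s - 1) (of_cube t)) = x).
by rewrite (kg _ _).1 ?ge // norm_vcons n1 max_r.
Qed.

(** The lift covers [h] reparametrized by [r]; since [r] fixes the sphere, the straight line from
    [r] to the identity is a homotopy relative to the boundary. *)
Lemma wlp_pi_surj n (x : E) (c : based_cube R n (q x)) :
  exists a : based_cube R n x, homotopic_rel (based_cube_map q a) c.
Proof.
pose h (z : 'rV[R]_n) := proj1_sig c (to_cube z).
have ch : continuous h by apply: cts_comp; [exact: cts_fun|exact: to_cube_continuous].
have [|k [r [ck cr kg r1 qk]]] := lq.2 n (fun=> x) h (continuous_cont_on (@ctscst _ _ x)) ch.
  by move=> u u1; rewrite /h (proj2_sig c) //; apply: boundary_to_cube; rewrite u1.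
have cko : continuous (fun t => k (of_cube t)).
  by apply: cts_comp => //; exact: of_cube_continuous.
pose kc : continuousType (cube R n) E := mkcts cko.
have kP t : cube_boundary t -> kc t = x.
  by move=> /boundary_of_cube t1; exact: (kg _ t1).1.
exists (exist _ kc kP).
have ct : continuous (fun z : cube R n * I => of_cube z.1).
  apply: cts_comp; first exact: of_cube_continuous.
  by apply: cts_fst; exact: cts_id.
have cs : continuous (fun z : cube R n * I => ival z.2).
  apply: cts_comp; first exact: ival_continuous.
  by apply: cts_snd; exact: cts_id.
have cH : continuous (fun z : cube R n * I =>
    h ((1 - ival z.2) *: r (of_cube z.1) + ival z.2 *: of_cube z.1)).
  apply: cts_comp => //; apply: ctsDv; apply: ctsZ => //; last exact: cts_comp.
  by apply: ctsB => //; exact: ctscst.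
exists (mkcts cH); split=> [t|t s bt] /=.
  change (h ((1 - 0) *: r (of_cube t) + 0 *: of_cube t) = q (k (of_cube t)) /\
    h ((1 - 1) *: r (of_cube t) + 1 *: of_cube t) = sval c t).
  rewrite subr0 scale1r scale0r addr0 subrr scale1r scale0r add0r.
  by rewrite qk ?norm_of_cube // /h of_cubeK.
have n1 := boundary_of_cube bt.
change (h ((1 - ival s) *: r (of_cube t) + ival s *: of_cube t) = q x).
rewrite (kg _ n1).2 -scalerDl subrK scale1r /h of_cubeK.
exact: (proj2_sig c).
Qed.

Lemma wlp_weak_homotopy_equivalence : weak_homotopy_equivalence R q.
Proof.
split; last by move=> n x _; split; [exact: wlp_pi_inj|exact: wlp_pi_surj].
split=> [x x' [c [c0 c1]]|y]; last first.
  have [x xy] := lq.1 y; exists x; rewrite xy.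
  by exists (mkcts (@ctscst _ _ y)).
(* A path is a homotopy between 0-cubes, whose boundary is empty, so injectivity on path components
   is the case [n = 0] of [wlp_pi_inj]. *)
have no_bnd (t : cube R 0) : ~ cube_boundary t by move=> [[]].
pose cst_cube y : continuousType (cube R 0) E := mkcts (@ctscst _ _ y).
have cst_cubeP y t : cube_boundary t -> cst_cube y t = y by [].
pose a : based_cube R 0 x := exist _ (cst_cube x) (cst_cubeP x).
have bP t : cube_boundary t -> cst_cube x' t = x by move=> /no_bnd.
pose b : based_cube R 0 x := exist _ (cst_cube x') bP.
have cH : continuous (fun z : cube R 0 * I => c z.2).
  by apply: cts_comp; [exact: cts_fun|apply: cts_snd; exact: cts_id].
have [|K [K01 _]] := @wlp_pi_inj 0 x a b.
  by exists (mkcts cH); split=> // t s /no_bnd.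
pose t0 : cube R 0 := fun i => itv0 R.
have cK : continuous (fun s : I => K (t0, s)).
  apply: cts_comp; first exact: cts_fun.
  by apply: cts_pair; [exact: ctscst|exact: cts_id].
by exists (mkcts cK); split; case: (K01 t0).
Qed.

End WlpWeakEquivalence.
End Lifting.

Ltac cts_step := match goal with
  | H : forall x, continuous_at x ?f |- forall x, continuous_at x ?f => exact: H
  | |- forall x, continuous_at x (fun y => y) => exact: cts_id
  | |- forall x, continuous_at x (fun _ => ?a) => exact: ctscst
  | |- forall x, continuous_at x (@fst _ _) => exact: (cts_fst (@cts_id _))
  | |- forall x, continuous_at x (@snd _ _) => exact: (cts_snd (@cts_id _))
  | |- forall x, continuous_at x (@Num.norm _ _) => exact: (cts_norm (@cts_id _))
  | |- forall x, continuous_at x (GRing.scale ?a) =>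
    exact: (ctsZ (@ctscst _ _ a) (@cts_id _))
  | |- forall x, continuous_at x (@rc _ _) => exact: rc_continuous
  | |- forall x, continuous_at x (@vhd _ _) => exact: (cts_vhd (@cts_id _))
  | |- forall x, continuous_at x (@vtl _ _) => exact: (cts_vtl (@cts_id _))
  | |- forall x, continuous_at x (fun y => (@?a y, @?b y)) => apply: cts_pair
  | |- forall x, continuous_at x (fun y => fst (@?a y)) => apply: cts_fst
  | |- forall x, continuous_at x (fun y => snd (@?a y)) => apply: cts_snd
  | |- forall x, continuous_at x (fun y => GRing.add (@?a y) (@?b y)) => apply: ctsDv
  | |- forall x, continuous_at x (fun y => GRing.opp (@?a y)) => apply: ctsNv
  | |- forall x, continuous_at x (fun y => GRing.mul (@?a y) (@?b y)) => apply: ctsM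
  | |- forall x, continuous_at x (fun y => GRing.scale (@?a y) (@?b y)) => apply: ctsZ
  | |- forall x, continuous_at x (fun y => Order.max (@?a y) (@?b y)) => apply: ctsmax
  | |- forall x, continuous_at x (fun y => Order.min (@?a y) (@?b y)) => apply: ctsmin
  | |- forall x, continuous_at x (fun y => Num.norm (@?a y)) => apply: cts_norm
  | |- forall x, continuous_at x (fun y => rc (@?a y)) => apply: cts_rc
  | |- forall x, continuous_at x (fun y => vhd (@?a y)) => apply: cts_vhd
  | |- forall x, continuous_at x (fun y => vtl (@?a y)) => apply: cts_vtl
  | |- forall x, continuous_at x (fun y => vcons (@?a y) (@?b y)) => apply: cts_vcons
  | H : forall x, continuous_at x ?f |- forall x, continuous_at x (fun y => ?f (@?g y)) =>
    apply: (@cts_comp _ _ _ g f H)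
  end.
Ltac cts := repeat cts_step.

Ltac minmax := repeat
  match goal with
  | |- context [Order.max ?a ?b] => case: (leP a b)
  | |- context [Order.min ?a ?b] => case: (leP a b)
  end; move=> *; lra.

Section Collar.
Variables (R : realType) (n : nat).
Local Notation V := 'rV[R]_n.

(* [l] on the concentric ball of radius 1/2, and the homotopy [K] from the
   sphere of radius 1 to the sphere of radius 1/2. *)
Definition collar (X : Type) (l : V -> X) (K : V -> R -> X) (x : V) : X :=
  if 2 * `|x| <= 1 then l (2 *: x) else K (dir x) (Num.max 0 (2 - 2 * `|x|)).

Definition shell : set (V * R) := [set q | `|q.1| = 1 /\ 0 <= q.2 <= 1].

Lemma collar_continuous (T X : topologicalType) (x : T -> V) (l : T -> V -> X)
    (K : T -> V -> R -> X) : continuous x ->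
  continuous (fun q : T * V => l q.1 q.2) ->
  cont_on [set q : T * (V * R) | shell q.2] (fun q => K q.1 q.2.1 q.2.2) ->
  (forall t u, `|u| = 1 -> K t u 1 = l t u) ->
  continuous (fun t => collar (l t) (K t) (x t)).
Proof.
move=> cx cl cK Kl; apply: cts_if.
- by cts.
- by cts.
- apply: continuous_cont_on.
  apply: (@cts_comp _ _ _ (fun t => (t, 2 *: x t)) (fun q => l q.1 q.2)) => //.
  by cts.
- apply: (@cont_on_comp _ _ _ _ [set q : T * (V * R) | shell q.2]
    (fun t => (t, (dir (x t), Num.max 0 (2 - 2 * `|x t|))))
    (fun q => K q.1 q.2.1 q.2.2)) => //.
    apply: cont_on_pair; first by apply: continuous_cont_on; cts.
    apply: cont_on_pair; last by apply: continuous_cont_on; cts.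
    apply: (@cont_on_comp _ _ _ _ [set y : V | y != 0] x (@dir R n)).
    + exact: continuous_cont_on.
    + exact: dir_cont_on.
    + by move=> t /= t1; rewrite -normr_eq0; apply/eqP => t0; move: t1; rewrite t0; lra.
  move=> t /= t1; have x0 : x t != 0.
    by rewrite -normr_eq0; apply/eqP => t0; move: t1; rewrite t0; lra.
  split=> /=; first exact: norm_dir.
  by apply/andP; split; minmax.
- move=> t t1; have -> : Num.max 0 (2 - 2 * `|x t|) = 1 by rewrite t1; minmax.
  have n2 : `|2 *: x t| = 1 by rewrite normrZ ger0_norm.
  have {1}<- : dir (2 *: x t) = dir (x t) by exact: dirZ.
  by rewrite (dir_sphere n2) Kl.
Qed.

Lemma collar_sphere (X : Type) (l : V -> X) (K : V -> R -> X) (u : V) :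
  `|u| = 1 -> collar l K u = K u 0.
Proof.
move=> u1; rewrite /collar u1 ifF; last by apply/negbTE; rewrite -ltNge; lra.
by rewrite dir_sphere //; congr (K _ _); minmax.
Qed.

Lemma collar_outside (X : Type) (l : V -> X) (K : V -> R -> X) (x : V) :
  1 <= `|x| -> collar l K x = K (dir x) 0.
Proof.
move=> x1; rewrite /collar ifF; last by apply/negbTE; rewrite -ltNge; lra.
by congr (K _ _); minmax.
Qed.

Lemma collarE (X Y : Type) (f : X -> Y) (l : V -> X) (K : V -> R -> X) (x : V) :
  f (collar l K x) = collar (fun z => f (l z)) (fun u s => f (K u s)) x.
Proof. by rewrite /collar; case: ifP. Qed.

Lemma eq_collar (X : Type) (l l' : V -> X) (K K' : V -> R -> X) (x : V) :
  (forall z, 2 * `|x| <= 1 -> `|z| <= 1 -> l z = l' z) ->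
  (forall u s, `|u| = 1 -> 0 <= s <= 1 -> K u s = K' u s) ->
  collar l K x = collar l' K' x.
Proof.
move=> ll KK; rewrite /collar; case: leP => x1.
  by apply: ll => //; rewrite normrZ ger0_norm.
apply: KK; last by apply/andP; split; minmax.
by apply: norm_dir; rewrite -normr_eq0; apply/eqP => x0; move: x1; rewrite x0; lra.
Qed.

Definition extend (T : topologicalType) (X : Type) (A : set T) (x0 : X)
  (f : set_type A -> X) (t : T) : X :=
  if pselect (A t) is left At then f (to_set At) else x0.

Lemma extendE (T : topologicalType) (X : Type) (A : set T) (x0 : X)
  (f : set_type A -> X) (t : T) (At : A t) : extend x0 f t = f (to_set At).
Proof.
rewrite /extend; case: pselect => // At'.
by congr f; apply: val_inj.
Qed.

Lemma extend_cont_on (T X : topologicalType) (A : set T) (x0 : X)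
  (f : set_type A -> X) : continuous f -> cont_on A (extend x0 f).
Proof.
move=> cf; apply: set_type_cont_on.
have -> : (fun t : set_type A => extend x0 f (set_val t)) = f.
  apply/funext => t; rewrite (extendE x0 f (set_valP t)); congr f.
  exact: val_inj.
exact: cf.
Qed.

End Collar.

Section RelativeHomotopy.
Variables (R : realType) (n : nat).
Local Notation V := 'rV[R]_n.

Definition hmt_rel (X : topologicalType) (f g : V -> X) :=
  exists H : V * R -> X, [/\ continuous H, forall x, H (x, 0) = f x,
    forall x, H (x, 1) = g x & forall u s, `|u| = 1 -> H (u, s) = f u].

Lemma hmt_rel_trans (X : topologicalType) (f g h : V -> X) :
  hmt_rel f g -> hmt_rel g h -> hmt_rel f h.
Proof.
move=> [H [cH H0 H1 Hs]] [K [cK K0 K1 Ks]].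
exists (fun p => if p.2 <= 2^-1 then H (p.1, 2 * p.2) else K (p.1, 2 * p.2 - 1)).
split.
- apply: cts_if; try by cts.
  + by apply: continuous_cont_on; cts.
  + by apply: continuous_cont_on; cts.
  + by move=> x ->; rewrite mulfV ?pnatr_eq0 // subrr H1 K0.
- by move=> x /=; rewrite invr_ge0 ler0n mulr0 H0.
- move=> x /=; rewrite ifF ?mulr1; last by apply/negbTE; rewrite -ltNge; lra.
  by rewrite -K1; congr (K (_, _)); lra.
- move=> u s u1 /=; case: ifP => _; first exact: Hs.
  by rewrite Ks // -H1 Hs.
Qed.

End RelativeHomotopy.

(** * Compression of balls along a weak homotopy equivalence *)

Section BallHomotopyGroups.
Variables (R : realType) (Y Z : topologicalType) (w : continuousType Y Z).
Hypothesis Ww : weak_homotopy_equivalence R w.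
Local Notation V n := 'rV[R]_n.

Definition based n (X : topologicalType) (x0 : X) (a : V n -> X) :=
  continuous a /\ forall x, 1 <= `|x| -> a x = x0.

Definition hmt_based n (X : topologicalType) (x0 : X) (a b : V n -> X) :=
  exists H : V n * R -> X, [/\ continuous H, forall x, H (x, 0) = a x,
    forall x, H (x, 1) = b x & forall x s, 1 <= `|x| -> H (x, s) = x0].

Let cw : continuous w. Proof. exact: cts_fun. Qed.

Lemma norm_rV0 (x : V 0) : `|x| = 0.
Proof. by rewrite (thinmx0 x) normr0. Qed.

Lemma cube_of_continuous n (X : topologicalType) (x0 : X) (a : V n -> X) :
  based x0 a -> continuous (fun t : cube R n => a (of_cube t)).
Proof. by move=> [ca _]; apply: cts_comp => //; exact: of_cube_continuous. Qed.

Lemma cube_of_boundary n (X : topologicalType) (x0 : X) (a : V n -> X)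
    (ba : based x0 a) (t : cube R n) : cube_boundary t ->
  (mkcts (cube_of_continuous ba) : continuousType (cube R n) X) t = x0.
Proof.
by move=> /boundary_of_cube t1; case: ba => ca; apply; rewrite t1.
Qed.

Definition cube_of n (X : topologicalType) (x0 : X) (a : V n -> X)
    (ba : based x0 a) : based_cube R n x0 := exist _ _ (cube_of_boundary ba).

Lemma hmt_based_of_cube n (X : topologicalType) (x0 : X) (a b : V n -> X)
  (ba : based x0 a) (bb : based x0 b) :
  homotopic_rel (cube_of ba) (cube_of bb) -> hmt_based x0 a b.
Proof.
move=> [H [H01 Hb]]; exists (fun q => H (to_cube q.1, clamp q.2)).
have cH : continuous H by exact: cts_fun.
have e (c : V n -> X) (x : V n) : based x0 c -> c (of_cube (to_cube x)) = c x.
  move=> [_ c0]; have [x1|/ltW x1] := leP `|x| 1; first by rewrite to_cubeK.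
  by rewrite !c0 //; have := boundary_of_cube (boundary_to_cube x1) => ->.
split.
- apply: cts_comp => //; apply: cts_pair.
    by apply: (cts_comp (@to_cube_continuous R _)); cts.
  by apply: (cts_comp (@clamp_continuous R)); cts.
- by move=> x /=; rewrite clamp0 (H01 _).1; exact: (e _ _ ba).
- by move=> x /=; rewrite clamp1 (H01 _).2; exact: (e _ _ bb).
- by move=> x s x1; apply: Hb; exact: boundary_to_cube.
Qed.

Lemma weak_equivalence_inj n (y0 : Y) (a : V n -> Y) : based y0 a ->
  hmt_based (w y0) (w \o a) (fun=> w y0) -> hmt_based y0 a (fun=> y0).
Proof.
case: n a => [|n] a ba [H [cH H0 H1 Hb]].
  (* Dimension 0 comes from path components, as weak homotopy equivalences constrain [pi_bijective]
     only for positive [n]. *)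
  have [] : joined R (a 0) y0.
    case: Ww => [[inj _] _]; apply: inj.
    have c : continuous (fun s : itv R => H (0, ival s)).
      by apply: cts_comp => //; apply: cts_pair; [exact: ctscst|exact: ival_continuous].
    exists (mkcts c); split; [exact: H0|exact: H1].
  move=> d [d0 d1]; exists (fun q => d (clamp q.2)); split.
  - apply: cts_comp; first exact: cts_fun.
    by apply: (cts_comp (@clamp_continuous R)); cts.
  - by move=> x /=; rewrite clamp0 d0 (thinmx0 x).
  - by move=> x /=; rewrite clamp1 d1.
  - by move=> x s; rewrite norm_rV0 ler10.
have bc : based y0 (fun _ : V n.+1 => y0) by split=> //; exact: ctscst.
apply: (hmt_based_of_cube (ba := ba) (bb := bc)).
case: Ww => _ /(_ n.+1 y0 isT)[inj _]; apply: inj.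
have cK : continuous (fun q : cube R n.+1 * itv R => H (of_cube q.1, ival q.2)).
  apply: cts_comp => //; apply: cts_pair.
    by apply: (cts_comp (@of_cube_continuous R _)); cts.
  by apply: (cts_comp (@ival_continuous R)); cts.
exists (mkcts cK); split=> [t|t s /boundary_of_cube t1].
  by split; [exact: H0|exact: H1].
by apply: Hb; rewrite t1.
Qed.

Lemma weak_equivalence_surj n (y0 : Y) (c : V n.+1 -> Z) : based (w y0) c ->
  exists a : V n.+1 -> Y, based y0 a /\ hmt_based (w y0) (w \o a) c.
Proof.
move=> bc; case: Ww => _ /(_ n.+1 y0 isT)[_ surj].
have [[a aP] ah] := surj (cube_of bc).
have ba : based y0 (fun x => a (to_cube x)).
  split; first by apply: cts_comp; [exact: cts_fun|exact: to_cube_continuous].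
  by move=> x x1; apply: (aP); exact: boundary_to_cube.
have bwa : based (w y0) (w \o (fun x => a (to_cube x))).
  case: ba => ca a0; split; first exact: cts_comp.
  by move=> x x1 /=; rewrite a0.
exists (fun x => a (to_cube x)); split=> //.
apply: (hmt_based_of_cube (ba := bwa) (bb := bc)).
move: ah => [H [H01 Hb]]; exists H; split=> // t.
split; last by case: (H01 t).
by case: (H01 t) => -> _; congr (w (a _)); rewrite of_cubeK.
Qed.

End BallHomotopyGroups.

Section Latitude.
Variables (R : realType) (n : nat).
Local Notation V := 'rV[R]_n.

(* The points of the sphere in R x R^n at latitude [l], running from the north
   pole ([l] = 0) to the south pole ([l] >= 1): the top face is [l] <= 1/3 and
   the bottom face is [l] >= 2/3. *)
Definition lat_rad (l : R) : R := Num.max 0 (Num.min 1 (Num.min (3 * l) (3 - 3 * l))).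
Definition lat_hd (l : R) : R := Num.max (-1) (Num.min 1 (3 - 6 * l)).
Definition lat_pt (l : R) (y : V) : 'rV[R]_n.+1 :=
  vcons (lat_hd l) ((lat_rad l / `|y|) *: y).

Lemma lat_pt_continuous (T : topologicalType) (l : T -> R) (y : T -> V) :
  continuous l -> continuous y -> (forall t, lat_rad (l t) <= 3 * `|y t|) ->
  continuous (fun t => lat_pt (l t) (y t)).
Proof.
move=> cl cy ly; apply: cts_vcons; first by rewrite /lat_hd; cts.
have cr : continuous (fun t => lat_rad (l t)) by rewrite /lat_rad; cts.
apply: (@cts_squeeze _ _ _ _ (fun t => `|y t|) 3); first by cts.
  move=> t; rewrite normrZ normr_id normrM normfV normr_id.
  have r0 : 0 <= lat_rad (l t) by rewrite /lat_rad le_max lexx.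
  rewrite (ger0_norm r0); have [->|y0] := eqVneq (y t) 0.
    by rewrite normr0 !mulr0.
  by rewrite divfK ?normr_eq0.
apply: set_type_cont_on; apply: ctsZ; last first.
  by apply: cts_comp => //; exact: set_val_continuous.
apply: ctsM; first by apply: (cts_comp cr); exact: set_val_continuous.
apply: ctsV; last by move=> t; exact: (set_valP t).
by apply: cts_norm; apply: (cts_comp cy); exact: set_val_continuous.
Qed.

Lemma lat_pt_norm (l : R) (y : V) : 0 <= l ->
  (y = 0 -> l = 0 \/ 1 <= l) -> `|lat_pt l y| = 1.
Proof.
move=> l0 yl; rewrite norm_vcons normrZ normrM normfV normr_id.
have r0 : 0 <= lat_rad l by rewrite /lat_rad le_max lexx.
rewrite (ger0_norm r0); have [y0|y0] := eqVneq y 0.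
  rewrite y0 normr0 mulr0; case: (yl y0) => [->|l1].
    rewrite (_ : lat_hd 0 = 1) ?normr1 ?max_l //; rewrite /lat_hd; minmax.
  rewrite (_ : lat_hd l = -1) ?normrN ?normr1 ?max_l //; rewrite /lat_hd; minmax.
rewrite divfK ?normr_eq0 //.
have [hd1|[hd1|[rad1 hd1]]] : lat_hd l = 1 \/ lat_hd l = -1 \/
    (lat_rad l = 1 /\ -1 <= lat_hd l <= 1).
  rewrite /lat_hd /lat_rad.
  have [l1|l1] := leP (3 * l) 1; first by left; minmax.
  have [l2|l2] := leP (3 - 3 * l) 1; first by right; left; minmax.
  right; right; split; first by minmax.
  by apply/andP; split; minmax.
- by rewrite hd1 normr1 max_l // /lat_rad; minmax.
- by rewrite hd1 normrN normr1 max_l // /lat_rad; minmax.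
- by rewrite rad1 max_r // ler_norml.
Qed.

Lemma lat_pt_south (l : R) (y : V) : 1 <= l -> lat_pt l y = vcons (-1) 0.
Proof.
move=> l1; rewrite /lat_pt (_ : lat_hd l = -1); last by rewrite /lat_hd; minmax.
rewrite (_ : lat_rad l = 0) ?mul0r ?scale0r //; rewrite /lat_rad; minmax.
Qed.

(** One polynomial for the three kinds of faces: with [r] the norm of the tail it equals [r / 3] on
    the top face, [1 - r / 3] on the bottom face and [(3 - vhd u) / 6] on the side. *)
Definition lat (u : 'rV[R]_n.+1) : R := (3 - vhd u) / 6 + vhd u * (`|vtl u| - 1) / 3.

Lemma sphere_cases (u : 'rV[R]_n.+1) : `|u| = 1 ->
  [\/ vhd u = 1 /\ `|vtl u| <= 1, vhd u = -1 /\ `|vtl u| <= 1 |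
      `|vtl u| = 1 /\ -1 <= vhd u <= 1].
Proof.
rewrite norm_vconsE; case: (leP `|vhd u| `|vtl u|) => [h1 t1|t1 h1].
  by apply: Or33; split=> //; rewrite -ler_norml (le_trans h1) // t1.
have tl1 : `|vtl u| <= 1 by rewrite -h1 ltW.
move: h1 => /eqP; rewrite eqr_norml ler01 andbT => /orP[]/eqP ->.
  exact: Or31.
exact: Or32.
Qed.

Lemma lat_ptK (u : 'rV[R]_n.+1) : `|u| = 1 -> lat_pt (lat u) (vtl u) = u.
Proof.
move=> u1; rewrite -[RHS]vcons_eta /lat_pt.
have sc (r : R) : r = `|vtl u| -> (r / `|vtl u|) *: vtl u = vtl u.
  move=> ->; have [->|y0] := eqVneq (vtl u) 0; first by rewrite scaler0.
  by rewrite divff ?normr_eq0 // scale1r.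
have t0 := normr_ge0 (vtl u).
case: (sphere_cases u1) => [[h1 t1]|[h1 t1]|[t1 /andP[h1 h2]]];
  rewrite sc; do ?congr vcons; rewrite /lat_hd /lat_rad /lat ?h1 ?t1; minmax.
Qed.

End Latitude.

Section Compression.
Variables (R : realType) (Y Z : topologicalType) (w : continuousType Y Z).
Hypothesis Ww : weak_homotopy_equivalence R w.
Local Notation V n := 'rV[R]_n.
Local Notation sph n := (@unit_sphere R n).

Let cw : continuous w. Proof. exact: cts_fun. Qed.

(** At [tau = 1] latitudes are tripled: the top face, [l <= 1/3], is spread over the whole sphere
    and all the rest is sent to the south pole. *)
Definition turn (tau l : R) : R := Num.min 1 ((1 + 2 * tau) * l).

Lemma turn_bounds (tau l : R) : 0 <= tau <= 1 -> 0 <= l ->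
  l <= (1 + 2 * tau) * l <= 3 * l.
Proof. by move=> /andP[t0 t1] l0; apply/andP; split; nra. Qed.

Lemma lat_bounds n (u : V n.+1) : `|u| = 1 -> 0 <= lat u <= 1.
Proof.
have t0 := normr_ge0 (vtl u).
by move=> /sphere_cases[[h1 t1]|[h1 t1]|[t1 /andP[h1 h2]]];
  rewrite /lat ?h1 ?t1; lra.
Qed.

Lemma turn_lat_rad n (u : V n.+1) (tau : R) : `|u| = 1 -> 0 <= tau <= 1 ->
  lat_rad (turn tau (lat u)) <= 3 * `|vtl u|.
Proof.
move=> u1 tau01; have /andP[l0 l1] := lat_bounds u1.
have := turn_bounds tau01 l0; rewrite /turn; move: ((1 + 2 * tau) * lat u) => m.
have t0 := normr_ge0 (vtl u); rewrite /lat_rad => /andP[].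
move: l0 l1; rewrite /lat; case: (sphere_cases u1) => [[-> t1]|[-> t1]|[-> ?]];
  minmax.
Qed.

Lemma turn_sphere n (u : V n.+1) (tau : R) : `|u| = 1 -> 0 <= tau <= 1 ->
  `|lat_pt (turn tau (lat u)) (vtl u)| = 1.
Proof.
move=> u1 tau01; have /andP[l0 l1] := lat_bounds u1.
have /andP[] := turn_bounds tau01 l0; rewrite /turn => m1 m2.
apply: lat_pt_norm => [|v0]; first by move: m1 m2; minmax.
move: l0 l1 m1 m2; move: (1 + 2 * tau) => c; rewrite /lat.
case: (sphere_cases u1) => [[-> _]|[-> _]|[]]; rewrite v0 normr0; last by lra.
  by move=> *; left; rewrite (_ : (3 - 1) / 6 + 1 * (0 - 1) / 3 = 0) ?mulr0; minmax.
by move=> *; right; minmax.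
Qed.

Lemma cont_onT (T X : topologicalType) (A : set T) (f : T -> X) :
  (forall t, A t) -> cont_on A f -> continuous f.
Proof. by move=> AT cf; apply/continuous_openP; apply: cont_onS cf => t _; exact: AT. Qed.

(* Precomposing with the rotation [turn], which is homotopic to the identity,
   moves the sphere onto the top face and collapses the other faces to the
   south pole, so that a null homotopy relative to the boundary of the top
   face extends the map to the ball. *)
Lemma sphere_extension n (g : V n.+1 -> Y) (h : V n.+1 -> Z) :
  cont_on (sph n.+1) g -> continuous h -> (forall u, `|u| = 1 -> w (g u) = h u) ->
  exists2 l : V n.+1 -> Y, continuous l & forall u, `|u| = 1 -> l u = g u.
Proof.
move=> cg ch gh; pose so : V n.+1 := vcons (-1) 0; pose y0 := g so.
have nso : `|so| = 1 by rewrite norm_vcons normrN normr1 normr0 max_l.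
(* [th] wraps the ball around the sphere with its boundary at the south pole; it is the fully turned
   top face. *)
pose th (x : V n) : V n.+1 := lat_pt `|x| x.
have cth : continuous th.
  apply: lat_pt_continuous; [cts|cts|move=> x].
  by have := normr_ge0 x; rewrite /lat_rad; minmax.
have th1 x : `|th x| = 1.
  by apply: lat_pt_norm => // ->; left; rewrite normr0.
have ca : continuous (fun x => g (th x)).
  apply: (@cont_onT _ _ setT) => //.
  apply: (@cont_on_comp _ _ _ _ (sph n.+1) th g) => //; last by move=> x _; exact: th1.
  exact: continuous_cont_on.
have ba : based y0 (fun x => g (th x)).
  by split=> // x x1; rewrite /th lat_pt_south.
have [|N [cN N0 N1 Nb]] := weak_equivalence_inj Ww ba.
  (* Since [h] is defined on the whole space, moving [th x] straight to the south pole gives a null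
     homotopy of [w \o g \o th]. *)
  exists (fun q => h ((1 - q.2) *: th q.1 + q.2 *: so)); split.
  - by cts.
  - by move=> x /=; rewrite subr0 scale1r scale0r addr0 gh.
  - by move=> x /=; rewrite subrr scale1r scale0r add0r gh.
  - move=> x s x1 /=; rewrite /th lat_pt_south // -/so -scalerDl subrK scale1r.
    by rewrite gh.
pose K u tau : Y := g (lat_pt (turn tau (lat u)) (vtl u)).
(* On the prism [N] runs from the top face to the constant bottom face. On its boundary this is the
   map turned by [tau = 1], which the collar [K] joins to [g]. *)
pose l1 (y : V n.+1) : Y := N (vtl y, (1 - vhd y) / 2).
have cl1 : continuous l1 by rewrite /l1; cts.
exists (collar l1 K).
- apply: (@collar_continuous _ _ _ _ (fun x => x) (fun=> l1) (fun=> K)).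
  + exact: cts_id.
  + by cts.
  + apply: (@cont_on_comp _ _ _ _ (sph n.+1)
      (fun q : V n.+1 * (V n.+1 * R) => lat_pt (turn q.2.2 (lat q.2.1)) (vtl q.2.1)) g) => //.
      apply: set_type_cont_on.
      set A := [set q : V n.+1 * (V n.+1 * R) | shell q.2].
      have cv : continuous (@set_val _ A) by exact: set_val_continuous.
      apply: (@lat_pt_continuous _ _ _ (fun q : set_type A =>
        turn (set_val q).2.2 (lat (set_val q).2.1)) (fun q => vtl (set_val q).2.1)).
      * by rewrite /turn /lat; cts.
      * by cts.
      * by move=> q; have [q1 q2] := set_valP q; exact: turn_lat_rad.
    by move=> q [q1 q2]; exact: turn_sphere.
  + move=> _ u u1; rewrite /K /l1 /turn.
    have t0 := normr_ge0 (vtl u).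
    case: (sphere_cases u1) => [[h1 t1]|[h1 t1]|[t1 /andP[h1 h2]]].
    * rewrite h1 subrr mul0r N0; congr (g (lat_pt _ _)).
      by rewrite /lat h1; minmax.
    * rewrite h1 (_ : (1 - -1) / 2 = 1) ?N1; last by lra.
      rewrite lat_pt_south // /lat h1; minmax.
    * rewrite Nb ?t1 // lat_pt_south // /lat t1; minmax.
- move=> u u1; rewrite collar_sphere // /K; congr g.
  have /andP[l0 l1'] := lat_bounds u1.
  by rewrite (_ : turn 0 (lat u) = lat u) ?lat_ptK // /turn; minmax.
Qed.

(* Changing the extension given by [sphere_extension] by the difference of its
   image and [h] in the n-th homotopy group. *)
Lemma compression n (g : V n -> Y) (h : V n -> Z) :
  cont_on (sph n) g -> continuous h -> (forall u, `|u| = 1 -> w (g u) = h u) ->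
  exists l : V n -> Y, [/\ continuous l, forall u, `|u| = 1 -> l u = g u &
    hmt_rel (fun x => w (l x)) (fun x => h (rc x))].
Proof.
case: n g h => [|n] g h cg ch gh.
  have [y [c [c0 c1]]] : exists y, joined R (w y) (h 0).
    by case: Ww => [[_ surj] _]; exact: surj.
  have sph0 (u : V 0) : `|u| != 1 by rewrite norm_rV0 eq_sym oner_eq0.
  exists (fun=> y); split; [exact: ctscst|by move=> u /eqP; rewrite (negbTE (sph0 u))|].
  exists (fun q => c (clamp q.2)); split.
  - apply: cts_comp; first exact: cts_fun.
    by apply: (cts_comp (@clamp_continuous R)); cts.
  - by move=> x /=; rewrite clamp0.
  - by move=> x /=; rewrite clamp1 c1 (thinmx0 (rc x)).
  - by move=> u s /eqP; rewrite (negbTE (sph0 u)).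
have [l0 cl0 l0g] := sphere_extension cg ch gh.
pose y0 := l0 0.
(* [d 0] is the difference of [h] and [w \o l0]: [h] on the inner ball, then [w \o l0] run inwards
   along the rays, ending at the constant [w y0]. Larger [tau] stop the run at radius [tau], and
   [d 1] is [h] followed by a constant collar. *)
pose d tau := collar h (fun u s => w (l0 (Num.max s tau *: u))).
have wl u : `|u| = 1 -> w (l0 u) = h u by move=> u1; rewrite l0g ?gh.
have cd : continuous (fun q : R * V n.+1 => d (Num.min 1 q.1) q.2).
  apply: (@collar_continuous _ _ _ _ (fun q : R * V n.+1 => q.2) (fun=> h)
    (fun q u s => w (l0 (Num.max s (Num.min 1 q.1) *: u)))); [by cts|by cts| |].
    by apply: continuous_cont_on; cts.
  move=> q u u1; rewrite -wl //; congr (w (l0 _)).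
  by rewrite -[RHS]scale1r; congr (_ *: _); minmax.
have bd : based (w y0) (d 0).
  split.
    have -> : d 0 = (fun x => d (Num.min 1 0) x).
      by apply/funext => x; congr (d _ x); minmax.
    exact: (@cts_comp _ _ _ (fun x : V n.+1 => (0 : R, x)) _ cd (cts_pair (@ctscst _ _ 0) (@cts_id _))).
  by move=> x x1; rewrite /d collar_outside // maxxx scale0r.
have [a [[ca a0] [H [cH H0 H1 Hb]]]] := weak_equivalence_surj Ww bd.
(* [a] realizes the difference in [Y]; the collar runs [l0] outwards from [y0], so that [l] ends at
   [g]. *)
pose l := collar a (fun u s => l0 ((1 - s) *: u)).
have cl : continuous l.
  apply: (@collar_continuous _ _ _ _ (fun x => x) (fun=> a)
    (fun _ u s => l0 ((1 - s) *: u))); [by cts|by cts| |].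
    by apply: continuous_cont_on; cts.
  by move=> _ u u1; rewrite subrr scale0r a0 ?u1.
exists l; split=> // [u u1|].
  by rewrite /l collar_sphere // subr0 scale1r l0g.
(* Both runs along [l0], inwards in [d] and outwards in the new collar, are cut at radius [tau]. At
   [tau = 1] both are constant along rays, and [f 1] is [h] squeezed into the ball of radius 1/4,
   whence the factor 4 in [rr]. *)
pose f tau := collar (d (Num.min 1 tau))
  (fun u s => w (l0 (Num.max (1 - s) (Num.min 1 tau) *: u))).
have f0 u tau : `|u| = 1 -> f tau u = h u.
  move=> u1; rewrite /f collar_sphere // -wl //; congr (w (l0 _)).
  by rewrite -[RHS]scale1r; congr (_ *: _); minmax.
have wlu u : `|u| = 1 -> w (l u) = h u.
  by move=> u1; rewrite /l collar_sphere // subr0 scale1r wl.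
apply: (@hmt_rel_trans _ _ _ _ (f 0)).
  exists (fun q => collar (fun z => H (z, q.2)) (fun u s => w (l0 ((1 - s) *: u))) q.1).
  split.
  - apply: (@collar_continuous _ _ _ _ (fun q : V n.+1 * R => q.1)
      (fun q z => H (z, q.2)) (fun _ u s => w (l0 ((1 - s) *: u)))); [by cts|by cts| |].
      by apply: continuous_cont_on; cts.
    by move=> q u u1; rewrite subrr scale0r Hb ?u1.
  - move=> x; rewrite /l (collarE w) /=; apply: eq_collar => [z _ _|u s _ _].
      exact: H0.
    by [].
  - move=> x; apply: eq_collar => [z _ _|u s u1 /andP[s0 s1]].
      by rewrite H1; congr (d _ z); minmax.
    by congr (w (l0 (_ *: u))); minmax.
  - by move=> u s u1; rewrite wlu // collar_sphere // subr0 scale1r wl.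
apply: (@hmt_rel_trans _ _ _ _ (f 1)).
  exists (fun q => f q.2 q.1); split=> //; last by move=> u s u1; rewrite !f0.
  apply: (@collar_continuous _ _ _ _ (fun q : V n.+1 * R => q.1)
    (fun q => d (Num.min 1 q.2))
    (fun q u s => w (l0 (Num.max (1 - s) (Num.min 1 q.2) *: u)))); [by cts| | |].
  - by apply: (@cts_comp _ _ _ (fun q : V n.+1 * R * V n.+1 => (q.1.2, q.2)) _ cd); cts.
  - by apply: continuous_cont_on; cts.
  - move=> q u u1; rewrite /d collar_sphere //; congr (w (l0 (_ *: u))); minmax.
have rr (x : V n.+1) : f 1 x = h (rc (4 *: x)).
  have n0 (c : R) : 0 <= c -> `|c *: x| = c * `|x| by move=> c0; rewrite normrZ ger0_norm.
  rewrite /f /d minxx /collar; case: leP => x1; last first.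
    rewrite max_r; last by minmax.
    rewrite scale1r wl ?norm_dir //; last first.
      by rewrite -normr_eq0; apply/eqP => x0; move: x1; rewrite x0; lra.
    rewrite -(@dirZ _ _ x 4) // rc_dir // n0 //; lra.
  rewrite n0 //; case: leP => x2.
    rewrite scalerA rc_id; last by rewrite n0 //; lra.
    by congr (h (_ *: _)); lra.
  rewrite max_r; last by minmax.
  have d2 : `|dir (2 *: x)| = 1.
    by apply: norm_dir; rewrite -normr_eq0 n0 //; apply/eqP => x0; lra.
  rewrite scale1r wl // dirZ // -(@dirZ _ _ x 4) // rc_dir // n0 //; lra.
exists (fun q => h (rc (Num.max 1 (4 - 3 * q.2) *: q.1))); split.
- have crc := @rc_continuous R n.+1; by cts.
- by move=> x; rewrite rr /=; congr (h (rc (_ *: x))); minmax.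
- by move=> x /=; rewrite -[in RHS](scale1r x); congr (h (rc (_ *: x))); minmax.
- move=> u s u1; rewrite f0 //=; congr h.
  have m1 : 1 <= Num.max 1 (4 - 3 * s) by rewrite le_max lexx.
  rewrite rcZ ?u1 ?mulr1 ?rc_id ?u1 //; exact: lt_le_trans m1.
Qed.

End Compression.

(** * The path fibration of a weak homotopy equivalence *)

Section PathFibrationLifting.
Variables (R : realType) (Y Z : topologicalType) (w : continuousType Y Z).
Hypothesis Ww : weak_homotopy_equivalence R w.
Local Notation V n := 'rV[R]_n.
Local Notation sph n := (@unit_sphere R n).
Local Notation P := (hpb R w id).
Local Notation p := (@hpb2 R _ _ _ w id).

Let cw : continuous w. Proof. exact: cts_fun. Qed.
Let c1 : continuous (@hpb1 R _ _ _ w id). Proof. exact: hpb1_continuous. Qed.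
Let c2 : continuous p. Proof. exact: hpb2_continuous. Qed.
Let cp : continuous (@hpbp R _ _ _ w id). Proof. exact: hpbp_continuous. Qed.

(** A sphere in the fibre over [z] is a sphere in [Y] with paths in [Z] from its image to [z]. These
    paths glue to a map [h] of the ball, constant near the centre; [compression] then fills the
    sphere in [Y] and joins the filling to [h]. *)
Lemma path_fibre_extension n (z : Z) (g : V n -> P) (p0 : P) : cont_on (sph n) g ->
  (forall u, `|u| = 1 -> p (g u) = z) ->
  exists k : V n -> P, [/\ continuous k, forall u, `|u| = 1 -> k u = g u &
    forall x, p (k x) = z].
Proof.
move=> cg gz.
pose S := set_type (sph n).
have cgS : continuous (fun u : S => g (set_val u)) by exact: cont_on_set_type.
pose gam u s := hpbp (g u, s).
have cgam : cont_on (@shell R n) (fun q => gam q.1 q.2).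
  apply: (@cont_on_comp _ _ _ _ setT (fun q : V n * R => (g q.1, q.2))
    (@hpbp R _ _ _ w id)) => //; last exact: continuous_cont_on.
  apply: cont_on_pair; last by apply: continuous_cont_on; cts.
  apply: (@cont_on_comp _ _ _ _ (sph n) fst g) => //; last by move=> q [].
  by apply: continuous_cont_on; cts.
pose h := collar (fun=> z) gam.
have ch : continuous h.
  apply: (@collar_continuous _ _ _ _ (fun x => x) (fun _ _ => z) (fun=> gam)).
  - by cts.
  - by cts.
  - apply: (@cont_on_comp _ _ _ _ (@shell R n) snd (fun q => gam q.1 q.2)) => //.
    by apply: continuous_cont_on; cts.
  - by move=> _ u u1; rewrite /gam hpb_end gz.
have gh u : `|u| = 1 -> w (hpb1 (g u)) = h u.
  by move=> u1; rewrite /h collar_sphere // /gam hpb_start.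
have cg1 : cont_on (sph n) (fun u => hpb1 (g u)).
  by apply: (cont_on_comp cg (continuous_cont_on (A := setT) c1)).
have [l [cl lg [H [cH H0 H1 Hs]]]] := compression Ww cg1 ch gh.
(* First the homotopy from [w (l x)] to [h (rc x)], then the ray back to the centre, where [h] is
   [z]. *)
pose G (q : V n * R) := if q.2 <= 2^-1 then H (q.1, 2 * q.2)
  else h ((2 - 2 * q.2) *: rc q.1).
have cG : continuous G.
  apply: cts_if; try by cts.
  - by apply: continuous_cont_on; cts.
  - by apply: continuous_cont_on; cts.
  - move=> x ->; rewrite mulfV ?pnatr_eq0 // H1; congr h.
    by rewrite (_ : 2 - 1 = 1) ?scale1r //; lra.
have h0 x : 2 * `|x| <= 1 -> h x = z by move=> x1; rewrite /h /collar x1.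
have [||k0 [ck0 k01 k02 k0p]] := hpb_map (f := w) (g := id) cl (@ctscst _ _ z) cG.
- by move=> x; rewrite /G /= invr_ge0 ler0n mulr0 H0.
- move=> x; rewrite /G /= ifF; last by apply/negbTE; rewrite -ltNge; lra.
  by rewrite mulr1 subrr scale0r h0 // normr0 mulr0 ler01.
(* Over the sphere [G] is the path of [g] reparametrized by [4 * s - 2]: it waits until 1/2 and
   arrives at 3/4. [th] interpolates between this, at [tau = 1], and the identity, at [tau = 0]; the
   collar absorbs the difference. *)
pose th (q : S * R * R) := Num.max 0 (Num.min 1
  ((1 + 3 * Num.max 0 q.1.2) * q.2 - 2 * Num.max 0 q.1.2)).
have [|||||m [cm m1 m2 mp]] := @hpb_map _ _ _ _ w id (S * R)%type
  (fun q => hpb1 (g (set_val q.1))) (fun=> z)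
  (fun q => hpbp (g (set_val q.1.1), th q)).
- by apply: (cts_comp c1); apply: (cts_comp cgS); cts.
- exact: ctscst.
- apply: (cts_comp cp); apply: cts_pair; last by rewrite /th; cts.
  by apply: (cts_comp cgS); cts.
- move=> t; rewrite (_ : th (t, 0) = 0) ?hpb_start // /th /=; minmax.
- move=> t; rewrite (_ : th (t, 1) = 1) ?hpb_end ?gz //; first exact: (set_valP t.1).
  by rewrite /th /=; minmax.
pose K u tau := extend p0 (fun u' : S => m (u', tau)) u.
have KE (u : S) tau : K (set_val u) tau = m (u, tau).
  by rewrite /K (extendE _ _ (set_valP u)); congr (m (_, _)); exact: val_inj.
have dir1 (x : V n) : 1 < 2 * `|x| -> `|dir x| = 1.
  by move=> x1; apply: norm_dir; rewrite -normr_eq0; apply/eqP => x0; lra.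
have K1 u : `|u| = 1 -> K u 1 = k0 u.
  move=> u1; rewrite -[u]/(set_val (to_set (u1 : sph n u) : S)) KE.
  apply: hpb_eq => [||s s01]; rewrite ?m1 ?m2 ?mp ?k01 ?k02 ?k0p //= ?lg //.
  have /andP[s0 s1] := s01; rewrite /G /=; case: ifP => [s2|/negbT].
    rewrite Hs // lg // (_ : th _ = 0) ?hpb_start // /th /=; minmax.
  rewrite -ltNge => s2; rewrite rc_id ?u1 // /h /collar normrZ u1 mulr1.
  rewrite ger0_norm; last by lra.
  case: leP => s3.
    rewrite (_ : th _ = 1) ?hpb_end ?gz // /th /=; minmax.
  rewrite dirZ; last by lra.
  by rewrite dir_sphere // /gam; congr (hpbp (_, _)); rewrite /th /=; minmax.
exists (collar k0 K); split.
- apply: (@collar_continuous _ _ _ _ (fun x => x) (fun=> k0) (fun=> K)); [by cts|by cts| |].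
    apply: set_type_cont_on.
    set A := [set q : V n * (V n * R) | shell q.2].
    have cv : continuous (@set_val _ A) by exact: set_val_continuous.
    pose uS (q : set_type A) : S := to_set (set_valP q).1.
    have cu : continuous uS by apply: continuous_to_set; cts.
    have -> : (fun q : set_type A => K (set_val q).2.1 (set_val q).2.2) =
        (fun q => m (uS q, (set_val q).2.2)).
      by apply/funext => q; rewrite -KE.
    by cts.
  by move=> _ u u1; exact: K1.
- move=> u u1; rewrite collar_sphere // -{1}[u]/(set_val (to_set (u1 : sph n u) : S)) KE.
  apply: hpb_eq => [||s s01]; rewrite ?m1 ?m2 ?mp //= ?gz //.
  by have /andP[s0 s1] := s01; congr (hpbp (_, _)); rewrite /th /=; minmax.
- move=> x; rewrite /collar; case: leP => [x1|/dir1 d1]; first exact: k02.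
  by rewrite -[dir x]/(set_val (to_set (d1 : sph n (dir x)) : S)) KE m2.
Qed.

Lemma path_fibration_point (z : Z) : exists e : P, p e = z.
Proof.
case: Ww => [[_ /(_ z)[y [c [d0 d1]]]] _].
have [|||m [_ _ m2 _]] := @hpb_map _ _ _ _ w id (V 0) (fun=> y) (fun=> z)
  (fun q => c (clamp q.2)) (@ctscst _ _ y) (@ctscst _ _ z).
- by apply: cts_comp; [exact: cts_fun|apply: (cts_comp (@clamp_continuous R)); cts].
- by move=> t; rewrite /= clamp0.
- by move=> t; rewrite /= clamp1.
by exists (m 0).
Qed.

(** Transport [g] along the rays into the fibre over [h 0], extend it there by
    [path_fibre_extension], and restore [g] in a collar; the result lies over [h \o c]. A second use
    of homotopy lifting moves [c] to the identity. *)
Lemma path_fibration_rlp : rlp R p.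
Proof.
split=> [z|n g h cg ch gh]; first exact: path_fibration_point.
have hp : hlp R p by exact: hpb2_hlp.
pose S := set_type (sph n).
have cgS : continuous (fun u : S => g (set_val u)) by exact: cont_on_set_type.
have cvS : continuous (@set_val _ (sph n)) by exact: set_val_continuous.
have [p0 _] := path_fibration_point (h 0).
have [||K [cK K0 Kp]] := hp S (fun u => g (set_val u))
  (fun q => h ((1 - q.2) *: set_val q.1)) cgS.
- by cts.
- by move=> u /=; rewrite subr0 scale1r gh //; exact: (set_valP u).
pose g1 := extend p0 (fun u : S => K (u, 1)).
have [|u u1|k1 [ck1 k1g k1h]] := @path_fibre_extension n (h 0) g1 p0.
- by apply: extend_cont_on; cts.
- rewrite /g1 (extendE _ _ (u1 : sph n u)) Kp //=.
  by rewrite subrr scale0r.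
pose L u tau := extend p0 (fun u' : S => K (u', tau)) u.
have LE (u : S) tau : L (set_val u) tau = K (u, tau).
  by rewrite /L (extendE _ _ (set_valP u)); congr (K (_, _)); exact: val_inj.
pose k2 := collar k1 L.
have ck2 : continuous k2.
  apply: (@collar_continuous _ _ _ _ (fun x => x) (fun=> k1) (fun=> L)); [by cts|by cts| |].
    apply: set_type_cont_on.
    set A := [set q : V n * (V n * R) | shell q.2].
    have cv : continuous (@set_val _ A) by exact: set_val_continuous.
    pose uS (q : set_type A) : S := to_set (set_valP q).1.
    have cu : continuous uS by apply: continuous_to_set; cts.
    have -> : (fun q : set_type A => L (set_val q).2.1 (set_val q).2.2) =
        (fun q => K (uS q, (set_val q).2.2)).
      by apply/funext => q; rewrite -LE.
    by cts.
  by move=> _ u u1; rewrite k1g.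
pose c (x : V n) := (Num.max 0 (2 * `|x| - 1) / Num.max 2^-1 `|x|) *: x.
have cc : continuous c.
  apply: ctsZ; last by cts.
  apply: ctsM; first by cts.
  by apply: ctsV; [cts|move=> x; rewrite gt_eqF // lt_max invr_gt0 ltr0n].
have dir1 (x : V n) : 1 < 2 * `|x| -> `|dir x| = 1.
  by move=> x1; apply: norm_dir; rewrite -normr_eq0; apply/eqP => x0; lra.
have k2h x : `|x| <= 1 -> p (k2 x) = h (c x).
  move=> x1; rewrite /k2 /collar; case: leP => x2.
    rewrite k1h; congr h; rewrite /c (_ : Num.max 0 _ = 0) ?mul0r ?scale0r //.
    by minmax.
  have d1 := dir1 x x2.
  rewrite -[dir x]/(set_val (to_set (d1 : sph n (dir x)) : S)) LE Kp; last by minmax.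
  rewrite /c /= /dir scalerA; congr (h (_ *: x)); congr (_ * _); first by minmax.
  by congr (_^-1); minmax.
have c_sph u : `|u| = 1 -> c u = u.
  move=> u1; rewrite /c u1 (_ : _ / _ = 1) ?scale1r //.
  rewrite (_ : Num.max 0 _ = 1); last by minmax.
  by rewrite (_ : Num.max _ 1 = 1) ?divr1 //; minmax.
pose v x := rc x - c (rc x).
(* The correction from [c] to the identity is completed at time [1 - |rc x|] and the lift is stopped
   there, so nothing moves on the sphere. The quotient is harmless because [v] vanishes where its
   denominator does. *)
pose mu (q : V n * R) := Num.min 1 (Num.max 0 q.2 / (1 - `|rc q.1|)).
have v0 x : 1 - `|rc x| = 0 -> v x = 0.
  by move=> x1; rewrite /v c_sph ?subrr //; lra.
have cv : continuous v by rewrite /v; cts.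
have cF : continuous (fun q => mu q *: v q.1).
  apply: (@cts_squeeze _ _ _ _ (fun q => `|v q.1|) 1); first by cts.
    move=> q; rewrite normrZ normr_id; apply: ler_wpM2r => //.
    have d0 : 0 <= (1 - `|rc q.1|)^-1.
      by rewrite invr_ge0 subr_ge0 norm_rc_le1.
    have m0 : 0 <= Num.max 0 q.2 / (1 - `|rc q.1|).
      by apply: mulr_ge0 => //; rewrite le_max lexx.
    by rewrite ger0_norm /mu ?ge_min ?lexx // le_min ler01.
  apply: set_type_cont_on; set A := [set q | _].
  have cA : continuous (@set_val _ A) by exact: set_val_continuous.
  apply: ctsZ; last by cts.
  apply: ctsmin; first by cts.
  apply: ctsM; first by cts.
  apply: ctsV; first by cts.
  move=> q; have := set_valP q; rewrite /A /= normr_eq0; apply: contraNN.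
  by move=> /eqP /v0 ->.
have [|||M [cM M0 Mp]] := hp (V n) (fun x => k2 (rc x))
  (fun q => h (c (rc q.1) + mu q *: v q.1)).
- by cts.
- by cts.
- move=> x /=; rewrite k2h ?norm_rc_le1 //; congr h.
  by rewrite /mu /= maxxx mul0r (_ : Num.min 1 0 = 0) ?scale0r ?addr0 //; minmax.
exists (fun x => M (x, 1 - `|rc x|)); split.
- by cts.
- move=> u u1; rewrite rc_id ?u1 // subrr M0 rc_id ?u1 // /k2 collar_sphere //.
  by rewrite -[u]/(set_val (to_set (u1 : sph n u) : S)) LE K0.
- move=> x x1; rewrite Mp ?subr_ge0 ?norm_rc_le1 //=; congr h.
  rewrite -[RHS](rc_id x1).
  have [r0|r0] := eqVneq (1 - `|rc x|) 0.
    by rewrite (v0 _ r0) scaler0 addr0 c_sph //; lra.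
  have r1 : 0 < 1 - `|rc x| by rewrite lt_def r0 subr_ge0 norm_rc_le1.
  by rewrite /mu /= max_r ?ltW // divff // minxx scale1r /v addrC subrK.
Qed.

End PathFibrationLifting.

Section VerticalPaths.
Variables (R : realType) (P Z : topologicalType) (p : P -> Z).
Hypotheses (cp : continuous p) (lp : rlp R p).
Local Notation V n := 'rV[R]_n.
Local Notation sph n := (@unit_sphere R n).

Lemma rlp_cylinder n (a b : V n -> P) (e : V n * R -> P) :
  continuous a -> continuous b ->
  cont_on [set q : V n * R | `|q.1| = 1 /\ `|q.2| <= 1] e ->
  (forall x, p (a x) = p (b x)) ->
  (forall x, `|x| = 1 -> e (x, -1) = a x) -> (forall x, `|x| = 1 -> e (x, 1) = b x) ->
  (forall x s, `|x| = 1 -> `|s| <= 1 -> p (e (x, s)) = p (a x)) ->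
  exists K : V n * R -> P, [/\ continuous K,
    forall x, `|x| <= 1 -> K (x, 0) = a x /\ K (x, 1) = b x,
    forall x s, `|x| = 1 -> 0 <= s <= 1 -> K (x, s) = e (x, 2 * s - 1) &
    forall x s, `|x| <= 1 -> 0 <= s <= 1 -> p (K (x, s)) = p (a x)].
Proof.
move=> ca cb ce pab ea eb pe; have [g [cg ga gb ge]] := vcons_boundary ca cb ce ea eb.
pose h (y : V n.+1) := p (a (vtl y)).
have ch : continuous h by rewrite /h; cts.
have [|k [ck kg kh]] := lp.2 n.+1 g h cg ch.
  move=> y y1; rewrite -{1}(vcons_eta y) /h.
  have := sphere_cases y1 => -[[-> t1]|[-> t1]|[t1 h1]].
  - by rewrite gb.
  - by rewrite ga.
  - by rewrite ge ?pe // ler_norml.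
exists (fun q => k (vcons (2 * q.2 - 1) q.1)).
have sE (x : V n) s : `|x| <= 1 -> 0 <= s <= 1 -> `|vcons (2 * s - 1) x| <= 1.
  by move=> x1 s01; rewrite norm_vcons ge_max x1 andbT ler_norml; lra.
split=> [|x x1|x s x1 s01|x s x1 s01].
- by cts.
- rewrite mulr0 sub0r mulr1 (_ : 2 - 1 = 1); last by lra.
  rewrite !kg ?ga ?gb // norm_vcons ?normrN normr1 max_l //.
- have s1 : `|2 * s - 1| <= 1 by rewrite ler_norml; lra.
  by rewrite kg ?ge // norm_vcons x1 max_r.
- by rewrite kh ?sE // /h vtl_cons.
Qed.

Local Notation PP := (hpb R (@id P) (@id P)).

Definition vertical_path : topologicalType := set_type
  [set z : PP | forall s, 0 <= s <= 1 -> p (hpbp (z, s)) = p (hpb1 z)].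

Lemma vertical_ends (z : vertical_path) :
  p (hpb1 (set_val z)) = p (hpb2 (set_val z)).
Proof.
have := set_valP z => /= /(_ 1); rewrite hpb_end => <- //.
by rewrite lexx ler01.
Qed.

Definition path_ends (z : vertical_path) : pb p p := pb_mk (vertical_ends z).

Lemma path_ends_continuous : continuous path_ends.
Proof.
apply: continuous_to_set; apply: cts_pair.
  by apply: cts_comp; [exact: hpb1_continuous|exact: set_val_continuous].
by apply: cts_comp; [exact: hpb2_continuous|exact: set_val_continuous].
Qed.

Lemma rlp_vertical_path n (h : V n -> pb p p) (e : V n * R -> P) : continuous h ->
  cont_on [set q : V n * R | `|q.1| = 1 /\ `|q.2| <= 1] e ->
  (forall x, `|x| = 1 -> e (x, -1) = pb1 (h x)) ->
  (forall x, `|x| = 1 -> e (x, 1) = pb2 (h x)) ->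
  (forall x s, `|x| = 1 -> `|s| <= 1 -> p (e (x, s)) = p (pb1 (h x))) ->
  exists k : V n -> vertical_path, [/\ continuous k,
    forall x, `|x| <= 1 -> path_ends (k x) = h x &
    forall x s, `|x| = 1 -> 0 <= s <= 1 -> hpbp (set_val (k x), s) = e (x, 2 * s - 1)].
Proof.
move=> ch ce e1 e2 pe.
have c1 : continuous (fun x => pb1 (h x)) by apply: cts_comp => //; exact: pb1_continuous.
have c2 : continuous (fun x => pb2 (h x)) by apply: cts_comp => //; exact: pb2_continuous.
have [|K [cK K01 Ks Kp]] := rlp_cylinder c1 c2 ce _ e1 e2 pe.
  by move=> x; exact: pb_sq.
have [||||| m [cm m1 m2 mp]] := @hpb_map R _ _ _ id id (V n)
  (fun x => K (rc x, 0)) (fun x => K (rc x, 1)) (fun q => K (rc q.1, q.2)).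
- by cts.
- by cts.
- by cts.
- by [].
- by [].
have i0 : 0 <= (0 : R) <= 1 by rewrite lexx ler01.
have mP x : [set z : PP | forall s, 0 <= s <= 1 -> p (hpbp (z, s)) = p (hpb1 z)] (m x).
  by move=> s s01; rewrite mp // m1 !Kp // norm_rc_le1.
exists (fun x => to_set (mP x)); split; first exact: continuous_to_set.
  move=> x x1; have [k0 k1] := K01 x x1.
  by apply: pb_eq => /=; rewrite /pb1 /pb2 /= ?m1 ?m2 rc_id // ?k0 ?k1.
by move=> x s x1 s01; rewrite /= mp // rc_id ?x1 // Ks.
Qed.

(** A ball of vertical paths is a map of the prism, with top and bottom given by [h] and side given
    by [g]; lifting against the prism solves the problem. *)
Lemma path_ends_rlp : rlp R path_ends.
Proof.
split=> [z|n g h cg ch gh].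
  have nsph (x : V 0) : `|x| = 1 -> False.
    by rewrite norm_rV0 => /eqP; rewrite eq_sym oner_eq0.
  have [||||k [_ kz _]] := @rlp_vertical_path 0 (fun=> z) (fun=> pb1 z) (@ctscst _ _ z).
  - by apply: continuous_cont_on; exact: ctscst.
  - by [].
  - by move=> x /nsph.
  - by [].
  by exists (k 0); apply: kz; rewrite normr0 ler01.
pose e (q : V n * R) := hpbp (set_val (g q.1), (q.2 + 1) / 2).
have hE x : `|x| = 1 -> pb1 (h x) = hpb1 (set_val (g x)) /\
    pb2 (h x) = hpb2 (set_val (g x)) by move=> x1; rewrite -gh.
have [||||k [ck kh ks]] := @rlp_vertical_path n h e ch.
- apply: (@cont_on_comp _ _ _ _ setT (fun q : V n * R => (set_val (g q.1), (q.2 + 1) / 2))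
    (@hpbp R _ _ _ id id)) => //; last by apply: continuous_cont_on; exact: hpbp_continuous.
  apply: cont_on_pair; last by apply: continuous_cont_on; cts.
  apply: (@cont_on_comp _ _ _ _ (sph n) fst (fun x => set_val (g x))).
  + by apply: continuous_cont_on; cts.
  + apply: (cont_on_comp cg (continuous_cont_on (A := setT) (@set_val_continuous _ _))) => //.
  + by move=> q [].
- by move=> x x1; rewrite /e /= addrC subrr mul0r hpb_start (hE x x1).1.
- move=> x x1; rewrite /e /= (_ : (1 + 1) / 2 = 1); last by lra.
  by rewrite hpb_end (hE x x1).2.
- move=> x s x1; rewrite ler_norml => s1.
  by rewrite /e /= (hE x x1).1; apply: (set_valP (g x)); lra.
exists k; split=> // u u1; apply: val_inj.
have [] := hE u u1; rewrite -kh ?u1 // => e1 e2.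
apply: hpb_eq => // s s01; rewrite ks // /e /=.
by congr (hpbp (_, _)); lra.
Qed.

End VerticalPaths.

Section ColocalOfLifting.
Variable R : realType.

(** Lifting along the path fibration of [w] gives surjectivity on homotopy classes. For injectivity,
    a homotopy below turns [f] and [g] into two maps to the path fibration with the same image in
    [Z], and lifting along [path_ends] joins them by vertical paths. *)
Lemma colocal_of_lifting (Q : topologicalType) :
  (forall (P Z : topologicalType) (p : P -> Z) (f : Q -> Z), continuous p ->
    rlp R p -> continuous f -> exists2 l : Q -> P, continuous l & forall x, p (l x) = f x) ->
  colocal R (@weak_homotopy_equivalence R) Q.
Proof.
move=> lQ Y Z w Ww; have lp := path_fibration_rlp Ww.
have cw : continuous w by exact: cts_fun.
pose p := @hpb2 R _ _ _ w id; pose q1 := @hpb1 R _ _ _ w id.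
have c1 : continuous q1 by exact: hpb1_continuous.
have c2 : continuous p by exact: hpb2_continuous.
split=> [f cf|f g cf cg wfg].
  have [l cl lf] := lQ _ _ p f c2 lp cf.
  exists (q1 \o l); first exact: cts_comp.
  have -> : f = p \o l by apply/funext => x; rewrite /= lf.
  exact: hmt_compr cl (hpb_sq R w id).
have [H [cH H0 H1]] := hmt_sym wfg.
have cwf : continuous (w \o f) by exact: cts_comp.
have [|||f' [cf' f1 f2 _]] := @hpb_map R _ _ _ w id Q f (w \o f) (fun q => w (f q.1)) cf cwf.
- by cts.
- by [].
- by [].
have [||g' [cg' g1 g2 _]] := hpb_map (f := w) (g := id) cg cwf cH.
- exact: H0.
- exact: H1.
have e x : p (f' x) = p (g' x) by rewrite /p f2 g2.
have [|l cl lE] := lQ _ _ (@path_ends R _ _ p) (fun x => pb_mk (e x))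
    (@path_ends_continuous R _ _ p) (path_ends_rlp c2 lp).
  by apply: continuous_to_set; exact: cts_pair.
have -> : f = q1 \o f' by apply/funext => x; rewrite /= /q1 f1.
have -> : g = q1 \o g' by apply/funext => x; rewrite /= /q1 g1.
apply: hmt_compl => //.
exists (fun q => hpbp (set_val (l q.1), q.2)); split.
- apply: cts_comp; first exact: hpbp_continuous.
  apply: cts_pair; last by cts.
  by apply: cts_comp; [exact: set_val_continuous|apply: cts_comp => //; cts].
- by move=> x /=; rewrite hpb_start -[LHS]/(pb1 (path_ends (l x))) lE.
- by move=> x /=; rewrite hpb_end -[LHS]/(pb2 (path_ends (l x))) lE.
Qed.

End ColocalOfLifting.

(** * Cell complexes as trees *)

Section CellTrees.
Variable R : realType.
Local Notation V n := 'rV[R]_n.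
Local Notation sph n := (@unit_sphere R n).
Local Notation ball n := (@unit_ball R n).

(* A point of the cell complex approximating [Y] is a point [t] of the open
   ball of a cell, which is given by its attaching map [phi] and by its
   characteristic map [d] to [Y]. *)
Inductive tree (Y : Type) :=
| leaf
| node (n : nat) (phi : V n -> tree Y) (d : V n -> Y) (t : V n).

Arguments leaf {Y}.

Section Trees.
Variable Y : Type.
Local Notation tree := (tree Y).

Definition chi n (phi : V n -> tree) (d : V n -> Y) (u : V n) : tree :=
  if `|u| < 1 then node phi d u else phi u.

Lemma chi_lt n (phi : V n -> tree) d u : `|u| < 1 -> chi phi d u = node phi d u.
Proof. by rewrite /chi => ->. Qed.

Lemma chi_sph n (phi : V n -> tree) d u : `|u| = 1 -> chi phi d u = phi u.
Proof. by rewrite /chi => ->; rewrite ltxx. Qed.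

(* [U] meets the closed cell in a relatively open set. *)
Definition op_at (U : set tree) n (phi : V n -> tree) (d : V n -> Y) :=
  forall u, `|u| <= 1 -> U (chi phi d u) ->
  exists N, [/\ open N, N u & forall t, N t -> `|t| < 1 -> U (node phi d t)].

(** Openness along the closed cell of [q] and all cells below it, a local notion available before
    the topology: [good] uses it to express continuity of attaching maps. *)
Fixpoint hop (U : set tree) (q : tree) : Prop :=
  match q with
  | leaf => True
  | node n phi d t => op_at U phi d /\ forall u, `|u| = 1 -> hop U (phi u)
  end.

Definition evr (q : tree) (y : Y) : Prop :=
  match q with leaf => False | node n phi d t => d t = y end.

Lemma evr_inj q y y' : evr q y -> evr q y' -> y = y'.
Proof. by case: q => //= n phi d t <- <-. Qed.

Lemma hopI (U U' : set tree) q : hop U q -> hop U' q -> hop (U `&` U') q.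
Proof.
elim: q => //= n phi ih d t [U1 U2] [V1 V2]; split; last by move=> u u1; apply: ih; auto.
move=> u u1 [Uu Vu]; have [N [oN Nu NU]] := U1 u u1 Uu.
have [N' [oN' Nu' NU']] := V1 u u1 Vu.
exists (N `&` N'); split=> //; first exact: openI.
by move=> t' [Nt Nt'] t1; split; [exact: NU|exact: NU'].
Qed.

Lemma hop_bigU (I : Type) (f : I -> set tree) q :
  (forall i, hop (f i) q) -> hop (\bigcup_i f i) q.
Proof.
elim: q => //= n phi ih d t h; split.
  move=> u u1 [i _ fu]; have [N [oN Nu NU]] := (h i).1 u u1 fu.
  by exists N; split=> // t' Nt t1; exists i => //; exact: NU.
by move=> u u1; apply: ih => i; exact: (h i).2.
Qed.

Lemma hopT q : hop setT q.
Proof.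
elim: q => //= n phi ih d t; split; last by move=> u _; exact: ih.
by move=> u _ _; exists setT; split=> //; exact: openT.
Qed.

(** The characteristic maps must stay in [U] on the whole vector space, not only on the ball, so
    that [conv] can corestrict them as total functions. *)
Fixpoint tin (U : set Y) (q : tree) : Prop :=
  match q with
  | leaf => True
  | node n phi d t => (forall x, U (d x)) /\ forall u, `|u| = 1 -> tin U (phi u)
  end.

Lemma tin_evr (U : set Y) q y : tin U q -> evr q y -> U y.
Proof. by case: q => //= n phi d t [Ud _] <-. Qed.

Lemma tinS (U U' : set Y) q : U `<=` U' -> tin U q -> tin U' q.
Proof.
move=> UU; elim: q => //= n phi ih d t [h1 h2]; split; first by move=> x; exact: UU.
by move=> u u1; apply: ih => //; exact: h2.
Qed.

End Trees.

(* The continuity of the attaching map only involves the cells below it. *)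
Fixpoint good (Y : topologicalType) (q : tree Y) : Prop :=
  match q with
  | leaf => False
  | node n phi d t => `|t| < 1 /\
      [/\ continuous d, forall x, `|x| != 1 -> phi x = leaf,
        forall u, `|u| = 1 -> good (phi u) /\ evr (phi u) (d u) &
        forall U : set (tree Y), (forall u, `|u| = 1 -> hop U (phi u)) ->
        forall u, `|u| = 1 -> U (phi u) ->
        exists N, [/\ open N, N u & forall v, N v -> `|v| = 1 -> U (phi v)]]
  end.

(** The part of [good] that concerns the cell and not the point [t]. The clause on [leaf] normalizes
    the attaching map off the sphere, so that trees can be compared by equality, as in [convK]. *)
Definition gcell (Y : topologicalType) n (phi : V n -> tree Y) (d : V n -> Y) :=
  [/\ continuous d, forall x, `|x| != 1 -> phi x = leaf,
    forall u, `|u| = 1 -> good (phi u) /\ evr (phi u) (d u) &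
    forall U : set (tree Y), (forall u, `|u| = 1 -> hop U (phi u)) ->
    forall u, `|u| = 1 -> U (phi u) ->
    exists N, [/\ open N, N u & forall v, N v -> `|v| = 1 -> U (phi v)]].

HB.instance Definition _ (Y : Type) := gen_eqMixin (tree Y).
HB.instance Definition _ (Y : Type) := gen_choiceMixin (tree Y).

Definition tree_open (Y : topologicalType) (U : set (tree Y)) :=
  forall q, good q -> hop U q.

Lemma tree_openT (Y : topologicalType) : @tree_open Y setT.
Proof. by move=> q _; exact: hopT. Qed.

Lemma tree_openI (Y : topologicalType) : setI_closed (@tree_open Y).
Proof. by move=> U U' oU oU' q gq; apply: hopI; auto. Qed.

Lemma tree_open_bigU (Y : topologicalType) (I : Type) (f : I -> set (tree Y)) :
  (forall i, tree_open (f i)) -> tree_open (\bigcup_i f i).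
Proof. by move=> of_ q gq; apply: hop_bigU => i; exact: of_. Qed.

HB.instance Definition _ (Y : topologicalType) :=
  isOpenTopological.Build (tree Y) (@tree_openT Y) (@tree_openI Y) (@tree_open_bigU Y).

Section FineTopology.
Variable Y : topologicalType.
Local Notation tree := (tree Y).

Lemma tree_openP (U : set tree) : open U <->
  forall n (phi : V n -> tree) d, gcell phi d -> op_at U phi d.
Proof.
split=> [oU n phi d gc|H].
  have g0 : good (node phi d 0) by split=> //; rewrite normr0.
  by have [] := oU _ g0.
change (tree_open U); elim=> //= n phi ih d t [t1 gc]; split; first exact: H.
by move=> u u1; apply: ih; case: gc => _ _ /(_ u u1)[].
Qed.

Lemma chi_good n (phi : V n -> tree) d u : gcell phi d -> `|u| <= 1 -> good (chi phi d u).
Proof.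
move=> gc; rewrite le_eqVlt => /orP[/eqP u1|u1].
  by rewrite chi_sph //; case: gc => _ _ /(_ u u1)[].
by rewrite chi_lt.
Qed.

Lemma chi_evr n (phi : V n -> tree) d u : gcell phi d -> `|u| <= 1 -> evr (chi phi d u) (d u).
Proof.
move=> gc; rewrite le_eqVlt => /orP[/eqP u1|u1].
  by rewrite chi_sph //; case: gc => _ _ /(_ u u1)[].
by rewrite chi_lt.
Qed.

Lemma chi_cont_on n (phi : V n -> tree) d : gcell phi d -> cont_on (ball n) (chi phi d).
Proof.
move=> gc x x1 W oW Wx; have [N [oN Nx NW]] := (tree_openP W).1 oW n phi d gc x x1 Wx.
have [N' [oN' Nx' NW']] : exists N', [/\ open N', N' x &
    forall v, N' v -> `|v| = 1 -> W (phi v)].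
  move: x1; rewrite /unit_ball /= le_eqVlt => /orP[/eqP x1|x1].
    case: gc => _ _ g /(_ W); apply=> //; last by rewrite -(chi_sph phi d x1).
    by move=> u u1; apply: oW; case: (g u u1).
  exists [set t : V n | `|t| < 1]; split=> //; last by move=> v /= + v1; rewrite v1 ltxx.
  by apply: open_lt_cts; [apply: cts_norm; exact: cts_id|exact: ctscst].
exists (N `&` N'); split=> //; first exact: openI.
move=> y [Ny N'y]; rewrite /unit_ball /= le_eqVlt => /orP[/eqP y1|y1].
  by rewrite chi_sph //; exact: NW'.
by rewrite chi_lt //; exact: NW.
Qed.

Definition Qt : topologicalType := set_type (@good Y).

Definition tree_val (q : tree) : good q -> Y :=
  match q with
  | leaf => fun h => False_rect _ h
  | node n phi d t => fun _ => d t
  end.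

Definition ev (q : Qt) : Y := tree_val (set_valP q).

Lemma evP (q : Qt) : evr (set_val q) (ev q).
Proof.
have H (t : tree) (h : good t) : evr t (tree_val h) by case: t h.
exact: H.
Qed.

Lemma ev_eq (q : Qt) y : evr (set_val q) y -> ev q = y.
Proof. exact: evr_inj (evP q). Qed.

Lemma ev_continuous : continuous ev.
Proof.
apply/continuous_openP => q _ W oW Wq.
have oU : open [set q' : tree | forall y, evr q' y -> W y].
  apply/tree_openP => n phi d gc u u1 Wu.
  have cd : continuous d by case: gc.
  exists (d @^-1` W); split.
  - by move/continuousP: cd; apply.
  - exact: Wu (chi_evr gc u1).
  - by move=> t Wt t1 y /= <-.
have cv : continuous (@set_val _ (@good Y)) by exact: set_val_continuous.
exists (set_val @^-1` [set q' : tree | forall y, evr q' y -> W y]); split.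
- by move/continuousP: cv; apply.
- by move=> y /(evr_inj (evP q)) <-.
- by move=> q' h _; apply: h; exact: evP.
Qed.

(* Sets that are open below some cells extend to open sets, through the collars
   |t| > 1/2 of the other cells. *)
Fixpoint tree_ext (U : set tree) (q : tree) : Prop :=
  match q with
  | leaf => False
  | node n phi d t => if pselect (hop U (node phi d t)) then U (node phi d t)
      else 1 < 2 * `|t| /\ tree_ext U (phi (dir t))
  end.

Lemma tree_extE (U : set tree) q : good q -> hop U q -> tree_ext U q = U q.
Proof. by case: q => [//|n phi d t] _ hU /=; case: pselect. Qed.

Lemma tree_ext_open (U : set tree) : open (tree_ext U).
Proof.
change (tree_open (tree_ext U)); elim=> //= n phi ih d t [t1 gc]; have ih' u : `|u| = 1 -> hop (tree_ext U) (phi u).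
  by move=> u1; apply: ih; case: gc => _ _ /(_ u u1)[].
split=> // u u1 Wu; have [hU|hU] := pselect (hop U (node phi d t)).
  have nodeE t' : tree_ext U (node phi d t') = U (node phi d t').
    by rewrite /=; case: pselect => // h; case: h; exact: hU.
  have {}Wu : U (chi phi d u).
    move: Wu u1; rewrite le_eqVlt => + /orP[/eqP u1|u1].
      rewrite chi_sph // tree_extE //; first by case: gc => _ _ /(_ u u1)[].
      exact: hU.2.
    by rewrite chi_lt // nodeE.
  have [N [oN Nu NU]] := hU.1 u u1 Wu.
  by exists N; split=> // t' Nt t1'; rewrite nodeE; exact: NU.
have nodeE t' : tree_ext U (node phi d t') = (1 < 2 * `|t'| /\ tree_ext U (phi (dir t'))).
  by rewrite /=; case: pselect => // h; case: hU; exact: h.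
have {Wu}[u2 Wu] : 1 < 2 * `|u| /\ tree_ext U (phi (dir u)).
  move: Wu u1; rewrite le_eqVlt => + /orP[/eqP u1|u1].
    by rewrite chi_sph // dir_sphere // u1; split=> //; lra.
  by rewrite chi_lt // nodeE.
have u0 : u != 0 by rewrite -normr_eq0; apply/eqP => e; move: u2; rewrite e; lra.
have [_ _ _ /(_ _ ih' _ (norm_dir u0) Wu)[N [oN Nu NU]]] := gc.
have [N' [oN' N'u N'N]] := @dir_cont_on R n u u0 N oN Nu.
exists (N' `&` [set t' | 1 < 2 * `|t'|]); split=> //.
  apply: openI => //; apply: open_lt_cts; first exact: ctscst.
  by apply: ctsM; [exact: ctscst|apply: cts_norm; exact: cts_id].
move=> t' [N't' t2] _; rewrite nodeE; split=> //.
have t0 : t' != 0 by rewrite -normr_eq0; apply/eqP => e; move: t2; rewrite /= e; lra.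
by apply: NU; [exact: N'N|exact: norm_dir].
Qed.

Definition new_phi n (g : V n -> tree) (x : V n) : tree := if `|x| == 1 then g x else leaf.

Lemma new_phiE n (g : V n -> tree) x : `|x| = 1 -> new_phi g x = g x.
Proof. by rewrite /new_phi => ->; rewrite eqxx. Qed.

Lemma new_cell n (g : V n -> tree) (h : V n -> Y) : cont_on (sph n) g ->
  (forall u, `|u| = 1 -> good (g u) /\ evr (g u) (h u)) -> continuous h ->
  gcell (new_phi g) (fun x => h (rc x)).
Proof.
move=> cg gg ch; split.
- by apply: cts_comp => //; exact: rc_continuous.
- by move=> x /negbTE x1; rewrite /new_phi x1.
- by move=> u u1; rewrite new_phiE //= rc_id ?u1 //; exact: gg.
- move=> U hU u u1; rewrite new_phiE // => Uu.
  (* [U] is only open along the cells below the image of [g]; [tree_ext U] is open and agrees with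
     it there, so continuity of [g] applies to it. *)
  have ext v : `|v| = 1 -> tree_ext U (g v) = U (g v).
    by move=> v1; apply: tree_extE; [case: (gg v v1)|have := hU v v1; rewrite new_phiE].
  have := cg u u1 _ (@tree_ext_open U); rewrite ext // => /(_ Uu)[N [oN Nu NU]].
  by exists N; split=> // v Nv v1; rewrite new_phiE // -ext //; exact: NU.
Qed.

Definition vertex (y : Y) : tree := @node _ 0 (fun=> leaf) (fun=> y) 0.

Lemma vertex_good y : good (vertex y).
Proof.
have n0 (u : V 0) : `|u| = 1 -> False.
  by rewrite norm_rV0 => /eqP; rewrite eq_sym oner_eq0.
split; first by rewrite normr0.
by split=> // [|u /n0|U _ u /n0] //; exact: ctscst.
Qed.

(** The lifting problem itself is a cell, attached along [g] with characteristic map [h]. Trees are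
    closed under attaching cells, so one step of the small object argument suffices. *)
Lemma ev_rlp : rlp R ev.
Proof.
split=> [y|n g h cg ch gh].
  by exists (to_set (vertex_good y)); exact: ev_eq.
have gg u : `|u| = 1 -> good (set_val (g u)) /\ evr (set_val (g u)) (h u).
  by move=> u1; split; [exact: set_valP|rewrite -gh //; exact: evP].
have cg' : cont_on (sph n) (fun u => set_val (g u)).
  exact: (cont_on_comp cg (continuous_cont_on (A := setT) (@set_val_continuous _ _))).
have gc := new_cell cg' gg ch.
exists (fun x => to_set (chi_good gc (norm_rc_le1 x)) : Qt); split.
- apply: continuous_to_set; apply: (@cont_onT _ _ setT) => //.
  apply: (cont_on_comp (B := ball n) _ (chi_cont_on gc)).
    by apply: continuous_cont_on; exact: rc_continuous.
  by move=> x _; exact: norm_rc_le1.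
- move=> u u1; apply: val_inj.
  change (chi (new_phi (fun u => set_val (g u))) (fun x => h (rc x)) (rc u) =
    set_val (g u)).
  by rewrite rc_id ?u1 // chi_sph // new_phiE.
- move=> x x1; apply: ev_eq; rewrite -[in h x](rc_id x1).
  rewrite -[in h _](rc_id (norm_rc_le1 x)).
  exact: (chi_evr gc (norm_rc_le1 x)).
Qed.

End FineTopology.

Section Lifting.
Variables (Y P Z : topologicalType) (p : P -> Z) (f : Qt Y -> Z).
Hypotheses (cp : continuous p) (lp : rlp R p) (cf : continuous f).

Section Lift.
Variables (z0 : Z) (e0 : P).

Let F (q : tree Y) : Z := extend z0 f q.

Definition lift_sol n (g : V n -> P) (h : V n -> Z) (k : V n -> P) :=
  [/\ continuous k, forall u, `|u| = 1 -> k u = g u &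
    forall x, `|x| <= 1 -> p (k x) = h x].

Definition lift_cell n (g : V n -> P) (h : V n -> Z) : V n -> P :=
  if pselect (exists k, lift_sol g h k) is left e then projT1 (cid e) else fun=> e0.

(** The extension chosen over a cell depends on its attaching and characteristic maps but not on the
    point [t], so the choices made at different points of one cell agree. *)
Fixpoint lift (q : tree Y) : P :=
  match q with
  | leaf => e0
  | node n phi d t =>
      lift_cell (fun x => lift (phi x)) (fun x => F (chi phi d (rc x))) t
  end.

Lemma lift_cellP n (phi : V n -> tree Y) d : gcell phi d ->
  (forall u, `|u| = 1 -> p (lift (phi u)) = F (phi u) /\
    forall W, open W -> hop (lift @^-1` W) (phi u)) ->
  lift_sol (fun x => lift (phi x)) (fun x => F (chi phi d (rc x)))
    (lift_cell (fun x => lift (phi x)) (fun x => F (chi phi d (rc x)))).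
Proof.
move=> gc ih; rewrite /lift_cell; case: pselect => [e|[]]; first by case: cid.
apply: lp.2.
- move=> u u1 W oW Wu; case: gc => _ _ _ /(_ (lift @^-1` W)).
  by case/(_ _ u u1 Wu) => [v v1|N [oN Nu NW]]; [exact: (ih v v1).2|exists N].
- apply: (@cont_onT _ _ setT) => //.
  apply: (@cont_on_comp _ _ _ _ (@good Y) (fun x => chi phi d (rc x)) F).
  + apply: (cont_on_comp (B := ball n) _ (chi_cont_on gc)).
      by apply: continuous_cont_on; exact: rc_continuous.
    by move=> x _; exact: norm_rc_le1.
  + exact: extend_cont_on.
  + by move=> x _; apply: chi_good => //; exact: norm_rc_le1.
- by move=> u u1; rewrite rc_id ?u1 // chi_sph //; case: (ih u u1).
Qed.

Lemma liftP q : good q -> p (lift q) = F q /\ forall W, open W -> hop (lift @^-1` W) q.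
Proof.
elim: q => // n phi ih d t [t1 gc].
have {}ih u : `|u| = 1 -> p (lift (phi u)) = F (phi u) /\
    forall W, open W -> hop (lift @^-1` W) (phi u).
  by move=> u1; apply: ih; case: gc => _ _ /(_ u u1)[].
have [ck kg kh] := lift_cellP gc ih; split.
  by rewrite /= kh ?ltW // rc_id ?ltW // chi_lt.
move=> W oW; split; last by move=> u u1; exact: (ih u u1).2.
move=> u u1 Wu.
pose k := lift_cell (fun x => lift (phi x)) (fun x => F (chi phi d (rc x))).
exists (k @^-1` W); split=> //; first by move/continuousP: ck; apply.
move: Wu u1; rewrite /preimage /= le_eqVlt => + /orP[/eqP u1|u1].
  by rewrite chi_sph // /k kg.
by rewrite chi_lt.
Qed.

End Lift.

Lemma tree_lifting : exists2 l : Qt Y -> P, continuous l & forall x, p (l x) = f x.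
Proof.
have [[q0 _]|nQ] := pselect (exists q : Qt Y, True); last first.
  have no (q : Qt Y) : False by apply: nQ; exists q.
  by exists (fun q => False_rect _ (no q)) => q; case: (no q).
have [e0 _] := lp.1 (f q0).
exists (fun q => lift (f q0) e0 (set_val q)).
  apply: (@cts_comp _ _ _ set_val); last exact: set_val_continuous.
  apply/continuousP => W oW.
  have h : tree_open (lift (f q0) e0 @^-1` W).
    by move=> q gq; apply: (liftP (f q0) e0 gq).2.
  exact: h.
move=> q; rewrite (liftP (f q0) e0 (set_valP q)).1.
by rewrite (extendE _ _ (set_valP q)); congr f; exact: val_inj.
Qed.

End Lifting.
End CellTrees.

Arguments leaf {R Y}.

(** * Functoriality of cell trees and corestriction to subspaces *)

Section TreeMaps.
Variable R : realType.
Local Notation V n := 'rV[R]_n.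
Local Notation sph n := (@unit_sphere R n).
Local Notation ball n := (@unit_ball R n).
Local Notation tree := (tree R).

Section Tmap.
Variables (Y Y' : Type) (f : Y -> Y').

Fixpoint tmap (q : tree Y) : tree Y' :=
  match q with
  | leaf => leaf
  | node n phi d t => node (fun x => tmap (phi x)) (fun x => f (d x)) t
  end.

Lemma tmap_chi n (phi : V n -> tree Y) d u :
  tmap (chi phi d u) = chi (fun x => tmap (phi x)) (fun x => f (d x)) u.
Proof. by rewrite /chi; case: ifP. Qed.

Lemma tmap_evr q y : evr q y -> evr (tmap q) (f y).
Proof. by case: q => //= n phi d t ->. Qed.

Lemma hop_tmap (U : set (tree Y')) q : hop U (tmap q) -> hop (tmap @^-1` U) q.
Proof.
elim: q => //= n phi ih d t [opU hU]; split; last by move=> u u1; apply: ih; exact: hU.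
move=> u u1; rewrite /preimage /= tmap_chi => Uu.
by have [N [oN Nu NU]] := opU u u1 Uu; exists N.
Qed.

Lemma tin_tmap (U : set Y') q : tin (f @^-1` U) q -> tin U (tmap q).
Proof.
by elim: q => //= n phi ih d t [h1 h2]; split=> // u u1; apply: ih; exact: h2.
Qed.

End Tmap.

Lemma tmap_comp (Y Y' Y'' : Type) (f : Y -> Y') (g : Y' -> Y'') q :
  tmap g (tmap f q) = tmap (fun y => g (f y)) q.
Proof. by elim: q => //= n phi ih d t; congr node; apply/funext => x. Qed.

Lemma tmap_eq (Y Y' : Type) (f g : Y -> Y') q : f =1 g -> tmap f q = tmap g q.
Proof. by move=> /funext ->. Qed.

Section TmapTop.
Variables (Y Y' : topologicalType) (f : Y -> Y').
Hypothesis cf : continuous f.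

Lemma good_tmap q : good q -> good (tmap f q).
Proof.
elim: q => //= n phi ih d t [t1 [cd phi0 gphi gU]]; split=> //; split.
- exact: cts_comp.
- by move=> x x1; rewrite phi0.
- move=> u u1; have [g1 g2] := gphi u u1; split; first exact: ih.
  exact: (@tmap_evr _ _ f _ _ g2).
- move=> U hU u u1 Uu.
  have [|N [oN Nu NU]] := gU (tmap f @^-1` U) _ u u1 Uu; last by exists N.
  by move=> v v1; apply: hop_tmap; exact: hU.
Qed.

Lemma gcell_tmap n (phi : V n -> tree Y) d : gcell phi d ->
  gcell (fun x => tmap f (phi x)) (fun x => f (d x)).
Proof.
move=> gc; have g0 : good (node phi d 0) by split=> //; rewrite normr0.
by case: (good_tmap g0).
Qed.

Lemma tmap_continuous : continuous (tmap f).
Proof.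
apply/continuousP => U oU; apply/tree_openP => n phi d gc.
have h := (tree_openP U).1 oU _ _ _ (gcell_tmap gc) => u u1.
rewrite /preimage /= tmap_chi => Uu.
by have [N [oN Nu NU]] := h u u1 Uu; exists N.
Qed.

Definition Qmap (q : Qt R Y) : Qt R Y' := to_set (good_tmap (set_valP q)).

Lemma Qmap_continuous : continuous Qmap.
Proof.
apply: continuous_to_set; apply: cts_comp; first exact: tmap_continuous.
exact: set_val_continuous.
Qed.

Lemma ev_Qmap q : ev (Qmap q) = f (ev q).
Proof. by apply: ev_eq; apply: tmap_evr; exact: evP. Qed.

End TmapTop.

Section Conv.
Variables (Y : Type) (U : set Y).

(* The corestriction of a tree in [U]; trees that do not lie in [U] are
   truncated. *)
Fixpoint conv (q : tree Y) : tree (set_type U) :=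
  match q with
  | leaf => leaf
  | node n phi d t =>
      if pselect (forall x, U (d x)) is left h
      then node (fun x => conv (phi x)) (fun x => exist _ (d x) (mem_set (h x))) t
      else leaf
  end.

Lemma conv_node n (phi : V n -> tree Y) d t (h : forall x, U (d x)) :
  conv (node phi d t) =
  node (fun x => conv (phi x)) (fun x => exist _ (d x) (mem_set (h x))) t.
Proof.
rewrite /=; case: pselect => // h'; congr node; apply/funext => x.
exact: val_inj.
Qed.

Lemma tmapK (q : tree (set_type U)) : conv (tmap set_val q) = q.
Proof.
elim: q => //= n phi ih d t; case: pselect => [h|[]]; last first.
  by move=> x; exact: (set_valP (d x)).
by congr node; apply/funext => x //; exact: val_inj.
Qed.

End Conv.

Lemma convK (Y : topologicalType) (U : set Y) (q : tree Y) : good q -> tin U q ->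
  tmap set_val (conv U q) = q.
Proof.
elim: q => // n phi ih d t [t1 [_ phi0 gphi _]] [Ud tphi].
rewrite (conv_node _ _ Ud) /=; congr node; apply/funext => x.
have [x1|x1] := eqVneq `|x| 1; last by rewrite phi0.
by apply: ih; [case: (gphi x x1)|exact: tphi].
Qed.

Section ConvTop.
Variables (Y : topologicalType) (U : set Y).

Lemma conv_chi n (phi : V n -> tree Y) d (h : forall x, U (d x)) u :
  conv U (chi phi d u) =
  chi (fun x => conv U (phi x)) (fun x => to_set (h x)) u.
Proof. by rewrite /chi; case: ifP => // _; exact: conv_node. Qed.

Lemma hop_conv (Q : set (tree (set_type U))) q : tin U q -> hop Q (conv U q) ->
  hop [set q' | tin U q' -> Q (conv U q')] q.
Proof.
elim: q => // n phi ih d t [Ud tphi]; rewrite (conv_node _ _ Ud) => -[opQ hQ].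
split; last by move=> u u1; apply: ih; [exact: tphi|exact: hQ].
move=> u u1 Qu; have [|N [oN Nu NQ]] := opQ u u1.
  rewrite -(conv_chi _ Ud); apply: Qu.
  by rewrite /chi; case: ifP => // /negbT; rewrite -leNgt => u2; apply: tphi; apply/eqP; rewrite eq_le u1.
by exists N; split=> // t' Nt' t1' _; rewrite (conv_node _ _ Ud); exact: NQ.
Qed.

Lemma evr_conv q y (Uy : U y) : tin U q -> evr q y -> evr (conv U q) (to_set Uy).
Proof.
case: q => // n phi d t [Ud _]; rewrite (conv_node _ _ Ud) /= => e.
exact: val_inj.
Qed.

Lemma good_conv q : good q -> tin U q -> good (conv U q).
Proof.
elim: q => // n phi ih d t [t1 [cd phi0 gphi gU]] [Ud tphi].
rewrite (conv_node _ _ Ud); split=> //; split.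
- exact: continuous_to_set.
- by move=> x x1; rewrite phi0.
- move=> u u1; have [g1 g2] := gphi u u1; split; first by apply: ih => //; exact: tphi.
  by apply: evr_conv => //; exact: tphi.
- move=> Q hQ u u1 Qu.
  have [||N [oN Nu NQ]] := gU [set q' | tin U q' -> Q (conv U q')] _ u u1.
  + by move=> v v1; apply: hop_conv; [exact: tphi|exact: hQ].
  + by [].
  + by exists N; split=> // v Nv v1; apply: NQ => //; exact: tphi.
Qed.

Lemma conv_cont_on : cont_on [set q | good q /\ tin U q] (conv U).
Proof.
move=> q [gq tq] Q oQ Qq; exists [set q' | tin U q' -> Q (conv U q')].
split; [|by move=> _|by move=> q' h [_ /h]].
apply/tree_openP => n phi d gc.
have [tc|tc] := pselect (tin U (node phi d 0)); last first.
  by move=> u u1 _; exists setT; split=> //; [exact: openT|move=> t _ _ /tc].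
have g0 : good (node phi d 0) by split=> //; rewrite normr0.
have : hop [set q' | tin U q' -> Q (conv U q')] (node phi d 0).
  by apply: hop_conv => //; exact: oQ (good_conv g0 tc).
by case.
Qed.

Lemma tin_conv (U' : set Y) q : tin U q -> tin U' q ->
  tin [set y : set_type U | U' (set_val y)] (conv U q).
Proof.
elim: q => // n phi ih d t [Ud tphi] [Ud' tphi']; rewrite (conv_node _ _ Ud).
by split=> // u u1; apply: ih; [exact: tphi|exact: tphi'].
Qed.

End ConvTop.

Lemma Qt_colocal (Y : topologicalType) :
  colocal R (@weak_homotopy_equivalence R) (Qt R Y).
Proof.
by apply: colocal_of_lifting => P Z p f cp lp cf; exact: tree_lifting.
Qed.

Lemma cylinder_rlp (X : topologicalType)
  (p : X * itv R -> X) : p =1 fst -> rlp R p.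
Proof.
move=> pE; split=> [x|n g h cg ch gh]; first by exists (x, itv0 R); rewrite pE.
pose f u := ival (g u).2.
have cf : cont_on (sph n) f.
  apply: (@cont_on_comp _ _ _ _ setT g (fun z => ival z.2)) => //.
  apply: continuous_cont_on.
  by apply: (cts_comp (@ival_continuous R)); cts.
have cc := @cone_continuous R n R f 1 cf _.
exists (fun x => (h x, clamp (`|x| *: f (dir x)))); split.
- apply: cts_pair => //; apply: (cts_comp (@clamp_continuous R)).
  by apply: cc => u _; have := ivalP (g u).2; rewrite /f ler_norml; lra.
- move=> u u1; rewrite u1 scale1r dir_sphere // /f ivalK -gh // pE.
  by case: (g u).
- by move=> x x1; rewrite pE.
Qed.

Local Notation we := (@weak_homotopy_equivalence R).

Lemma cylinder_weak_equivalence (X : topologicalType)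
  (p : continuousType (X * itv R)%type X) : p =1 fst -> we p.
Proof.
move=> pE; apply: wlp_weak_homotopy_equivalence; apply: rlp_wlp.
exact: cylinder_rlp.
Qed.

Definition Qev (X : topologicalType) : continuousType (Qt R X) X :=
  mkcts (@ev_continuous R X).

Definition Qfun (X Y : topologicalType) (f : continuousType X Y) :
  continuousType (Qt R X) (Qt R Y) :=
  mkcts (@Qmap_continuous X Y f (@cts_fun _ _ f)).

Lemma Qev_nat (X Y : topologicalType) (f : continuousType X Y) z :
  Qev Y (Qfun f z) = f (Qev X z).
Proof. exact: (@ev_Qmap X Y f (@cts_fun _ _ f)). Qed.

Lemma Qfun_comp (X Y Z : topologicalType) (f : continuousType X Y)
    (g : continuousType Y Z) (h : continuousType X Z) :
  h =1 g \o f -> forall z, Qfun h z = Qfun g (Qfun f z).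
Proof. by move=> hE z; apply: val_inj; rewrite /= tmap_comp; exact: tmap_eq. Qed.

Lemma Qev_weak_equivalence (X : topologicalType) : we (Qev X).
Proof. by apply: wlp_weak_homotopy_equivalence; apply: rlp_wlp; exact: ev_rlp. Qed.

Definition quillen_rep : rep_model R we :=
  @RepModel R we (fun X => Qt R X) Qev Qfun Qev_nat Qfun_comp
    cylinder_weak_equivalence Qev_weak_equivalence Qt_colocal.

End TreeMaps.

(** * Trees subordinate to an open cover *)

Section BoxExtension.
Variables (R : realType) (n N : nat) (T : topologicalType).
Local Notation V := 'rV[R]_n.
Variable Pr : V -> T -> Prop.
Implicit Types a w : 'I_n -> nat.

Definition box a w : set V := [set x | forall i, (a i)%:R <= x ord0 i <= (a i + w i)%:R].

(** The boundary relative to the affine span: directions of width 0 contribute no faces, and a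
    single grid point has empty boundary. *)
Definition box_bd a w : set V := [set x | box a w x /\ exists2 i, (0 < w i)%N &
  x ord0 i = (a i)%:R \/ x ord0 i = (a i + w i)%:R].

Definition box_ext a w := forall F : V -> T, cont_on (box_bd a w) F ->
  (forall x, box_bd a w x -> Pr x (F x)) ->
  exists F' : V -> T, [/\ cont_on (box a w) F', forall x, box a w x -> Pr x (F' x) &
    forall x, box_bd a w x -> F' x = F x].

Lemma box_closed a w : closed (box a w).
Proof.
have cx i : continuous (fun x : V => x ord0 i) by apply: cts_coord; exact: cts_id.
have -> : box a w = \bigcap_(i in [set: 'I_n]) ([set x | (a i)%:R <= x ord0 i] `&`
    [set x | x ord0 i <= (a i + w i)%:R]).
  apply/seteqP; split=> [x xb i _|x xb i]; first by split=> /=; have /andP[] := xb i.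
  by have [/= -> ->] := xb i I.
apply: closed_bigI => i _; apply: closedI.
  by apply: closed_le_cts => //; exact: ctscst.
by apply: closed_le_cts => //; exact: ctscst.
Qed.

Lemma hyperplane_closed i (s : R) : closed [set x : V | x ord0 i = s].
Proof.
have cx : continuous (fun x : V => x ord0 i) by apply: cts_coord; exact: cts_id.
have -> : [set x : V | x ord0 i = s] = [set x | x ord0 i <= s] `&` [set x | s <= x ord0 i].
  by apply/seteqP; split=> x /=; [move=> ->|move=> [xs sx]; apply/eqP; rewrite eq_le xs].
by apply: closedI; apply: closed_le_cts => //; exact: ctscst.
Qed.

Lemma box_bd_closed a w : closed (box_bd a w).
Proof.
have -> : box_bd a w = box a w `&` \bigcup_(i in [set i | (0 < w i)%N])
    ([set x : V | x ord0 i = (a i)%:R] `|` [set x : V | x ord0 i = (a i + w i)%:R]).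
  by apply/seteqP; split=> x /= [xb [i wi xi]]; split=> //; exists i.
apply: closedI; first exact: box_closed.
apply: closed_bigcup => [|i _]; first exact: finite_finset.
by apply: closedU; exact: hyperplane_closed.
Qed.

Definition upd a (i : 'I_n) (v : nat) : 'I_n -> nat := fun j => if j == i then v else a j.

Lemma sum_upd w i v : (v < w i)%N -> (\sum_j upd w i v j < \sum_j w j)%N.
Proof.
move=> vw; rewrite (bigD1 i) //= [X in (_ < X)%N](bigD1 i) //= {1}/upd eqxx.
rewrite (eq_bigr w) ?ltn_add2r // => j ji.
by rewrite /upd (negbTE ji).
Qed.

Lemma box_upd a w a' w' i x : box a w x ->
  (forall j, j != i -> a' j = a j /\ w' j = w j) ->
  (a' i)%:R <= x ord0 i <= (a' i + w' i)%:R -> box a' w' x.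
Proof.
move=> xb e xi j; have [->//|ji] := eqVneq j i.
by have [-> ->] := e j ji; exact: xb.
Qed.

(** Cut the box by the hyperplane one step above its lower face in direction [i]. Extending first
    over the cut makes the values on the boundaries of both pieces available and forces the two
    extensions to agree there. *)
Lemma box_ext_split a w i : (1 < w i)%N ->
  box_ext (upd a i (a i).+1) (upd w i 0) -> box_ext a (upd w i 1) ->
  box_ext (upd a i (a i).+1) (upd w i (w i).-1) -> box_ext a w.
Proof.
move=> wi extM extL extU F cF PF.
pose s := (a i).+1.
have ss : (s + (w i).-1 = a i + w i)%N by rewrite /s addSn -addnS prednK // ltnW.
have lt1 : (a i)%:R < s%:R :> R by rewrite ltr_nat.
have lt2 : s%:R < (a i + w i)%:R :> R by rewrite ltr_nat /s -addn1 ltn_add2l.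
pose aM := upd a i s; pose wM := upd w i 0; pose wL := upd w i 1; pose wU := upd w i (w i).-1.
have boxM x : box aM wM x <-> box a w x /\ x ord0 i = s%:R.
  split=> [xb|[xb xi]].
    have xi : x ord0 i = s%:R.
      by have := xb i; rewrite /aM /wM /upd eqxx addn0 => /andP[h1 h2]; apply/eqP; rewrite eq_le h1 h2.
    split=> //; apply: (box_upd (i := i) xb) => [j ji|]; last by rewrite xi !ltW.
    by rewrite /aM /wM /upd (negbTE ji).
  apply: (box_upd (i := i) xb) => [j ji|]; first by rewrite /aM /wM /upd (negbTE ji).
  by rewrite /aM /wM /upd eqxx addn0 xi lexx.
have boxL x : box a wL x <-> box a w x /\ x ord0 i <= s%:R.
  split=> [xb|[xb xi]].
    have := xb i; rewrite /wL /upd eqxx addn1 => /andP[h1 h2].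
    split=> //; apply: (box_upd (i := i) xb) => [j ji|].
      by rewrite /wL /upd (negbTE ji).
    by rewrite h1 (le_trans h2) // ltW.
  apply: (box_upd (i := i) xb) => [j ji|]; first by rewrite /wL /upd (negbTE ji).
  by rewrite /wL /upd eqxx addn1 xi andbT; have /andP[] := xb i.
have boxU x : box aM wU x <-> box a w x /\ s%:R <= x ord0 i.
  split=> [xb|[xb xi]].
    have := xb i; rewrite /aM /wU /upd eqxx ss => /andP[h1 h2].
    split=> //; apply: (box_upd (i := i) xb) => [j ji|].
      by rewrite /aM /wU /upd (negbTE ji).
    by rewrite h2 (le_trans _ h1) // ltW.
  apply: (box_upd (i := i) xb) => [j ji|]; first by rewrite /aM /wU /upd (negbTE ji).
  by rewrite /aM /wU /upd eqxx ss xi; have /andP[] := xb i.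
have bdM x : box_bd aM wM x -> box_bd a w x.
  move=> [/boxM[xb xi] [j]]; rewrite /aM /wM /upd; case: eqP => // ji wj xj.
  by split=> //; exists j.
have bd_ne x : box_bd a w x -> x ord0 i = s%:R -> box_bd aM wM x.
  move=> [xb [j wj xj]] xi; split; first by apply/boxM.
  have ji : j != i.
    apply/eqP => e; move: xj; rewrite e xi => -[] e'.
      by move: lt1; rewrite e' ltxx.
    by move: lt2; rewrite -e' ltxx.
  by exists j; rewrite /aM /wM /upd (negbTE ji).
have [||M [cM PM ME]] := extM F.
- by apply: cont_onS cF.
- by move=> x /bdM; exact: PF.
pose F1 (x : V) := if x ord0 i == s%:R then M x else F x.
have F1M x : box aM wM x -> F1 x = M x by move=> /boxM[_ xi]; rewrite /F1 xi eqxx.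
have F1F x : box_bd a w x -> F1 x = F x.
  by move=> xb; rewrite /F1; case: eqP => // xi; rewrite ME //; exact: bd_ne.
have cF1 : cont_on (box_bd a w `|` box aM wM) F1.
  apply: cont_on_closedU; [exact: box_bd_closed|exact: box_closed| |].
    by apply: cont_on_eq cF => x xb; rewrite F1F.
  by apply: cont_on_eq cM => x xb; rewrite F1M.
have PF1 x : (box_bd a w `|` box aM wM) x -> Pr x (F1 x).
  by move=> [xb|xb]; [rewrite F1F//; exact: PF|rewrite F1M//; exact: PM].
have bdL x : box_bd a wL x -> (box_bd a w `|` box aM wM) x.
  move=> [/boxL[xb xi] [j]]; rewrite /wL /upd; case: eqP => [->|ji] wj xj.
    case: xj => xj; first by left; split=> //; exists i; [exact: ltnW|left].
    by right; apply/boxM; split=> //; rewrite xj addn1.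
  by left; split=> //; exists j.
have bdU x : box_bd aM wU x -> (box_bd a w `|` box aM wM) x.
  move=> [/boxU[xb xi] [j]]; rewrite /aM /wU /upd; case: eqP => [->|ji] wj xj.
    case: xj => xj; first by right; apply/boxM.
    by left; split=> //; exists i; [exact: ltnW|right; rewrite xj ss].
  by left; split=> //; exists j.
have [||L [cL PL LE]] := extL F1.
- exact: cont_onS cF1.
- by move=> x /bdL; exact: PF1.
have [||U [cU PU UE]] := extU F1.
- exact: cont_onS cF1.
- by move=> x /bdU; exact: PF1.
pose F2 (x : V) := if x ord0 i <= s%:R then L x else U x.
have seam x : box a w x -> x ord0 i = s%:R -> L x = U x.
  move=> xb xi; rewrite LE ?UE //; split.
  - by apply/boxU; rewrite xi.
  - by exists i; rewrite /aM /wU /upd eqxx ?xi; [rewrite -subn1 subn_gt0|left].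
  - by apply/boxL; rewrite xi.
  - by exists i; rewrite /wL /upd eqxx // addn1 xi; right.
have F2L x : box a wL x -> F2 x = L x by move=> /boxL[_ xi]; rewrite /F2 xi.
have F2U x : box aM wU x -> F2 x = U x.
  move=> /boxU[xb xi]; rewrite /F2; case: ifP => // xi'.
  by apply: seam => //; apply/eqP; rewrite eq_le xi xi'.
have LU x : box a w x -> box a wL x \/ box aM wU x.
  move=> xb; have [xi|/ltW xi] := leP (x ord0 i) s%:R; [left|right].
    by apply/boxL.
  by apply/boxU.
exists F2; split.
- apply: (@cont_onS _ _ _ (box a wL `|` box aM wU)); first by move=> x /LU.
  apply: cont_on_closedU; [exact: box_closed|exact: box_closed| |].
    by apply: cont_on_eq cL => x xb; rewrite F2L.
  by apply: cont_on_eq cU => x xb; rewrite F2U.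
- by move=> x /LU[] xb; [rewrite F2L//; exact: PL|rewrite F2U//; exact: PU].
- move=> x [xb [j wj xj]]; rewrite -F1F; last by split=> //; exists j.
  have [xL|xU] := LU x xb.
    rewrite F2L // LE //; split=> //; have [ji|ji] := eqVneq j i; last first.
      by exists j; rewrite /wL /upd (negbTE ji).
    exists i; rewrite /wL /upd eqxx //; move: xj; rewrite ji => -[xi|xi]; first by left.
    by case/boxL: xL => _; rewrite xi leNgt lt2.
  rewrite F2U // UE //; split=> //; have [ji|ji] := eqVneq j i; last first.
    by exists j; rewrite /aM /wU /upd (negbTE ji).
  exists i; rewrite /aM /wU /upd eqxx ?ss; first by rewrite -subn1 subn_gt0.
  move: xj; rewrite ji => -[xi|xi]; last by right.
  by case/boxU: xU => _; rewrite xi leNgt lt1.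
Qed.

Lemma box_extension : (forall a w, (forall i, (a i + w i <= N)%N) ->
    (forall i, (w i <= 1)%N) -> box_ext a w) ->
  forall a w, (forall i, (a i + w i <= N)%N) -> box_ext a w.
Proof.
move=> base a w; have [k] := ubnP (\sum_j w j)%N.
elim: k a w => // k ih a w; rewrite ltnS => wk aN.
have [w1|] := pselect (forall i, (w i <= 1)%N); first exact: base.
move=> /existsNP[i /negP]; rewrite -ltnNge => wi.
have aN' j : (upd a i (a i).+1 j + upd w i 0 j <= N)%N /\
    (upd a i (a i).+1 j + upd w i (w i).-1 j <= N)%N /\ (a j + upd w i 1 j <= N)%N.
  by have := aN j; rewrite /upd; case: eqP => [->|_]; lia.
apply: (box_ext_split wi); apply: ih => [|j]; try by case: (aN' j) => ? [].
all: by apply: leq_trans wk; apply: sum_upd; lia.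
Qed.

End BoxExtension.

Section FacetCoordinates.
Variables (R : realType) (n : nat) (a w : 'I_n -> nat).
Hypothesis w1 : forall i, (w i <= 1)%N.
Local Notation V := 'rV[R]_n.

Definition facet_dirs : {set 'I_n} := [set i | w i == 1%N].
Definition facet_dim : nat := #|facet_dirs|.
Local Notation m := facet_dim.

Definition facet_in (y : 'rV[R]_m) : V := \row_i
  ((a i)%:R + if pselect (i \in facet_dirs) is left h
    then (1 + y ord0 (enum_rank_in h i)) / 2 else 0).

Definition facet_out (x : V) : 'rV[R]_m := \row_j
  (2 * (x ord0 (enum_val j) - (a (enum_val j))%:R) - 1).

Lemma facet_in_dir y (j : 'I_m) :
  facet_in y ord0 (enum_val j) = (a (enum_val j))%:R + (1 + y ord0 j) / 2.
Proof.
rewrite mxE; case: pselect => [h|[]]; last exact: enum_valP.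
by congr (_ + (1 + y _ _) / _); rewrite enum_valK_in.
Qed.

Lemma facet_in_const y i : i \notin facet_dirs -> facet_in y ord0 i = (a i)%:R.
Proof. by move=> h; rewrite mxE; case: pselect => [h'|_]; [rewrite h' in h|rewrite addr0]. Qed.

Lemma facet_dirP i : i \in facet_dirs -> exists j : 'I_m, i = enum_val j.
Proof. by move=> h; exists (enum_rank_in h i); rewrite enum_rankK_in. Qed.

Lemma facet_width i : (w i = if i \in facet_dirs then 1 else 0)%N.
Proof. by rewrite inE; have := w1 i; case: (w i) => [|[|]]. Qed.

Lemma facet_inK y : facet_out (facet_in y) = y.
Proof. by apply/rowP => j; rewrite mxE facet_in_dir; field. Qed.

Lemma facet_outK x : box a w x -> facet_in (facet_out x) = x.
Proof.
move=> xb; apply/rowP => i; have [h|h] := boolP (i \in facet_dirs).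
  by have [j ->] := facet_dirP h; rewrite facet_in_dir mxE; field.
rewrite facet_in_const //; have := xb i; rewrite facet_width (negbTE h) addn0.
by move=> /andP[h1 h2]; apply/eqP; rewrite eq_le h1 h2.
Qed.

Lemma facet_in_box y : `|y| <= 1 -> box a w (facet_in y).
Proof.
move=> /(norm_leP _ ler01) y1 i; rewrite facet_width; case: ifP => [h|/negbT h].
  have [j ->] := facet_dirP h; rewrite facet_in_dir natrD.
  by have := y1 j; rewrite ler_norml; lra.
by rewrite facet_in_const // addn0 lexx.
Qed.

Lemma facet_out_norm x : box a w x -> `|facet_out x| <= 1.
Proof.
move=> xb; apply/(norm_leP _ ler01) => j; rewrite mxE.
have := xb (enum_val j); rewrite facet_width enum_valP natrD ler_norml.
lra.
Qed.

Lemma facet_bdP x : box a w x -> (box_bd a w x <-> `|facet_out x| = 1).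
Proof.
move=> xb; split=> [[_ [i wi xi]]|x1].
  have h : i \in facet_dirs by rewrite inE; have := w1 i; case: (w i) wi => [|[|]].
  apply/eqP; rewrite eq_le facet_out_norm //=.
  have [j e] := facet_dirP h.
  apply: le_trans (coord_le_norm _ j); rewrite mxE -e.
  have wi1 : w i = 1%N by rewrite facet_width h.
  case: xi => ->; first by rewrite subrr mulr0 sub0r normrN normr1.
  by rewrite wi1 natrD ger0_norm; lra.
split=> //; have [|j e] := @norm_attained R m (facet_out x); first by rewrite x1.
have wj : w (enum_val j) = 1%N by rewrite facet_width enum_valP.
exists (enum_val j); first by rewrite wj.
move: e; rewrite x1 mxE wj natrD => /esym/eqP; rewrite eqr_norml ler01 andbT.
by move=> /orP[]/eqP e; [right|left]; lra.
Qed.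

Lemma facet_in_bd u : `|u| = 1 -> box_bd a w (facet_in u).
Proof.
move=> u1; have xb : box a w (facet_in u) by apply: facet_in_box; rewrite u1.
by apply/(facet_bdP xb); rewrite facet_inK.
Qed.

Lemma facet_in_continuous : continuous facet_in.
Proof.
apply: cts_row => i.
have [h|h] := boolP (i \in facet_dirs).
  have [j ->] := facet_dirP h.
  have -> : (fun t => facet_in t ord0 (enum_val j)) =
      (fun t => (a (enum_val j))%:R + (1 + t ord0 j) / 2).
    by apply/funext => t; rewrite facet_in_dir.
  have cj : continuous (fun t : 'rV[R]_m => t ord0 j) by apply: cts_coord; cts.
  by apply: ctsDv; [cts|apply: ctsM; [apply: ctsDv; cts|cts]].
have -> : (fun t => facet_in t ord0 i) = (fun t => (a i)%:R).
  by apply/funext => t; rewrite facet_in_const.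
exact: ctscst.
Qed.

Lemma facet_out_continuous : continuous facet_out.
Proof.
apply: cts_row => j.
have -> : (fun t => facet_out t ord0 j) =
    (fun t => 2 * (t ord0 (enum_val j) - (a (enum_val j))%:R) - 1).
  by apply/funext => t; rewrite mxE.
have cj : continuous (fun t : V => t ord0 (enum_val j)) by apply: cts_coord; cts.
by cts.
Qed.

(** In a direction of width 1 an interior coordinate lies strictly between consecutive integers,
    which forces [b i = a i]; so a grid box that contains an interior point of a facet contains the
    facet. *)
Lemma facet_interior (x : V) (b : 'I_n -> nat) : box a w x -> `|facet_out x| < 1 ->
  (forall i, (b i)%:R <= x ord0 i <= (b i).+1%:R) ->
  forall x' : V, box a w x' -> forall i, (b i)%:R <= x' ord0 i <= (b i).+1%:R.
Proof.
move=> xb x1 bx x' xb' i; have [h|h] := boolP (i \in facet_dirs); last first.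
  have e (z : V) : box a w z -> z ord0 i = (a i)%:R.
    move=> zb; have := zb i; rewrite facet_width (negbTE h) addn0.
    by move=> /andP[h1 h2]; apply/eqP; rewrite eq_le h1 h2.
  by rewrite e // -(e x).
have [j e] := facet_dirP h.
have : `|facet_out x ord0 j| < 1 by apply: le_lt_trans x1; exact: coord_le_norm.
rewrite mxE -e ltr_norml => /andP[l1 l2]; have /andP[b1 b2] := bx i.
have l1' : (a i)%:R < x ord0 i by lra.
have l2' : x ord0 i < (a i).+1%:R by rewrite -[(a i).+1]addn1 natrD; lra.
have : ((b i) < (a i).+1)%N by rewrite -(ltr_nat R); exact: le_lt_trans l2'.
have : ((a i) < (b i).+1)%N by rewrite -(ltr_nat R); exact: lt_le_trans b2.
rewrite !ltnS => ab ba; have -> : b i = a i by apply/eqP; rewrite eqn_leq ab ba.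
by have := xb' i; rewrite facet_width h addn1.
Qed.

End FacetCoordinates.

Definition alex (J : Type) (le : J -> J -> Prop) : Type := J.

Section Alexandrov.
Variables (J : Type) (le : J -> J -> Prop).

HB.instance Definition _ := gen_eqMixin (alex le).
HB.instance Definition _ := gen_choiceMixin (alex le).

Definition alex_open (D : set (alex le)) := forall i j, le i j -> D j -> D i.

Lemma alex_openT : alex_open setT. Proof. by []. Qed.

Lemma alex_openI : setI_closed alex_open.
Proof. by move=> D D' oD oD' i j ij [Dj D'j]; split; [exact: oD Dj|exact: oD' D'j]. Qed.

Lemma alex_open_bigU (K : Type) (f : K -> set (alex le)) :
  (forall i, alex_open (f i)) -> alex_open (\bigcup_i f i).
Proof. by move=> of_ i j ij [k _ fk]; exists k => //; exact: of_ fk. Qed.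

HB.instance Definition _ :=
  isOpenTopological.Build (alex le) alex_openT alex_openI alex_open_bigU.

Lemma alex_openE (D : set (alex le)) :
  (forall i j, le i j -> D j -> D i) -> open D.
Proof. by []. Qed.

Lemma alex_open_le (D : set (alex le)) i j : open D -> le i j -> D j -> D i.
Proof. by move=> oD; exact: (oD : alex_open D). Qed.

End Alexandrov.

(** * Subdivision of balls and the weak equivalence from flags *)

Section Cech.
Variables (R : realType) (Y : topologicalType).
Variables (J : Type) (le : J -> J -> Prop) (meet : J -> J -> J) (O : J -> set Y).
Hypotheses (le_refl : forall i, le i i)
  (le_trans' : forall i j k, le i j -> le j k -> le i k)
  (meetP : forall i j k, le k (meet i j) <-> le k i /\ le k j).
Hypotheses (O_open : forall j, open (O j))
  (O_mono : forall i j, le i j -> O i `<=` O j)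
  (O_meet : forall i j, O i `&` O j `<=` O (meet i j))
  (O_cover : forall y, exists j, O j y).
Local Notation V n := 'rV[R]_n.
Local Notation sph n := (@unit_sphere R n).
Local Notation ball n := (@unit_ball R n).
Local Notation JA := (alex le).

(* The Alexandrov topology lets the index only decrease locally, so that maps
   given compatibly over the sets [O j] glue to a continuous map. *)
Definition flag_set : set (JA * tree R Y) :=
  [set z | good z.2 /\ tin (O z.1) z.2].
Definition flag_space : topologicalType := set_type flag_set.

Lemma flag_good (z : flag_space) : good (set_val z).2.
Proof. by case: (set_valP z). Qed.

Definition flag_tree (z : flag_space) : Qt R Y := to_set (flag_good z).
Definition flag_ev (z : flag_space) : Y := ev (flag_tree z).

Lemma flag_tree_continuous : continuous flag_tree.
Proof. by apply: continuous_to_set; apply: cts_snd; exact: set_val_continuous. Qed.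

Lemma flag_ev_continuous : continuous flag_ev.
Proof. by apply: cts_comp; [exact: ev_continuous|exact: flag_tree_continuous]. Qed.

Lemma finite_meet (K : eqType) (f : K -> J) (s : seq K) (k0 : K) : k0 \in s ->
  exists j, (forall i, le i j <-> forall k, k \in s -> le i (f k)) /\
    forall y, (forall k, k \in s -> O (f k) y) -> O j y.
Proof.
elim: s k0 => // k1 [|k2 s] ih k0 _.
  exists (f k1); split=> [i|y]; last by apply; rewrite mem_head.
  by split=> [ik k|]; [rewrite inE => /eqP ->|apply; rewrite mem_head].
have [|j [jP jO]] := ih k2; first exact: mem_head.
exists (meet (f k1) j); split=> [i|y yO].
  split=> [/meetP[i1 /jP i2] k|H]; first by rewrite inE => /orP[/eqP ->|/i2].
  apply/meetP; split; first by apply: H; rewrite mem_head.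
  by apply/jP => k ks; apply: H; rewrite inE ks orbT.
apply: O_meet; split; first by apply: yO; rewrite mem_head.
by apply: jO => k ks; apply: yO; rewrite inE ks orbT.
Qed.

Section Grid.
Variables (n M : nat).
Local Notation N := M.+1.
Variables (h : V n -> Y) (jb : {ffun 'I_n -> 'I_N} -> J).
Hypothesis ch : continuous h.

Definition gbox (b : {ffun 'I_n -> 'I_N}) : set (V n) :=
  [set x | forall i, (b i)%:R <= x ord0 i <= (b i).+1%:R].

Hypothesis h_gbox : forall b x, gbox b x -> O (jb b) (h x).

Lemma gbox_convex b x y (s : R) : 0 <= s <= 1 -> gbox b x -> gbox b y ->
  gbox b (x + s *: (y - x)).
Proof.
move=> s01 bx by_ i; rewrite !mxE; have := bx i; have := by_ i.
move: (x ord0 i) (y ord0 i) => x1 y1 /andP[h1 h2] /andP[h3 h4].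
have /andP[s0 s1] := s01; apply/andP; split; nra.
Qed.

Lemma gbox_dist b x y : gbox b x -> gbox b y -> `|x - y| <= N%:R.
Proof.
move=> bx by_; apply/norm_leP => // i; rewrite !mxE.
have := bx i; have := by_ i.
move: (x ord0 i) (y ord0 i) => x1 x2 /andP[h1 h2] /andP[h3 h4].
have b0 : 0 <= (b i)%:R :> R by [].
have bN : (b i).+1%:R <= N%:R :> R by rewrite ler_nat.
by rewrite ler_norml; lra.
Qed.

Lemma facet_gbox (a w : 'I_n -> nat) : (forall i, (a i + w i <= N)%N) ->
  (forall i, (w i <= 1)%N) ->
  exists b, box a w `<=` gbox b.
Proof.
move=> aN w1; exists [ffun i => inord (minn (a i) M)] => x xb i.
have := xb i; have := aN i; have := w1 i.
rewrite ffunE inordK ?ltnS ?geq_minr //.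
case: (w i) => [|[|//]] _ /=.
  rewrite addn0 => aiN /andP[h1 h2]; apply/andP; split.
    by apply: Order.POrderTheory.le_trans h1; rewrite ler_nat geq_minl.
  by apply: Order.POrderTheory.le_trans h2 _; rewrite ler_nat; lia.
rewrite addn1 => aiN /andP[h1 h2]; apply/andP; split.
  by apply: Order.POrderTheory.le_trans h1; rewrite ler_nat geq_minl.
by apply: Order.POrderTheory.le_trans h2 _; rewrite ler_nat; lia.
Qed.

Lemma box_gbox (x : V n) : (forall i, 0 <= x ord0 i <= N%:R) -> exists b, gbox b x.
Proof.
move=> x01; exists [ffun i => inord (minn (Num.trunc (x ord0 i)) M)] => i.
have /andP[x0 xN] := x01 i.
rewrite ffunE inordK ?ltnS ?geq_minr //.
have /andP[t1 t2] := Num.Theory.trunc_itv x0.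
apply/andP; split.
  by apply: Order.POrderTheory.le_trans t1; rewrite ler_nat geq_minl.
have [tM|tM] := leqP (Num.trunc (x ord0 i)) M.
  by rewrite ltW.
by [].
Qed.

Local Notation T := (JA * tree R Y * V n)%type.

(** The local requirement on a lift over the grid: an index, a tree subordinate to it, and the
    reparametrized point [z.2] where [h] is evaluated. This point stays in every grid box of [x], so
    that it can be coned off without leaving the set attached to the box. *)
Definition cell_sol (x : V n) (z : T) : Prop :=
  [/\ good z.1.2, tin (O z.1.1) z.1.2, evr z.1.2 (h z.2) &
    forall b, gbox b x -> le z.1.1 (jb b) /\ gbox b z.2].

Section Facet.
Variables (a w : 'I_n -> nat).
Hypotheses (aN : forall i, (a i + w i <= N)%N) (w1 : forall i, (w i <= 1)%N).
Variable F : V n -> T.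
Hypotheses (cF : cont_on (box_bd a w) F)
  (PF : forall x, box_bd a w x -> cell_sol x (F x)).

Local Notation m := (facet_dim w).
Local Notation fin := (@facet_in R n a w).
Local Notation fout := (@facet_out R n a w).

Let cfin : continuous fin. Proof. exact: facet_in_continuous. Qed.
Let cfout : continuous fout. Proof. exact: facet_out_continuous. Qed.

Let Fin u := F (fin u).
Let cFin : cont_on (sph m) Fin.
Proof.
apply: (cont_on_comp (continuous_cont_on cfin) cF) => u.
exact: facet_in_bd.
Qed.

Let center : V n := fin 0.

Let center_box : box a w center.
Proof. by apply: facet_in_box => //; rewrite normr0 ler01. Qed.

Definition facet_c (y : V m) : V n := center + `|y| *: ((Fin (dir y)).2 - center).

Let sol_bound u : `|u| = 1 -> `|(Fin u).2 - center| <= N%:R.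
Proof.
move=> u1; have bd := facet_in_bd a w1 u1.
have [b bb] := facet_gbox aN w1.
have [_ _ _ /(_ b)[]] := PF bd; first by apply: bb; case: bd.
move=> _ gb; exact: gbox_dist gb (bb _ center_box).
Qed.

Lemma facet_c_continuous : continuous facet_c.
Proof.
apply: ctsDv; first exact: ctscst.
apply: (@cone_continuous R m _ (fun u => (Fin u).2 - center) N%:R) => //.
apply: set_type_cont_on; apply: ctsDv; last exact: ctscst.
by apply: cts_snd; exact: cont_on_set_type.
Qed.

Lemma facet_c_sph u : `|u| = 1 -> facet_c u = (Fin u).2.
Proof. by move=> u1; rewrite /facet_c u1 scale1r dir_sphere // addrC subrK. Qed.

Lemma facet_c_gbox b y : box a w `<=` gbox b -> `|y| <= 1 -> gbox b (facet_c y).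
Proof.
move=> bb y1; have [->|y0] := eqVneq y 0.
  by rewrite /facet_c normr0 scale0r addr0; exact: bb.
apply: gbox_convex; first by rewrite normr_ge0.
  exact: bb.
have bd := facet_in_bd a w1 (norm_dir y0).
by have [_ _ _ /(_ b (bb _ _))[|//]] := PF bd; case: bd.
Qed.

(** One cell is attached along the trees given on the boundary, with characteristic map [h] after
    the cone [facet_c]. Its index [js] is the meet over all grid boxes containing the facet. The new
    cell occupies the inner half of the facet and the boundary values fill a collar. *)
Lemma facet_solution : exists F' : V n -> T, [/\ cont_on (box a w) F',
  forall x, box a w x -> cell_sol x (F' x) &
  forall x, box_bd a w x -> F' x = F x].
Proof.
have [b0 bb0] := facet_gbox aN w1.
pose s := [seq b <- enum {ffun 'I_n -> 'I_N} | `[< box a w `<=` gbox b >]].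
have sP b : b \in s <-> box a w `<=` gbox b.
  by rewrite mem_filter mem_enum andbT; split=> [/asboolP|?]//; exact/asboolP.
have [js [jsP jsO]] : exists j, (forall i, le i j <-> forall b, b \in s -> le i (jb b)) /\
    forall y, (forall b, b \in s -> O (jb b) y) -> O j y.
  by apply: (@finite_meet _ jb s b0); exact/sP.
have hc y : `|y| <= 1 -> O js (h (facet_c y)).
  by move=> y1; apply: jsO => b /sP bb; apply: h_gbox; exact: facet_c_gbox.
have bd_le u : `|u| = 1 -> le (Fin u).1.1 js.
  move=> u1; apply/jsP => b /sP bb; have bd := facet_in_bd a w1 u1.
  by have [_ _ _ /(_ b (bb _ _))[|//]] := PF bd; case: bd.
pose g u := (Fin u).1.2; pose hb y := h (facet_c (rc y)).
have cfc := facet_c_continuous.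
have chb : continuous hb by rewrite /hb; cts.
have cg : cont_on (sph m) g.
  apply: (@cont_on_comp _ _ _ _ setT Fin (fun z : T => z.1.2)) => //.
  by apply: continuous_cont_on; cts.
have gc : gcell (new_phi g) (fun x => hb (rc x)).
  apply: new_cell => // u u1; have [g1 g2 g3 _] := PF (facet_in_bd a w1 u1).
  by rewrite /hb rc_id ?u1 // facet_c_sph.
have tc u : tin (O js) (chi (new_phi g) (fun x => hb (rc x)) u).
  have tg v : `|v| = 1 -> tin (O js) (new_phi g v).
    move=> v1; rewrite new_phiE //; have [_ g2 _ _] := PF (facet_in_bd a w1 v1).
    by apply: tinS g2; apply: O_mono; exact: bd_le.
  rewrite /chi; case: ifP => [_|/negbT]; last first.
    rewrite -leNgt => u1; have [u1'|u1'] := eqVneq `|u| 1; first exact: tg.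
    by rewrite /new_phi (negbTE u1').
  by split=> // x; apply: hc; exact: norm_rc_le1.
pose l (z : V m) : tree R Y * V n :=
  (chi (new_phi g) (fun x => hb (rc x)) (rc z), facet_c (rc z)).
pose K (u : V m) (_ : R) : tree R Y * V n := ((Fin u).1.2, (Fin u).2).
pose G x := collar l K (fout x).
pose k1 x : JA := if 2 * `|fout x| <= 1 then js else (Fin (dir (fout x))).1.1.
have cG : continuous G.
  apply: (@collar_continuous R m _ _ fout (fun=> l) (fun=> K)) => //.
  - apply: cts_pair; last by cts.
    apply: (@cont_onT _ _ setT) => //.
    apply: (@cont_on_comp _ _ _ _ (ball m) (fun q : V n * V m => rc q.2)
      (chi (new_phi g) (fun x => hb (rc x)))).
    + by apply: continuous_cont_on; cts.
    + exact: chi_cont_on.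
    + by move=> q _; exact: norm_rc_le1.
  - apply: (@cont_on_comp _ _ _ _ (sph m) (fun q : V n * (V m * R) => q.2.1)
      (fun u => K u 0)).
    + by apply: continuous_cont_on; cts.
    + apply: (@cont_on_comp _ _ _ _ setT Fin (fun z : T => (z.1.2, z.2))) => //.
      by apply: continuous_cont_on; cts.
    + by move=> q [].
  - move=> _ u u1; rewrite /l /K rc_id ?u1 // chi_sph // new_phiE //.
    by rewrite facet_c_sph.
have out0 x : 1 < 2 * `|fout x| -> fout x != 0.
  by move=> x1; rewrite -normr_eq0; apply/eqP => e; lra.
(* The index jumps from [js] to the boundary indices where the collar begins. These lie below [js],
   and a downward jump on an open set is continuous for the Alexandrov topology. *)
have ck1 : cont_on (box a w) k1.
  move=> x xb D oD Dx; have [Djs|Djs] := pselect (D js).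
    exists setT; split=> //; first exact: openT.
    move=> y _ yb; rewrite /k1; case: leP => // y1.
    by apply: alex_open_le oD (bd_le _ _) Djs; apply: norm_dir; exact: out0.
  have x1 : 1 < 2 * `|fout x| by move: Dx; rewrite /k1; case: leP.
  have Dx' : D (Fin (dir (fout x))).1.1 by move: Dx; rewrite /k1 leNgt x1.
  have : cont_on [set x | 1 < 2 * `|fout x|] (fun x => (Fin (dir (fout x))).1.1 : JA).
    apply: (@cont_on_comp _ _ _ _ (sph m) (fun x => dir (fout x)) (fun u => (Fin u).1.1 : JA)).
    + apply: (@cont_on_comp _ _ _ _ [set y : V m | y != 0] fout (@dir R m)).
      * exact: continuous_cont_on.
      * exact: dir_cont_on.
      * by move=> y /= y1; exact: out0.
    + apply: (@cont_on_comp _ _ _ _ setT Fin (fun z : T => z.1.1)) => //.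
      by apply: continuous_cont_on; cts.
    + by move=> y /= y1; apply: norm_dir; exact: out0.
  move=> /(_ x x1 D oD Dx')[U [oU Ux UD]].
  exists (U `&` [set y | 1 < 2 * `|fout y|]); split=> //.
    by apply: openI => //; apply: open_lt_cts; cts.
  by move=> y [Uy /= y1] _; rewrite /k1 leNgt y1 /=; exact: UD.
exists (fun x => (k1 x, (G x).1, (G x).2)); split.
- apply: cont_on_pair; last by apply: continuous_cont_on; apply: cts_snd.
  by apply: cont_on_pair => //; apply: continuous_cont_on; apply: cts_fst.
- move=> x xb; have x1 := facet_out_norm w1 xb.
  have int b : `|fout x| < 1 -> gbox b x -> box a w `<=` gbox b.
    by move=> x1' bx x' xb'; exact: (facet_interior w1 xb x1' bx xb').
  rewrite /cell_sol /k1 /G /collar; case: leP => x2 /=.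
    have n2 : `|2 *: fout x| <= 1 by rewrite normrZ ger0_norm.
    rewrite (rc_id n2); split.
    + exact: chi_good.
    + exact: tc.
    + by have := chi_evr gc n2; rewrite /hb (rc_id n2) (rc_id n2).
    + move=> b bx; have bb := int b _ bx.
      have bx' : box a w `<=` gbox b by apply: bb; lra.
      split; last exact: facet_c_gbox.
      by have [+ _] := jsP js; apply; [exact: le_refl|exact/sP].
  have d1 := norm_dir (out0 _ x2); have bd := facet_in_bd a w1 d1.
  have [p1 p2 p3 p4] := PF bd; split=> // b bx; apply: p4.
  have [x3|x3] := eqVneq `|fout x| 1; first by rewrite dir_sphere // facet_outK.
  by apply: (int b) => //; [rewrite lt_neqAle x3|case: bd].
- move=> x xbd; have xb := xbd.1; have := (facet_bdP w1 xb).1 xbd => x1.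
  rewrite /G collar_sphere // /k1 x1 ifF; last by apply/negbTE; rewrite -ltNge; lra.
  by rewrite dir_sphere // /K /Fin facet_outK //; case: (F x) => -[].
Qed.

End Facet.

Lemma grid_solution (F : V n -> T) : cont_on (box_bd (fun=> 0%N) (fun=> N)) F ->
  (forall x, box_bd (fun=> 0%N) (fun=> N) x -> cell_sol x (F x)) ->
  exists F' : V n -> T, [/\ cont_on (box (fun=> 0%N) (fun=> N)) F',
  forall x, box (fun=> 0%N) (fun=> N) x -> cell_sol x (F' x) &
  forall x, box_bd (fun=> 0%N) (fun=> N) x -> F' x = F x].
Proof.
apply: (@box_extension R n N _ cell_sol) => [a w aN w1 F0 cF0 PF0|i]; last first.
  by rewrite add0n.
exact: facet_solution.
Qed.

End Grid.

Section Scaling.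
Variables (n M : nat).
Local Notation N := M.+1.

Definition grid_out (x : V n) : V n := (2 / N%:R) *: x - const_mx 1.
Definition grid_in (y : V n) : V n := (N%:R / 2) *: (y + const_mx 1).

Let N0 : 0 < N%:R :> R. Proof. by rewrite ltr0n. Qed.

Let N2 : (2 / N%:R) * (N%:R / 2) = 1 :> R.
Proof. by rewrite mulf_div [2 * _]mulrC divff // mulf_neq0 ?pnatr_eq0. Qed.

Lemma grid_inK y : grid_out (grid_in y) = y.
Proof. by rewrite /grid_out /grid_in scalerA N2 scale1r addrK. Qed.

Lemma grid_out_continuous : continuous grid_out.
Proof. by rewrite /grid_out; cts. Qed.

Lemma grid_in_continuous : continuous grid_in.
Proof. by rewrite /grid_in; cts. Qed.

Lemma grid_out_coord x i : grid_out x ord0 i = 2 * (x ord0 i / N%:R) - 1.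
Proof. by rewrite !mxE mulrA mulrAC. Qed.

Lemma grid_coordP (x : R) : 0 <= x <= N%:R <-> `|2 * (x / N%:R) - 1| <= 1.
Proof.
rewrite ler_norml; have -> : x = (x / N%:R) * N%:R by rewrite divfK ?gt_eqF.
move: (x / _) => y; rewrite mulfK ?gt_eqF //.
split=> /andP[h1 h2]; apply/andP; split.
- move: h1; rewrite pmulr_lge0 //; lra.
- move: h2; rewrite ger_pMl //; lra.
- rewrite pmulr_lge0 //; lra.
- rewrite ger_pMl //; lra.
Qed.

Lemma grid_boxP x : box (fun=> 0%N) (fun=> N) x <-> `|grid_out x| <= 1.
Proof.
split=> [xb|/(norm_leP _ ler01) x1 i].
  apply/(norm_leP _ ler01) => i; rewrite grid_out_coord.
  by apply/grid_coordP; have := xb i; rewrite add0n.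
by rewrite add0n; apply/grid_coordP; rewrite -grid_out_coord.
Qed.

Lemma grid_bdP x : box_bd (fun=> 0%N) (fun=> N) x <-> `|grid_out x| = 1.
Proof.
split=> [[xb [i _ xi]]|x1].
  apply/eqP; rewrite eq_le (grid_boxP x).1 //=.
  apply: Order.POrderTheory.le_trans (coord_le_norm _ i); rewrite grid_out_coord.
  case: xi => ->; first by rewrite mul0r mulr0 sub0r normrN normr1.
  by rewrite add0n divff ?gt_eqF // mulr1 ger0_norm; lra.
have xb : box (fun=> 0%N) (fun=> N) x by apply/grid_boxP; rewrite x1.
split=> //; have [|i] := @norm_attained R n (grid_out x); first by rewrite x1.
rewrite x1 grid_out_coord => /esym/eqP; rewrite eqr_norml ler01 andbT => e.
exists i => //; have : x ord0 i = (x ord0 i / N%:R) * N%:R by rewrite divfK ?gt_eqF.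
move: e; move: (x ord0 i / _) => z e ->.
case/orP: e => /eqP e; [right|left].
  by have -> : z = 1; [lra|exact: mul1r].
by have -> : z = 0; [lra|exact: mul0r].
Qed.

Lemma grid_gbox_dist (b : {ffun 'I_n -> 'I_N}) x y : gbox b x -> gbox b y ->
  `|grid_out x - grid_out y| <= 2 / N%:R.
Proof.
move=> bx by_; rewrite /grid_out opprB addrA subrK -scalerBr.
have c0 : 0 <= 2 / N%:R :> R by rewrite divr_ge0.
rewrite normrZ ger0_norm // ler_piMr //; apply/(norm_leP _ ler01) => i.
rewrite !mxE; have := bx i; have := by_ i.
move: (x ord0 i) (y ord0 i) => x1 y1; rewrite -[(b i).+1]addn1 natrD.
by rewrite ler_norml => /andP[h1 h2] /andP[h3 h4]; lra.
Qed.

Lemma gbox_sub (b : {ffun 'I_n -> 'I_N}) : gbox b `<=` box (fun=> 0%N) (fun=> N).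
Proof.
move=> x xb i; have /andP[h1 h2] := xb i; rewrite add0n; apply/andP; split.
  exact: Order.POrderTheory.le_trans h1.
by apply: Order.POrderTheory.le_trans h2 _; rewrite ler_nat.
Qed.

Lemma gbox_corner (b : {ffun 'I_n -> 'I_N}) : gbox b (\row_i (b i)%:R).
Proof. by move=> i; rewrite mxE lexx ler_nat leqnSn. Qed.

End Scaling.

(** Around each point of the ball some index [j] has [h] in [O j] and the indices of [g] below [j].
    A grid subordinate to these neighbourhoods is filled facet by facet; the cones over the facets
    move points inside their boxes, which accounts for the reparametrization in [wlp]. *)
Lemma flag_wlp : wlp R flag_ev.
Proof.
split=> [y|n g h cg ch gh].
  have [j jy] := O_cover y.
  have jz : flag_set (j, vertex R y) by split; [exact: vertex_good|split].
  exists (to_set jz); apply: ev_eq => /=; exact: erefl.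
have [j0 _] := O_cover (h 0).
have cv : continuous (@set_val _ flag_set) by exact: set_val_continuous.
have [jN jNP] : exists jN : V n -> J * set (V n), forall u, `|u| <= 1 ->
    [/\ open (jN u).2, (jN u).2 u & forall v, (jN u).2 v -> `|v| <= 1 ->
      O (jN u).1 (h v) /\ (`|v| = 1 -> le (set_val (g v)).1 (jN u).1)].
  suff /choice[jN ?] : forall u : V n, exists jN : J * set (V n), `|u| <= 1 -> [/\ open jN.2, jN.2 u &
      forall v, jN.2 v -> `|v| <= 1 -> O jN.1 (h v) /\
        (`|v| = 1 -> le (set_val (g v)).1 jN.1)] by exists jN.
  move=> u; have [u1|u1] := eqVneq `|u| 1.
    pose j : J := (set_val (g u)).1.
    have oD : open [set i : JA | le i j].
      by apply: alex_openE => i i' ii' i'j; exact: le_trans' i'j.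
    have oD' : open [set z : flag_space | le (set_val z).1 j].
      have c1 : continuous (fun z : flag_space => (set_val z).1) by cts.
      by move/continuousP: c1 => /(_ _ oD).
    have [N [oN Nu NP]] := cg u u1 _ oD' (le_refl j).
    exists (j, N `&` h @^-1` O j) => _; split=> /=.
    - by apply: openI => //; move/continuousP: ch; apply; exact: O_open.
    - split=> //; rewrite /preimage /= -gh //.
      have [_ gt] := set_valP (g u); apply: tin_evr gt _.
      exact: (evP (flag_tree (g u))).
    - by move=> v [Nv Ov] _; split=> // v1; exact: NP.
  have [j ju] := O_cover (h u); exists (j, [set v | `|v| < 1] `&` h @^-1` O j) => u1'.
  split=> /=.
  - apply: openI; first by apply: open_lt_cts; cts.
    by move/continuousP: ch; apply; exact: O_open.
  - by split=> //=; rewrite lt_neqAle u1.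
  - by move=> v [/= v1 Ov] _; split=> // v1'; move: v1; rewrite v1' ltxx.
have [|e e0 eP] := @compact_lebesgue R n (@unit_ball R n) (fun u => (jN u).2)
  (@unit_ball_compact R n).
  by move=> u u1; have [] := jNP u u1.
(* The ball has side 2, so the boxes of a grid with [M.+1] steps have diameter [2 / M.+1], below the
   Lebesgue number [e]. *)
pose M := Num.trunc (2 / e).
have Me : 2 / M.+1%:R < e.
  have /andP[_] : M%:R <= 2 / e < M.+1%:R.
    by apply: Num.Theory.trunc_itv; rewrite divr_ge0 // ltW.
  by rewrite ltr_pdivrMr // ltr_pdivrMr ?ltr0n // mulrC.
have [jb jbP] : exists jb : {ffun 'I_n -> 'I_M.+1} -> J, forall b x, gbox b x ->
    O (jb b) (h (grid_out M x)) /\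
    (`|grid_out M x| = 1 -> le (set_val (g (grid_out M x))).1 (jb b)).
  suff /choice[jb ?] : forall b : {ffun 'I_n -> 'I_M.+1}, exists j, forall x, gbox b x ->
      O j (h (grid_out M x)) /\
      (`|grid_out M x| = 1 -> le (set_val (g (grid_out M x))).1 j) by exists jb.
  move=> b; have cb := gbox_corner b.
  have [u u1 uP] := eP (grid_out M (\row_i (b i)%:R)) ((grid_boxP M _).1 (gbox_sub cb)).
  exists (jN u).1 => x bx; have [_ _ H] := jNP u u1.
  apply: H; last by apply/grid_boxP; exact: gbox_sub bx.
  apply: uP; rewrite -ball_normE /=.
  by apply: Order.POrderTheory.le_lt_trans Me; exact: grid_gbox_dist cb bx.
have cgo := @grid_out_continuous n M; have cgi := @grid_in_continuous n M.
pose F (x : V n) : JA * tree R Y * V n :=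
  ((set_val (g (grid_out M x))).1, (set_val (g (grid_out M x))).2, x).
have [||||F' [cF' PF' FE]] := @grid_solution n M (fun x => h (grid_out M x)) jb _ _ F.
- by cts.
- by move=> b x bx; case: (jbP b x bx).
- have cgg : cont_on (box_bd (fun=> 0%N) (fun=> M.+1)) (fun x => set_val (g (grid_out M x))).
    apply: (@cont_on_comp _ _ _ _ (sph n) (grid_out M) (fun u => set_val (g u))).
    + exact: continuous_cont_on.
    + exact: (cont_on_comp cg (continuous_cont_on (A := setT) cv)).
    + by move=> x /grid_bdP.
  apply: (@cont_on_comp _ _ _ _ setT
    (fun x => (set_val (g (grid_out M x)), x)) (fun z => (z.1.1, z.1.2, z.2))) => //.
    by apply: cont_on_pair => //; apply: continuous_cont_on; cts.
  by apply: continuous_cont_on; cts.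
- move=> x xb; have x1 := (grid_bdP M x).1 xb.
  have [g1 g2] := set_valP (g (grid_out M x)); split=> //=.
  + by rewrite -gh //; exact: (evP (flag_tree (g (grid_out M x)))).
  + by move=> b bx; split=> //; exact: (jbP b x bx).2.
have inb (x : V n) : box (fun=> 0%N) (fun=> M.+1) (grid_in M (rc x)).
  by apply/grid_boxP; rewrite grid_inK norm_rc_le1.
have fP (x : V n) : flag_set (F' (grid_in M (rc x))).1 by have [] := PF' _ (inb x).
have cF'' : continuous (fun x => F' (grid_in M (rc x))).
  apply: (@cont_onT _ _ setT) => //.
  apply: (@cont_on_comp _ _ _ _ _ (fun x => grid_in M (rc x)) F' _ cF').
    by apply: continuous_cont_on; cts.
  by move=> x _; exact: inb.
exists (fun x => to_set (fP x)), (fun x => grid_out M (F' (grid_in M (rc x))).2).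
have bdE u : `|u| = 1 -> F' (grid_in M (rc u)) = F (grid_in M u).
  by move=> u1; rewrite rc_id ?u1 // FE //; apply/grid_bdP; rewrite grid_inK.
split.
- by apply: continuous_to_set; cts.
- by cts.
- move=> u u1; split; last by rewrite bdE //= grid_inK.
  apply: val_inj; change ((F' (grid_in M (rc u))).1 = set_val (g u)).
  by rewrite bdE // /F grid_inK /=; case: (set_val (g u)).
- move=> x x1; apply/grid_boxP.
  have [|b bx] := @box_gbox n M (grid_in M (rc x)).
    by move=> i; have := inb x i; rewrite add0n.
  by have [_ _ _ /(_ b bx)[_ /gbox_sub]] := PF' _ (inb x).
- move=> x x1; apply: ev_eq; have [_ _ + _] := PF' _ (inb x).
  by [].
Qed.

End Cech.

(** * The Quillen model structure *)

Section CoarseTrees.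
Variable R : realType.
Local Notation V n := 'rV[R]_n.
Local Notation sph n := (@unit_sphere R n).

(* The cells of a coarse tree carry open collars |t| > 1 along the cells below
   them, so that each cell is a retract of an open set. *)
Inductive ctree (D : nat -> Type) :=
| cleaf
| cnode (n : nat) (phi : V n -> ctree D) (d : D n) (t : V n).

Arguments cleaf {D}.

Section Chains.
Variable D : nat -> Type.
Local Notation ctree := (ctree D).

Record cell := Cell { cdim : nat; cphi : V cdim -> ctree; cdat : D cdim }.

Arguments cphi c x : clear implicits.

(** [e] lies in the open neighbourhood of the cell [c] and retracts to its point [t]. A point in the
    collar [1 < |u|] of a cell also belongs to the neighbourhoods of the cells that contain its
    radial projection [phi (dir u)], with the same coordinates. *)
Fixpoint in_chain (e : ctree) (c : cell) (t : V (cdim c)) : Prop :=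
  match e with
  | cleaf => False
  | cnode n phi d u => cnode phi d u = cnode (cphi c) (cdat c) t \/
      (1 < `|u| /\ in_chain (phi (dir u)) t)
  end.

Arguments in_chain e c t : clear implicits.

Lemma cnode_inj n (phi phi' : V n -> ctree) d d' (t t' : V n) :
  cnode phi d t = cnode phi' d' t' -> [/\ phi = phi', d = d' & t = t'].
Proof.
have inj (F : nat -> Type) (x y : F n) : existT F n x = existT F n y -> x = y.
  exact: (Eqdep_dec.inj_pair2_eq_dec _ PeanoNat.Nat.eq_dec).
by case=> h1 h2 h3; rewrite (inj _ _ _ h1) (inj _ _ _ h2) (inj _ _ _ h3).
Qed.

Lemma cnode_cell n (phi : V n -> ctree) d u (c : cell) (t : V (cdim c)) :
  cnode phi d u = cnode (cphi c) (cdat c) t -> Cell phi d = c.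
Proof.
case: c t => m phi' d' t /= H; have e : n = m by case: H.
by subst m; have [-> -> _] := cnode_inj H.
Qed.

(* The attaching maps of the cells of a chain are well-founded trees. *)
Lemma chain_irrefl e c t : in_chain e c t -> forall u t', ~ in_chain (cphi c u) c t'.
Proof.
elim: e c t => // n phi ih d u0 c t /= [/cnode_cell <-|[_ /ih//]] u t' h.
exact: (ih u _ t' h u t' h).
Qed.

(** Following the radial projections, a point descends through a single sequence of cells, so any
    two cells of its chain are comparable. *)
Lemma chain_cases e c t c' t' : in_chain e c t -> in_chain e c' t' ->
  [\/ 1 < `|t| /\ in_chain (cphi c (dir t)) c' t', c = c' |
      1 < `|t'| /\ in_chain (cphi c' (dir t')) c t].
Proof.
elim: e c t c' t' => // n phi ih d u c t c' t' [h|[u1 h]] [h'|[u1' h']].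
- by apply: Or32; rewrite -(cnode_cell h) -(cnode_cell h').
- have ec := cnode_cell h; subst c; have [_ _ e] := cnode_inj h.
  by apply: Or31; rewrite -e.
- have ec := cnode_cell h'; subst c'; have [_ _ e] := cnode_inj h'.
  by apply: Or33; rewrite -e.
- exact: ih h h'.
Qed.

Lemma chain_uniq e c t t' : in_chain e c t -> in_chain e c t' -> t = t'.
Proof.
elim: e c t t' => // n phi ih d u c t t' /= [h|[u1 h]] [h'|[_ h']]; last exact: ih h h'.
- by move: h'; rewrite h => /cnode_inj[].
- have ec := cnode_cell h; subst c.
  by case: (@chain_irrefl (cnode phi d t) (Cell phi d) t _ (dir u) t' h'); left.
- have ec := cnode_cell h'; subst c.
  by case: (@chain_irrefl (cnode phi d t) (Cell phi d) t _ (dir u) t h); left.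
Qed.

Definition csub (c : cell) (W : set (V (cdim c))) : set ctree :=
  [set e | exists2 t, in_chain e c t & W t].

HB.instance Definition _ := gen_eqMixin ctree.
HB.instance Definition _ := gen_choiceMixin ctree.

(** The topology with the sets [csub W] as subbase: the coarsest one in which the neighbourhoods of
    the cells are open and the retractions [coord] on them are continuous. *)
Definition ctree_open (U : set ctree) := forall e, U e ->
  exists L : seq (set ctree),
    (forall B, List.In B L -> B e /\ exists c W, open W /\ B = @csub c W) /\
    forall e', (forall B, List.In B L -> B e') -> U e'.

Lemma ctree_openT : ctree_open setT.
Proof. by move=> e _; exists [::]. Qed.

Lemma ctree_openI : setI_closed ctree_open.
Proof.
move=> U U' oU oU' e [/oU[L [Le LU]] /oU'[L' [Le' LU']]].
exists (L ++ L'); split=> [B /List.in_app_iff[/Le|/Le']//|e' h].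
by split; [apply: LU|apply: LU'] => B BL; apply: h; apply/List.in_app_iff; auto.
Qed.

Lemma ctree_open_bigU (I : Type) (f : I -> set ctree) :
  (forall i, ctree_open (f i)) -> ctree_open (\bigcup_i f i).
Proof.
move=> of_ e [i _ fe]; have [L [Le LU]] := of_ i e fe.
by exists L; split=> // e' h; exists i => //; exact: LU.
Qed.

HB.instance Definition _ := isOpenTopological.Build ctree
  ctree_openT ctree_openI ctree_open_bigU.

Lemma csub_open c (W : set (V (cdim c))) : open W -> open (csub W).
Proof.
move=> oW; have h : ctree_open (csub W).
  move=> e We; exists [:: csub W]; split=> [B [<-|[]]|e' h]; last by apply: h; left.
  by split=> //; exists c, W.
exact: h.
Qed.

Lemma ctree_cont_on (T : topologicalType) (A : set T) (f : T -> ctree) :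
  (forall c (W : set (V (cdim c))) x, open W -> A x -> csub W (f x) ->
    exists N, [/\ open N, N x & forall y, N y -> A y -> csub W (f y)]) ->
  cont_on A f.
Proof.
move=> H x Ax U oU Ux; have [L [Le LU]] := (oU : ctree_open U) _ Ux.
have [N [oN Nx NL]] : exists N, [/\ open N, N x &
    forall y, N y -> A y -> forall B, List.In B L -> B (f y)].
  elim: L Le {LU} => [|B L ih] Le.
    by exists setT; split=> //; exact: openT.
  have [|N [oN Nx NL]] := ih; first by move=> B' B'L; apply: Le; right.
  have [Bx [c [W [oW BE]]]] := Le B (or_introl erefl).
  rewrite BE in Bx; have [N' [oN' N'x N'B]] := H c W x oW Ax Bx.
  exists (N `&` N'); split=> //; first exact: openI.
  move=> y [Ny N'y] Ay B' [<-|B'L]; first by rewrite BE; exact: N'B.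
  exact: NL.
by exists N; split=> // y Ny Ay; apply: LU; exact: NL.
Qed.

Definition csupp (c : cell) : set ctree := [set e | exists t, in_chain e c t].

Definition coord (c : cell) (e : ctree) : V (cdim c) :=
  if pselect (exists t, in_chain e c t) is left h then projT1 (cid h) else 0.

Lemma coordP c e : csupp c e -> in_chain e c (coord c e).
Proof. by move=> h; rewrite /coord; case: pselect => // h'; case: cid. Qed.

Lemma coordE c e t : in_chain e c t -> coord c e = t.
Proof. by move=> h; apply: (chain_uniq _ h); apply: coordP; exists t. Qed.

Lemma csupp_open c : open (csupp c).
Proof.
have -> : csupp c = csub (setT : set (V (cdim c))).
  by apply/seteqP; split=> e [t]; exists t.
by apply: csub_open; exact: openT.
Qed.

Lemma coord_cont_on c : cont_on (csupp c) (coord c).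
Proof.
move=> e ce W oW We; exists (csub W); split; first exact: csub_open.
  by exists (coord c e) => //; exact: coordP.
by move=> e' [t h Wt] _; rewrite (coordE h).
Qed.

Variable agr : forall n m, D n -> D m -> set (V n * V m) -> Prop.

(** The set given to [agr] consists of the pairs of coordinates, in the new cell and in [c], of the
    points of their overlap; there the data of the two cells have to agree. *)
Fixpoint cgood (e : ctree) : Prop :=
  match e with
  | cleaf => False
  | cnode n phi d t =>
      [/\ cont_on (sph n) phi, forall u, `|u| = 1 -> cgood (phi u) &
        forall c : cell, agr d (cdat c)
          [set q | 1 < `|q.1| /\ in_chain (phi (dir q.1)) c q.2]]
  end.

Definition ccell n (phi : V n -> ctree) (d : D n) :=
  [/\ cont_on (sph n) phi, forall u, `|u| = 1 -> cgood (phi u) &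
    forall c : cell, agr d (cdat c)
      [set q | 1 < `|q.1| /\ in_chain (phi (dir q.1)) c q.2]].

Lemma gt1_neq0 n (u : V n) : 1 < `|u| -> u != 0.
Proof. by move=> u1; rewrite -normr_eq0; apply/eqP => e; move: u1; rewrite e; lra. Qed.

Lemma chain_ccell e c t : cgood e -> in_chain e c t -> ccell (cphi c) (cdat c).
Proof.
elim: e c t => // n phi ih d u c t ge [h|[u1 h]].
  by have ec := cnode_cell h; subst c.
by apply: ih h; case: ge => _ + _; apply; apply: norm_dir; exact: gt1_neq0.
Qed.

Lemma collar_nbhd n (phi : V n -> ctree) c (W : set (V (cdim c))) (x : V n) :
  cont_on (sph n) phi -> open W -> x != 0 -> csub W (phi (dir x)) ->
  exists N, [/\ open N, N x & forall y, N y -> y != 0 /\ csub W (phi (dir y))].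
Proof.
move=> cphi oW x0 Wx.
have [N [oN Nx NW]] := cphi _ (norm_dir x0) _ (csub_open oW) Wx.
have [N' [oN' N'x N'N]] := @dir_cont_on R n x x0 N oN Nx.
have o0 : open [set y : V n | y != 0].
  have -> : [set y : V n | y != 0] = [set y | 0 < `|y|].
    by apply/seteqP; split=> y /=; rewrite normr_gt0.
  by apply: open_lt_cts; cts.
exists (N' `&` [set y : V n | y != 0]); split=> //; first exact: openI.
move=> y [N'y /= y0]; split=> //; apply: NW; first exact: N'N.
exact: norm_dir.
Qed.

Lemma cnode_continuous n (phi : V n -> ctree) d : cont_on (sph n) phi ->
  continuous (cnode phi d).
Proof.
move=> cphi; apply: (@cont_onT _ _ setT) => //; apply: ctree_cont_on.
move=> c W x oW _ [t [h|[x1 h]] Wt].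
  have ec := cnode_cell h; subst c; have [_ _ e] := cnode_inj h.
  exists W; split=> //; first by rewrite e.
  by move=> y Wy _; exists y => //=; left.
have [|N [oN Nx NW]] := collar_nbhd cphi oW (gt1_neq0 x1) (x := x).
  by exists t.
exists (N `&` [set y | 1 < `|y|]); split=> //.
  by apply: openI => //; apply: open_lt_cts; cts.
by move=> y [/NW[_ [t' h' Wt']] /= y1] _; exists t' => //; right.
Qed.

(* A cell whose coordinates are rescaled so that its collar ends at the unit
   sphere is continuous up to the boundary. *)
Definition ball_cell n (phi : V n -> ctree) d (x : V n) : ctree :=
  if `|x| < 1 then cnode phi d (2 *: x) else phi x.

Lemma ball_cell_cont_on n (phi : V n -> ctree) d : cont_on (sph n) phi ->
  cont_on (@unit_ball R n) (ball_cell phi d).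
Proof.
move=> cphi; apply: ctree_cont_on => c W x oW x1.
have c2 : continuous (fun y : V n => 2 *: y) by cts.
have o1 : open [set y : V n | `|y| < 1] by apply: open_lt_cts; cts.
rewrite /ball_cell; case: ifP => [x1' Wx|/negbT].
  have cn := @cts_comp _ _ _ _ _ (@cnode_continuous n phi d cphi) c2.
  exists ([set y : V n | `|y| < 1] `&` (fun y => cnode phi d (2 *: y)) @^-1` csub W).
  split=> //.
    apply: openI => //; move/continuousP: cn; apply; exact: csub_open.
  by move=> y [/= -> Wy].
rewrite -leNgt => x1' Wx; have xE : `|x| = 1 by apply/eqP; rewrite eq_le x1' x1.
have [|N [oN Nx NW]] := collar_nbhd cphi oW (dir_neq0 xE); first by rewrite dir_sphere.
exists (N `&` [set y | 1 < 2 * `|y|]); split.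
- by apply: openI => //; apply: open_lt_cts; cts.
- by split=> //=; rewrite xE; lra.
move=> y [/NW[_ [t h Wt]] /= y2] y1; case: ifP => [y1'|/negbT]; last first.
  rewrite -leNgt => y1'; have yE : `|y| = 1 by apply/eqP; rewrite eq_le y1' y1.
  by exists t => //; rewrite -{1}(dir_sphere yE).
exists t => //; right; rewrite normrZ ger0_norm //; split=> //.
by rewrite dirZ.
Qed.

End Chains.
End CoarseTrees.

Arguments cleaf {R D}.
Arguments in_chain {R D} e c t.
Arguments cphi {R D} c x.

Section TreeConnected.
Variables (R : realType) (Y : topologicalType) (S : set Y) (I : Type) (T : I -> set Y).
Hypotheses (cov : forall y, S y -> exists i, T i y)
  (disj : forall i j y, T i y -> T j y -> i = j)
  (relo : forall i y, T i y -> exists N, [/\ open N, N y & forall y', N y' -> S y' -> T i y']).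

Lemma line_connected n (d : 'rV[R]_n -> Y) i : continuous d -> (forall x, S (d x)) ->
  T i (d 0) -> forall x, T i (d x).
Proof.
move=> cd Sd T0 x.
have cl : continuous (fun s : R => d (s *: x)) by cts.
have oT j : open [set s : R | T j (d (s *: x))].
  rewrite openE => s Ts; have [N [oN Ns NT]] := relo Ts.
  have : nbhs s ((fun s : R => d (s *: x)) @^-1` N).
    by apply: cl; exact: open_nbhs_nbhs.
  by apply: filterS => s' Ns'; exact: NT.
suff h : `[0, 1]%classic `&` [set s : R | T i (d (s *: x))] = `[0, 1]%classic.
  have : `[0, 1]%classic (1 : R) by rewrite /= in_itv /= lexx ler01.
  by rewrite -h => -[_] /=; rewrite scale1r.
apply: (@segment_connected R 0 1).
- exists 0; split; first by rewrite /= in_itv /= lexx ler01.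
  by rewrite /= scale0r.
- by exists [set s : R | T i (d (s *: x))].
- exists (~` \bigcup_(j in [set j | j <> i]) [set s : R | T j (d (s *: x))]).
    by apply: open_closedC; apply: bigcup_open.
  apply/seteqP; split=> s [s01 h]; split=> //=.
    by move=> [j ji Tj]; apply: ji; exact: disj Tj h.
  have [j Tj] := cov (Sd (s *: x)); have [<-//|ji] := pselect (j = i).
  by case: h; exists j.
Qed.

(* The image of a cell is connected and meets those of the cells attached to it. *)
Lemma tree_connected (q : tree R Y) : good q -> tin S q -> exists i, tin (T i) q.
Proof.
elim: q => // n phi ih d t [_ [cd _ gphi _]] [Sd Sphi].
have [i T0] := cov (Sd 0); have Td := line_connected cd Sd T0.
exists i; split=> // u u1; have [g1 g2] := gphi u u1.
have [j Tj] := ih u g1 (Sphi u u1).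
by rewrite -(disj (tin_evr Tj g2) (Td u)).
Qed.

End TreeConnected.

Lemma tmap_eq_tin (R : realType) (Y : topologicalType) (Y' : Type) (S : set Y) (f g : Y -> Y')
  (q : tree R Y) : good q -> tin S q -> (forall y, S y -> f y = g y) ->
  tmap f q = tmap g q.
Proof.
move=> + + fg; elim: q => // n phi ih d t [_ [_ phi0 gphi _]] [Sd Sphi] /=.
congr node; apply/funext => x; last by rewrite fg.
have [x1|x1] := eqVneq `|x| 1; last by rewrite phi0.
by apply: ih; [case: (gphi x x1)|exact: Sphi].
Qed.

(** * Maps of coarse complexes and the complex of singular cells *)

Section CoarseMaps.
Variable R : realType.
Local Notation V n := 'rV[R]_n.
Local Notation sph n := (@unit_sphere R n).

Section Base.
Variables (D : nat -> Type) (agr : forall n m, D n -> D m -> set (V n * V m) -> Prop).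
Variables (X : topologicalType) (bx : forall n, D n -> V n -> X).
Hypotheses (cbx : forall n (d : D n), continuous (bx d))
  (agrx : forall n m (d : D n) (d' : D m) S, agr d d' S ->
    forall q, S q -> bx d q.1 = bx d' q.2).

Definition cspace : topologicalType := set_type (@cgood R D agr).

Definition cbase_val (e : ctree R D) : cgood agr e -> X :=
  match e with
  | cleaf => fun h => False_rect _ h
  | cnode n phi d t => fun _ => bx d t
  end.

Definition cbase (e : cspace) : X := cbase_val (set_valP e).

Lemma cbaseE (e : cspace) c t : in_chain (set_val e) c t -> cbase e = bx (cdat c) t.
Proof.
have H (e' : ctree R D) (h : cgood agr e') : in_chain e' c t ->
    cbase_val h = bx (cdat c) t.
  case: e' h => //= n phi d u [cphi gphi ag] [h|[u1 h]].
    by have ec := cnode_cell h; subst c; have [_ _ ->] := cnode_inj h.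
  exact: (agrx (ag c) (q := (u, t))).
exact: H.
Qed.

Lemma chain_top (e : cspace) : exists c, csupp c (set_val e).
Proof.
have H (e' : ctree R D) : cgood agr e' -> exists c, csupp c e'.
  by case: e' => // n phi d t _; exists (Cell phi d), t; left.
exact: (H _ (set_valP e)).
Qed.

Lemma cbase_continuous : continuous cbase.
Proof.
apply: (@cont_onT _ _ setT) => //; apply: cont_on_local => e _.
have cv : continuous (@set_val _ (@cgood R D agr)) by exact: set_val_continuous.
have [c ce] := chain_top e; exists (set_val @^-1` csupp c).
  by split=> //; move/continuousP: cv; apply; exact: csupp_open.
apply: (@cont_on_eq _ _ _ (fun e => bx (cdat c) (coord c (set_val e)))).
  by move=> e' [ce' _]; rewrite (cbaseE (coordP ce')).
apply: (@cont_on_comp _ _ _ _ setT (fun e : cspace => coord c (set_val e)) (bx (cdat c))) => //.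
  apply: (@cont_on_comp _ _ _ _ (csupp c) set_val (coord c)).
  - exact: continuous_cont_on.
  - exact: coord_cont_on.
  - by move=> e' [].
by apply: continuous_cont_on; exact: cbx.
Qed.

End Base.

Section Singular.
Variable Z : topologicalType.

Definition sing (n : nat) : Type := continuousType (V n) Z.
Definition sing_agr n m (d : sing n) (d' : sing m) (S : set (V n * V m)) :=
  forall q, S q -> (d : V n -> Z) q.1 = (d' : V m -> Z) q.2.

Definition sing_space : topologicalType := cspace sing_agr.
Definition sing_ev : sing_space -> Z := @cbase sing sing_agr Z (fun n d => d : V n -> Z).

Lemma sing_evE (e : sing_space) c t : in_chain (set_val e) c t ->
  sing_ev e = (cdat c : V _ -> Z) t.
Proof. by apply: cbaseE => n m d d' S; exact. Qed.

Lemma sing_ev_continuous : continuous sing_ev.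
Proof.
by apply: cbase_continuous => [n d|n m d d' S]; [exact: cts_fun|exact].
Qed.

(** As for [ev], the lifting problem defines the cell that solves it. The ball reaches its boundary
    only through the collar of the cell, where the characteristic map [h \o rc] is constant along
    rays; hence the reparametrization [rc (2 *: x)]. *)
Lemma sing_wlp : wlp R sing_ev.
Proof.
split=> [z|n g h cg ch gh].
  pose d : sing 0 := mkcts (@ctscst _ _ z).
  have n0 (u : V 0) : 1 < `|u| -> False by rewrite norm_rV0 ltr10.
  have n1 (u : V 0) : `|u| = 1 -> False.
    by rewrite norm_rV0 => /eqP; rewrite eq_sym oner_eq0.
  have gd : cgood sing_agr (cnode (fun=> cleaf) d 0).
    split; [by move=> u /n1|by move=> u /n1|by move=> c q [/n0]].
  exists (to_set gd : sing_space).
  by rewrite (@sing_evE _ (Cell (fun=> cleaf) d) 0) //; left.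
pose phi u := set_val (g u).
have cphi : cont_on (sph n) phi.
  exact: (cont_on_comp cg (continuous_cont_on (A := setT) (@set_val_continuous _ _))).
have chr : continuous (fun x => h (rc x)) by cts.
pose d : sing n := mkcts chr.
have ccd t : cgood sing_agr (cnode phi d t).
  split=> //; first by move=> u _; exact: set_valP.
  move=> c [a b] [/= a1 hc]; rewrite -(sing_evE hc) gh ?norm_dir ?gt1_neq0 //.
  by change (h (rc a) = h (dir a)); rewrite rc_dir // ltW.
have kg x : cgood sing_agr (ball_cell phi d (rc x)).
  by rewrite /ball_cell; case: ifP => _ //; exact: set_valP.
exists (fun x => to_set (kg x) : sing_space), (fun x => rc (2 *: x)); split.
- apply: continuous_to_set; apply: (@cont_onT _ _ setT) => //.
  apply: (@cont_on_comp _ _ _ _ _ (@rc R n) (ball_cell phi d)).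
  - by apply: continuous_cont_on; exact: rc_continuous.
  - by apply: ball_cell_cont_on; exact: cphi.
  - by move=> x _; exact: norm_rc_le1.
- by cts.
- move=> u u1; split.
    apply: val_inj; change (ball_cell phi d (rc u) = set_val (g u)).
    by rewrite rc_id ?u1 // /ball_cell u1 ltxx.
  by rewrite rcZ ?rc_id ?u1 // mulr1 ler1n.
- by move=> x _; exact: norm_rc_le1.
- move=> x x1; have [xl|xl] := ltP `|x| 1.
    rewrite (@sing_evE _ (Cell phi d) (2 *: x)) //.
    change (in_chain (ball_cell phi d (rc x)) (Cell phi d) (2 *: x)).
    by rewrite rc_id // /ball_cell xl; left.
  have xE : `|x| = 1 by apply/eqP; rewrite eq_le x1 xl.
  have -> : (to_set (kg x) : sing_space) = g x.
    apply: val_inj; change (ball_cell phi d (rc x) = set_val (g x)).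
    by rewrite rc_id // /ball_cell ltNge xl.
  by rewrite gh // rcZ ?rc_id ?xE // mulr1 ler1n.
Qed.

End Singular.

Section Cmap.
Variables (D D' : nat -> Type).
Variables (agr : forall n m, D n -> D m -> set (V n * V m) -> Prop)
  (agr' : forall n m, D' n -> D' m -> set (V n * V m) -> Prop)
  (fd : forall n, D n -> D' n).

Fixpoint cmap (e : ctree R D) : ctree R D' :=
  match e with
  | cleaf => cleaf
  | cnode n phi d t => cnode (fun x => cmap (phi x)) (fd d) t
  end.

Definition cmap_cell (c : cell R D) : cell R D' :=
  Cell (fun x => cmap (cphi c x)) (fd (cdat c)).

Lemma in_chain_cmap e c t : in_chain e c t -> in_chain (cmap e) (cmap_cell c) t.
Proof.
elim: e => //= n phi ih d u [h|[u1 h]]; last by right; split=> //; exact: ih.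
by have ec := cnode_cell h; subst c; have [_ _ ->] := cnode_inj h; left.
Qed.

Lemma in_chain_cmap_inv e m (phi' : V m -> ctree R D') (d' : D' m) (t : V m) :
  in_chain (cmap e) (Cell phi' d') t -> exists (phi : V m -> ctree R D) (d : D m),
    [/\ phi' = (fun x => cmap (phi x)), d' = fd d & in_chain e (Cell phi d) t].
Proof.
elim: e => //= n phi ih d u [h|[u1 /ih[phi0 [d0 [e1 e2 e3]]]]]; last first.
  by exists phi0, d0; split=> //; right.
have e : n = m by case: h.
subst m; have [<- <- <-] := cnode_inj h.
by exists phi, d; split=> //; left.
Qed.

Lemma cmap_continuous : continuous cmap.
Proof.
apply: (@cont_onT _ _ setT) => //; apply: ctree_cont_on.
move=> [m phi' d'] W e oW _ [t /in_chain_cmap_inv[phi [d [e1 e2 h]]] Wt].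
exists (csub (c := Cell phi d) W); split; [exact: csub_open|by exists t|].
move=> e' [t' h' Wt'] _; exists t' => //; subst phi' d'.
exact: (in_chain_cmap h').
Qed.

(* [cmap fd] may identify cells; the cells [dd i] with the same image [d'] occur
   over disjoint open sets [T i], so agreement over each of them is enough. *)
Hypothesis local_agr : forall n m (d : D n) (d' : D' m) (S : set (V n * V m))
    (I : Type) (dd : I -> D m) (T : I -> set (V n * V m)),
  (forall i, d' = fd (dd i)) -> (forall i, agr d (dd i) (T i)) ->
  (forall q, S q -> exists i, T i q) -> (forall i j q, T i q -> T j q -> i = j) ->
  (forall i q, T i q -> exists N, [/\ open N, N q & forall q', N q' -> S q' -> T i q']) ->
  agr' (fd d) d' S.

Lemma cmap_good e : cgood agr e -> cgood agr' (cmap e).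
Proof.
elim: e => //= n phi ih d t [kphi gphi ag]; split.
- apply: (@cont_on_comp _ _ _ _ setT phi cmap) => //.
  by apply: continuous_cont_on; exact: cmap_continuous.
- by move=> u u1; apply: ih => //; exact: gphi.
- move=> [m phi' d'].
  pose I := {pd : (V m -> ctree R D) * D m |
    phi' = (fun x => cmap (pd.1 x)) /\ d' = fd pd.2}.
  pose cl (i : I) : cell R D := Cell (sval i).1 (sval i).2.
  have clE i : cmap_cell (cl i) = Cell phi' d'.
    case: i => -[p1 p2] [/= e1 e2].
    by change (Cell (fun x => cmap (p1 x)) (fd p2) = Cell phi' d'); rewrite e1 e2.
  have clphi i (u : V m) : cmap (cphi (cl i) u) = phi' u.
    case: i => -[p1 p2] [/= e1 e2].
    by change (cmap (p1 u) = phi' u); rewrite e1.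
  apply: (@local_agr n m d d' _ I (fun i => (sval i).2)
    (fun i => [set q | 1 < `|q.1| /\ in_chain (phi (dir q.1)) (cl i) q.2])).
  + by move=> [pd []].
  + by move=> i; exact: (ag (cl i)).
  + move=> q [q1 /in_chain_cmap_inv[phi0 [d0 [e1 e2 h]]]].
    by exists (exist _ (phi0, d0) (conj e1 e2)).
  + move=> i j q [q1 hi] [_ hj].
    (* If one of two cells with the same image lay below the other, the image cell would lie below
       itself. So in a chain only one cell can have this image. *)
    have bad (i' j' : I) (u : V m) (t' : V m) : ~ in_chain (cphi (cl i') u) (cl j') t'.
      move=> h.
      have : csupp (cmap_cell (cl j')) (phi' u) by rewrite -(clphi i'); exists t'; exact: in_chain_cmap.
      rewrite clE => -[t0]; apply: (@chain_irrefl _ _ (cnode phi' d' 0) (Cell phi' d') 0).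
      by left.
    have [[_ /bad//]|e|[_ /bad//]] := chain_cases hi hj.
    have ee : cnode (sval i).1 (sval i).2 0 = cnode (sval j).1 (sval j).2 (0 : V m).
      have : cnode (cphi (cl i)) (cdat (cl i)) 0 = cnode (cphi (cl j)) (cdat (cl j)) 0.
        by rewrite e.
      by [].
    have [e1 e2 _] := cnode_inj ee.
    apply: (@eq_sig_hprop _ _ (fun x => @Prop_irrelevance _) i j).
    by rewrite (surjective_pairing (sval i)) e1 e2 -surjective_pairing.
  + move=> [[p1 p2] [/= e1 e2]] [a b] [/= a1 h].
    have [|N [oN Na NP]] := @collar_nbhd _ _ n phi (Cell p1 p2) setT a kphi openT (gt1_neq0 a1).
      by exists b.
    have c1 : continuous (@fst (V n) (V m)) by cts.
    exists (fst @^-1` N); split=> //; first by move/continuousP: c1; apply.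
    move=> [a' b'] /= /NP[_ [t' h' _]] [/= a1' hc]; split=> //.
    rewrite e1 e2 in hc.
    by rewrite (chain_uniq hc (in_chain_cmap h')).
Qed.

End Cmap.
End CoarseMaps.

Section Flags.
Variables (R : realType) (D : nat -> Type)
  (agr : forall n m, D n -> D m -> set ('rV[R]_n * 'rV[R]_m) -> Prop).
Variables (Y : topologicalType) (pi : Y -> cspace agr).
Hypothesis cpi : continuous pi.

(** Nonempty finite lists of cells; more cells means a smaller index, and concatenation is the meet.
    The distinguished head provides a cell over which a flag can be evaluated. *)
Definition cells : Type := (cell R D * list (cell R D))%type.
Definition in_cells (c : cell R D) (j : cells) := List.In c (j.1 :: j.2).
Definition cells_le (i j : cells) := forall c, in_cells c j -> in_cells c i.
Definition cells_cat (i j : cells) : cells := (i.1, i.2 ++ j.1 :: j.2).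

Definition over_cell (c : cell R D) : set Y := [set y | csupp c (set_val (pi y))].
Definition over_cells (j : cells) : set Y :=
  [set y | forall c, in_cells c j -> over_cell c y].

Lemma over_cell_open c : open (over_cell c).
Proof.
have cv : continuous (fun y => set_val (pi y)).
  by apply: cts_comp => //; exact: set_val_continuous.
by move/continuousP: cv; apply; exact: csupp_open.
Qed.

Lemma in_cells_cat c i j : in_cells c (cells_cat i j) <-> in_cells c i \/ in_cells c j.
Proof.
exact: (List.in_app_iff (i.1 :: i.2) (j.1 :: j.2)).
Qed.

Lemma cells_wlp :
  wlp R (@flag_ev R Y cells cells_le over_cells).
Proof.
apply: (@flag_wlp R Y cells cells_le cells_cat).
- by move=> i c.
- by move=> i j k ij jk c /jk; exact: ij.
- move=> i j k; split=> [H|[H1 H2] c /in_cells_cat[/H1|/H2]//].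
  by split=> c ci; apply: H; apply/in_cells_cat; [left|right].
- move=> [c0 s]; rewrite /over_cells.
  have E l : open [set y | forall c, List.In c l -> over_cell c y].
    elim: l => [|c l ih].
      have -> : [set y | forall c, List.In c nil -> over_cell c y] = setT.
        by apply/seteqP; split=> // y _ c [].
      exact: openT.
    have -> : [set y | forall c', List.In c' (c :: l) -> over_cell c' y] =
        over_cell c `&` [set y | forall c', List.In c' l -> over_cell c' y].
      apply/seteqP; split=> y /=.
        by move=> H; split=> [|c' ?]; apply: H; [left|right].
      by move=> [h1 h2] c' [<-//|]; exact: h2.
    by apply: openI => //; exact: over_cell_open.
  exact: E.
- by move=> i j ij y H c /ij; exact: H.
- by move=> i j y [H1 H2] c /in_cells_cat[/H1|/H2].
- move=> y; have [c ce] := chain_top (pi y).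
  by exists (c, nil) => c' [<-|[]].
Qed.

End Flags.

Section Exclusion.
Variables (R : realType) (D : nat -> Type).

Lemma chain_exclusion (e : ctree R D) c c' t u t' u' t'' : in_chain e c t ->
  in_chain (cphi c u) c' t' -> ~ in_chain (cphi c' u') c t''.
Proof.
elim: e c c' t u t' u' t'' => // n phi ih d v c c' t u t' u' t'' /= [h|[_ h]].
  have ec := cnode_cell h; subst c => h1 h2.
  exact: (ih u c' (Cell phi d) t' u' t'' u t' h1 h2 h1).
exact: ih h.
Qed.

Lemma tinI (Y : Type) (U U' : set Y) (q : tree R Y) :
  tin U q -> tin U' q -> tin (U `&` U') q.
Proof.
by elim: q => //= n phi ih d t [h1 h2] [h1' h2']; split=> // u u1; apply: ih => //;
  [exact: h2|exact: h2'].
Qed.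

Lemma good_nonempty (Y : topologicalType) (U : set Y) (q : tree R Y) :
  good q -> tin U q -> exists y, U y.
Proof. by case: q => // n phi d t _ [Ud _]; exists (d 0). Qed.

Lemma Qt_eq (Y : topologicalType) (U : set Y) (q q' : Qt R (set_type U)) :
  tmap set_val (set_val q) = tmap set_val (set_val q') -> q = q'.
Proof. by move=> e; apply: val_inj; rewrite -[LHS]tmapK e tmapK. Qed.

Lemma tmap_conv (Y : topologicalType) (Y' : Type) (U : set Y) (f : Y -> Y')
  (g : set_type U -> Y') (q : tree R Y) : good q -> tin U q ->
  (forall y, g y = f (set_val y)) -> tmap g (conv U q) = tmap f q.
Proof.
by move=> gq tq gf; rewrite (tmap_eq _ gf) -(tmap_comp set_val f) convK.
Qed.

End Exclusion.

(** * Evaluation of sections on flags *)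

Section Leg.
Variables (R : realType) (X A B : topologicalType) (p : A -> X).
Local Notation V n := 'rV[R]_n.
Variables (D : nat -> Type) (bx : forall n, D n -> V n -> X)
  (sv : forall n (d : D n), Qt R (pb (bx d) p) -> B).

(** Sections are functions of trees rather than of points, so agreement on an overlap is tested on
    whole trees in it. The trees [q1] and [q2] in the pullbacks are determined by the equations, as
    [Qt_eq] shows. *)
Definition leg_agr n m (d : D n) (d' : D m) (S : set (V n * V m)) :=
  forall z : tree R (V n * V m * A), good z ->
    tin [set y | [/\ S y.1, bx d y.1.1 = p y.2 & bx d' y.1.2 = p y.2]] z ->
    forall (q1 : Qt R (pb (bx d) p)) (q2 : Qt R (pb (bx d') p)),
      tmap set_val (set_val q1) = tmap (fun y => (y.1.1, y.2)) z ->
      tmap set_val (set_val q2) = tmap (fun y => (y.1.2, y.2)) z -> sv q1 = sv q2.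

Variable agr : forall n m, D n -> D m -> set (V n * V m) -> Prop.
Hypotheses (cbx : forall n (d : D n), continuous (bx d))
  (csv : forall n (d : D n), continuous (@sv n d))
  (agrx : forall n m (d : D n) (d' : D m) S, agr d d' S ->
    forall q, S q -> bx d q.1 = bx d' q.2)
  (agrs : forall n m (d : D n) (d' : D m) S, agr d d' S -> leg_agr d d' S).

Local Notation E := (cspace agr).
Definition base (e : E) : X := @cbase R D agr X bx e.
Local Notation P := (pb base p).
Local Notation pi := (@pb1 _ _ _ base p).

Lemma base_coord c (y : P) : over_cell pi c y ->
  bx (cdat c) (coord c (set_val (pb1 y))) = p (pb2 y).
Proof. by move=> ye; rewrite -pb_sq /base (cbaseE agrx (coordP ye)). Qed.

Definition cell_fun c (y : P) : V (cdim c) * A :=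
  (coord c (set_val (pb1 y)), pb2 y).

Definition cell_retract c (y : set_type (over_cell pi c)) : pb (bx (cdat c)) p :=
  pb_mk (base_coord (set_valP y)).

Lemma cell_retract_continuous c : continuous (@cell_retract c).
Proof.
apply: continuous_to_set; apply: cts_pair; last first.
  by apply: cts_comp; [exact: pb2_continuous|exact: set_val_continuous].
apply: (@cont_onT _ _ setT) => //.
apply: (@cont_on_comp _ _ _ _ (csupp c)
  (fun y : set_type (over_cell pi c) => set_val (pb1 (set_val y))) (coord c)).
- apply: continuous_cont_on; apply: cts_comp; first exact: set_val_continuous.
  by apply: cts_comp; [exact: pb1_continuous|exact: set_val_continuous].
- exact: coord_cont_on.
- by move=> y _; exact: (set_valP y).
Qed.

Definition cell_trees c : set (tree R P) := [set q | good q /\ tin (over_cell pi c) q].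

Definition cell_tree c (q : set_type (cell_trees c)) : Qt R (pb (bx (cdat c)) p) :=
  Qmap (@cell_retract_continuous c)
    (to_set (good_conv (set_valP q).1 (set_valP q).2)).

Definition cell_value c (q : set_type (cell_trees c)) : B := sv (cell_tree q).

Lemma cell_value_continuous c : continuous (@cell_value c).
Proof.
apply: cts_comp; first exact: csv.
apply: cts_comp; first exact: Qmap_continuous.
apply: continuous_to_set; apply: (@cont_onT _ _ setT) => //.
apply: (@cont_on_comp _ _ _ _ (cell_trees c) set_val (conv (over_cell pi c))).
- by apply: continuous_cont_on; exact: set_val_continuous.
- exact: conv_cont_on.
- by move=> q _; exact: (set_valP q).
Qed.

Lemma cell_treeE c (q : set_type (cell_trees c)) :
  tmap set_val (set_val (cell_tree q)) = tmap (cell_fun c) (set_val q).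
Proof.
have [gq tq] := set_valP q.
change (tmap set_val (tmap (@cell_retract c) (conv (over_cell pi c) (set_val q))) =
  tmap (cell_fun c) (set_val q)).
by rewrite tmap_comp; apply: (@tmap_conv R P _ (over_cell pi c) (cell_fun c)).
Qed.

Lemma cell_valueE c (q : set_type (cell_trees c)) (q1 : Qt R (pb (bx (cdat c)) p)) :
  tmap set_val (set_val q1) = tmap (cell_fun c) (set_val q) -> cell_value q = sv q1.
Proof. by move=> h; congr sv; apply: Qt_eq; rewrite h; exact: cell_treeE. Qed.

(** The coordinates with respect to [c] and [c'] turn the common tree into a tree in their overlap,
    where agreement of the two data is part of the goodness of the cell [c]. *)
Lemma cell_value_below c c' u t' (q : set_type (cell_trees c))
  (q' : set_type (cell_trees c')) : set_val q = set_val q' ->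
  in_chain (cphi c u) c' t' -> cell_value q = cell_value q'.
Proof.
move=> qq' below; have [gq tq] := set_valP q.
have tq' : tin (over_cell pi c') (set_val q) by rewrite qq'; case: (set_valP q').
pose U : set P := over_cell pi c `&` over_cell pi c'.
have tU : tin U (set_val q) by exact: tinI.
have cUc k : U `<=` over_cell pi k -> continuous (fun y : set_type U => coord k (set_val (pb1 (set_val y)))).
  move=> Uk; apply: (@cont_onT _ _ setT) => //.
  apply: (@cont_on_comp _ _ _ _ (csupp k)
    (fun y : set_type U => set_val (pb1 (set_val y))) (coord k)).
  - apply: continuous_cont_on; apply: cts_comp; first exact: set_val_continuous.
    by apply: cts_comp; [exact: pb1_continuous|exact: set_val_continuous].
  - exact: coord_cont_on.
  - by move=> y _; exact: (Uk _ (set_valP y)).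
pose g (y : set_type U) : V (cdim c) * V (cdim c') * A :=
  (coord c (set_val (pb1 (set_val y))), coord c' (set_val (pb1 (set_val y))),
   pb2 (set_val y)).
have cg : continuous g.
  apply: cts_pair; last by apply: cts_comp; [exact: pb2_continuous|exact: set_val_continuous].
  by apply: cts_pair; apply: cUc => y [].
have [y0 [cy0 _]] := good_nonempty gq tU.
have [_ _ /(_ c') ag] := chain_ccell (set_valP (pb1 y0)) (coordP cy0).
apply: (agrs ag (z := tmap g (conv U (set_val q)))).
- by apply: good_tmap => //; exact: good_conv.
- apply: tin_tmap; apply: tinS (tin_conv tU tU) => y [cy c'y].
  split; [|exact: base_coord|exact: base_coord].
  (* As [c'] occurs below [c], the other two orders contradict well-foundedness of attaching maps,
     so the point lies in the collar of [c]. *)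
  have [[h1 h2]|e|[_ h]] := chain_cases (coordP cy) (coordP c'y).
  + by split.
  + by subst c'; case: (chain_irrefl (coordP cy) below).
  + by case: (chain_exclusion (coordP cy) below h).
- by rewrite cell_treeE tmap_comp; symmetry; apply: (@tmap_conv R P _ U (cell_fun c)).
- by rewrite cell_treeE tmap_comp qq'; symmetry; apply: (@tmap_conv R P _ U (cell_fun c')); rewrite -?qq'.
Qed.

(** A good tree passes through at least one point of the pullback; both cells are in the chain of
    that point, hence equal or one below the other. *)
Lemma cell_value_indep c c' (q : set_type (cell_trees c))
  (q' : set_type (cell_trees c')) : set_val q = set_val q' ->
  cell_value q = cell_value q'.
Proof.
move=> qq'; have [gq tq] := set_valP q.
have tq' : tin (over_cell pi c') (set_val q) by rewrite qq'; case: (set_valP q').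
have [y0 [cy cy']] := good_nonempty gq (tinI tq tq').
have [[_ h]|e|[_ h]] := chain_cases (coordP cy) (coordP cy').
- exact: cell_value_below qq' h.
- by subst c'; congr cell_value; exact: val_inj.
- by symmetry; apply: (cell_value_below _ h).
Qed.

Local Notation G := (flag_space R (@cells_le R D) (over_cells pi)).

Lemma flag_cell (z : G) c : in_cells c (set_val z).1 -> cell_trees c (set_val z).2.
Proof.
by move=> cz; have [gz tz] := set_valP z; split=> //; apply: tinS tz => y; exact.
Qed.

Definition flag_value (z : G) : B :=
  cell_value (to_set (flag_cell (or_introl erefl : in_cells (set_val z).1.1 (set_val z).1))).

(** Near a flag the index can only acquire cells, so its head cell stays available. By
    [cell_value_indep] the value may be computed with this fixed cell, where it is continuous. *)
Lemma flag_value_continuous : continuous flag_value.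
Proof.
apply: (@cont_onT _ _ setT) => //; apply: cont_on_local => z _.
pose c := (set_val z).1.1.
pose N : set G := [set z' | in_cells c (set_val z').1].
have oD : open [set j : alex (@cells_le R D) | in_cells c j].
  by apply: alex_openE => i j; exact.
have c1 : continuous (fun z : G => (set_val z).1) by cts; exact: set_val_continuous.
exists N; first by split; [move/continuousP: c1 => /(_ _ oD)|left].
apply: cont_onS (_ : cont_on N _); first by move=> ? [].
apply: set_type_cont_on.
have fc (z' : set_type N) : cell_trees c (set_val (set_val z')).2.
  by apply: flag_cell; exact: (set_valP z').
have -> : (fun z' : set_type N => flag_value (set_val z')) =
    (fun z' => cell_value (to_set (fc z'))).
  apply/funext => z'; exact: cell_value_indep.
apply: cts_comp; first exact: cell_value_continuous.
apply: continuous_to_set; apply: cts_snd; apply: cts_comp; exact: set_val_continuous.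
Qed.

Lemma flag_value_ev (be : B -> A) :
  (forall n (d : D n) q, be (sv q) = pb2 (ev q : pb (bx d) p)) ->
  forall z : G, be (flag_value z) = pb2 (flag_ev z).
Proof.
move=> beE z; rewrite /flag_value /cell_value beE ev_Qmap.
set q := to_set _; change (pb2 (set_val (ev q)) = pb2 (flag_ev z)); congr pb2.
have [gz tz] := set_valP z; symmetry; apply: ev_eq.
have := @tmap_evr R _ _ set_val _ _ (evP q).
rewrite convK //.
exact: (flag_cell (or_introl erefl : in_cells (set_val z).1.1 (set_val z).1)).2.
Qed.

End Leg.

Section FlagMap.
Variables (R : realType) (Y Y' : topologicalType) (f : Y -> Y') (cf : continuous f).
Variables (J J' : Type) (le : J -> J -> Prop) (le' : J' -> J' -> Prop)
  (O : J -> set Y) (O' : J' -> set Y') (h : J -> J').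
Hypotheses (hle : forall i j, le i j -> le' (h i) (h j))
  (hO : forall j, O j `<=` f @^-1` O' (h j)).

Lemma flag_map_subproof (z : flag_space R le O) :
  @flag_set R Y' J' le' O' (h (set_val z).1, tmap f (set_val z).2).
Proof.
have [gz tz] := set_valP z; split; first exact: good_tmap.
by apply: tin_tmap; apply: tinS tz; exact: hO.
Qed.

Definition flag_map (z : flag_space R le O) : flag_space R le' O' :=
  to_set (flag_map_subproof z).

Lemma flag_map_continuous : continuous flag_map.
Proof.
have ch : continuous (h : alex le -> alex le').
  by apply/continuousP => D oD; apply: alex_openE => i j ij; exact: alex_open_le oD (hle ij).
have cv : continuous (fun z : flag_space R le O => set_val z) by exact: set_val_continuous.
apply: continuous_to_set; apply: cts_pair.
  by apply: (cts_comp ch); exact: cts_fst.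
by apply: (cts_comp (tmap_continuous cf)); exact: cts_snd.
Qed.

Lemma flag_ev_map z : flag_ev (flag_map z) = f (flag_ev z).
Proof. by apply: ev_eq; apply: tmap_evr; exact: (evP (flag_tree z)). Qed.

End FlagMap.

(** * Restriction of strict data to singular cells *)

Section SingularLeg.
Variables (R : realType) (X A B Z : topologicalType) (p : A -> X) (y : Z -> X)
  (s' : Qt R (pb y p) -> B).
Local Notation V n := 'rV[R]_n.

Lemma sing_change_continuous (T : topologicalType) (d : T -> Z) : continuous d ->
  continuous (base_change (p := p) (fun u => erefl (y (d u)))).
Proof. by move=> cd; exact: (base_change_continuous (fun u => erefl (y (d u))) cd). Qed.

Definition sing_change (T : topologicalType) (d : T -> Z) (cd : continuous d)
    (q : Qt R (pb (fun u => y (d u)) p)) : Qt R (pb y p) :=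
  Qmap (sing_change_continuous cd) q.

Lemma sing_changeE (T : topologicalType) (d : T -> Z) (cd : continuous d) q :
  tmap set_val (set_val (sing_change cd q)) =
  tmap (fun a => (d a.1, a.2)) (tmap set_val (set_val q)).
Proof.
change (tmap set_val (tmap (base_change (p := p) (fun u => erefl (y (d u)))) (set_val q)) =
  tmap (fun a => (d a.1, a.2)) (tmap set_val (set_val q))).
by rewrite !tmap_comp.
Qed.

(** Several singular cells may carry the same datum and so be identified in [E]. A tree in the
    overlap is connected, hence lies over a single [T i], where [d] and [dd i] coincide. *)
Lemma sing_leg_agr n m (d : sing R Z n) (S : set (V n * V m)) (I : Type)
    (dd : I -> sing R Z m) (T : I -> set (V n * V m)) :
  (forall i, sing_agr d (dd i) (T i)) -> (forall x, S x -> exists i, T i x) ->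
  (forall i j x, T i x -> T j x -> i = j) ->
  (forall i x, T i x -> exists N, [/\ open N, N x & forall x', N x' -> S x' -> T i x']) ->
  forall z : tree R (V n * V m * A), good z -> tin [set x | S x.1] z ->
  exists i, forall q1 q2,
    tmap set_val (set_val q1) = tmap (fun x => (x.1.1, x.2)) z ->
    tmap set_val (set_val q2) = tmap (fun x => (x.1.2, x.2)) z ->
    s' (sing_change (@cts_fun _ _ d) q1) = s' (sing_change (@cts_fun _ _ (dd i)) q2).
Proof.
move=> dT cov disj relo z gz Sz.
have [|||i Tz] := @tree_connected R _ [set x : V n * V m * A | S x.1] I
  (fun i => [set x | T i x.1]) _ _ _ z gz Sz.
- by move=> x /cov.
- by move=> i j x; exact: disj.
- move=> i x /relo[N [oN Nx NT]]; exists (fst @^-1` N); split=> //.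
    have c1 : continuous (@fst (V n * V m) A) by cts.
    by move/continuousP: c1; apply.
  by move=> x'; exact: NT.
exists i => q1 q2 e1 e2; congr s'; apply: Qt_eq; rewrite !sing_changeE e1 e2 !tmap_comp.
by apply: (tmap_eq_tin gz Tz) => x Tx /=; rewrite (dT i _ Tx).
Qed.

End SingularLeg.

Section QuillenModel.
Variable R : realType.
Local Notation V n := 'rV[R]_n.
Local Notation we := (@weak_homotopy_equivalence R).
Local Notation L := (lmap we).

Section Generic.
Variables (X A A1 B S : topologicalType).
Variables (p : A -> X) (q : A1 -> X) (r1 r2 : A1 -> A) (be : B -> A)
  (s1 s2 : S -> B).
Hypotheses (cr1 : continuous r1) (cr2 : continuous r2).
Hypotheses (r1E : forall z, p (r1 z) = q z) (r2E : forall z, p (r2 z) = q z).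

Definition strict (Z : topologicalType) (x : Z -> X) (s : Qt R (pb x p) -> B)
    (t : Qt R (pb x q) -> S) :=
  @strict_datum R we (quillen_rep R) X A A1 B S p q r1 r2 be s1 s2 cr1 cr2 r1E r2E
    Z x s t.

Record datum n := Datum {
  dx : V n -> X;
  dx_continuous : continuous dx;
  ds : Qt R (pb dx p) -> B;
  dt : Qt R (pb dx q) -> S;
  d_strict : strict ds dt }.

Definition datum_agr n m (d : datum n) (d' : datum m) (T : set (V n * V m)) :=
  [/\ forall x, T x -> dx d x.1 = dx d' x.2, leg_agr (bx := dx) ds d d' T &
    leg_agr (bx := dx) dt d d' T].

Lemma datum_agrx n m (d : datum n) (d' : datum m) T : datum_agr d d' T ->
  forall x, T x -> dx d x.1 = dx d' x.2.
Proof. by case. Qed.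

Lemma datum_agrs n m (d : datum n) (d' : datum m) T : datum_agr d d' T ->
  leg_agr (bx := dx) ds d d' T.
Proof. by case. Qed.

Lemma datum_agrt n m (d : datum n) (d' : datum m) T : datum_agr d d' T ->
  leg_agr (bx := dx) dt d d' T.
Proof. by case. Qed.

Local Notation E := (cspace datum_agr).
Definition gbase : E -> X := @base R X datum (@dx) (@datum_agr).

Lemma gbase_continuous : continuous gbase.
Proof. exact: (cbase_continuous dx_continuous datum_agrx). Qed.

Definition gflags (C : topologicalType) (k : C -> X) : topologicalType :=
  flag_space R (@cells_le R datum) (over_cells (@pb1 _ _ _ gbase k)).
Definition gflag_ev (C : topologicalType) (k : C -> X) : gflags k -> pb gbase k :=
  @flag_ev _ _ _ _ _.

Lemma gflag_ev_continuous (C : topologicalType) (k : C -> X) : continuous (@gflag_ev C k).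
Proof. exact: flag_ev_continuous. Qed.

Lemma gflag_ev_iso (C : topologicalType) (k : C -> X) :
  exists v : @hom (localization we) (pb gbase k) (gflags k),
    v \c L (@gflag_ev_continuous C k) === idm _ /\ L (@gflag_ev_continuous C k) \c v === idm _.
Proof.
apply: lmap_iso; apply: wlp_weak_homotopy_equivalence.
by apply: cells_wlp; exact: pb1_continuous.
Qed.

Definition gsec : gflags p -> B := flag_value ds datum_agrx.
Definition ghom : gflags q -> S := flag_value dt datum_agrx.

Lemma gsec_continuous : continuous gsec.
Proof.
apply: flag_value_continuous; last exact: datum_agrs.
by move=> n d; case: (d_strict d).
Qed.

Lemma ghom_continuous : continuous ghom.
Proof.
apply: flag_value_continuous; last exact: datum_agrt.
by move=> n d; case: (d_strict d).
Qed.

Lemma gsec_be z : be (gsec z) = pb2 (gflag_ev z).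
Proof.
by apply: flag_value_ev => n d q0; case: (d_strict d) => _ _ h _ _; exact: h.
Qed.

Section Faces.
Variables (r : A1 -> A) (cr : continuous r) (rE : forall z, p (r z) = q z)
  (si : S -> B).
Hypothesis si_dt : forall n (d : datum n) z,
  si (dt z) = ds (Qmap (face_continuous rE (dx d) cr) z).

Definition gface : gflags q -> gflags p :=
  @flag_map R _ _ _ (face_continuous rE gbase cr) _ _ (@cells_le R datum)
    (@cells_le R datum) (over_cells (@pb1 _ _ _ gbase q))
    (over_cells (@pb1 _ _ _ gbase p)) id (fun j y h => h).

Lemma gface_continuous : continuous gface.
Proof. by apply: flag_map_continuous => i j. Qed.

Lemma gflag_ev_face z : gflag_ev (gface z) = face rE gbase (gflag_ev z).
Proof. exact: flag_ev_map. Qed.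

Lemma gface_value z : si (ghom z) = gsec (gface z).
Proof.
rewrite /ghom /flag_value /cell_value si_dt; symmetry; apply: cell_valueE.
set w := cell_tree _ _.
have wE := cell_treeE datum_agrx (to_set (flag_cell (or_introl erefl : in_cells (set_val z).1.1 (set_val z).1))).
change (tmap set_val (tmap (face rE (dx (cdat (set_val z).1.1))) (set_val w)) =
  tmap (cell_fun (set_val z).1.1) (tmap (face rE gbase) (set_val z).2)).
transitivity (tmap (fun a => (a.1, r a.2)) (tmap set_val (set_val w))).
  by rewrite !tmap_comp.
by rewrite wE !tmap_comp.
Qed.

End Faces.

(** On flags the compatibility of section and witness is strict, by [gface_value]; it is carried to
    the pullbacks by inverting the weak equivalences [gflag_ev]. *)
Lemma gface_square (r : A1 -> A) (cr : continuous r) (rE : forall z, p (r z) = q z)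
    (si : S -> B) (csi : continuous si)
    (vp : @hom (localization we) (pb gbase p) (gflags p))
    (vq : @hom (localization we) (pb gbase q) (gflags q)) :
  (forall n (d : datum n) z, si (dt z) = ds (Qmap (face_continuous rE (dx d) cr) z)) ->
  vp \c L (@gflag_ev_continuous A p) === idm _ ->
  L (@gflag_ev_continuous A1 q) \c vq === idm _ ->
  L csi \c (L ghom_continuous \c vq) ===
  L gsec_continuous \c vp \c L (face_continuous rE gbase cr).
Proof.
move=> si_dt vp1 vq2.
have cfm := @gface_continuous r cr rE.
have e1 : L csi \c L ghom_continuous === L gsec_continuous \c L cfm.
  have c := cts_comp csi ghom_continuous.
  rewrite -(lmap_comp we ghom_continuous csi c) //.
  by rewrite -(lmap_comp we cfm gsec_continuous c) // => z; exact: gface_value.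
have e2 : L (@gflag_ev_continuous A p) \c L cfm ===
    L (face_continuous rE gbase cr) \c L (@gflag_ev_continuous A1 q).
  have c := cts_comp (@gflag_ev_continuous A p) cfm.
  rewrite -(lmap_comp we cfm (@gflag_ev_continuous A p) c) //.
  rewrite -(lmap_comp we (@gflag_ev_continuous A1 q) (face_continuous rE gbase cr) c) // => z.
  exact: gflag_ev_face.
rewrite comp_assoc e1 -!comp_assoc; apply: comp_heq => //.
have e3 : L cfm \c vq === vp \c L (face_continuous rE gbase cr).
  rewrite -[L (face_continuous rE gbase cr)]comp_idr -vq2 [_ \c (_ \c vq)]comp_assoc -e2.
  by rewrite -comp_assoc (comp_preK vp1).
by rewrite e3.
Qed.

Section Classify.
Variables (Z : topologicalType) (y : Z -> X) (s' : Qt R (pb y p) -> B)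
  (t' : Qt R (pb y q) -> S).
Hypotheses (cy : continuous y) (st : strict s' t').

Lemma sing_strict n (d : sing R Z n) :
  @strict (V n) (fun u => y ((d : V n -> Z) u)) (fun z => s' (sing_change (@cts_fun _ _ d) z))
    (fun z => t' (sing_change (@cts_fun _ _ d) z)).
Proof.
have [cs ct sE t1 t2] := st.
have fE (r : A1 -> A) (rE : forall z, p (r z) = q z) (cr : continuous r) z :
    Qmap (face_continuous rE y cr) (sing_change (@cts_fun _ _ d) z) =
    sing_change (@cts_fun _ _ d) (Qmap (face_continuous rE _ cr) z).
  apply: val_inj; change (tmap (face rE y) (tmap (base_change (fun u => erefl (y ((d : V n -> Z) u)))) (set_val z)) =
    tmap (base_change (fun u => erefl (y ((d : V n -> Z) u)))) (tmap (face rE _) (set_val z))).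
  by rewrite !tmap_comp; apply: tmap_eq => a; exact: pb_eq.
split.
- by apply: cts_comp => //; exact: Qmap_continuous.
- by apply: cts_comp => //; exact: Qmap_continuous.
- move=> z; rewrite sE; change (pb2 (ev (sing_change (@cts_fun _ _ d) z)) = pb2 (ev z)).
  by rewrite ev_Qmap.
- by move=> z; rewrite t1; congr s'; exact: fE.
- by move=> z; rewrite t2; congr s'; exact: fE.
Qed.

Lemma sing_base_continuous n (d : sing R Z n) :
  continuous (fun u => y ((d : V n -> Z) u)).
Proof. by apply: cts_comp => //; exact: cts_fun. Qed.

Definition sing_datum n (d : sing R Z n) : datum n :=
  Datum (@sing_base_continuous n d) (sing_strict d).

Lemma sing_datum_good (e : sing_space R Z) : cgood datum_agr (cmap sing_datum (set_val e)).
Proof.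
apply: cmap_good (set_valP e) => n m d d' T I dd U d'E agrU cov disj relo; split.
- by move=> x /cov[i Ux]; rewrite (d'E i) /=; congr y; exact: agrU Ux.
- move=> z gz tz.
  have Tz : tin [set x | T x.1] z by apply: tinS tz => x [].
  have [i iP] := sing_leg_agr s' agrU cov disj relo gz Tz.
  by rewrite (d'E i) => q1 q2; exact: iP.
- move=> z gz tz.
  have Tz : tin [set x | T x.1] z by apply: tinS tz => x [].
  have [i iP] := sing_leg_agr t' agrU cov disj relo gz Tz.
  by rewrite (d'E i) => q1 q2; exact: iP.
Qed.

Definition classify (e : sing_space R Z) : E := to_set (sing_datum_good e).

Lemma classify_continuous : continuous classify.
Proof.
apply: continuous_to_set; apply: cts_comp; first exact: cmap_continuous.
exact: set_val_continuous.
Qed.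

Lemma classify_base e : gbase (classify e) = y (sing_ev e).
Proof.
have [c [t h]] := chain_top e; rewrite (sing_evE h) /gbase /base.
exact: (@cbaseE R datum (@datum_agr) X (@dx) datum_agrx (classify e)
  (cmap_cell sing_datum c) t (in_chain_cmap sing_datum h)).
Qed.

Local Notation yw := (fun e => y (sing_ev e)).
Local Notation bF := (base_change (p := p) classify_base).
Local Notation cbF := (base_change_continuous (p := p) classify_base classify_continuous).
Local Notation sflags := (flag_space R (@cells_le R (sing R Z))
  (over_cells (@pb1 _ _ _ yw p))).

Definition cells_map (j : cells R (sing R Z)) : cells R datum :=
  (cmap_cell sing_datum j.1, List.map (cmap_cell sing_datum) j.2).

Lemma in_cells_map c j : in_cells c (cells_map j) ->
  exists2 c', c = cmap_cell sing_datum c' & in_cells c' j.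
Proof.
move=> h; have : List.In c (List.map (cmap_cell sing_datum) (j.1 :: j.2)) by exact: h.
by move/List.in_map_iff => [c' [<- ?]]; exists c'.
Qed.

Lemma in_cells_map_cell c j : in_cells c j -> in_cells (cmap_cell sing_datum c) (cells_map j).
Proof. exact: (List.in_map (cmap_cell sing_datum) (j.1 :: j.2)). Qed.

Lemma over_cells_map j :
  over_cells (@pb1 _ _ _ yw p) j `<=` bF @^-1` over_cells (@pb1 _ _ _ gbase p) (cells_map j).
Proof.
move=> a ja c /in_cells_map[c' -> /ja[t h]]; exists t.
exact: (in_chain_cmap sing_datum h).
Qed.

Definition classify_flag : sflags -> gflags p :=
  @flag_map R _ _ bF cbF _ _ (@cells_le R (sing R Z)) (@cells_le R datum) _ _
    cells_map over_cells_map.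

Lemma classify_flag_continuous : continuous classify_flag.
Proof.
apply: flag_map_continuous => i j ij c /in_cells_map[c' -> /ij].
exact: in_cells_map_cell.
Qed.

Lemma classify_value (z : sflags) :
  gsec (classify_flag z) = s' (sing_change (@sing_ev_continuous R Z) (flag_tree z)).
Proof.
rewrite /gsec /flag_value /cell_value.
set w := cell_tree _ _.
change (s' (sing_change (@cts_fun _ _ (cdat (set_val z).1.1)) w) =
  s' (sing_change (@sing_ev_continuous R Z) (flag_tree z))).
have wE : tmap set_val (set_val w) =
    tmap (cell_fun (cmap_cell sing_datum (set_val z).1.1)) (tmap bF (set_val z).2).
  exact: cell_treeE.
congr s'; apply: Qt_eq; rewrite !sing_changeE wE !tmap_comp.
have [gz tz] := set_valP z; apply: (tmap_eq_tin gz tz) => a /= /(_ (set_val z).1.1 (or_introl erefl)) [t h].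
rewrite (sing_evE h).
have e : coord (cmap_cell sing_datum (set_val z).1.1) (cmap sing_datum (set_val (pb1 a))) = t.
  by apply: coordE; exact: in_chain_cmap.
by rewrite -[in RHS]e.
Qed.

(** Both arrows are compared after the weak equivalence from the flags of singular cells. There each
    of them is [s'] applied to the same tree, by [classify_value]. *)
Lemma classify_section (v : @hom (localization we) (pb gbase p) (gflags p))
    (cs : continuous s') (phi : @hom (localization we) (pb y p) B) :
  v \c L (@gflag_ev_continuous A p) === idm _ ->
  phi \c L (@ev_continuous R (pb y p)) === L cs ->
  L gsec_continuous \c v \c L cbF ===
  phi \c L (@sing_change_continuous X A Z p y _ _ (@sing_ev_continuous R Z)).
Proof.
move=> v1 phiE.
have cf : continuous (@flag_ev _ _ _ _ _ : sflags -> pb yw p) by exact: flag_ev_continuous.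
have [u [_ u2]] : exists u : @hom (localization we) (pb yw p) sflags,
    u \c L cf === idm _ /\ L cf \c u === idm _.
  apply: lmap_iso; apply: wlp_weak_homotopy_equivalence.
  by apply: cells_wlp; exact: pb1_continuous.
suff H : L gsec_continuous \c v \c L cbF \c L cf ===
    phi \c L (@sing_change_continuous X A Z p y _ _ (@sing_ev_continuous R Z)) \c L cf.
  have K (g : @hom (localization we) (pb yw p) B) : g === g \c L cf \c u.
    by rewrite -comp_assoc u2 comp_idr.
  by apply: heq_trans (K _) _; rewrite H; exact: heq_sym (K _).
have cfl := classify_flag_continuous.
have e1 : L cbF \c L cf === L (@gflag_ev_continuous A p) \c L cfl.
  have c := cts_comp cbF cf.
  rewrite -(lmap_comp we cf cbF c) // -(lmap_comp we cfl (@gflag_ev_continuous A p) c) // => z.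
  by symmetry; exact: flag_ev_map.
rewrite -!comp_assoc e1 (comp_preK v1).
have ct : continuous (@flag_tree _ _ _ _ _ : sflags -> Qt R (pb yw p)) by exact: flag_tree_continuous.
have cq : continuous (@sing_change R X A Z p y _ _ (@sing_ev_continuous R Z)).
  exact: Qmap_continuous.
have cqt := cts_comp cq ct.
have e2 : L (@sing_change_continuous X A Z p y _ _ (@sing_ev_continuous R Z)) \c L cf ===
    L (@ev_continuous R (pb y p)) \c L cqt.
  have c := cts_comp (@sing_change_continuous X A Z p y _ _ (@sing_ev_continuous R Z)) cf.
  rewrite -(lmap_comp we cf _ c) // -(lmap_comp we cqt _ c) // => z.
  by symmetry; exact: ev_Qmap.
rewrite e2 comp_assoc phiE.
have c := cts_comp cs cqt.
by rewrite -(lmap_comp we cqt cs c) // -(lmap_comp we cfl gsec_continuous c) // => z;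
  rewrite classify_value.
Qed.

End Classify.

Lemma quillen_generic (cbe : continuous be) (cs1 : continuous s1)
  (cs2 : continuous s2) : generic_datum (quillen_rep R) cr1 cr2 r1E r2E cbe cs1 cs2.
Proof.
have [vp [vp1 vp2]] := @gflag_ev_iso A p.
have [vq [vq1 vq2]] := @gflag_ev_iso A1 q.
exists E, gbase, gbase_continuous, (L gsec_continuous \c vp), (L ghom_continuous \c vq).
split.
- have c := cts_comp cbe gsec_continuous.
  rewrite comp_assoc -(lmap_comp we gsec_continuous cbe c) //.
  rewrite (lmap_comp we (@gflag_ev_continuous A p) (@pb2_continuous _ _ _ gbase p) c).
    by rewrite -comp_assoc vp2 comp_idr.
  exact: gsec_be.
- by apply: gface_square vp1 vq2 => n d z; case: (d_strict d) => _ _ _ h _; exact: h.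
- by apply: gface_square vp1 vq2 => n d z; case: (d_strict d) => _ _ _ _ h; exact: h.
move=> Z y s' t' cs cy st.
exists (sing_space R Z), (@sing_ev R Z), (classify cy st), (@sing_ev_continuous R Z),
  (@classify_continuous Z y s' t' cy st), (classify_base cy st); split.
  by apply: wlp_weak_homotopy_equivalence; exact: sing_wlp.
move=> phi phiE.
have phiE' : phi \c L (@ev_continuous R (pb y p)) === L cs.
  by rewrite -phiE; apply: comp_heq => //; apply: loc_in_heq => z.
apply: heq_trans (classify_section cy st vp1 phiE') _.
by apply: comp_heq => //; apply: loc_in_heq => z.
Qed.

End Generic.

Theorem quillen_locally_cartesian_closed :
  locally_cartesian_closed (exact_completion (Ho (Top_Q R))).
Proof.
apply: lcc_exact_completion.
- exact: (rep_terminal (quillen_rep R)).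
- exact: (rep_products (quillen_rep R)).
- exact: (rep_weak_pullbacks (quillen_rep R)).
- by apply: (@rep_weak_dependent_products _ _ (quillen_rep R)) => *; exact: quillen_generic.
Qed.

End QuillenModel.

Theorem mainTheorem3 (R : realType) :
  locally_cartesian_closed (exact_completion (Ho (Top_S R))) /\
  locally_cartesian_closed (exact_completion (Ho (Top_Q R))).
Proof.
by split; [exact: strom_locally_cartesian_closed|exact: quillen_locally_cartesian_closed].
Qed.
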